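(* Under the standing setup below, $$\lim_{N\to\infty}\ \limsup_{R\to\infty}\ \left|\frac{\mathcal N(f_N,B(R))}{\operatorname{vol}B(R)}-c_{NS}(\mu)\right|=0,$$ where $c_{NS}(\mu):=\lim_{R\to\infty}\mathbb E[\mathcal N(F_\mu,B(R))]/\operatorname{vol}B(R)$ (this limit exists) is the Nazarov–Sodin constant of the Gaussian field $F_\mu$.
   Context: Standing setup: Fix an integer $m\ge 2$, put $\Lambda=(m-2)/2$, $e(t)=e^{2\pi i t}$, let $\langle\cdot,\cdot\rangle$ be the Euclidean inner product on $\mathbb R^m$, $B(x,\rho)$ the open ball of radius $\rho$ centred at $x$, $B(\rho)=B(0,\rho)$, and $\mathbb S^{m-1}$ the unit sphere. Let $\{r_n\}_{n\ge1}\subset\mathbb S^{m-1}$ be a sequence of vectors linearly independent over $\mathbb Q$ and not all contained in a hyperplane; set $r_{-n}:=-r_n$. Let $a_n\in\mathbb C$ ($n\in\mathbb Z\setminus\{0\}$) with $|a_n|=1$ and $a_{-n}=\overline{a_n}$. For $N\ge1$ let $f=f_N:\mathbb R^m\to\mathbb R$, $f(x)=(2N)^{-1/2}\sum_{1\le|n|\le N}a_n e(\langle r_n,x\rangle)$. Let $\mu_{r,N}=(2N)^{-1}\sum_{1\le|n|\le N}\delta_{r_n}$; it is assumed (after passing to a subsequence in $N$) that $\mu_{r,N}$ converges weak$^*$ to a probability measure $\mu$ on $\mathbb S^{m-1}$. For a symmetric ($\nu(-A)=\nu(A)$) Borel probability measure $\nu$ on $\mathbb S^{m-1}$, $F_\nu$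 denotes the centred stationary real Gaussian field on $\mathbb R^m$ with covariance $\mathbb E[F_\nu(x)F_\nu(y)]=\int_{\mathbb S^{m-1}}e(\langle x-y,\lambda\rangle)\,d\nu(\lambda)$ (with a.s. smooth sample paths). $\operatorname{vol}_R$ denotes the uniform probability measure on $B(R)$ and $\fint_{B(R)}h\,dx=\frac1{\operatorname{vol}B(R)}\int_{B(R)}h\,dx$. Nodal counts: for a continuous $h$ and a ball $B$, $\mathcal N(h,B)$ is the number of connected components of $B\setminus h^{-1}(0)$ whose closure does not meet $\partial B$ (nodal domains of $h$ in $B$ not touching $\partial B$). *)

(* Defs.v *)
From HB Require Import structures.
From mathcomp Require Import all_boot all_order all_algebra.
From mathcomp Require Import all_classical all_reals all_analysis.
From mathcomp Require Import complex.

Set Implicit Arguments.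
Unset Strict Implicit.
Unset Printing Implicit Defensive.

Import Order.TTheory GRing.Theory Num.Theory.
Import numFieldNormedType.Exports.

Local Open Scope classical_set_scope.
Local Open Scope ring_scope.

Section Defs.
Variables (R : realType) (m : nat).

Notation vec := 'rV[R]_m.

Definition dotv (u v : vec) : R := \sum_(i < m) u ord0 i * v ord0 i.
Definition enorm (u : vec) : R := Num.sqrt (dotv u u).

Definition eball (x : vec) (rho : R) : set vec := [set y | enorm (y - x) < rho].
Definition eball0 (rho : R) : set vec := eball 0 rho.
Definition sphere : set vec := [set y | enorm y = 1].

Definition tboundary (A : set vec) : set vec := closure A `\` interior A.

Definition nodal_domains (h : vec -> R) (B : set vec) : set (set vec) :=
  let D := B `\` h @^-1` [set 0] in
  [set C | (exists x, D x /\ C = connected_component D x) /\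
           closure C `&` tboundary B = set0].

Definition nodal_count (h : vec -> R) (B : set vec) : \bar R :=
  (\esum_(C in nodal_domains h B) 1)%E.

(** Volume of the unit ball of R^k: omega 0 = 1, omega 1 = 2,
    omega (k+2) = 2 pi / (k+2) * omega k  (= pi^(k/2) / Gamma(k/2+1)). *)
Fixpoint omega_vol (k : nat) : R :=
  match k with
  | 0%N => 1
  | 1%N => 2
  | k'.+2 => (2 * pi / k'.+2%:R) * omega_vol k'
  end.

Definition volB (rho : R) : R := omega_vol m * rho ^+ m.

Definition vecB := g_sigma_algebraType (@open vec).

Definition ee (t : R) : R[i] := (cos (2 * pi * t) +i* sin (2 * pi * t))%C.

(** f_N(x) = (2N)^{-1/2} sum_{1 <= |n| <= N} a_n e(<r_n, x>)  (a real number
    under the symmetry assumptions; we take its real part, which is itself). *)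
Definition fN (a : int -> R[i]) (r : int -> vec) (N : nat) (x : vec) : R :=
  complex.Re (((Num.sqrt (2 * N%:R))^-1)%:C *
    \sum_(1 <= n < N.+1)
       (a n%:Z * ee (dotv (r n%:Z) x) + a (- n%:Z) * ee (dotv (r (- n%:Z)) x)))%C.

Fixpoint dder (f : vec -> R) (vs : seq vec) : vec -> R :=
  match vs with
  | [::] => f
  | v :: vs' => fun x => 'D_v (dder f vs') x
  end.

Definition smooth (f : vec -> R) : Prop :=
  forall vs : seq vec, continuous (dder f vs) /\
    forall (v x : vec), derivable (dder f vs) x v.

(** Covariance kernel of F_nu :  int e(<z, lambda>) dnu(lambda) (real for symmetric nu). *)
Definition gcov (nu : probability vecB R) (z : vec) : R :=
  fine (\int[nu]_(l in [set: vecB]) (cos (2 * pi * dotv z l))%:E)%E.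

Definition centered_gaussian {d} {Omega : measurableType d}
  (P : probability Omega R) (X : Omega -> R) (v : R) : Prop :=
  measurable_fun [set: Omega] X /\
  ((v = 0 /\ {ae P, forall w, X w = 0}) \/
   (0 < v /\ forall A : set R, measurable A ->
      pushforward P X A = normal_prob 0 (Num.sqrt v) A)).

(** F is a centred (real) Gaussian field on R^m with covariance
    E[F(x)F(y)] = gcov nu (x - y): all finite linear combinations of its values
    are centred Gaussian with the corresponding variance. *)
Definition gaussian_field {d} {Omega : measurableType d}
  (P : probability Omega R) (F : Omega -> vec -> R) (nu : probability vecB R) : Prop :=
  forall (k : nat) (xs : 'I_k -> vec) (cs : 'I_k -> R),
    centered_gaussian P (fun w => \sum_(i < k) cs i * F w (xs i))
      (\sum_(i < k) \sum_(j < k) cs i * cs j * gcov nu (xs i - xs j)).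

Definition limsup_pinfty (g : R -> \bar R) : \bar R := limf_esup g (pinfty_nbhs R).

End Defs.

(* Main.v *)
(** On a lattice h Z^m with generic h <= 1, linear independence of the frequencies
    makes the summands of f_N behave like independent variables as R -> oo, and
    a central limit theorem shows that the windows f_N(h z + .), z in B(R), are
    distributed, as N -> oo, like the field F.  The number of nodal domains in a
    window is stable under uniformly small perturbations of a function with
    bounded second order increments which varies by much more than these
    increments near its zeros.  Windows without these properties are rare: the
    increments are controlled by second moments of derivatives, and degenerate
    zeros of F by a small ball estimate along the directions in which the limit
    of the second moments of the frequencies is nondegenerate.  Hence the sum
    over windows of the local counts is close to E[N(F, B(rho))] times the number
    of windows.  It differs from the global count only through bad windows and
    through domains too long for a window.  A domain contains a definite volume
    around each sizeable maximum (a discrete mean value inequality for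
    Laplacian f = - 4 pi^2 f), and a long nondegenerate domain has many such
    maxima, hence large volume, so that there are few of them.  Comparing
    the windows of all radii rho gives both the existence of the limit of
    E[N(F, B(rho))] / vol B(rho) and the theorem. *)

Require Import Defs.
From HB Require Import structures.
From mathcomp Require Import all_boot all_order all_algebra finmap.
From mathcomp Require Import all_classical all_reals all_analysis.
From mathcomp Require Import measurable_realfun measurable_fun_approximation complex.
From mathcomp Require Import ring lra zify.
Import Order.TTheory GRing.Theory Num.Theory.
Import numFieldNormedType.Exports.
Local Open Scope classical_set_scope.
Local Open Scope ring_scope.
Set Implicit Arguments.
Unset Strict Implicit.
Unset Printing Implicit Defensive.

(** The central limit theorem controls finitely many values of the field at a time, and the nodal
    count is not known to be a measurable function of the sample. Hence properties of windows are
    phrased by finite differences, which survive pointwise limits, and probabilities enter only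
    through bounded test functionals built from cosines of linear combinations of values. The limit
    measure may live on a smaller subsphere even if the directions span, so the field can be
    constant along some directions. A net is needed only in the n others: [(W/t)^n] points, each
    with probability of order [M t^2 (M t)^n] of a small value and n small slopes, leave a factor
    [t^2]. A long domain is examined in blocks of only about log(1/t) shells, since f halves from
    one shell to the next; so the window size W grows slowly enough for [W^m (1/M + M^(m+1) t^2)] to
    tend to zero. The existence of the limit of the means needs no ergodic theorem: all means are
    compared with the same sample averages and so are close to each other. *)

Section EuclideanNorm.
Variables (R : realType) (m : nat).
Local Notation vec := 'rV[R]_m.
Implicit Types u v w : vec.

Lemma dotvC u v : dotv u v = dotv v u.
Proof. by apply: eq_bigr => i _; rewrite mulrC. Qed.

Lemma dotvDl u v w : dotv (u + v) w = dotv u w + dotv v w.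
Proof.
by rewrite /dotv -big_split/=; apply: eq_bigr => i _; rewrite mxE mulrDl.
Qed.

Lemma dotvZl a u v : dotv (a *: u) v = a * dotv u v.
Proof.
by rewrite /dotv mulr_sumr; apply: eq_bigr => i _; rewrite mxE mulrA.
Qed.

Lemma dotvDr u v w : dotv u (v + w) = dotv u v + dotv u w.
Proof. by rewrite dotvC dotvDl !(dotvC u). Qed.

Lemma dotvZr a u v : dotv u (a *: v) = a * dotv u v.
Proof. by rewrite dotvC dotvZl (dotvC u). Qed.

Lemma dotvNl u v : dotv (- u) v = - dotv u v.
Proof. by rewrite -scaleN1r dotvZl mulN1r. Qed.

Lemma dotvNr u v : dotv u (- v) = - dotv u v.
Proof. by rewrite dotvC dotvNl dotvC. Qed.

Lemma dotvBr u v w : dotv u (v - w) = dotv u v - dotv u w.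
Proof. by rewrite dotvDr dotvNr. Qed.

Lemma dotv0r u : dotv u 0 = 0.
Proof. by rewrite -(scale0r 0) dotvZr mul0r. Qed.

Lemma dotv_suml (I : Type) (s : seq I) (F : I -> vec) v :
  dotv (\sum_(i <- s) F i) v = \sum_(i <- s) dotv (F i) v.
Proof.
elim: s => [|i s IH]; first by rewrite !big_nil dotvC dotv0r.
by rewrite !big_cons dotvDl IH.
Qed.

Lemma dotvv_ge0 u : 0 <= dotv u u.
Proof. by apply: sumr_ge0 => i _; rewrite -expr2 sqr_ge0. Qed.

Lemma enorm_ge0 u : 0 <= enorm u. Proof. exact: sqrtr_ge0. Qed.

Lemma sqr_enorm u : enorm u ^+ 2 = dotv u u.
Proof. by rewrite sqr_sqrtr// dotvv_ge0. Qed.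

Lemma enormZ a u : enorm (a *: u) = `|a| * enorm u.
Proof.
rewrite /enorm dotvZl dotvZr mulrA -expr2 sqrtrM ?sqr_ge0//.
by rewrite sqrtr_sqr.
Qed.

Lemma enormN u : enorm (- u) = enorm u.
Proof. by rewrite -scaleN1r enormZ normrN1 mul1r. Qed.

Lemma enormB u v : enorm (u - v) = enorm (v - u).
Proof. by rewrite -enormN opprB. Qed.

Lemma enorm0 : enorm (0 : vec) = 0.
Proof. by rewrite /enorm dotv0r sqrtr0. Qed.

Lemma cauchy_schwarz u v : `|dotv u v| <= enorm u * enorm v.
Proof.
have [v0|v0] := eqVneq (dotv v v) 0.
  suff -> : v = 0 by rewrite dotv0r normr0 mulr_ge0 ?enorm_ge0.
  apply/rowP => i; rewrite mxE; apply/eqP; rewrite -sqrf_eq0 expr2.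
  move/eqP: v0; rewrite /dotv psumr_eq0; last by move=> j _; rewrite -expr2 sqr_ge0.
  by move/allP => /(_ i); rewrite mem_index_enum => /(_ isT).
have vp : 0 < dotv v v by rewrite lt_neqAle eq_sym v0 dotvv_ge0.
(* This squared length is [dotv v v] times the defect in the squared inequality. *)
have := dotvv_ge0 (dotv v v *: u - dotv u v *: v).
rewrite dotvDl !dotvDr !dotvNl !dotvNr !dotvZl !dotvZr (dotvC v u).
set a := dotv u u; set b := dotv u v; set c := dotv v v => H.
have {}H : 0 <= c * (a * c - b ^+ 2) by move: H; congr (_ <= _); ring.
have {}H : b ^+ 2 <= a * c by move: H; rewrite pmulr_rge0// subr_ge0.
rewrite -ler_sqr ?nnegrE ?mulr_ge0 ?enorm_ge0//.
by rewrite exprMn !sqr_enorm real_normK ?num_real.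
Qed.

Lemma ler_enormD u v : enorm (u + v) <= enorm u + enorm v.
Proof.
rewrite -ler_sqr ?nnegrE ?addr_ge0 ?enorm_ge0//.
rewrite sqrrD !sqr_enorm dotvDl !dotvDr (dotvC v u).
have := le_trans (ler_norm _) (cauchy_schwarz u v).
by rewrite -mulr_natr; lra.
Qed.

Lemma ler_enormB u v : enorm u <= enorm v + enorm (u - v).
Proof. by rewrite -{1}(subrK v u) addrC ler_enormD. Qed.

Lemma coord_le_norm v i : `|v ord0 i| <= `|v|.
Proof.
rewrite /Num.Def.normr/= mx_normrE.
by apply: (@le_trans _ _ `|v (ord0, i).1 (ord0, i).2|); last exact: le_bigmax.
Qed.

Lemma norm_le_coord v a : 0 <= a -> (forall i, `|v ord0 i| <= a) -> `|v| <= a.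
Proof.
move=> a0 H; rewrite /Num.Def.normr/= mx_normrE.
by apply/bigmax_leP; split => // -[i j] _/=; rewrite (ord1 i).
Qed.

(** The balls of the theorem are Euclidean, while [|v|] is the supremum norm, in which topology,
    grids and regularity are expressed. Together with [enorm_le_norm] this compares the two at the
    cost of a factor [m]. *)
Lemma norm_le_enorm v : `|v| <= enorm v.
Proof.
apply: norm_le_coord => [|i]; first exact: enorm_ge0.
rewrite -ler_sqr ?nnegrE ?enorm_ge0// sqr_enorm real_normK ?num_real//.
rewrite /dotv (bigD1 i)//= -expr2 lerDl.
by apply: sumr_ge0 => j _; rewrite -expr2 sqr_ge0.
Qed.

Lemma enorm_le_norm v : enorm v <= m%:R * `|v|.
Proof.
have [m0|m0] := posnP m.
  rewrite /enorm /dotv big1 ?sqrtr0 ?mulr_ge0// => i.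
  by have := ltn_ord i; lia.
rewrite -ler_sqr ?nnegrE ?mulr_ge0 ?enorm_ge0// sqr_enorm.
apply: (@le_trans _ _ (\sum_(i < m) `|v| ^+ 2)).
  apply: ler_sum => i _; rewrite -expr2 -(real_normK (num_real _)).
  by rewrite ler_sqr ?nnegrE// coord_le_norm.
rewrite sumr_const card_ord exprMn -[leLHS]mulr_natl ler_wpM2r ?sqr_ge0//.
by rewrite -natrX ler_nat -{1}(expn1 m) leq_pexp2l.
Qed.

Lemma dotv_le u v : `|dotv u v| <= m%:R * `|u| * `|v|.
Proof.
rewrite /dotv; apply: le_trans (ler_norm_sum _ _ _) _.
apply: (@le_trans _ _ (\sum_(i < m) `|u| * `|v|)).
  by apply: ler_sum => i _; rewrite normrM ler_pM// coord_le_norm.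
by rewrite sumr_const card_ord -[leLHS]mulr_natl mulrA.
Qed.

End EuclideanNorm.

Lemma lipschitz_continuous (R : realType) m (f : 'rV[R]_m -> R) (L : R) : 0 <= L ->
  (forall y y', `|f y - f y'| <= L * `|y - y'|) -> continuous f.
Proof.
move=> L0 H y; have Fy := nbhs_filter y; apply/cvgrPdist_le => e e0.
have L1 : 0 < L + 1 by lra.
have d0 : 0 < e / (L + 1) by rewrite divr_gt0.
apply: (@filterS _ (nbhs y) Fy _ _ _ (nbhsx_ballx y _ d0)).
move=> y'; rewrite -ball_normE/= => yy'; apply: le_trans (H _ _) _.
move: yy'; rewrite ltr_pdivlMr//; have := normr_ge0 (y - y'); nra.
Qed.

(** * Sums over lattice points *)

Section LatticeSums.
Variables (R : realType) (m : nat).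
Local Notation vec := 'rV[R]_m.
Local Notation lat := 'rV[int]_m.

Definition emb (z : lat) : vec := map_mx intr z.

Lemma embD z e : emb (z + e) = emb z + emb e.
Proof. exact: map_mxD. Qed.

Lemma embN z : emb (- z) = - emb z.
Proof. exact: map_mxN. Qed.

Definition lball (h : R) (y : vec) (rho : R) : set lat :=
  [set z | enorm (h *: emb z - y) < rho].

(** [fset_set A] carries information only for finite [A], whence the finiteness hypotheses below. *)
Definition latsum (A : set lat) (g : lat -> R) := \sum_(z <- fset_set A) g z.

Definition latcount (A : set lat) := latsum A (fun=> 1).

Lemma latsumD A g g' : latsum A (fun z => g z + g' z) = latsum A g + latsum A g'.
Proof. exact: big_split. Qed.

Lemma latsumZ A c g : latsum A (fun z => c * g z) = c * latsum A g.
Proof. by rewrite /latsum mulr_sumr. Qed.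

Lemma latsum_cst A c : latsum A (fun=> c) = c * latcount A.
Proof. by rewrite -latsumZ; apply: eq_bigr => z _; rewrite mulr1. Qed.

Lemma latsum_sum (I : Type) (s : seq I) A (g : I -> lat -> R) :
  latsum A (fun z => \sum_(i <- s) g i z) = \sum_(i <- s) latsum A (g i).
Proof. exact: exchange_big. Qed.

Lemma eq_latsum A g g' : (forall z, g z = g' z) -> latsum A g = latsum A g'.
Proof. by move=> H; apply: eq_bigr. Qed.

Lemma ler_latsum A g g' : finite_set A -> (forall z, A z -> g z <= g' z) ->
  latsum A g <= latsum A g'.
Proof.
move=> fA H; rewrite /latsum [leLHS]big_seq [leRHS]big_seq.
by apply: ler_sum => z; rewrite in_fset_set// inE => /H.
Qed.

Lemma latsum_ge0 A g : (forall z, 0 <= g z) -> 0 <= latsum A g.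
Proof. by move=> H; apply: sumr_ge0. Qed.

Lemma ler_norm_latsum A g : `|latsum A g| <= latsum A (fun z => `|g z|).
Proof. exact: ler_norm_sum. Qed.

Lemma latcountE A : latcount A = (#|` fset_set A|)%:R.
Proof. by rewrite /latcount /latsum big_const_seq count_predT iter_addr addr0. Qed.

Lemma latcount_ge0 A : 0 <= latcount A.
Proof. by rewrite latcountE. Qed.

Lemma latsum_diff A B g : finite_set A -> B `<=` A ->
  latsum A g = latsum B g + latsum (A `\` B) g.
Proof.
move=> fA BA; have fB := sub_finite_set BA fA.
have fD : finite_set (A `\` B) by apply: sub_finite_set fA; exact: subDsetl.
rewrite /latsum -big_cat/=; apply: perm_big; apply: uniq_perm; first exact: fset_uniq.
  rewrite cat_uniq !fset_uniq/= andbT; apply/hasPn => z.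
  by rewrite !in_fset_set// => /set_mem[_ nB]; apply/negP => /set_mem.
move=> z; rewrite mem_cat !in_fset_set//; apply/idP/orP.
  by move=> /set_mem Az; have [|] := pselect (B z); [left|right]; apply/mem_set.
by move=> [/set_mem/BA Az|/set_mem[Az _]]; apply/mem_set.
Qed.

Lemma ler_latsum_sub A B g : finite_set A -> B `<=` A -> (forall z, 0 <= g z) ->
  latsum B g <= latsum A g.
Proof.
by move=> fA BA g0; rewrite (latsum_diff g fA BA) lerDl latsum_ge0.
Qed.

Lemma ler_latcount A B : finite_set A -> B `<=` A -> latcount B <= latcount A.
Proof. by move=> fA BA; apply: ler_latsum_sub. Qed.

Lemma latsum_shift A g e : finite_set A ->
  latsum A (fun z => g (z + e)) = latsum [set z | A (z - e)] g.
Proof.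
move=> fA; have fA' : finite_set [set z | A (z - e)].
  apply: (sub_finite_set _ (finite_image (fun z => z + e) fA)) => z /= Az.
  by exists (z - e); rewrite ?subrK.
rewrite /latsum -(big_map (fun z => z + e) predT g); apply: perm_big.
apply: uniq_perm => [||z]; [|exact: fset_uniq|].
  by rewrite map_inj_uniq ?fset_uniq//; exact: addIr.
rewrite in_fset_set//; apply/mapP/idP.
  by move=> [x]; rewrite in_fset_set// !inE => Ax ->/=; rewrite addrK.
by rewrite inE/= => Az; exists (z - e); rewrite ?subrK// in_fset_set// inE.
Qed.

Lemma finite_box (K : nat) :
  finite_set [set z : lat | forall i, `|z ord0 i| <= K%:Z] /\
  latcount [set z : lat | forall i, `|z ord0 i| <= K%:Z] <= (2 * K%:R + 1) ^+ m.
Proof.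
(* Coordinates in [[-K, K]] are coded, with offset [K], by [2K + 1] ordinals. *)
pose F (f : {ffun 'I_m -> 'I_(2 * K).+1}) : lat :=
  \row_i ((f i : nat)%:Z - K%:Z).
pose s := [seq F f | f <- enum {ffun 'I_m -> 'I_(2 * K).+1}].
have sub (z : lat) : (forall i, `|z ord0 i| <= K%:Z) -> z \in s.
  move=> zK; apply/mapP; exists [ffun i => inord (absz (z ord0 i + K%:Z))].
    by rewrite mem_enum.
  apply/rowP => i; rewrite -[LHS]/(z ord0 i) mxE ffunE inordK;
    by move: (zK i); generalize (z ord0 i) => x; lia.
have fs : finite_set [set z : lat | forall i, `|z ord0 i| <= K%:Z].
  by apply: (@sub_finite_set _ _ [set` s]) => [z /=|]; [exact: sub|exact: finite_seq].
split=> //; rewrite latcountE.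
have -> : (2 * K%:R + 1 : R) ^+ m = (size s)%:R.
  rewrite size_map -cardE card_ffun !card_ord natrX.
  by rewrite -[in RHS]addn1 natrD natrM.
rewrite ler_nat; apply: uniq_leq_size => [|z]; first exact: fset_uniq.
by rewrite in_fset_set// inE/= => /sub.
Qed.

Variable h : R.
Hypothesis h0 : 0 < h.

Lemma lball_box y rho : lball h y rho `<=`
  [set z : lat | forall i, `|z ord0 i| <= (Num.truncn ((rho + `|y|) / h))%:Z].
Proof.
move=> z /= zB i; have := zB; have [rho0|rho0] := ltP rho 0.
  by move=> /lt_le_trans /(_ (ltW rho0)); rewrite ltNge enorm_ge0.
move=> _; have yz : `|(z ord0 i)%:~R : R| <= (rho + `|y|) / h.
  rewrite ler_pdivlMr//.
  have := le_trans (norm_le_enorm _) (ltW zB).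
  move=> /(le_trans (coord_le_norm _ i)); rewrite !mxE => H.
  have H2 := coord_le_norm y i.
  rewrite -(gtr0_norm h0) -normrM mulrC.
  rewrite -(subrK (y ord0 i) (h * _)); apply: le_trans (ler_normD _ _) _.
  exact: lerD.
have x0 : 0 <= (rho + `|y|) / h by rewrite divr_ge0 ?addr_ge0// ltW.
have /andP[_] := Num.Theory.truncn_itv x0.
move=> /(le_lt_trans yz); rewrite -intr_norm pmulrn ltr_int.
by generalize (z ord0 i) => x; lia.
Qed.

Lemma lball_finite y rho : finite_set (lball h y rho).
Proof. exact: sub_finite_set (@lball_box y rho) (finite_box _).1. Qed.

Lemma lball_count_ub rho : 0 <= rho ->
  latcount (lball h 0 rho) <= (2 * (rho / h) + 1) ^+ m.
Proof.
move=> rho0; apply: le_trans (ler_latcount (finite_box _).1 (@lball_box _ _)) _.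
apply: le_trans (finite_box _).2 _.
rewrite normr0 addr0; set x := rho / h.
have x0 : 0 <= x by rewrite divr_ge0// ltW.
have tx : (Num.truncn x)%:R <= x by have /andP[] := Num.Theory.truncn_itv x0.
have t0 : 0 <= (Num.truncn x)%:R :> R by [].
by apply: lerXn2r; rewrite ?nnegrE; lra.
Qed.

Lemma sub_lball y rho rho' : rho <= rho' -> lball h y rho `<=` lball h y rho'.
Proof. by move=> H z /= /lt_le_trans; apply. Qed.

Lemma lball_shift y rho e g :
  latsum (lball h y rho) (fun z => g (z + e)) = latsum (lball h (y + h *: emb e) rho) g.
Proof.
rewrite latsum_shift; last exact: lball_finite.
congr latsum; apply/seteqP; split=> z /=; rewrite /lball/= embD embN scalerDr;
  by rewrite scalerN opprD addrA addrAC.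
Qed.

Lemma lball_count_shift y rho e :
  latcount (lball h (y + h *: emb e) rho) = latcount (lball h y rho).
Proof. by rewrite /latcount -(lball_shift _ _ _ (fun=> 1)). Qed.

Definition round (y : vec) : lat := \row_i Num.floor (y ord0 i / h).

Lemma round_coord y i : 0 <= (y - h *: emb (round y)) ord0 i < h.
Proof.
rewrite !mxE; have /andP[] := Num.Theory.floor_itv (y ord0 i / h).
rewrite ler_pdivlMr// ltr_pdivrMr// intrD mulrDl mul1r => a b.
by apply/andP; split; lra.
Qed.

Lemma round_norm y : `|y - h *: emb (round y)| <= h.
Proof.
apply: norm_le_coord => [|i]; first exact: ltW.
by have /andP[a b] := round_coord y i; rewrite ger0_norm// ltW.
Qed.

Lemma round_enorm y : enorm (y - h *: emb (round y)) <= m%:R * h.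
Proof.
by apply: le_trans (enorm_le_norm _) _; rewrite ler_wpM2l// round_norm.
Qed.

Lemma lball_sub y y' rho rho' : enorm (y - y') + rho <= rho' ->
  lball h y rho `<=` lball h y' rho'.
Proof.
move=> H z /= zy; apply: lt_le_trans H.
have -> : h *: emb z - y' = (y - y') + (h *: emb z - y).
  by rewrite [RHS]addrC addrA subrK.
by apply: le_lt_trans (ler_enormD _ _) _; rewrite ltrD2l.
Qed.

(** Lattice translations preserve counts, so the centre may be replaced by its rounding, which is at
    Euclidean distance at most [m h]. *)
Lemma lball_count_le y rho :
  latcount (lball h y rho) <= latcount (lball h 0 (rho + m%:R * h)).
Proof.
rewrite -(lball_count_shift 0 _ (round y)) add0r.
apply: ler_latcount; first exact: lball_finite.
by apply: lball_sub; rewrite addrC lerD2l round_enorm.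
Qed.

Lemma lball_count_ge y rho :
  latcount (lball h 0 (rho - m%:R * h)) <= latcount (lball h y rho).
Proof.
rewrite -(lball_count_shift 0 _ (round y)) add0r.
apply: ler_latcount; first exact: lball_finite.
by apply: lball_sub; rewrite enormB; have := round_enorm y; lra.
Qed.

(* Division with remainder by k cuts the lattice points of a large ball into
   k^m classes, each a copy of those of a ball k times smaller. *)
Lemma lball_count_scale (k : nat) rho : (0 < k)%N ->
  k%:R ^+ m * latcount (lball h 0 rho) <=
  latcount (lball h 0 (k%:R * (rho + m%:R * h))).
Proof.
move=> k0; rewrite !latcountE.
pose F (p : {ffun 'I_m -> 'I_k} * lat) : lat :=
  \row_i (k%:Z * p.2 ord0 i + (p.1 i : nat)%:Z).
pose s := [seq F (f, q) | f <- enum {ffun 'I_m -> 'I_k},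
                          q <- enum_fset (fset_set (lball h 0 rho))].
have ss : size s = (k ^ m * #|` fset_set (lball h 0 rho)|)%N.
  by rewrite size_allpairs -cardE card_ffun !card_ord.
have Finj : injective F.
  move=> [f q] [f' q'] /rowP E.
  have Ei i : q ord0 i = q' ord0 i /\ (f i = f' i :> nat).
    have := E i; rewrite !mxE/=.
    have := ltn_ord (f i); have := ltn_ord (f' i).
    move: (f i : nat) (f' i : nat) (q ord0 i) (q' ord0 i) => a b x y ak bk.
    move=> H; have nxy : ~ (x + 1 <= y) by nia.
    have nyx : ~ (y + 1 <= x) by nia.
    have xy : x = y by lia.
    by subst y; split; lia.
  congr pair; first by apply/ffunP => i; apply/val_inj; have [] := Ei i.
  by apply/rowP => i; have [] := Ei i.
rewrite -natrX -natrM -ss ler_nat; apply: uniq_leq_size.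
  apply: allpairs_uniq; [exact: enum_uniq|exact: fset_uniq|].
  by move=> p p' _ _; case: p => ? ?; case: p' => ? ? /Finj.
move=> z /allpairsP[[f q] /= [_ + ->]].
rewrite !in_fset_set ?inE/=; try exact: lball_finite.
rewrite /lball /= !subr0 => qr.
have -> : h *: emb (F (f, q)) =
    k%:R *: (h *: emb q) + h *: (\row_i (f i : nat)%:R : vec).
  by apply/rowP => i; rewrite !mxE/= intrD intrM mulrDr; congr (_ + _); ring.
apply: le_lt_trans (ler_enormD _ _) _; rewrite mulrDr enormZ normr_nat.
have k0' : 0 < k%:R :> R by rewrite ltr0n.
apply: ltr_leD; first by rewrite ltr_pM2l.
rewrite enormZ gtr0_norm// mulrA [leRHS]mulrC ler_wpM2l ?(ltW h0)//.
apply: le_trans (enorm_le_norm _) _; rewrite mulrC; apply: ler_wpM2r => //.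
apply: norm_le_coord => // i; rewrite mxE normr_nat ler_nat ltnW//.
Qed.

End LatticeSums.

Lemma cvg_invr_pinfty (R : realType) : (x^-1 : R) @[x --> +oo] --> (0 : R).
Proof.
apply/cvgrPdist_le => d d0; near=> x.
have x0 : 0 < x by near: x; exact: (nbhs_pinfty_gt (num_real _)).
rewrite sub0r normrN gtr0_norm ?invr_gt0//.
suff : d^-1 <= x by rewrite invf_ple ?posrE.
by near: x; exact: (nbhs_pinfty_ge (num_real _)).
Unshelve. all: by end_near. Qed.

(** After factoring out [x], the quotient [(1 + c / x)^m] tends to 1. *)
Lemma near_powD (R : realType) (m : nat) (c e : R) : 0 < e ->
  \forall x \near +oo, `|(x + c) ^+ m - x ^+ m| <= e * x ^+ m.
Proof.
move=> e0.
have H1 : (1 + c * x^-1) @[x --> +oo] --> (1 : R).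
  rewrite -[X in _ --> X]addr0; apply: cvgD; first exact: cvg_cst.
  rewrite -[X in _ --> X](mulr0 c); apply: cvgMr.
  exact: cvg_invr_pinfty.
have H : (1 + c * x^-1) ^+ m @[x --> +oo] --> (1 : R).
  rewrite -[X in _ --> X](expr1n _ m).
  exact: (cvg_comp _ _ H1 (@exprn_continuous _ m 1)).
move/cvgrPdist_le : H => /(_ _ e0) H; near=> x.
have x0 : 0 < x by near: x; exact: (nbhs_pinfty_gt (num_real _)).
have -> : x + c = x * (1 + c * x^-1) by field; rewrite gt_eqF.
rewrite exprMn -{2}[x ^+ m]mulr1 -mulrBr normrM ger0_norm ?exprn_ge0 ?(ltW x0)//.
rewrite mulrC ler_wpM2r ?exprn_ge0 ?(ltW x0)// distrC.
by near: x.
Unshelve. all: by end_near. Qed.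

(** * Density of lattice points in large balls *)

Section LatticeDensity.
Variables (R : realType) (m : nat) (h : R).
Hypothesis h0 : 0 < h.

Local Notation G rho := (latcount R (lball h (0 : 'rV[R]_m) rho)).

(** A Fekete argument: by [lball_count_scale] the ratio [G rho / (rho + c)^m] at one radius is
    nearly a lower bound at all much larger radii, so it converges to its supremum. The value of
    [kappa] is never computed, since it cancels when means are compared with samples. *)
Lemma lball_density : exists kappa : R, 0 < kappa /\
  forall e, 0 < e -> \forall rho \near +oo,
    (kappa - e) * rho ^+ m <= G rho <= (kappa + e) * rho ^+ m.
Proof.
pose c := m%:R * h; have c0 : 0 <= c by rewrite mulr_ge0 ?ler0n ?ltW.
pose A := [set G rho / (rho + c) ^+ m | rho in [set rho | 1 <= rho]].
pose u := (2 / h + 1) ^+ m.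
have scale rho rho' : 1 <= rho -> rho + c <= rho' ->
    (rho' - (rho + c)) ^+ m * (G rho / (rho + c) ^+ m) <= G rho'.
  move=> rho1 rr; have rc : 0 < rho + c by lra.
  (* The largest integer dilation of the small ball that fits into the large one. *)
  pose k := Num.truncn (rho' / (rho + c)).
  have x1 : 1 <= rho' / (rho + c) by rewrite ler_pdivlMr// mul1r.
  have /andP[k1 k2] := Num.Theory.truncn_itv (le_trans ler01 x1).
  rewrite -/k in k1 k2.
  have k0 : (0 < k)%N.
    by rewrite -(ltr0n R); move: k2; rewrite -[k.+1]addn1 natrD; lra.
  move: k1; rewrite ler_pdivlMr// => k1.
  move: k2; rewrite ltr_pdivrMr// -[k.+1]addn1 natrD mulrDl mul1r => k2.
  apply: le_trans (ler_latcount R (lball_finite h0 _ _) (sub_lball k1)).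
  apply: le_trans (lball_count_scale m h0 rho k0).
  rewrite mulrCA [leRHS]mulrC ler_wpM2l ?latcount_ge0//.
  rewrite ler_pdivrMr ?exprn_gt0// -exprMn.
  by apply: lerXn2r; rewrite ?nnegrE; lra.
have hi : 0 < h^-1 by rewrite invr_gt0.
have A1 : A !=set0 by exists (G 1 / (1 + c) ^+ m); exists 1 => /=.
have Aub : ubound A u.
  move=> _ [rho /= rho1 <-]; rewrite ler_pdivrMr ?exprn_gt0//; last by lra.
  apply: le_trans (lball_count_ub _ h0 _) _; first by lra.
  have H : 0 <= c * (2 / h + 1) by rewrite mulr_ge0//; lra.
  have H1 : 0 <= rho * h^-1 by rewrite mulr_ge0//; lra.
  by rewrite -exprMn; apply: lerXn2r; rewrite ?nnegrE; nra.
have supA : has_sup A by split => //; exists u.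
pose kappa := sup A.
have le_kappa rho : 1 <= rho -> G rho / (rho + c) ^+ m <= kappa.
  by move=> rho1; apply: ub_le_sup; [exists u|exists rho].
have kappa0 : 0 < kappa.
  apply: lt_le_trans (le_kappa 1 (lexx _)).
  rewrite divr_gt0 ?exprn_gt0//; last by lra.
  rewrite latcountE ltr0n cardfs_gt0; apply/fset0Pn; exists 0.
  rewrite in_fset_set ?inE; last exact: lball_finite.
  rewrite /lball/= subr0 (_ : emb R 0 = 0) ?scaler0 ?enorm0//.
  exact: map_mx0.
exists kappa; split=> // e e0.
(* Small enough for both [kappa (1 + d) <= kappa + e] and [(kappa - e/2) (1 - d) >= kappa - e]. *)
pose d := e / (2 * (kappa + e)).
have ke : 0 < kappa + e by lra.
have d0 : 0 < d by rewrite divr_gt0// mulr_gt0.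
have dE : d * (2 * (kappa + e)) = e by rewrite divfK// gt_eqF// mulr_gt0.
have [_ [rho0 /= rho01 <-] Hrho0] := sup_adherent (divr_gt0 e0 (ltr0n _ 2)) supA.
rewrite -/kappa in Hrho0.
near=> rho.
have r1 : 1 <= rho by near: rho; exact: (nbhs_pinfty_ge (num_real _)).
have r0 : rho0 + c <= rho by near: rho; exact: (nbhs_pinfty_ge (num_real _)).
have rm : 0 < rho ^+ m by rewrite exprn_gt0//; lra.
have up : `|(rho + c) ^+ m - rho ^+ m| <= d * rho ^+ m.
  by near: rho; exact: near_powD.
have lo : `|(rho + - (rho0 + c)) ^+ m - rho ^+ m| <= d * rho ^+ m.
  by near: rho; exact: near_powD.
apply/andP; split.
  apply: le_trans (scale _ _ rho01 r0).
  move: lo; rewrite ler_norml => /andP[lo _].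
  have {}lo : (1 - d) * rho ^+ m <= (rho - (rho0 + c)) ^+ m by lra.
  have d1 : 0 <= 1 - d by nra.
  set X := (_ - _) ^+ m in lo *; set Y := G rho0 / _ in Hrho0 *.
  have X0 : 0 <= X by apply: le_trans lo; rewrite mulr_ge0// ltW.
  have Y0 : 0 <= Y by rewrite divr_ge0 ?latcount_ge0 ?exprn_ge0//; lra.
  have [kk|kk] := leP 0 (kappa - e / 2); last first.
    by apply: (@le_trans _ _ 0); [nra|exact: mulr_ge0].
  apply: (@le_trans _ _ (X * (kappa - e / 2))); last by rewrite ler_wpM2l// ltW.
  apply: le_trans (ler_wpM2r kk lo).
  rewrite mulrAC ler_wpM2r ?(ltW rm)//; nra.
have := le_kappa rho r1; rewrite ler_pdivrMr ?exprn_gt0//; last by lra.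
move=> /le_trans; apply.
move: up; rewrite ler_norml => /andP[_ up].
have kd : kappa * d <= e by nra.
have {}up : (rho + c) ^+ m <= (1 + d) * rho ^+ m by lra.
apply: le_trans (ler_wpM2l (ltW kappa0) up) _.
by rewrite mulrA ler_wpM2r ?(ltW rm)//; lra.
Unshelve. all: by end_near. Qed.

End LatticeDensity.

(** * Nodal domains *)

Section Components.
Variables (R : realType) (m : nat).
Local Notation vec := 'rV[R]_m.
Implicit Types (A D : set vec) (x y z : vec) (f : vec -> R).

Lemma segment_component A x y :
  (forall t : R, 0 <= t <= 1 -> A (x + t *: (y - x))) -> connected_component A x y.
Proof.
move=> H; pose g (t : R) : vec := x + t *: (y - x).
have cg : continuous g.
  move=> t; apply: cvgD; first exact: cvg_cst.
  by apply: cvgZr_tmp; exact: cvg_id.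
have := @connected_continuous_connected R vec `[0, 1]%classic g
  (@segment_connected R 0 1) (continuous_subspaceT cg).
move=> Hc; apply: (@connected_component_max _ _ (g @` `[0, 1]%classic)) => //.
- by exists 0; rewrite /= ?in_itv/= ?lexx ?ler01// /g scale0r addr0.
- by move=> _ [t /= + <-]; rewrite in_itv/= => /H.
- by exists 1; rewrite /= ?in_itv/= ?lexx ?ler01// /g scale1r addrC subrK.
Qed.

(** A discrete continuity method: steps of a fixed size make [E] both relatively open and relatively
    closed in the connected set [A]. *)
Lemma connected_step A E (r : R) : 0 < r -> connected A -> E `<=` A -> E !=set0 ->
  (forall y y', E y -> A y' -> `|y - y'| < r -> E y') -> E = A.
Proof.
move=> r0 cA EA E0 step; apply: cA => //.
  exists (\bigcup_(y in E) ball y r).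
    by apply: bigcup_open => y _; exact: ball_open.
  apply/seteqP; split=> [y Ey|y [Ay [y' Ey']]].
    by split; [exact: EA|exists y => //; exact: ballxx].
  by rewrite -ball_normE/= => /(step _ _ Ey' Ay).
exists (closure E); first exact: closed_closure.
apply/seteqP; split=> [y Ey|y [Ay cy]].
  by split; [exact: EA|exact: subset_closure].
have [y' [Ey']] := cy _ (nbhsx_ballx y r r0).
by rewrite -ball_normE/= distrC => /(step _ _ Ey' Ay).
Qed.

Lemma ball_segment x y z (r : R) (t : R) : 0 <= t <= 1 -> `|x - y| < r -> `|x - z| < r ->
  `|x - (y + t *: (z - y))| < r.
Proof.
move=> /andP[t0 t1] xy xz.
have -> : x - (y + t *: (z - y)) = (1 - t) *: (x - y) + t *: (x - z).
  by apply/rowP => i; rewrite !mxE; ring.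
apply: le_lt_trans (ler_normD _ _) _; rewrite !normrZ !ger0_norm ?subr_ge0//.
have [->|t1'] := eqVneq t 1; first by rewrite subrr mul0r mul1r add0r.
have : 0 < 1 - t by rewrite subr_gt0 lt_neqAle t1' t1.
by move=> t1''; nra.
Qed.

Lemma open_component D x y : open D -> connected_component D x y ->
  exists2 r : R, 0 < r & forall z, `|y - z| < r -> connected_component D x z.
Proof.
move=> oD xy; have Dy : D y by apply: connected_component_sub xy.
have /nbhs_ballP[r/= r0 rD] : nbhs y D by exact: open_nbhs_nbhs.
exists r => // z yz; apply: connected_component_trans xy _.
apply: segment_component => t t01; apply: rD; rewrite -ball_normE/=.
by apply: ball_segment => //; rewrite subrr normr0.
Qed.

(** A small ball about [y] lies in a single component of [D] and meets the component of [x]. *)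
Lemma closure_component D x y : open D -> D y ->
  closure (connected_component D x) y -> connected_component D x y.
Proof.
move=> oD Dy cy; have [r r0 rD] := open_component oD (connected_component_refl Dy).
have [z [xz]] := cy _ (nbhsx_ballx y r r0).
rewrite -ball_normE/= => /rD yz.
by apply: connected_component_trans xz _; exact: connected_component_sym.
Qed.

Definition nonzero f : set vec := ~` (f @^-1` [set 0]).

Definition domain f x : set vec := connected_component (nonzero f) x.

(** Components are taken in the whole space and only then required to stay inside [B]. The count is
    thus monotone in [B], and a domain keeps its identity when it is seen through different
    windows. *)
Definition ndomains f (B : set vec) : set (set vec) :=
  [set C | (exists2 x, nonzero f x & C = domain f x) /\ closure C `<=` B].

Lemma open_nonzero f : continuous f -> open (nonzero f).
Proof.
move=> cf; apply: closed_openC; move/continuous_closedP : cf; apply.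
exact: closed_eq.
Qed.

(** A component of [B] minus the zero set whose closure stays in [B] is open and closed in the
    corresponding component of the whole space, so the two coincide. Conversely, a global domain
    with closure in [B] lies in [B] and is still a component there. *)
Lemma nodal_domainsE f (B : set vec) : continuous f -> open B ->
  nodal_domains f B = ndomains f B.
Proof.
move=> cf oB; have oU := open_nonzero cf.
have bB : tboundary B = closure B `\` B by rewrite /tboundary (interior_id B).1.
rewrite /nodal_domains bB; set D := B `\` _.
have DE : D = B `&` nonzero f by [].
have oD : open D by rewrite DE; exact: openI.
apply/seteqP; split=> C.
  move=> [[x [Dx ->]] H].
  have CB : closure (connected_component D x) `<=` B.
    move=> y Cy; apply: contrapT => nBy.
    suff : set0 y by [].
    rewrite -H; split=> //; split=> //; apply: closureS Cy.
    by move=> z /connected_component_sub[].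
  split=> //; exists x; first by case: Dx.
  have sub : connected_component D x `<=` domain f x.
    move=> z xz; apply: (@connected_component_max _ _ (connected_component D x)) => //.
    - exact: connected_component_refl.
    - by move=> y /connected_component_sub[].
    - exact: component_connected.
  have x0 := connected_component_refl Dx.
  apply: (component_connected (A := nonzero f) (x := x)); first by exists x.
    exists (connected_component D x); last by apply/esym/setIidPr.
    rewrite openE => y xy; have [r r0 rD] := open_component oD xy.
    apply/nbhs_ballP; exists r => //= z; rewrite -ball_normE/=; exact: rD.
  exists (closure (connected_component D x)); first exact: closed_closure.
  apply/seteqP; split=> [y xy|y [xy cy]].
    by split; [exact: sub|exact: subset_closure].
  apply: closure_component => //; split; first exact: CB.
  exact: connected_component_sub xy.
move=> [[x fx ->] CB].
have xD : domain f x x by exact: connected_component_refl.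
have sub : domain f x `<=` D.
  move=> y xy; split; first by apply: CB; exact: subset_closure.
  exact: connected_component_sub xy.
split; last first.
  by rewrite -subset0 => y [/CB By []].
exists x; split; first exact: sub.
apply/seteqP; split=> y xy.
  apply: (@connected_component_max _ _ (domain f x)) => //.
  exact: component_connected.
apply: (@connected_component_max _ _ (connected_component D x)) => //.
- by apply: connected_component_refl; exact: sub.
- by move=> z /connected_component_sub[].
- exact: component_connected.
Qed.

(** On a domain the conditions [0 < f] and [0 <= f] describe the same subset, which is therefore
    open and closed in it. *)
Lemma domain_gt0 f x y : continuous f -> 0 < f x -> domain f x y -> 0 < f y.
Proof.
move=> cf fx xy; have x0 : nonzero f x by move=> /= H; rewrite H ltxx in fx.
have cont2 : forall z, f @ z --> f z by [].
suff H : domain f x `&` f @^-1` [set s | 0 < s] = domain f x.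
  by move: xy; rewrite -H => -[].
apply: (component_connected (A := nonzero f) (x := x)).
- by exists x; split => //; exact: connected_component_refl.
- exists (f @^-1` [set s | 0 < s]) => //.
  by apply: open_comp => [z _|]; [exact: cf|exact: open_gt].
- exists (f @^-1` [set s | 0 <= s]).
    by move/continuous_closedP : cf; apply; exact: closed_ge.
  apply/seteqP; split=> z [xz /= z0]; split=> //=; first exact: ltW.
  rewrite lt_neqAle z0 andbT eq_sym; apply/eqP.
  exact: (connected_component_sub xz).
Qed.

Lemma domainN f x : domain (fun y => - f y) x = domain f x.
Proof.
rewrite /domain; congr connected_component; apply/seteqP.
by split=> y /= fy H; apply: fy; move: H => /=; [move=> ->; rewrite oppr0|move/eqP; rewrite oppr_eq0 => /eqP].
Qed.

Lemma same_domain f x y : domain f x y -> domain f x = domain f y.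
Proof. exact: same_connected_component. Qed.

Lemma domain_segment f x y z : domain f x y ->
  (forall t : R, 0 <= t <= 1 -> 0 < f (y + t *: (z - y))) -> domain f x z.
Proof.
move=> xy H; apply: connected_component_trans xy _.
by apply: segment_component => t /H f0 /= E; rewrite E ltxx in f0.
Qed.

(** The maximum over the compact closure is positive, so it is not attained on the zero set and lies
    in the domain itself. *)
Lemma domain_max f x (M : R) : continuous f -> 0 < f x ->
  (forall y, domain f x y -> `|y| <= M) ->
  exists2 y, domain f x y & forall z, domain f x z -> f z <= f y.
Proof.
move=> cf fx bd; have x0 : nonzero f x by move=> /= H; rewrite H ltxx in fx.
have xx : domain f x x by exact: connected_component_refl.
have cC : compact (closure (domain f x)).
  apply: bounded_closed_compact; last exact: closed_closure.
  exists M; split; first exact: num_real.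
  move=> M' MM' y cy /=; apply: le_trans (ltW MM').
  have cl : closed [set y : vec | `|y| <= M].
    have /continuous_closedP := @norm_continuous R vec.
    by move=> /(_ [set t | t <= M]); apply; exact: closed_le.
  have : closure [set y : vec | `|y| <= M] y := closureS bd cy.
  by rewrite -((closure_id _).1 cl).
have C0 : closure (domain f x) !=set0 by exists x; exact: subset_closure.
have [c /set_mem cc cmax] := compact_EVT_max C0 cC (continuous_subspaceT cf).
exists c => [|z xz]; last by apply: cmax; apply/mem_set; exact: subset_closure.
apply: closure_component => //; first exact: open_nonzero.
have : f x <= f c by apply: cmax; apply/mem_set; exact: subset_closure.
by move=> /(lt_le_trans fx) f0 /= E; rewrite E ltxx in f0.
Qed.

Lemma ndomainsS f (B B' : set vec) : B `<=` B' -> ndomains f B `<=` ndomains f B'.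
Proof. by move=> BB' C [Cx CB]; split=> // y /CB /BB'. Qed.

End Components.

(** Lower bounds for a cardinality by duplicate-free lists: meaningful before finiteness is known,
    and carried along injective maps. *)
Definition atleast (T : eqType) (D : set T) (k : nat) :=
  exists s : seq T, [/\ uniq s, size s = k & forall C, C \in s -> D C].

Lemma atleastW (T : eqType) (D : set T) (j k : nat) : (j <= k)%N ->
  atleast D k -> atleast D j.
Proof.
move=> jk [s [us sk sD]]; exists (take j s); split.
- exact: take_uniq.
- by rewrite size_take_min sk; apply/minn_idPl.
- by move=> C /mem_take /sD.
Qed.

Lemma atleast_map (T T' : eqType) (D : set T) (D' : set T') (g : T -> T') k :
  (forall C, D C -> D' (g C)) ->
  (forall C C', D C -> D C' -> g C = g C' -> C = C') ->
  atleast D k -> atleast D' k.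
Proof.
move=> gD ginj [s [us <- sD]]; exists (map g s); split.
- rewrite map_inj_in_uniq// => C C' /sD DC /sD DC'; exact: ginj.
- by rewrite size_map.
- by move=> _ /mapP[C /sD DC ->]; exact: gD.
Qed.

Lemma atleast_finite (T : choiceType) (D : set T) k : ~ atleast D k.+1 ->
  finite_set D /\ (#|` fset_set D| <= k)%N.
Proof.
move=> nD; have fD : finite_set D.
  apply: contrapT => iD; apply: nD.
  have [A AD cA] := infinite_set_fset k.+1 iD.
  exists (take k.+1 A); split; first by rewrite take_uniq ?fset_uniq.
    by rewrite size_take_min; apply/minn_idPl.
  by move=> C /mem_take CA; apply: AD.
split=> //; rewrite leqNgt; apply/negP => kD; apply: nD.
exists (take k.+1 (fset_set D)); split; first by rewrite take_uniq ?fset_uniq.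
  by rewrite size_take_min; apply/minn_idPl.
by move=> C /mem_take; rewrite in_fset_set// inE.
Qed.

Lemma atleast_esum (R : realType) (T : choiceType) (D : set T) k :
  atleast D k <-> ((k%:R : R)%:E <= \esum_(C in D) 1)%E.
Proof.
split=> [[s [us <- sD]]|H].
  apply: esum_ge; exists [set` s] => //.
  rewrite -fsbig_seq//.
  by rewrite sumEFin lee_fin big_const_seq count_predT iter_addr addr0.
case: k H => [|k] H; first by exists [::]; split.
apply: contrapT => /atleast_finite[fD Dk]; move: H; apply/negP; rewrite -ltNge.
rewrite esum_fset//.
rewrite fsbig_finite//= sumEFin lte_fin.
rewrite big_const_seq count_predT iter_addr addr0 ltr_nat.
by rewrite ltnS.
Qed.

(** * Stability of nodal domains *)

Section Stability.
Variables (R : realType) (m : nat).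
Local Notation vec := 'rV[R]_m.
Implicit Types (x y z v a b : vec) (f g F : vec -> R).

(** A [C^{1,1}] bound written with first and second differences instead of derivatives. It is closed
    under pointwise limits and so passes from samples to the Gaussian field. *)
Definition regular_on (W M : R) f :=
  [/\ forall y, `|y| <= W -> `|f y| <= M,
      forall y z, `|y| <= W -> `|z| <= W -> `|f y - f z| <= M * `|y - z| &
      forall y v, `|y + v| <= W -> `|y - v| <= W ->
        `|f (y + v) + f (y - v) - 2 * f y| <= M * `|v| ^+ 2].

(* Quantitative regularity of the zero set without derivatives: near its zeros
   f varies at scale t by much more than its second order increments M t^2. *)
Definition nondegenerate_on (W M t u s : R) f :=
  forall y, `|y| <= W -> `|f y| <= u * (M * t ^+ 2) ->
  exists2 v, `|v| <= t & s * (M * t ^+ 2) <= `|f (y + v) - f y|.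

Lemma continuous_oppf f : continuous f -> continuous (fun y => - f y).
Proof.
by move=> cf y; have H := cvgN (cf y); exact: H.
Qed.

Lemma regular_onN W M f : regular_on W M f -> regular_on W M (fun y => - f y).
Proof.
move=> [H1 H2 H3]; split=> [y yW|y z yW zW|y v yW1 yW2].
- by rewrite normrN H1.
- by rewrite -opprD normrN; apply: H2.
- have -> : - f (y + v) + - f (y - v) - 2 * - f y =
    - (f (y + v) + f (y - v) - 2 * f y) by ring.
  by rewrite normrN H3.
Qed.

Lemma nondegenerate_onN W M t u s f :
  nondegenerate_on W M t u s f -> nondegenerate_on W M t u s (fun y => - f y).
Proof.
move=> H y yW; rewrite normrN => /(H y yW)[v vt fv]; exists v => //.
by rewrite -opprD normrN.
Qed.

Lemma norm_segment W a b (t : R) : `|a| <= W -> `|b| <= W -> 0 <= t <= 1 ->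
  `|a + t *: (b - a)| <= W.
Proof.
move=> aW bW /andP[t0 t1].
have -> : a + t *: (b - a) = (1 - t) *: a + t *: b.
  by apply/rowP => i; rewrite !mxE; ring.
apply: le_trans (ler_normD _ _) _; rewrite !normrZ !ger0_norm ?subr_ge0//; nra.
Qed.

(* Minimise along the segment: at an interior minimum of the difference with
   the chord the second difference would be negative. *)
Lemma almost_concave W M f a b (t : R) : continuous f -> 0 < M ->
  regular_on W M f -> `|a| <= W -> `|b| <= W -> 0 <= t <= 1 ->
  (1 - t) * f a + t * f b - M * `|b - a| ^+ 2 * (t * (1 - t)) <= f (a + t *: (b - a)).
Proof.
move=> cf M0 [_ _ H3] aW bW t01.
have [->|ba] := eqVneq b a.
  by rewrite subrr scaler0 addr0 normr0; lra.
set d := `|b - a|; have d0 : 0 < d by rewrite normr_gt0 subr_eq0.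
pose psi (s : R) := f (a + s *: (b - a)) + (s - 1) * f a - s * f b + M * d ^+ 2 * (s * (1 - s)).
have cpsi : continuous psi.
  move=> s; apply: cvgD; [apply: cvgB; [apply: cvgD|]|].
  - apply: (@cvg_comp _ _ _ (fun s : R => a + s *: (b - a)) f _ (nbhs (a + s *: (b - a)))); last exact: cf.
    by apply: cvgD; [exact: cvg_cst|apply: cvgZr_tmp; exact: cvg_id].
  - by apply: cvgMl; apply: cvgB; [exact: cvg_id|exact: cvg_cst].
  - by apply: cvgMl; exact: cvg_id.
  - apply: cvgMr; apply: cvgM; first exact: cvg_id.
    by apply: cvgB; [exact: cvg_cst|exact: cvg_id].
have [c c01 cmin] := EVT_min (@ler01 R) (continuous_subspaceT cpsi).
suff : 0 <= psi c.
  move=> /le_trans /(_ (cmin t _)); rewrite in_itv/= => /(_ t01).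
  by rewrite /psi; lra.
move: c01; rewrite in_itv/= => /andP[c0 c1].
have psi0 : psi 0 = 0 by rewrite /psi scale0r addr0; ring.
have psi1 : psi 1 = 0 by rewrite /psi scale1r addrC [a + _]addrC subrK; ring.
have [->|c0'] := eqVneq c 0; first by rewrite psi0.
have [->|c1'] := eqVneq c 1; first by rewrite psi1.
have {}c0 : 0 < c by rewrite lt_neqAle eq_sym c0'.
have {}c1 : c < 1 by rewrite lt_neqAle c1'.
(* The largest symmetric step that keeps [c + e] and [c - e] in [[0, 1]]. *)
pose e := Num.min c (1 - c).
have e0 : 0 < e by rewrite lt_min c0 subr_gt0.
have ec : e <= c by rewrite ge_min lexx.
have ec1 : e <= 1 - c by rewrite ge_min lexx orbT.
have m1 : psi c <= psi (c + e) by apply: cmin; rewrite in_itv/=; apply/andP; split; lra.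
have m2 : psi c <= psi (c - e) by apply: cmin; rewrite in_itv/=; apply/andP; split; lra.
exfalso; have := H3 (a + c *: (b - a)) (e *: (b - a)).
rewrite -addrA -scalerDl -[_ - e *: _]addrA -scalerBl.
have i1 : 0 <= c + e <= 1 by apply/andP; split; lra.
have i2 : 0 <= c - e <= 1 by apply/andP; split; lra.
move=> /(_ (norm_segment aW bW i1) (norm_segment aW bW i2)).
rewrite normrZ gtr0_norm// exprMn -/d ler_norml => /andP[_].
(* The quadratic term of [psi] contributes [- 2 M d^2 e^2] to its second difference and [f] at most
   [M d^2 e^2]; the total is negative, which is impossible at a minimum. *)
have Mde : 0 < M * d ^+ 2 * e ^+ 2 by rewrite !mulr_gt0 ?exprn_gt0.
move: m1 m2; rewrite /psi; nra.
Qed.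

Section Fixed.
Variables (W W' M t : R) (f : vec -> R).
Hypotheses (cf : continuous f) (M0 : 0 < M) (t0 : 0 < t) (t1 : t <= 1).
Hypothesis regf : regular_on W M f.
Hypothesis WW' : W' + t <= W.
Local Notation q := (M * t ^+ 2).

Let q0 : 0 < q. Proof. by rewrite mulr_gt0// exprn_gt0. Qed.

(** Over a segment of length [2 t] the defect of concavity is at most [M (2t)^2 / 4 = q], so
    [f >= q > 0] along it. This is how nearby high points are put into one domain. *)
Lemma high_same_domain a b : `|a| <= W -> `|b| <= W -> `|b - a| <= 2 * t ->
  2 * q <= f a -> 2 * q <= f b -> domain f a b.
Proof.
move=> aW bW ab fa fb; apply: (@domain_segment _ _ f a a).
  apply: connected_component_refl => /= E; rewrite E in fa; have := q0; lra.
move=> s s01; apply: lt_le_trans (almost_concave cf M0 regf aW bW s01).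
have ab2 : M * `|b - a| ^+ 2 <= 4 * q.
  rewrite (_ : 4 * q = M * (2 * t) ^+ 2); last by ring.
  by rewrite ler_wpM2l ?(ltW M0)// lerXn2r ?nnegrE//; have := t0; lra.
move: s01 => /andP[s0 s1].
have s4 : 0 <= s * (1 - s) <= 1 / 4.
  apply/andP; split; first by rewrite mulr_ge0//; lra.
  by have := sqr_ge0 (s - 1 / 2); rewrite expr2; lra.
have : M * `|b - a| ^+ 2 * (s * (1 - s)) <= q.
  move: s4 => /andP[s40 s41]; apply: le_trans (ler_wpM2r s40 ab2) _.
  by have := q0; nra.
have := q0; nra.
Qed.

(** Nondegeneracy gives a change of [14 q] in some direction [v]; if it is a descent, the bound on
    the second difference makes [- v] an ascent of at least [13 q]. Concavity up to [q s (1 - s)]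
    keeps [f] positive on the way. *)
Lemma climb y : nondegenerate_on W' M t 3 14 f -> `|y| <= W' -> - q <= f y -> f y <= 3 * q ->
  exists v, [/\ `|v| <= t, f y + 13 * q <= f (y + v) &
    0 < f y -> domain f y (y + v)].
Proof.
move=> ndf yW fy1 fy3; have WW1 := WW'; have t0' := t0.
have WW : forall v, `|v| <= t -> `|y + v| <= W.
  by move=> v vt; apply: le_trans (ler_normD _ _) _; lra.
have q0' := q0.
have [v [vt fv]] : exists v, `|v| <= t /\ f y + 13 * q <= f (y + v).
  have [|v vt] := ndf y yW; first by rewrite ler_norml; apply/andP; split; lra.
  have vt' : `|- v| <= t by rewrite normrN.
  rewrite ler_normr => /orP[H|H]; first by exists v; split=> //; lra.
  exists (- v); split => //; have [_ _ /(_ y v (WW _ vt) (WW _ vt'))] := regf.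
  rewrite ler_norml => /andP[H1 _].
  have : M * `|v| ^+ 2 <= q by rewrite ler_wpM2l ?(ltW M0)// lerXn2r ?nnegrE// ltW.
  by lra.
exists v; split => // fy0; apply: (@domain_segment _ _ f y y).
  by apply: connected_component_refl => /= E; rewrite E ltxx in fy0.
move=> s s01; have yW' : `|y| <= W by have := t0; lra.
apply: lt_le_trans (almost_concave cf M0 regf yW' (WW _ vt) s01).
have -> : y + v - y = v by rewrite addrC addKr.
have : M * `|v| ^+ 2 <= q by rewrite ler_wpM2l ?(ltW M0)// lerXn2r ?nnegrE// ltW.
move: s01 => /andP[s0 s1]; set X := M * _ => XQ.
have X1 : X * (s * (1 - s)) <= q * s.
  have : 0 <= s * (1 - s) by rewrite mulr_ge0//; lra.
  by have := q0; nra.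
have := q0; nra.
Qed.

End Fixed.

(** * Transport of nodal domains to a uniformly close function *)

Section Transfer.
Variables (w W W' M t : R) (B B' : set vec).
Hypotheses (M0 : 0 < M) (t0 : 0 < t) (t1 : t <= 1).
Hypotheses (WW' : W' + t <= W) (wW' : w + 2 * t <= W').
Hypothesis Bw : forall y, B y -> `|y| <= w.
Hypothesis BB' : forall y z, B y -> `|y - z| <= 2 * t -> B' z.
Local Notation q := (M * t ^+ 2).

Let q0 : 0 < q. Proof. by rewrite mulr_gt0// exprn_gt0. Qed.

(** The height [3 q] survives a perturbation of size [q] with its sign, and lies below what [climb]
    reaches. *)
Definition summit f p := 3 * q <= `|f p|.

(** At the maximum of [|f|] over the domain, a value below [3 q] would contradict [climb]. *)
Lemma summit_exists f x : continuous f -> regular_on W M f ->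
  nondegenerate_on W' M t 3 14 f -> nonzero f x -> closure (domain f x) `<=` B ->
  exists2 p, domain f x = domain f p & summit f p.
Proof.
have q0' := q0; have t0' := t0; have WW1 := WW'; have wW1 := wW'.
wlog fx : f x / 0 < f x => [H cf rf nf fx0 CB|].
  have [fx|fx] := ltP 0 (f x); first exact: H.
  have [||||||p] := H (fun y => - f y) x.
  - by rewrite oppr_gt0 lt_neqAle fx andbT; apply/eqP.
  - exact: continuous_oppf.
  - exact: regular_onN.
  - exact: nondegenerate_onN.
  - by move=> /= /eqP; rewrite oppr_eq0 => /eqP.
  - by rewrite domainN.
  by rewrite !domainN /summit normrN => ? ?; exists p.
move=> cf rf nf x0 CB.
have xw y : domain f x y -> `|y| <= w by move=> xy; apply/Bw/CB/subset_closure.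
have [p xp pmax] := domain_max cf fx xw.
exists p; first exact: same_domain.
rewrite /summit; apply: le_trans (ler_norm _); rewrite leNgt; apply/negP => fp3.
have fp := domain_gt0 cf fx xp.
have pW : `|p| <= W' by have := xw _ xp; lra.
have [||v [_ fv pv]] := climb cf M0 t0 rf WW' nf pW; [lra|lra|].
have : f (p + v) <= f p by apply: pmax; rewrite (same_domain xp); exact: pv.
lra.
Qed.

(** The points of the perturbed domain are followed by companions [a] in the original one, at
    distance at most [t] and of height at least [3 q]. The set of points that have a companion is
    stable under steps of length [t^2], hence is the whole domain of [g]. *)
Lemma domain_transfer f g p : continuous f -> continuous g -> regular_on W M f ->
  nondegenerate_on W' M t 3 14 f -> (forall y, `|y| <= W -> `|g y - f y| < q) ->
  closure (domain f p) `<=` B -> 3 * q <= f p ->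
  forall y, domain g p y -> exists a, [/\ domain f p a, `|a - y| <= t & 3 * q <= f a].
Proof.
have q0' := q0; have t0' := t0; have WW1 := WW'; have wW1 := wW'.
move=> cf cg rf nf fg CB fp.
have pp : domain f p p.
  by apply: connected_component_refl => /= E; rewrite E in fp; lra.
have pw y : domain f p y -> `|y| <= w by move=> py; apply/Bw/CB/subset_closure.
have gp : 0 < g p.
  have := fg p _; rewrite ltr_norml => /(_ _)/andP[|]; last by lra.
  by have := pw _ pp; lra.
have gpp : domain g p p.
  by apply: connected_component_refl => /= E; rewrite E in gp; lra.
pose E : set vec := [set y | domain g p y /\
  exists a, [/\ domain f p a, `|a - y| <= t & 3 * q <= f a]].
suff -> : domain g p = E by move=> y [].
(* A step of length [t^2] costs at most [M t^2 = q] in height, as [M] is a Lipschitz constant of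
   [f]. *)
apply/esym; have r0 : 0 < t ^+ 2 by rewrite exprn_gt0.
have Hs := @connected_step R m (domain g p) E (t ^+ 2) r0 (@component_connected _ _ _).
apply: Hs => [y []//||y y'].
  by exists p; split => //; exists p; rewrite subrr normr0; split => //; exact: ltW.
move=> [gy [a [pa ay fa]]] gy' yy'; split => //.
have t1' := t1; have r1 : t ^+ 2 <= t by rewrite expr2 -[leRHS]mulr1 ler_pM2l.
have yw : `|y| <= w + t.
  rewrite -(subrK a y); apply: le_trans (ler_normD _ _) _; rewrite distrC.
  by have := pw _ pa; lra.
have y'W : `|y'| <= W'.
  rewrite -(subrK y y'); apply: le_trans (ler_normD _ _) _; rewrite distrC; lra.
have fy' : - q < f y'.
  have := fg y' _; rewrite ltr_norml => /(_ _)/andP[|]; first by lra.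
  by have := domain_gt0 cg gp gy'; lra.
have [a' a'y' fa'] : exists2 a', `|a' - y'| <= t & 3 * q <= f a'.
  have [f3|f3] := leP (3 * q) (f y').
    by exists y' => //; rewrite subrr normr0 ltW.
  have [||v [vt fv _]] := climb cf M0 t0 rf WW' nf y'W; [lra|lra|].
  by exists (y' + v); [rewrite addrC addKr|lra].
exists a'; split => //.
(* The old companion is moved along with the point and keeps the height [2 q]; then [a] is joined to
   [b] and [b] to the new companion [a'] by [high_same_domain]. *)
pose b := a + (y' - y).
have by' : `|b - y'| <= t.
  by rewrite /b (_ : _ - y' = a - y)//; apply/rowP => i; rewrite !mxE; ring.
have ab : `|b - a| < t ^+ 2.
  by rewrite /b addrC addKr distrC.
have WyW z : `|z - y'| <= t -> `|z| <= W.
  by move=> zy; rewrite -(subrK y' z); apply: le_trans (ler_normD _ _) _; lra.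
have aW : `|a| <= W by have := pw _ pa; lra.
have fb : 2 * q <= f b.
  have [_ + _] := rf; move=> /(_ b a (WyW _ by') aW).
  rewrite ler_norml => /andP[H _].
  have : M * `|b - a| <= q by rewrite ler_wpM2l ?(ltW M0)// ltW.
  lra.
have Dab : domain f a b.
  by apply: (high_same_domain cf M0 t0 rf aW (WyW _ by')); lra.
have Dba' : domain f b a'.
  apply: (high_same_domain cf M0 t0 rf (WyW _ by') (WyW _ a'y')); [|lra|lra].
  rewrite -(subrK y' a') -addrA; apply: le_trans (ler_normD _ _) _.
  by rewrite (distrC y' b); lra.
apply: connected_component_trans pa _; exact: connected_component_trans Dab Dba'.
Qed.

(** Each domain of [f] is sent to the domain of [g] through one of its summits. Every point of the
    image is [t]-close to the original domain, which keeps the image inside [B']; a summit of [f] in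
    the image belongs to the original domain, which gives injectivity. *)
Lemma stability f g k : continuous f -> continuous g -> regular_on W M f ->
  nondegenerate_on W' M t 3 14 f -> (forall y, `|y| <= W -> `|g y - f y| < q) ->
  atleast (ndomains f B) k -> atleast (ndomains g B') k.
Proof.
have q0' := q0; have t0' := t0; have WW1 := WW'; have wW1 := wW'.
move=> cf cg rf nf fg.
have rf' := regular_onN rf; have nf' := nondegenerate_onN nf.
have cf' := continuous_oppf cf.
have cg' := continuous_oppf cg.
have fg' y : `|y| <= W -> `|- g y - - f y| < q.
  by move=> /fg; rewrite -opprD normrN.
have key p : closure (domain f p) `<=` B -> summit f p ->
    nonzero g p /\ forall y, domain g p y ->
    exists a, [/\ domain f p a, `|a - y| <= t & summit f y -> domain f a y].
  move=> CB; rewrite /summit ler_normr => fp.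
  have pp : domain f p p.
    apply: connected_component_refl => /= E.
    by move: fp; rewrite E oppr0 => /orP[]; lra.
  have pw y : domain f p y -> `|y| <= w by move=> py; apply/Bw/CB/subset_closure.
  have pW : `|p| <= W by have := pw _ pp; lra.
  have aW (a y : vec) : domain f p a -> `|a - y| <= t -> `|a| <= W /\ `|y| <= W.
    move=> /pw aw ay; split; first by lra.
    by rewrite -(subrK a y); apply: le_trans (ler_normD _ _) _; rewrite distrC; lra.
  case/orP: fp => fp.
    have gp : 0 < g p by have := fg p pW; rewrite ltr_norml => /andP[]; lra.
    split=> [/= E|y gy]; first by rewrite E ltxx in gp.
    have [a [pa ay fa]] := domain_transfer cf cg rf nf fg CB fp gy.
    exists a; split => //; have [aW' yW] := aW _ _ pa ay.
    have gy0 := domain_gt0 cg gp gy.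
    have := fg y yW; rewrite ltr_norml => /andP[_ H].
    rewrite ler_normr => /orP[fy|]; last by lra.
    by apply: (high_same_domain cf M0 t0 rf aW' yW); rewrite 1?distrC; lra.
  have CB' : closure (domain (fun y => - f y) p) `<=` B by rewrite domainN.
  have gp : 0 < - g p by have := fg p pW; rewrite ltr_norml => /andP[]; lra.
  split=> [/= E|y gy]; first by rewrite E oppr0 ltxx in gp.
  have gy' : domain (fun y => - g y) p y by rewrite domainN.
  have [a [pa ay fa]] := domain_transfer cf' cg' rf' nf' fg' CB' fp gy'.
  rewrite domainN in pa; exists a; split => //; have [aW' yW] := aW _ _ pa ay.
  have gy0 := domain_gt0 cg' gp gy'.
  have := fg y yW; rewrite ltr_norml => /andP[H _].
  rewrite ler_normr => /orP[|fy]; first by lra.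
  rewrite -domainN; apply: (high_same_domain cf' M0 t0 rf' aW' yW); rewrite 1?distrC; lra.
pose P C := [set p | C = domain f p /\ summit f p].
have PC C : ndomains f B C -> exists p, P C p.
  move=> [[x fx ->] CB]; have [p E sp] := summit_exists cf rf nf fx CB.
  by exists p.
pose p0 C := xget 0 (P C).
have p0P C : ndomains f B C -> P C (p0 C) by move=> /PC[p]; exact: xgetI.
apply: (@atleast_map _ _ _ _ (fun C => domain g (p0 C))) => [C DC|C C' DC DC' E].
  have [EC sp] := p0P C DC; have CB : closure (domain f (p0 C)) `<=` B by case: DC => _; rewrite -EC.
  have [gp H] := key _ CB sp; split; first by exists (p0 C).
  move=> y cy; have [z [gz yz]] := cy _ (nbhsx_ballx y t t0).
  rewrite -ball_normE/= in yz; have [a [pa az _]] := H z gz.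
  apply: (@BB' a); first by apply/CB/subset_closure.
  rewrite -(subrK z a) -addrA; apply: le_trans (ler_normD _ _) _.
  by rewrite (distrC z y); lra.
have [EC sp] := p0P C DC; have CB : closure (domain f (p0 C)) `<=` B by case: DC => _; rewrite -EC.
have [EC' sp'] := p0P C' DC'.
have CB' : closure (domain f (p0 C')) `<=` B by case: DC' => _; rewrite -EC'.
have [_ H] := key _ CB sp; have [gp' _] := key _ CB' sp'.
have [|a [pa _ /(_ sp') ap']] := H (p0 C').
  by rewrite E; exact: connected_component_refl.
by rewrite EC EC' (same_domain pa) (same_domain ap').
Qed.

(** An error [q / 2] changes values by [q / 2] and differences by [q]; the gaps between 4, 16 and 3,
    14 leave room for this. *)
Lemma nondegenerate_perturb f F :
  (forall y, `|y| <= W -> `|F y - f y| <= q / 2) ->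
  nondegenerate_on W' M t 4 16 f -> nondegenerate_on W' M t 3 14 F.
Proof.
have q0' := q0; have t0' := t0; have WW1 := WW'; have wW1 := wW'.
move=> Ff nf y yW Fy; have yW' : `|y| <= W by lra.
have H1 := Ff y yW'; have [|v vt fv] := nf y yW.
  by move: Fy H1; rewrite !ler_norml => /andP[? ?] /andP[? ?]; apply/andP; split; lra.
exists v => //; have yv : `|y + v| <= W by apply: le_trans (ler_normD _ _) _; lra.
have H2 := Ff _ yv; move: fv H1 H2; rewrite !ler_normr !ler_norml.
by move=> /orP[?|?] /andP[? ?] /andP[? ?]; apply/orP; [left|right]; lra.
Qed.

End Transfer.
End Stability.

(** * Random walks and the discrete mean value inequality *)

Section RandomWalk.
Variables (R : realType) (m : nat).
Local Notation lat := 'rV[int]_m.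
Implicit Types (u v : lat -> R) (z w : lat).

Definition unitv (i : 'I_m) : lat := delta_mx ord0 i.

Definition step (i : 'I_m) u : lat -> R :=
  fun z => (u (z + unitv i) + u (z - unitv i)) / 2.

(* T steps of the walk whose coordinates listed in s move independently. *)
Definition walk (T : nat) (s : seq 'I_m) u : lat -> R :=
  foldr (fun i v => iter T (step i) v) u s.

Lemma stepC i j u : step i (step j u) = step j (step i u).
Proof.
apply/funext => z; rewrite /step !(addrAC z (unitv j)) !(addrAC z (- unitv j)).
by field.
Qed.

Lemma walk1_step s i u : step i (walk 1 s u) = walk 1 s (step i u).
Proof. by elim: s => //= j s IH; rewrite stepC IH. Qed.

Lemma walk1_iter_step T s i u :
  iter T (step i) (walk 1 s u) = walk 1 s (iter T (step i) u).
Proof. by elim: T => //= T ->; rewrite walk1_step. Qed.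

(** Steps in different coordinates commute, so they may be regrouped by time instead of by
    coordinate. *)
Lemma walkS T s u : walk T.+1 s u = walk 1 s (walk T s u).
Proof.
elim: s => //= i s IH; rewrite IH; congr (step i _).
by rewrite walk1_iter_step.
Qed.

Lemma walk0 s u : walk 0 s u = u.
Proof. by elim: s => //= i s ->. Qed.

(** One round of the walk changes each coordinate by at most the number of its moves; this crude
    locality suffices for comparisons on a domain. *)
Lemma walk1_ge s u v z :
  (forall w, (forall k, `|w ord0 k - z ord0 k| <= (size s)%:Z) -> u w <= v w) ->
  walk 1 s u z <= walk 1 s v z.
Proof.
elim: s z => [|i s IH] z /= H; first by apply: H => k; rewrite subrr normr0.
rewrite /step ler_pM2r ?invr_gt0// lerD//; apply: IH => w Hw; apply: H => k;
  move: (Hw k); rewrite !mxE; case: (_ && _) => /=;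
  by generalize (w ord0 k) (z ord0 k) => a b; lia.
Qed.

Lemma walk_ge0 T s u z : (forall w, 0 <= u w) -> 0 <= walk T s u z.
Proof.
have it k v : (forall w, 0 <= v w) -> forall w, 0 <= iter T (step k) v w.
  by elim: T => //= T IH v0 w; rewrite divr_ge0// addr_ge0// IH.
by move=> u0; elim: s z => //= k s IH z; apply: it.
Qed.

Lemma walk1D s u v z : walk 1 s (fun x => u x + v x) z = walk 1 s u z + walk 1 s v z.
Proof.
by elim: s z => //= i s IH z; rewrite /step !IH; field.
Qed.

Lemma walk1Z s c u z : walk 1 s (fun x => c * u x) z = c * walk 1 s u z.
Proof. by elim: s z => //= i s IH z; rewrite /step !IH; field. Qed.

Lemma walk1_cst s c z : walk 1 s (fun=> c) z = c.
Proof. by elim: s z => //= i s IH z; rewrite /step !IH; field. Qed.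

Lemma walk1_sum s (I : Type) (r : seq I) (g : I -> lat -> R) z :
  walk 1 s (fun x => \sum_(l <- r) g l x) z = \sum_(l <- r) walk 1 s (g l) z.
Proof.
elim: r z => [|l r IH] z.
  under [in LHS]eq_fun do rewrite big_nil.
  by rewrite big_nil walk1_cst.
under [in LHS]eq_fun do rewrite big_cons.
by rewrite walk1D big_cons IH.
Qed.

(** The binomial law of the simple random walk, by Pascal's rule. *)
Lemma iter_stepE T i u z : iter T (step i) u z =
  \sum_(j < T.+1) 'C(T, j)%:R / 2 ^+ T * u (z + unitv i *~ (2 * j%:Z - T%:Z)).
Proof.
elim: T z => [|T IH] z.
  by rewrite /= big_ord1 bin0 expr0 divr1 mul1r mulr0z addr0.
rewrite iterS /step !IH -big_split/= mulr_suml.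
pose F j := u (z + unitv i *~ (2 * j%:Z - T.+1%:Z)).
have e1 (j : nat) : u (z + unitv i + unitv i *~ (2 * j%:Z - T%:Z)) = F j.+1.
  rewrite /F -addrA -{1}[unitv i]mulr1z -mulrzDr; congr (u (z + unitv i *~ _)).
  by rewrite !intS; lia.
have e2 (j : nat) : u (z - unitv i + unitv i *~ (2 * j%:Z - T%:Z)) = F j.
  rewrite /F -addrA -{1}[unitv i]mulr1z -mulrNz -mulrzDr; congr (u (z + unitv i *~ _)).
  by rewrite !intS; lia.
under [LHS]eq_bigr => j _ do rewrite e1 e2.
have -> : \sum_(j < T.+1) ('C(T, j)%:R / 2 ^+ T * F j.+1 + 'C(T, j)%:R / 2 ^+ T * F j) / 2
  = (\sum_(j < T.+1) 'C(T, j)%:R * F j.+1 + \sum_(j < T.+1) 'C(T, j)%:R * F j) / 2 ^+ T.+1.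
  rewrite -big_split/= mulr_suml; apply: eq_bigr => j _; rewrite exprS.
  by field; rewrite ?expf_neq0.
have -> : \sum_(j < T.+2) 'C(T.+1, j)%:R / 2 ^+ T.+1 * F j =
  (\sum_(j < T.+2) 'C(T.+1, j)%:R * F j) / 2 ^+ T.+1.
  by rewrite mulr_suml; apply: eq_bigr => j _; rewrite mulrAC.
congr (_ / _); rewrite [RHS]big_ord_recl/= bin0.
rewrite [X in _ + X = _]big_ord_recl/= bin0 addrCA; congr (_ + _).
have -> : \sum_(j < T.+1) 'C(T.+1, bump 0 j)%:R * F (bump 0 j) =
    \sum_(j < T.+1) ('C(T, j)%:R * F j.+1 + 'C(T, j.+1)%:R * F j.+1).
  by apply: eq_bigr => j _; rewrite /bump/= add1n binS natrD mulrDl addrC.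
rewrite big_split/=; congr (_ + _).
rewrite [RHS]big_ord_recr/= bin_small// mul0r addr0.
by apply: eq_bigr => j _.
Qed.

(** The return probability of the simple walk after [2 n] steps, which is its largest atom. *)
Definition kernel (n : nat) : R := 'C(n.*2, n)%:R / 2 ^+ n.*2.

Lemma kernel_ge0 n : 0 <= kernel n.
Proof. by rewrite divr_ge0// exprn_ge0. Qed.

Lemma bin_central n j : ('C(n.*2, j) <= 'C(n.*2, n))%N.
Proof.
have lo i : (i <= n)%N -> ('C(n.*2, n - i) <= 'C(n.*2, n))%N.
  elim: i => [|i IH] ni; first by rewrite subn0.
  apply: leq_trans (IH (ltnW ni)).
  have -> : (n - i = (n - i.+1).+1)%N by lia.
  set k := (n - i.+1)%N; have := mul_bin_left n.*2 k.
  have kn : (k.+1 <= n.*2 - k)%N by lia.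
  move=> E; rewrite -(@leq_pmul2l k.+1)// E leq_mul2r kn orbT//.
have [jn|nj] := leqP j n; first by rewrite -(subKn jn); apply: lo; lia.
have [j2|j2] := leqP j n.*2; last by rewrite bin_small.
by rewrite -bin_sub// (_ : n.*2 - j = n - (j - n))%N; [apply: lo|]; lia.
Qed.

(** Induction by the recurrence [k_{n+1} (2n+2) = k_n (2n+1)] and [(2n+1) (2n+3) <= (2n+2)^2]: the
    order [n^{-1/2}] without Stirling's formula. *)
Lemma kernel_sqr n : kernel n ^+ 2 * n.*2.+1%:R <= 1.
Proof.
elim: n => [|n IH]; first by rewrite /kernel bin0 expr0 divr1 expr1n mul1r.
have E : kernel n.+1 * (2 * n.+1%:R) = kernel n * n.*2.+1%:R.
  rewrite /kernel doubleS.
  have b1 : (n.+1 * 'C(n.*2.+2, n.+1) = n.*2.+2 * 'C(n.*2.+1, n))%N.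
    by rewrite mul_bin_diag.
  have b2 : (n.+1 * 'C(n.*2.+1, n) = n.*2.+1 * 'C(n.*2, n))%N.
    have /= -> := mul_bin_down n.*2.+1 n; congr (_ * _)%N; lia.
  have {}b1 : n.+1%:R * 'C(n.*2.+2, n.+1)%:R = n.*2.+2%:R * 'C(n.*2.+1, n)%:R :> R.
    by rewrite -!natrM b1.
  have {}b2 : n.+1%:R * 'C(n.*2.+1, n)%:R = n.*2.+1%:R * 'C(n.*2, n)%:R :> R.
    by rewrite -!natrM b2.
  have p0 : (2 : R) ^+ n.*2 != 0 by rewrite expf_neq0.
  have n1 : n.+1%:R != 0 :> R by rewrite pnatr_eq0.
  have d2 : n.*2.+2%:R = 2 * n.+1%:R :> R by rewrite -natrM; congr (_%:R); lia.
  rewrite d2 in b1; rewrite !exprS.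
  move: b1 b2; set A := 'C(_, _)%:R; set B := 'C(_, _)%:R; set D := 'C(_, _)%:R => b1 b2.
  have b3 : A = 2 * B by apply: (mulfI n1); rewrite b1; ring.
  transitivity (n.+1%:R * B / 2 ^+ n.*2); first by rewrite b3; field.
  by rewrite b2; field.
have n1 : 0 < n.+1%:R :> R by rewrite ltr0n.
have n2 : n.*2.+1%:R = 2 * n.+1%:R - 1 :> R.
  by rewrite -[n.+1]addn1 natrD -mul2n -[_.+1]addn1 natrD natrM; ring.
have n3 : n.+1.*2.+1%:R = 2 * n.+1%:R + 1 :> R.
  by rewrite -mul2n -[_.+1 in LHS]addn1 natrD natrM.
rewrite n3; rewrite n2 in E IH; set a := n.+1%:R in n1 E IH *.
set k := kernel n.+1 in E *; set k' := kernel n in E IH.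
have a1 : 1 <= a by rewrite /a ler1n.
have s0 : 0 < 2 * a by lra.
rewrite -(@ler_pM2r _ ((2 * a) ^+ 2)) ?exprn_gt0// mul1r.
have -> : k ^+ 2 * (2 * a + 1) * (2 * a) ^+ 2 = (k * (2 * a)) ^+ 2 * (2 * a + 1) by ring.
rewrite E exprMn.
have -> : k' ^+ 2 * (2 * a - 1) ^+ 2 * (2 * a + 1) =
  (k' ^+ 2 * (2 * a - 1)) * ((2 * a - 1) * (2 * a + 1)) by ring.
have p : 0 <= (2 * a - 1) * (2 * a + 1) by rewrite mulr_ge0; lra.
apply: le_trans (ler_wpM2r p IH) _; lra.
Qed.

(** The coordinates in [s] are treated one at a time. Each atom is at most [kernel n], and an end
    point [w] is reached through a single intermediate value of the coordinate, so nothing is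
    counted twice. *)
Lemma walk_kernel n (s : seq 'I_m) u (A : set lat) z : uniq s -> finite_set A ->
  (forall w, 0 <= u w) -> (forall w, ~ A w -> u w = 0) ->
  walk n.*2 s u z <= kernel n ^+ size s *
    latsum A (fun w => (`[< forall k, k \notin s -> w ord0 k = z ord0 k >])%:R * u w).
Proof.
move=> us fA u0 uA; elim: s z us => [|i s IH] z /=.
  move=> _; rewrite expr0 mul1r.
  have [Az|nAz] := pselect (A z); last first.
    by rewrite uA//; apply: latsum_ge0 => w; rewrite mulr_ge0.
  rewrite /latsum (bigD1_seq z) ?fset_uniq ?in_fset_set ?inE//=.
  by rewrite asboolT// mul1r lerDl sumr_ge0// => w _; rewrite mulr_ge0.
move=> /andP[ins us]; rewrite iter_stepE.
apply: (@le_trans _ _ (\sum_(j < n.*2.+1) kernel n * (kernel n ^+ size s *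
    latsum A (fun w => (`[< forall k, k \notin s ->
       w ord0 k = (z + unitv i *~ (2 * j%:Z - n.*2%:Z)) ord0 k >])%:R * u w)))).
  apply: ler_sum => j _; apply: ler_pM; last exact: IH.
  - by rewrite divr_ge0// exprn_ge0.
  - exact: walk_ge0.
  - by rewrite ler_wpM2r ?invr_ge0 ?exprn_ge0// ler_nat bin_central.
rewrite -mulr_sumr -mulr_sumr mulrA -exprS ler_wpM2l ?exprn_ge0 ?kernel_ge0//.
rewrite -latsum_sum; apply: ler_latsum => // w Aw.
rewrite -mulr_suml ler_wpM2r//.
have unitE k : unitv i ord0 k = (k == i)%:R by rewrite mxE eqxx.
have sE (c : int) k : (z + unitv i *~ c) ord0 k = z ord0 k + (k == i)%:R * c.
  by rewrite mxE -scaler_int mxE unitE mulrC intz.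
case: (pselect (exists j : 'I_n.*2.+1, forall k, k \notin s ->
    w ord0 k = (z + unitv i *~ (2 * j%:Z - n.*2%:Z)) ord0 k)) => [[j Hj]|nj].
  rewrite (bigD1 j)//= big1 ?addr0 => [|j' jj']; last first.
    rewrite asboolF// => /(_ i ins); rewrite (Hj i ins) !sE eqxx => E.
    by move/eqP: jj'; apply; apply/val_inj => /=; lia.
  rewrite asboolT// ler_nat lt0b; apply/asboolP => k.
  by rewrite inE negb_or => /andP[ki /Hj ->]; rewrite sE (negbTE ki) mul0r addr0.
rewrite big1// => j _; rewrite asboolF// => Hj; apply: nj; by exists j.
Qed.

End RandomWalk.

(** * Discrete mean value inequality on a nodal domain *)

Section MeanValue.
Variables (R : realType) (m : nat).
Local Notation vec := 'rV[R]_m.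
Local Notation lat := 'rV[int]_m.
Implicit Types (f : vec -> R) (x y p : vec) (z w : lat).

Definition cube x (s : R) : set vec := [set y | `|y - x| <= s].

(* Discrete form of  Laplacian f = - 4 pi^2 f. *)
Definition helmholtz (C L : R) f :=
  [/\ 0 <= C, 0 <= L, forall y y', `|f y - f y'| <= L * `|y - y'| &
  forall h p z, 0 < h ->
    `|walk 1 (enum 'I_m) (fun w => f (p + h *: emb R w)) z -
      (1 - 2 * pi ^+ 2 * h ^+ 2) * f (p + h *: emb R z)| <= C * h ^+ 4].

Lemma helmholtz_continuous C L f : helmholtz C L f -> continuous f.
Proof. by move=> [_ L0 H _]; exact: lipschitz_continuous L0 H. Qed.

Lemma helmholtzN C L f : helmholtz C L f -> helmholtz C L (fun y => - f y).
Proof.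
move=> [C0 L0 H1 H2]; split=> // [y y'|h p z h0].
  by rewrite -opprD normrN; exact: H1.
have := H2 h p z h0; rewrite -normrN opprB; congr (_ <= _); congr `|_|.
have -> : (fun w => - f (p + h *: emb R w)) = (fun w => -1 * f (p + h *: emb R w)).
  by apply/funext => w; rewrite mulN1r.
by rewrite walk1Z; ring.
Qed.

Lemma helmholtz_translate C L f q : helmholtz C L f -> helmholtz C L (fun y => f (q + y)).
Proof.
move=> [C0 L0 H1 H2]; split=> // [y y'|h p z h0].
  by apply: le_trans (H1 _ _) _; rewrite opprD addrACA subrr add0r.
have := H2 h (q + p) z h0; rewrite -addrA.
by under [X in walk 1 _ X]eq_fun do rewrite -addrA.
Qed.

(** The total time [2 n h^2] of the walk at mesh [h], chosen so that the errors [(2 pi^2 + m) S h^2]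
    of the single rounds add up to [S / 8]. *)
Definition tau : R := (8 * (2 * pi ^+ 2 + m%:R))^-1.
Definition mesh (n : nat) : R := Num.sqrt (tau / n.*2%:R).
(** A discrete volume: [kernel n ^+ m] is the largest mass that the walk can put on a lattice point.
    Monotonicity, additivity and uniform bounds are all that is used of it; no limit in [n] is
    taken. *)
Definition vol (n : nat) (A : set vec) : R :=
  kernel R n ^+ m * latcount R [set z : lat | A (mesh n *: emb R z)].

Let tauE : 0 < 2 * pi ^+ 2 + m%:R :> R.
Proof. by rewrite ltr_pwDl ?ler0n// mulr_gt0// exprn_gt0 ?pi_gt0. Qed.

Lemma tau_gt0 : 0 < tau.
Proof. by rewrite invr_gt0 mulr_gt0. Qed.

Lemma mesh_gt0 n : (0 < n)%N -> 0 < mesh n.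
Proof. by move=> n0; rewrite sqrtr_gt0 divr_gt0 ?tau_gt0// ltr0n double_gt0. Qed.

Lemma mesh_sqr n : (0 < n)%N -> n.*2%:R * mesh n ^+ 2 = tau.
Proof.
move=> n0; rewrite sqr_sqrtr ?divr_ge0 ?(ltW tau_gt0)//.
by rewrite mulrC divfK// pnatr_eq0 double_eq0 -lt0n.
Qed.

Lemma mesh_small (d : R) : 0 < d -> \forall n \near \oo, (0 < n)%N /\ mesh n <= d.
Proof.
move=> d0; near=> n; have n0 : (0 < n)%N by near: n; exists 1%N.
split=> //; rewrite -(ler_pXn2r (ltn0Sn 1)) ?nnegrE ?sqrtr_ge0 ?(ltW d0)//.
have n2 : 0 < n.*2%:R :> R by rewrite ltr0n double_gt0.
rewrite -(@ler_pM2l _ n.*2%:R)// mesh_sqr//.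
have dd : 0 < d ^+ 2 by rewrite exprn_gt0.
rewrite -ler_pdivrMr//.
have : tau / d ^+ 2 <= n%:R by near: n; exact: nbhs_infty_ger.
move/le_trans; apply; rewrite ler_nat; lia.
Unshelve. all: by end_near. Qed.

(** From [kernel n <= (2n + 1)^{-1/2}] and [2 n h^2 = tau]. It makes the discrete volume of a cube
    bounded uniformly in the mesh. *)
Lemma kernel_mesh n : (0 < n)%N -> kernel R n <= mesh n / Num.sqrt tau.
Proof.
move=> n0; have t0 : 0 < Num.sqrt tau by rewrite sqrtr_gt0 tau_gt0.
have mn := mesh_gt0 n0; rewrite ler_pdivlMr//.
rewrite -(ler_pXn2r (ltn0Sn 1)) ?nnegrE ?mulr_ge0 ?kernel_ge0 ?(ltW mn) ?(ltW t0)//.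
rewrite exprMn sqr_sqrtr ?(ltW tau_gt0)// -(mesh_sqr n0) mulrA.
rewrite -[leRHS]mul1r ler_wpM2r ?sqr_ge0//.
apply: le_trans (kernel_sqr R n).
by rewrite ler_wpM2l ?sqr_ge0// ler_nat.
Qed.

Lemma kernel_le1 n : kernel R n <= 1.
Proof.
rewrite -(ler_pXn2r (ltn0Sn 1)) ?nnegrE ?kernel_ge0// expr1n.
apply: le_trans (kernel_sqr R n); rewrite -[leLHS]mulr1 ler_wpM2l ?sqr_ge0//.
by rewrite ler1n.
Qed.

Definition volbound (s : R) := (2 * s / Num.sqrt tau + 1) ^+ m.

Lemma cube_finite n (s : R) : (0 < n)%N -> 0 <= s ->
  finite_set [set z : lat | cube 0 s (mesh n *: emb R z)] /\
  vol n (cube 0 s) <= volbound s.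
Proof.
move=> n0 s0; have h0 := mesh_gt0 n0.
pose K := Num.truncn (s / mesh n).
have sub : [set z : lat | cube 0 s (mesh n *: emb R z)] `<=`
    [set z : lat | forall i, `|z ord0 i| <= K%:Z].
  move=> z; rewrite /cube/= subr0 => zs i.
  have := le_trans (coord_le_norm _ i) zs; rewrite !mxE normrM gtr0_norm//.
  rewrite mulrC -ler_pdivlMr// => zi.
  have /andP[_] := Num.Theory.truncn_itv (divr_ge0 s0 (ltW h0)).
  move=> /(le_lt_trans zi); rewrite -intr_norm pmulrn ltr_int.
  by rewrite -/K; generalize (z ord0 i) => x; lia.
have [fK cK] := finite_box R m K.
split; first exact: sub_finite_set fK.
apply: (@le_trans _ _ (kernel R n ^+ m * (2 * K%:R + 1) ^+ m)).
  rewrite ler_wpM2l ?exprn_ge0 ?kernel_ge0//.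
  exact: le_trans (ler_latcount R fK sub) cK.
have t0 : 0 < Num.sqrt tau by rewrite sqrtr_gt0 tau_gt0.
have k0 := kernel_ge0 R n; have k1 := kernel_le1 n.
have kK : kernel R n * K%:R <= s / Num.sqrt tau.
  have K1 : K%:R <= s / mesh n.
    by have /andP[] := Num.Theory.truncn_itv (divr_ge0 s0 (ltW h0)).
  apply: le_trans (ler_wpM2l k0 K1) _.
  apply: le_trans (ler_wpM2r (divr_ge0 s0 (ltW h0)) (kernel_mesh n0)) _.
  by rewrite le_eqVlt; apply/orP; left; apply/eqP; field; rewrite !gt_eqF.
rewrite -exprMn; apply: lerXn2r; rewrite ?nnegrE.
- by rewrite mulr_ge0// addr_ge0// mulr_ge0.
- by rewrite addr_ge0// divr_ge0 ?(ltW t0)// mulr_ge0.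
- nra.
Qed.

Lemma vol_ge0 n A : 0 <= vol n A.
Proof. by rewrite mulr_ge0 ?exprn_ge0 ?kernel_ge0 ?latcount_ge0. Qed.

Lemma vol_le n A B (s : R) : (0 < n)%N -> 0 <= s -> B `<=` cube 0 s -> A `<=` B ->
  vol n A <= vol n B.
Proof.
move=> n0 s0 Bs AB; rewrite ler_wpM2l ?exprn_ge0 ?kernel_ge0//.
apply: ler_latcount; last by move=> z; exact: AB.
by apply: sub_finite_set (cube_finite n0 s0).1 => z; exact: Bs.
Qed.

Lemma vol_disjoint n (I : Type) (r : seq I) (A : I -> set vec) (B : set vec) (s : R) :
  (0 < n)%N -> 0 <= s -> B `<=` cube 0 s -> (forall i, A i `<=` B) ->
  (forall y, \sum_(i <- r) (`[< A i y >])%:R <= 1 :> R) ->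
  \sum_(i <- r) vol n (A i) <= vol n B.
Proof.
move=> n0 s0 Bs As dA; have [fC _] := cube_finite n0 s0.
have fQ : finite_set [set z : lat | B (mesh n *: emb R z)].
  by apply: sub_finite_set fC => z; exact: Bs.
rewrite /vol -mulr_sumr ler_wpM2l ?exprn_ge0 ?kernel_ge0//.
have E i : latcount R [set z : lat | A i (mesh n *: emb R z)] =
    latsum [set z : lat | B (mesh n *: emb R z)]
      (fun z => (`[< A i (mesh n *: emb R z) >])%:R).
  rewrite (latsum_diff _ fQ (_ : [set z : lat | A i (mesh n *: emb R z)] `<=` _)).
    rewrite /latcount [X in _ = _ + X]/latsum big_seq [X in _ = _ + X]big1 ?addr0.
      rewrite /latsum [LHS]big_seq [RHS]big_seq; apply: eq_bigr => z.
      rewrite in_fset_set => [/set_mem H|]; first by rewrite asboolT.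
      by apply: sub_finite_set fQ => w; exact: As.
    move=> z; rewrite in_fset_set => [/set_mem[_ H]|]; first by rewrite asboolF.
    by apply: sub_finite_set fQ => w [].
  by move=> z; exact: As.
under eq_bigr => i _ do rewrite E.
by rewrite -latsum_sum; apply: ler_latsum.
Qed.

Definition sqdist p y : R := dotv (y - p) (y - p).

(** Each coordinate step adds [h^2] to the mean squared distance. *)
Lemma walk1_sqdist (h : R) p s z :
  walk 1 s (fun w => sqdist p (h *: emb R w)) z =
  sqdist p (h *: emb R z) + (size s)%:R * h ^+ 2.
Proof.
have unitE i : emb R (unitv i) = delta_mx ord0 i.
  apply/rowP => k; rewrite !mxE; by case: (_ && _).
have de i : dotv (delta_mx ord0 i : vec) (delta_mx ord0 i) = 1.
  rewrite /dotv (bigD1 i)//= big1 ?addr0 => [|k ki]; rewrite !mxE eqxx ?eqxx ?mulr1//.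
  by rewrite (negbTE ki) mulr0.
have gen (v u : vec) : (dotv (v + h *: u) (v + h *: u) +
    dotv (v + (- h) *: u) (v + (- h) *: u)) / 2 = dotv v v + h ^+ 2 * dotv u u.
  by rewrite !dotvDl !dotvDr !dotvZl !dotvZr (dotvC u v); field.
have st i w : (sqdist p (h *: emb R (w + unitv i)) +
    sqdist p (h *: emb R (w - unitv i))) / 2 = sqdist p (h *: emb R w) + h ^+ 2.
  rewrite /sqdist !embD embN unitE.
  have -> : h *: (emb R w + delta_mx ord0 i) - p =
    (h *: emb R w - p) + h *: delta_mx ord0 i by rewrite scalerDr addrAC.
  have -> : h *: (emb R w - delta_mx ord0 i) - p =
    (h *: emb R w - p) + (- h) *: delta_mx ord0 i by rewrite scalerBr scaleNr addrAC.
  by rewrite gen de mulr1.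
elim: s z => [|i s IH] z /=; first by rewrite mul0r addr0.
rewrite /step !IH; have := st i z.
by rewrite -[in X in _ -> X](addn1 (size s)) natrD; lra.
Qed.

Lemma walk1_mono s (u v : lat -> R) z : (forall w, u w <= v w) -> walk 1 s u z <= walk 1 s v z.
Proof. by move=> H; apply: walk1_ge. Qed.

Lemma walk_iter_bound (T : nat) u (E : R) : (forall z, u z <= walk 1 (enum 'I_m) u z + E) ->
  forall z, u z <= walk T (enum 'I_m) u z + T%:R * E.
Proof.
move=> H; elim: T => [|T IH] z; first by rewrite walk0 mul0r addr0.
rewrite walkS; apply: le_trans (H z) _.
have := walk1_mono (enum 'I_m) z IH; rewrite walk1D walk1_cst.
by rewrite -[T.+1]addn1 natrD; lra.
Qed.

Lemma lattice_cube_finite (h : R) p (s : R) : 0 < h ->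
  finite_set [set w : lat | `|h *: emb R w - p| <= s].
Proof.
move=> h0; apply: (sub_finite_set _ (lball_finite h0 p (m%:R * s + 1))).
move=> w /= ws; rewrite /lball/=; apply: le_lt_trans (enorm_le_norm _) _.
by apply: (@le_lt_trans _ _ (m%:R * s)); [rewrite ler_wpM2l|lra].
Qed.

Lemma ball_lt1 p y : enorm (y - p) < 1 -> `|y - p| < 1.
Proof. exact: le_lt_trans (norm_le_enorm _). Qed.

Lemma emb_norm (s : nat) w z : (forall k, `|w ord0 k - z ord0 k| <= s%:Z) ->
  `|emb R w - emb R z| <= s%:R.
Proof.
move=> H; apply: norm_le_coord => // k; rewrite !mxE -intrB -intr_norm pmulrn ler_int.
exact: H.
Qed.

(* The truncation w of f - S |y - p|^2 on a nodal domain is almost a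
   subsolution of the walk, and after 2n steps the walk charges every lattice
   point with probability at most (kernel n)^m. *)
Lemma mean_value_lattice C L f x z0 (S : R) n : helmholtz C L f -> 0 < f x ->
  (0 < n)%N -> m%:R * mesh n <= 1 -> 0 < S ->
  let p := mesh n *: emb R z0 in domain f x p ->
  (forall y, domain f x y -> `|y - p| <= 2 -> f y <= S) ->
  f p <= S / 8 + (L * m%:R * mesh n + C * mesh n ^+ 2) +
    S * vol n (domain f x `&` cube p 1).
Proof.
move=> Hf fx n0 mh S0 p xp fS; have cf := helmholtz_continuous Hf.
have [C0 L0 HL HH] := Hf; have h0 := mesh_gt0 n0; set h := mesh n in h0 mh *.
(* Bounds the oscillation of [f] over one round of the walk, so that a point of the domain with
   [f > eps] has all its neighbours in the same domain. *)
pose eps := L * m%:R * h; have eps0 : 0 <= eps by rewrite !mulr_ge0 ?(ltW h0).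
(* Where [f <= S], the quadratic term makes [psi] nonpositive outside the unit ball about [p]. *)
pose psi z := f (h *: emb R z) - eps - S * sqdist p (h *: emb R z).
pose P z := [/\ domain f x (h *: emb R z), enorm (h *: emb R z - p) < 1 & 0 < psi z].
pose u z := if `[< P z >] then psi z else 0.
have sqd0 y : 0 <= sqdist p y by exact: dotvv_ge0.
have u0 z : 0 <= u z by rewrite /u; case: asboolP => // -[_ _ /ltW].
have vA0 := vol_ge0 n (domain f x `&` cube p 1).
(* The loss per round: [2 pi^2 h^2 S] from the eigenvalue, [m h^2 S] from the squared distance,
   [C h^4] from the discretisation. *)
pose E := h ^+ 2 * ((2 * pi ^+ 2 + m%:R) * S + C * h ^+ 2).
have h2 : 0 <= h ^+ 2 by exact: sqr_ge0.
have E0 : 0 <= E.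
  by apply: mulr_ge0 => //; apply: addr_ge0; apply: mulr_ge0 => //; exact: ltW.
have sub z : u z <= walk 1 (enum 'I_m) u z + E.
  rewrite {1}/u; case: asboolP => [[xz zp psi0]|_]; last first.
    by rewrite addr_ge0//; exact: walk_ge0.
  have fz : eps < f (h *: emb R z).
    by move: psi0; rewrite /psi; have := sqd0 (h *: emb R z); nra.
  have fzS : f (h *: emb R z) <= S.
    by apply: fS => //; have := ball_lt1 zp; lra.
  (* At a neighbour [w] either [psi w <= 0 <= u w], or [w] satisfies [P] again and [u w = psi w]. *)
  have psiu : walk 1 (enum 'I_m) psi z <= walk 1 (enum 'I_m) u z.
    apply: walk1_ge => w; rewrite -cardE card_ord => Hw.
    have d1 : `|h *: emb R w - h *: emb R z| <= h * m%:R.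
      by rewrite -scalerBr normrZ gtr0_norm// ler_wpM2l ?(ltW h0)// emb_norm.
    have xw : domain f x (h *: emb R w).
      apply: (domain_segment xz) => t /andP[t0 t1].
      set y := _ + _; have := HL (h *: emb R z) y.
      have -> : h *: emb R z - y = - (t *: (h *: emb R w - h *: emb R z)).
        by rewrite /y opprD addrA subrr add0r.
      rewrite normrN normrZ ger0_norm// ler_norml => /andP[_ H].
      have : L * (t * `|h *: emb R w - h *: emb R z|) <= eps.
        rewrite /eps -mulrA ler_wpM2l// -[leRHS]mul1r; apply: ler_pM => //.
        by rewrite mulrC.
      by move: H fz; lra.
    rewrite /u; case: asboolP => // nP; rewrite leNgt; apply/negP => psiw.
    apply: nP; split=> //; rewrite ltNge; apply/negP => wp.
    have wS : f (h *: emb R w) <= S.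
      apply: fS => //; rewrite -(subrK (h *: emb R z) (h *: emb R w)) -addrA.
      apply: le_trans (ler_normD _ _) _; have := ball_lt1 zp.
      by move: d1 mh; rewrite mulrC; lra.
    have : 1 <= sqdist p (h *: emb R w).
      by rewrite /sqdist -sqr_enorm -(expr1n _ 2) lerXn2r ?nnegrE ?enorm_ge0.
    by move: psiw; rewrite /psi; nra.
  have psiE : walk 1 (enum 'I_m) psi z = walk 1 (enum 'I_m) (fun w => f (0 + h *: emb R w)) z
      - eps - S * (sqdist p (h *: emb R z) + m%:R * h ^+ 2).
    have <- : (size (enum 'I_m))%:R = m%:R :> R by rewrite -cardE card_ord.
    rewrite -walk1_sqdist.
    have -> : psi = (fun w => (f (0 + h *: emb R w) + - eps) +
         (- S) * sqdist p (h *: emb R w)).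
      by apply/funext => w; rewrite /psi add0r mulNr.
    by rewrite walk1D walk1Z walk1D walk1_cst mulNr.
  have := HH h 0 z h0; rewrite ler_norml => /andP[H _].
  rewrite add0r in H; apply: le_trans (lerD psiu (lexx _)); rewrite psiE /psi /E.
  have H2 : 2 * pi ^+ 2 * h ^+ 2 * f (h *: emb R z) <= 2 * pi ^+ 2 * h ^+ 2 * S.
    by rewrite ler_wpM2l// mulr_ge0// mulr_ge0// sqr_ge0.
  have h4 : h ^+ 4 = h ^+ 2 * h ^+ 2 by rewrite -exprD.
  by move: H H2; rewrite h4; lra.
pose A := [set w : lat | `|h *: emb R w - p| <= 1].
have fA : finite_set A by exact: lattice_cube_finite.
have uA w : ~ A w -> u w = 0.
  move=> nA; rewrite /u; case: asboolP => // -[_ /ball_lt1 H _].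
  by exfalso; apply: nA; exact: ltW.
have K1 := walk_kernel n z0 (enum_uniq 'I_m) fA u0 uA.
have K2 := walk_iter_bound n.*2 sub z0.
have TE : n.*2%:R * E <= S / 8 + C * h ^+ 2.
  rewrite /E mulrA (mesh_sqr n0) mulrDr mulrA.
  have -> : tau * (2 * pi ^+ 2 + m%:R) = 1 / 8.
    by rewrite /tau invfM -mulrA mulVf ?mulr1 ?div1r// gt_eqF.
  have t1 : tau <= 1.
    rewrite invf_le1; last by rewrite mulr_gt0.
    have := @pi_ge2 R => p2; have : 4 <= pi ^+ 2 :> R by rewrite expr2; nra.
    by have := ler0n R m; lra.
  have : tau * (C * h ^+ 2) <= C * h ^+ 2.
    by rewrite -[leRHS]mul1r ler_wpM2r// mulr_ge0.
  lra.
have sumu : latsum A (fun w => (`[< forall k, k \notin enum 'I_m -> w ord0 k = z0 ord0 k >])%:R * u w)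
    <= S * latcount R [set z : lat | (domain f x `&` cube p 1) (h *: emb R z)].
  have fD : finite_set [set z : lat | (domain f x `&` cube p 1) (h *: emb R z)].
    by apply: sub_finite_set fA => w [].
  rewrite -latsum_cst.
  rewrite (@latsum_diff _ _ A [set z : lat | (domain f x `&` cube p 1) (h *: emb R z)]) //;
    last by move=> w [].
  rewrite [X in _ + X](_ : _ = 0) ?addr0.
    apply: ler_latsum => // w [xw _].
    rewrite asboolT ?mul1r; last by move=> k; rewrite mem_enum.
    rewrite /u; case: asboolP => [[_ wp _]|_]; last exact: ltW.
    have : f (h *: emb R w) <= S by apply: fS => //; have := ball_lt1 wp; lra.
    by rewrite /psi; have := sqd0 (h *: emb R w); nra.
  rewrite /latsum big_seq big1// => w.
  rewrite in_fset_set; last by apply: sub_finite_set fA => v [].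
  move=> /set_mem[Aw nD]; rewrite /u; case: (asboolP (P w)) => [[xw _ _]|_]; last by rewrite mulr0.
  by exfalso; apply: nD.
have kS : walk n.*2 (enum 'I_m) u z0 <= S * vol n (domain f x `&` cube p 1).
  apply: le_trans K1 _; rewrite -cardE card_ord /vol mulrCA.
  by rewrite ler_wpM2l ?exprn_ge0 ?kernel_ge0.
have [fpe|fpe] := leP (f p) eps.
  have : 0 <= S * vol n (domain f x `&` cube p 1) by rewrite mulr_ge0// ltW.
  have : 0 <= C * h ^+ 2 by rewrite mulr_ge0.
  move: fpe; rewrite /eps; lra.
have up : u z0 = f p - eps.
  have s0 : sqdist p p = 0 by rewrite /sqdist subrr dotv0r.
  rewrite /u asboolT; first by rewrite /psi -/p s0 mulr0 subr0.
  split; rewrite -?/p//; first by rewrite subrr enorm0.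
  by rewrite /psi -/p s0; lra.
by move: K2; rewrite up /eps; lra.
Qed.

(** Covers the rounding of the centre to the lattice, the cut-off at [L m h] and the
    discretisation. *)
Definition err (C L : R) n := (2 * m%:R + 1) * L * mesh n + C * mesh n ^+ 2.

Lemma err_small C L (e : R) : 0 <= C -> 0 <= L -> 0 < e ->
  \forall n \near \oo, [/\ (0 < n)%N, m%:R * mesh n <= 1, mesh n <= 1 & err C L n <= e].
Proof.
move=> C0 L0 e0; pose K := (2 * m%:R + 1) * L + C + m%:R + 1.
have mR := ler0n R m.
have K0 : 0 < K by rewrite /K; have : 0 <= (2 * m%:R + 1) * L by [rewrite mulr_ge0//; lra]; lra.
have d0 : 0 < Num.min 1 e / K by rewrite divr_gt0// lt_min ltr01.
near=> n; have [n0 nd] : (0 < n)%N /\ mesh n <= Num.min 1 e / K.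
  by near: n; exact: mesh_small.
have h0 := mesh_gt0 n0.
move: nd; rewrite ler_pdivlMr// le_min => /andP[nK1 nKe].
have L1 : 0 <= (2 * m%:R + 1) * L by rewrite mulr_ge0//; lra.
have m1 : m%:R * mesh n <= 1 by move: nK1; rewrite /K; nra.
have m2 : mesh n <= 1 by move: nK1; rewrite /K; nra.
split=> //; apply: le_trans nKe; rewrite /err /K.
have : C * mesh n ^+ 2 <= C * mesh n by rewrite ler_wpM2l// expr2 -[leRHS]mul1r ler_wpM2r// ltW.
nra.
Unshelve. all: by end_near. Qed.

(** The centre is rounded to the lattice, at the cost of [L h] in the value and of one unit in each
    radius. *)
Lemma mean_value C L f x y0 (S : R) n : helmholtz C L f -> 0 < f x ->
  (0 < n)%N -> m%:R * mesh n <= 1 -> mesh n <= 1 -> 0 < S ->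
  domain f x y0 -> (forall y, domain f x y -> `|y - y0| <= 3 -> f y <= S) ->
  f y0 <= S / 8 + err C L n + S * vol n (domain f x `&` cube y0 2).
Proof.
move=> Hf fx n0 mh h1 S0 xy fS; have cf := helmholtz_continuous Hf.
have [C0 L0 HL HH] := Hf; have h0 := mesh_gt0 n0.
pose z0 := round (mesh n) y0; pose p := mesh n *: emb R z0.
have yp : `|y0 - p| <= mesh n by exact: round_norm.
have mR := ler0n R m.
have v0 := vol_ge0 n (domain f x `&` cube y0 2).
have Lh : 0 <= L * mesh n by rewrite mulr_ge0// ltW.
have Ch : 0 <= C * mesh n ^+ 2 by rewrite mulr_ge0// sqr_ge0.
have mLh : 0 <= m%:R * (L * mesh n) by rewrite mulr_ge0.
have errE : err C L n = 2 * (m%:R * (L * mesh n)) + L * mesh n + C * mesh n ^+ 2.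
  by rewrite /err; ring.
have [fy|fy] := leP (f y0) (L * mesh n).
  by rewrite errE; have : 0 <= S * vol n (domain f x `&` cube y0 2) by [rewrite mulr_ge0// ltW]; lra.
have xp : domain f x p.
  apply: (domain_segment xy) => t /andP[t0 t1].
  have := HL y0 (y0 + t *: (p - y0)).
  rewrite opprD addrA subrr add0r normrN normrZ ger0_norm// ler_norml => /andP[_ H].
  have : L * (t * `|p - y0|) <= L * mesh n.
    rewrite ler_wpM2l// -[leRHS]mul1r; apply: ler_pM => //; by rewrite distrC.
  lra.
have := HL y0 p; rewrite ler_norml => /andP[_ Hp].
have Lp : L * `|y0 - p| <= L * mesh n by rewrite ler_wpM2l.
have H : f p <= S / 8 + (L * m%:R * mesh n + C * mesh n ^+ 2) +
    S * vol n (domain f x `&` cube p 1).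
  have := @mean_value_lattice C L f x z0 S n Hf fx n0 mh S0 xp; rewrite -/p.
  apply=> y xy' yp'; apply: fS => //.
  rewrite -(subrK p y) -addrA; apply: le_trans (ler_normD _ _) _.
  by rewrite (distrC p); lra.
have vv : vol n (domain f x `&` cube p 1) <= vol n (domain f x `&` cube y0 2).
  rewrite ler_wpM2l ?exprn_ge0 ?kernel_ge0//; apply: ler_latcount.
    by apply: sub_finite_set (@lattice_cube_finite (mesh n) y0 2 h0) => w [].
  move=> w [xw]; rewrite /cube/= => wp; split => //.
  rewrite /cube/= -(subrK p (_ *: _)) -addrA; apply: le_trans (ler_normD _ _) _.
  by rewrite (distrC p); lra.
have : S * vol n (domain f x `&` cube p 1) <= S * vol n (domain f x `&` cube y0 2).
  by rewrite ler_wpM2l// ltW.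
rewrite errE; lra.
Qed.

End MeanValue.

(** * Volume of nodal domains *)

Section DomainVolume.
Variables (R : realType) (m : nat).
Local Notation vec := 'rV[R]_m.
Implicit Types (f : vec -> R) (x y p : vec).

(** With [S = |f p|] the mean value inequality loses at most [S / 8 + S / 8]; the rest must come
    from the volume term. *)
Lemma fat_summit C L f p n : helmholtz C L f -> f p != 0 ->
  (forall y, domain f p y -> `|f y| <= `|f p|) ->
  (0 < n)%N -> m%:R * mesh R m n <= 1 -> mesh R m n <= 1 -> err m C L n <= `|f p| / 8 ->
  1 / 2 <= vol n (domain f p `&` cube p 2).
Proof.
wlog fp : f / 0 < f p => [H Hf fp0 fmax n0 mh h1 en|].
  have [fp|fp] := ltP 0 (f p); first exact: (H f).
  have := H (fun y => - f y); rewrite domainN; apply.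
  - by rewrite oppr_gt0 lt_neqAle fp0.
  - exact: helmholtzN.
  - by rewrite oppr_eq0.
  - by move=> y; rewrite !normrN; exact: fmax.
  - by [].
  - by [].
  - by [].
  - by rewrite normrN.
move=> Hf fp0 fmax n0 mh h1; rewrite gtr0_norm// => en.
have cf := helmholtz_continuous Hf.
have pp : domain f p p by apply: connected_component_refl; exact/eqP.
have := mean_value Hf fp n0 mh h1 fp pp => /(_ _).
have fS y : domain f p y -> `|y - p| <= 3 -> f y <= f p.
  move=> py _; have := fmax y py; rewrite (gtr0_norm fp); apply: le_trans.
  exact: ler_norm.
move=> /(_ fS) H.
have : f p * (1 / 2) <= f p * vol n (domain f p `&` cube p 2) by lra.
by rewrite ler_pM2l.
Qed.

Lemma same_domain_sum f (s : seq (set vec)) (Q : set vec -> set vec) y : uniq s ->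
  (forall C, C \in s -> exists x, C = domain f x) -> (forall C, Q C `<=` C) ->
  \sum_(C <- s) (`[< Q C y >])%:R <= 1 :> R.
Proof.
move=> us sD QC.
have [[C Cs Cy]|nC] := pselect (exists2 C, C \in s & Q C y).
  rewrite (bigD1_seq C)//= big_seq_cond big1 ?addr0; first by case: asboolP.
  move=> C' /andP[C's C'C]; rewrite asboolF// => /QC C'y; move/eqP: C'C; apply.
  have [x xE] := sD _ Cs; have [x' x'E] := sD _ C's.
  move/QC : Cy => Cy; rewrite xE in Cy *; rewrite x'E in C'y *.
  by rewrite (same_domain Cy) (same_domain C'y).
rewrite big_seq big1// => C Cs; rewrite asboolF// => Cy; apply: nC; by exists C.
Qed.

(** Each of these domains has volume at least 1/2 inside the cube of radius [3 = 1 + 2], and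
    distinct domains are disjoint. *)
Lemma summits_in_cell C L f (s : seq (set vec)) : helmholtz C L f -> uniq s ->
  (forall D, D \in s -> exists p, [/\ f p != 0, D = domain f p, `|p| <= 1 &
     forall y, D y -> `|f y| <= `|f p|]) ->
  (size s)%:R <= 2 * volbound m (3 : R).
Proof.
move=> Hf us sP; have [C0 L0 _ _] := Hf.
(* The mesh must be fine compared with the lowest of these finitely many maxima; the resulting bound
   does not depend on it. *)
have [e e0 He] : exists2 e : R, 0 < e & forall D, D \in s -> exists p,
    [/\ f p != 0, D = domain f p, `|p| <= 1,
     forall y, D y -> `|f y| <= `|f p| & e <= `|f p|].
  elim: s us sP => [|D s IH] /=; first by exists 1.
  move=> /andP[_ us] sP; have [//|D' D's|e e0 He] := IH.
    by apply: sP; rewrite in_cons D's orbT.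
  have [p [fp DE p1 pm]] := sP D (mem_head _ _).
  exists (Num.min e `|f p|); first by rewrite lt_min e0 normr_gt0.
  move=> D'; rewrite in_cons => /orP[/eqP->|/He[p' [? ? ? ? ep']]].
    by exists p; split => //; rewrite ge_min lexx orbT.
  by exists p'; split => //; rewrite ge_min ep'.
have e8 : 0 < e / 8 by rewrite divr_gt0.
have [N _ HN] := err_small m C0 L0 e8; have [n0 mh h1 en] := HN N (leqnn N).
have Ds D : D \in s -> 1 / 2 <= vol N (D `&` cube 0 3).
  move=> /He[p [fp -> p1 pm ep]].
  have eN : err m C L N <= `|f p| / 8 by lra.
  apply: le_trans (fat_summit Hf fp _ n0 mh h1 eN) _; first by rewrite -?DE.
  apply: (@vol_le R m N _ _ 3) => // y [py]; rewrite /cube/= => yp; split=> //.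
  by rewrite /cube/= subr0 -(subrK p y); apply: le_trans (ler_normD _ _) _; lra.
have [_ vQ] := @cube_finite R m N 3 n0 (ler0n _ 3).
have : \sum_(D <- s) vol N (D `&` cube 0 3) <= volbound m (3 : R).
  apply: le_trans vQ; apply: (@vol_disjoint R m N _ s _ _ 3) => // y.
  apply: (@same_domain_sum f s (fun D => D `&` cube 0 3) y us) => [D /He[p [_ -> _ _ _]]|D y' []//].
  by exists p.
have : \sum_(D <- s) (1 / 2) <= \sum_(D <- s) vol N (D `&` cube 0 3).
  by rewrite big_seq [leRHS]big_seq; apply: ler_sum => D /Ds.
rewrite big_const_seq count_predT iter_addr addr0 -mulr_natr; lra.
Qed.

(** The norm takes an interval of values on a connected set. *)
Lemma domain_sphere f x a c (rho : R) : domain f x a -> domain f x c ->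
  `|a| <= rho -> rho <= `|c| -> exists2 y, domain f x y & `|y| = rho.
Proof.
move=> xa xc ar rc.
have : connected (Num.norm @` domain f x).
  apply: connected_continuous_connected; first exact: component_connected.
  by apply: continuous_subspaceT; exact: norm_continuous.
move=> /connected_intervalP /(_ `|a| `|c|).
move=> /(_ (ex_intro2 _ _ a xa erefl) (ex_intro2 _ _ c xc erefl) rho).
by rewrite ar rc => /(_ isT)[y xy <-]; exists y.
Qed.

(* If a block of shells contained no point around which the domain is fat, f
   would be halved from shell to shell, hence too small in the middle of the
   block for a nondegenerate function. *)
Lemma long_domain_volume C L f (W W' M t : R) x a c (P J n : nat) :
  helmholtz C L f -> 0 < M -> 0 < t -> t <= 1 -> regular_on W M f ->
  nondegenerate_on W' M t 3 14 f -> W' + t <= W ->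
  P%:R * (6 * J%:R + 6) <= W' -> (1 / 2) ^+ J <= t ^+ 2 ->
  domain f x a -> domain f x c -> nonzero f x ->
  `|a| <= 1 -> P%:R * (6 * J%:R + 6) <= `|c| ->
  (0 < n)%N -> m%:R * mesh R m n <= 1 -> mesh R m n <= 1 ->
  err m C L n <= M * (1 / 2) ^+ J / 8 ->
  P%:R / 4 <= vol n (domain f x `&` cube 0 (P%:R * (6 * J%:R + 6))).
Proof.
wlog fx : f / 0 < f x => [H Hf M0 t0 t1 rf nf WW PW Jt xa xc fx0|].
  have [fx|fx] := ltP 0 (f x); first exact: (H f).
  have := H (fun y => - f y); rewrite domainN; apply=> //.
  - by rewrite oppr_gt0 lt_neqAle fx andbT; apply/eqP.
  - exact: helmholtzN.
  - exact: regular_onN.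
  - exact: nondegenerate_onN.
  - by move=> /= /eqP; rewrite oppr_eq0 => /eqP.
set b := 6 * J%:R + 6 => Hf M0 t0 t1 rf nf WW PW Jt xa xc fx0 a1 cP n0 mh h1 en.
have cf := helmholtz_continuous Hf.
have J0 : 0 <= J%:R :> R by [].
have bE : b = 6 * J%:R + 6 by [].
clearbody b; have b6 : 6 <= b by lra.
have q0 : 0 < M * t ^+ 2 by rewrite mulr_gt0// exprn_gt0.
(* One fat point in each block of width [b]; the margin 3 keeps the cubes of radius 2 of different
   blocks disjoint. *)
have fat (i : nat) : (i < P)%N -> exists y, [/\ domain f x y, i%:R * b + 3 <= `|y|,
    `|y| <= i.+1%:R * b - 3 & 1 / 4 <= vol n (domain f x `&` cube y 2)].
  move=> iP; apply: contrapT => nfat.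
  have iPb : i.+1%:R * b <= P%:R * b by rewrite ler_wpM2r ?ler_nat//; lra.
  have iE : i.+1%:R * b = i%:R * b + b by rewrite -[i.+1]addn1 natrD mulrDl mul1r.
  have ib0 : 0 <= i%:R * b by rewrite mulr_ge0//; lra.
  (* Each round gives up 3, the radius in [mean_value], at both ends of the block, and the bound
     becomes [S/8 + S/8 + S/4 = S/2]. *)
  have decay (j : nat) : (j <= J)%N -> forall y, domain f x y ->
      i%:R * b + 3 * j%:R <= `|y| -> `|y| <= i.+1%:R * b - 3 * j%:R ->
      f y <= M * (1 / 2) ^+ j.
    elim: j => [|j IH] jJ y xy y1 y2.
      rewrite expr0 mulr1; apply: le_trans (ler_norm _) _.
      by have [+ _ _] := rf; apply; lra.
    have jS : j.+1%:R = j%:R + 1 :> R by rewrite -[j.+1]addn1 natrD.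
    rewrite jS in y1 y2.
    have j0 : 0 <= j%:R :> R by [].
    have S0 : 0 < M * (1 / 2) ^+ j by rewrite mulr_gt0// exprn_gt0.
    have := mean_value Hf fx n0 mh h1 S0 xy => /(_ _).
    have fS y' : domain f x y' -> `|y' - y| <= 3 -> f y' <= M * (1 / 2) ^+ j.
      move=> xy' yy'; apply: IH => //; first exact: ltnW.
        have := ler_normB y y'; rewrite distrC; have := ler_dist_dist y y'.
        rewrite ler_norml distrC => /andP[_]; lra.
      rewrite -(subrK y y'); apply: le_trans (ler_normD _ _) _; lra.
    move=> /(_ fS) H.
    have v4 : vol n (domain f x `&` cube y 2) <= 1 / 4.
      rewrite leNgt; apply/negP => v4; apply: nfat; exists y; split => //; lra.
    have e1 : (1 / 2) ^+ J <= (1 / 2) ^+ j :> R by apply: ler_wiXn2l; [lra|lra|exact: ltnW].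
    have e2 : M * (1 / 2) ^+ J <= M * (1 / 2) ^+ j by rewrite ler_wpM2l ?(ltW M0).
    have e3 : M * (1 / 2) ^+ j * vol n (domain f x `&` cube y 2) <=
        M * (1 / 2) ^+ j * (1 / 4) by rewrite ler_wpM2l ?(ltW S0).
    rewrite exprSr mulrA; lra.
  (* The middle of the block: after [J] rounds a shell of half-width 3 about it is left, which still
     contains the end point of [climb]. *)
  pose rho := i%:R * b + 3 * J%:R + 3.
  have [y xy yr] : exists2 y, domain f x y & `|y| = rho.
    by apply: (domain_sphere xa xc); rewrite /rho; lra.
  have fy := domain_gt0 cf fx xy.
  have yW : `|y| <= W' by rewrite yr /rho; lra.
  have fyJ : f y <= M * t ^+ 2.
    apply: le_trans (decay J (leqnn _) y xy _ _) _; rewrite ?yr /rho; try lra.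
    by rewrite ler_wpM2l// ltW.
  have [||v [vt fv /(_ fy) yv]] := climb cf M0 t0 rf WW nf yW; [lra|lra|].
  have xv : domain f x (y + v) by apply: connected_component_trans xy yv.
  have : f (y + v) <= M * (1 / 2) ^+ J.
    apply: (decay J (leqnn _) _ xv).
      by have := ler_normB (y + v) v; rewrite addrK yr /rho; lra.
    by apply: le_trans (ler_normD _ _) _; rewrite yr /rho; lra.
  have : M * (1 / 2) ^+ J <= M * t ^+ 2 by rewrite ler_wpM2l// ltW.
  lra.
have /choice[y Hy] : forall i : 'I_P, exists y, [/\ domain f x y, i%:R * b + 3 <= `|y|,
    `|y| <= i.+1%:R * b - 3 & 1 / 4 <= vol n (domain f x `&` cube y 2)].
  by move=> i; exact: fat.
have Pb0 : 0 <= P%:R * b by rewrite mulr_ge0//; lra.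
have ann (i : 'I_P) y' : cube (y i) 2 y' -> i%:R * b < `|y'| /\ `|y'| < i.+1%:R * b.
  rewrite /cube/= => yy'; have [_ y1 y2 _] := Hy i.
  have := ler_dist_dist (y i) y'; rewrite distrC => H1; have := le_trans H1 yy'.
  rewrite ler_norml => /andP[? ?]; split; lra.
apply: (@le_trans _ _ (\sum_(i <- enum 'I_P) vol n (domain f x `&` cube (y i) 2))).
  apply: (@le_trans _ _ (\sum_(i <- enum 'I_P) (1 / 4))).
    rewrite big_const_seq count_predT iter_addr addr0 -cardE card_ord -mulr_natr; lra.
  by apply: ler_sum => i _; have [] := Hy i.
apply: (@vol_disjoint R m n _ _ _ _ (P%:R * b)) => // [i y' [xy' /[dup] /ann[_ H] _]|y'].
  split=> //; rewrite /cube/= subr0 ltW//; apply: lt_le_trans H _.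
  by rewrite ler_wpM2r ?ler_nat//; lra.
have [[i Hi]|ni] := pselect (exists i : 'I_P, (domain f x `&` cube (y i) 2) y').
  rewrite (bigD1_seq i) ?mem_enum ?enum_uniq//= big1 ?addr0; first by case: asboolP.
  move=> j ji; rewrite asboolF// => -[_ /ann[j1 j2]]; have [_ /ann[i1 i2]] := Hi.
  have lt1 (k l : nat) : k%:R * b < l.+1%:R * b -> (k <= l)%N.
    by rewrite ltr_pM2r ?ltr_nat//; lra.
  have Hji := lt1 _ _ (lt_trans j1 i2); have Hij := lt1 _ _ (lt_trans i1 j2).
  by move: ji; rewrite -val_eqE eqn_leq Hji Hij.
rewrite big1// => i _; rewrite asboolF// => Hi; apply: ni; by exists i.
Qed.

End DomainVolume.

(** * Trigonometric sums *)

Section TrigonometricFacts.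
Variable R : realType.
Implicit Types a b x y : R.

(** The k-th derivative of the cosine is its shift by [k pi / 2], so that sine and cosine are
    treated together through the base point [a]. *)
Definition cos_taylor (K : nat) a x : R :=
  \sum_(k < K) x ^+ k / k`!%:R * cos (a + k%:R * (pi / 2)).

Lemma is_derive_cos_taylor K a x :
  is_derive x (1 : R) (cos_taylor K.+1 a) (cos_taylor K (a + pi / 2) x).
Proof.
elim: K => [|K IH].
  rewrite /cos_taylor big_ord0.
  have -> : (fun y => \sum_(k < 1) y ^+ k / k`!%:R * cos (a + k%:R * (pi / 2))) = cst (cos a).
    by apply/funext => y; rewrite big_ord1 expr0 fact0 divr1 mul1r mul0r addr0.
  exact: is_derive_cst.
have -> : cos_taylor K.+2 a = cos_taylor K.+1 a \+
    (fun y => (cos (a + K.+1%:R * (pi / 2)) / K.+1`!%:R) *: (y ^+ K.+1 : R)).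
  apply/funext => y; rewrite /cos_taylor [LHS]big_ord_recr/=; congr (_ + _).
  by rewrite mulrAC -mulrA mulrC.
have -> : cos_taylor K.+1 (a + pi / 2) x = cos_taylor K (a + pi / 2) x +
    (cos (a + K.+1%:R * (pi / 2)) / K.+1`!%:R) *: (K.+1%:R * x ^+ K).
  rewrite /cos_taylor [LHS]big_ord_recr/=; congr (_ + _).
  have -> : a + pi / 2 + K%:R * (pi / 2) = a + K.+1%:R * (pi / 2).
    by rewrite -[K.+1]addn1 natrD; ring.
  rewrite factS natrM /GRing.scale/=; field.
  by apply/andP; split; [rewrite pnatr_eq0 -lt0n fact_gt0|rewrite gt_eqF// ltr_pwDl].
apply: is_deriveD; apply: is_deriveZ.
have -> : (fun y : R => y ^+ K.+1) = (id : R -> R) ^+ K.+1.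
  by apply/funext => y; rewrite exprfctE.
apply: (is_derive_eq (is_deriveX K.+1 (is_derive_id x (1 : R)))).
by rewrite /GRing.scale/= mulr1.
Qed.

Lemma mvt_bound (g g' : R -> R) x (B : R) : (forall y, is_derive y (1 : R) g (g' y)) ->
  (forall y, `|y| <= `|x| -> `|g' y| <= B) -> `|g x - g 0| <= B * `|x|.
Proof.
move=> dg gB.
have cg a b : {within `[a, b], continuous g}.
  apply: continuous_subspaceT => y; apply: differentiable_continuous.
  by apply/derivable1_diffP; have [] := dg y.
have [x0|x0|x0] := ltgtP x 0; last by rewrite x0 subrr normr0 mulr0.
- have [c /[!in_itv]/= /andP[c1 c2] E] := MVT x0 (fun y _ => dg y) (cg x 0).
  rewrite distrC E normrM sub0r normrN ler_wpM2r// gB//.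
  by rewrite !ltr0_norm//; lra.
- have [c /[!in_itv]/= /andP[c1 c2] E] := MVT x0 (fun y _ => dg y) (cg 0 x).
  rewrite E normrM subr0 ler_wpM2r// gB//.
  by rewrite !gtr0_norm//; lra.
Qed.

Lemma is_derive_cos_shift a y : is_derive y (1 : R) (fun z => cos (a + z)) (- sin (a + y)).
Proof.
have H : is_derive y (1 : R) (fun z => a + z) 1.
  by apply: (is_derive_eq (is_deriveD (is_derive_cst a y (1 : R)) (is_derive_id y (1 : R)))); rewrite add0r.
by have := @is_derive1_comp R cos (fun z => a + z) y _ _ (is_derive_cos (a + y)) H; rewrite mulr1.
Qed.

(** The derivative of the remainder is the remainder of one order less at [a + pi / 2]. No factorial
    is gained; convergence in [K] is exploited only for [|x| <= 1/2]. *)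
Lemma cos_taylor_bound K a x : `|cos (a + x) - cos_taylor K a x| <= `|x| ^+ K.
Proof.
elim: K a x => [|K IH] a x; first by rewrite /cos_taylor big_ord0 subr0 expr0 cos_max.
pose g y := cos (a + y) - cos_taylor K.+1 a y.
have dg y : is_derive y (1 : R) g (cos (a + pi / 2 + y) - cos_taylor K (a + pi / 2) y).
  have -> : cos (a + pi / 2 + y) = - sin (a + y) by rewrite addrAC cosDpihalf.
  apply: is_deriveB; last exact: is_derive_cos_taylor.
  exact: is_derive_cos_shift.
have g0 : g 0 = 0.
  rewrite /g /cos_taylor big_ord_recl/= big1 => [|k _].
    by rewrite expr0 fact0 divr1 !mul0r !mul1r !addr0 subrr.
  by rewrite /bump/= add1n expr0n/= !mul0r.
have := @mvt_bound g _ x (`|x| ^+ K) dg; rewrite g0 subr0 exprSr; apply=> y yx.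
by apply: le_trans (IH _ _) _; apply: lerXn2r; rewrite ?nnegrE.
Qed.

Lemma cos_taylor4 x : `|cos x - (1 - x ^+ 2 / 2)| <= x ^+ 4.
Proof.
have := cos_taylor_bound 4 0 x; rewrite add0r /cos_taylor !big_ord_recr big_ord0/=.
rewrite !add0r mul0r cos0 !mul1r cos_pihalf.
have -> : 2%:R * (pi / 2) = pi :> R by field.
have -> : 3%:R * (pi / 2) = pi + pi / 2 :> R by field.
rewrite cospi cosDpihalf sinpi oppr0 !mulr0 !addr0.
have x4 : 0 <= x ^+ 4 by rewrite exprn_even_ge0.
rewrite -normrX (ger0_norm x4).
move=> H; apply: le_trans H; rewrite le_eqVlt; apply/orP; left; apply/eqP; congr `|_|.
by rewrite !factE/=; field.
Qed.

Lemma sin_taylor3 x : `|sin x - x| <= `|x| ^+ 3.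
Proof.
have := cos_taylor_bound 3 (- (pi / 2)) x; rewrite /cos_taylor !big_ord_recr big_ord0/=.
rewrite [- _ + x]addrC cosBpihalf !add0r mul0r addr0 !mul1r cosN cos_pihalf.
have -> : - (pi / 2) + pi / 2 = 0 :> R by ring.
have -> : - (pi / 2) + 2%:R * (pi / 2) = pi / 2 :> R by field.
rewrite cos0 cos_pihalf !mulr0 add0r addr0 mulr1 expr1 => H.
apply: le_trans H; rewrite le_eqVlt; apply/orP; left; apply/eqP; congr `|_|.
by rewrite !factE/= divr1.
Qed.

Lemma polar x y : exists psi, x = Num.sqrt (x ^+ 2 + y ^+ 2) * cos psi /\
  y = Num.sqrt (x ^+ 2 + y ^+ 2) * sin psi.
Proof.
set r := Num.sqrt _; have r0 : 0 <= r by exact: sqrtr_ge0.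
have r2 : r ^+ 2 = x ^+ 2 + y ^+ 2 by rewrite sqr_sqrtr// addr_ge0 ?sqr_ge0.
have [rE|rn0] := eqVneq r 0.
  move: r2; rewrite rE expr0n/= => /esym/eqP.
  rewrite paddr_eq0 ?sqr_ge0// !sqrf_eq0 => /andP[/eqP-> /eqP->].
  by exists 0; rewrite !mul0r.
have rp : 0 < r by rewrite lt_neqAle eq_sym rn0.
have xr : -1 <= x / r <= 1.
  rewrite -ler_norml normrM normfV (gtr0_norm rp) ler_pdivrMr// mul1r.
  rewrite -(ler_pXn2r (ltn0Sn 1)) ?nnegrE// real_normK ?num_real// r2 lerDl sqr_ge0//.
have ca : cos (acos (x / r)) = x / r by rewrite acosK// in_itv.
have sa : sin (acos (x / r)) = `|y| / r.
  rewrite sin_acos//.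
  have -> : 1 - (x / r) ^+ 2 = (`|y| / r) ^+ 2.
    rewrite !expr_div_n real_normK ?num_real//.
    have -> : y ^+ 2 = r ^+ 2 - x ^+ 2 by rewrite r2; ring.
    by field.
  by rewrite sqrtr_sqr ger0_norm// divr_ge0.
have [y0|y0] := leP 0 y.
  exists (acos (x / r)); rewrite ca sa ger0_norm//.
  by split; field.
exists (- acos (x / r)); rewrite cosN sinN ca sa ltr0_norm//.
by split; field.
Qed.

Lemma cos_periodz x (k : int) : cos (x + k%:~R * (2 * pi)) = cos x.
Proof.
have P n y : cos (y + n%:R * (2 * pi)) = cos y.
  elim: n y => [|n IH] y; first by rewrite mul0r addr0.
  have -> : y + n.+1%:R * (2 * pi) = (y + n%:R * (2 * pi)) + pi *+ 2.
    by rewrite -[n.+1]addn1 natrD -mulr_natl; ring.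
  by rewrite cosD2pi IH.
case: k => n; first exact: P.
by rewrite NegzE mulrNz mulNr -[in RHS](subrK (n.+1%:R * (2 * pi)) x) P.
Qed.

(** Reduction to one period, then injectivity of the cosine on [[0, pi]], after a reflection in the
    second half. *)
Lemma cos_eq1 x : cos x = 1 -> exists k : int, x = k%:~R * (2 * pi).
Proof.
have p0 : 0 < pi :> R := pi_gt0 R; have pp : 0 < 2 * pi :> R by rewrite mulr_gt0.
move=> cx; exists (Num.floor (x / (2 * pi))); set k := Num.floor _.
pose y := x + (- k)%:~R * (2 * pi).
have cy : cos y = 1 by rewrite /y cos_periodz.
have /andP[k1 k2] := Num.Theory.floor_itv (x / (2 * pi)).
rewrite -/k in k1 k2; move: k1; rewrite ler_pdivlMr// => k1.
move: k2; rewrite ltr_pdivrMr// intrD mulrDl mul1r => k2.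
have yE : y = x - k%:~R * (2 * pi) by rewrite /y mulrNz mulNr.
have y0 : 0 <= y by rewrite yE; lra.
have y2 : y < 2 * pi by rewrite yE; lra.
suff : y = 0 by rewrite yE; lra.
have [yp|yp] := leP y pi.
  by apply: cos_inj; rewrite ?cos0// in_itv/= ?lexx ?y0 ?(ltW p0).
have : 2 * pi - y = 0.
  apply: cos_inj; rewrite ?cos0 ?in_itv/= ?lexx ?(ltW p0)//; first by apply/andP; split; lra.
  have -> : 2 * pi - y = - y + 1%:~R * (2 * pi) by rewrite mul1r addrC.
  by rewrite cos_periodz cosN.
lra.
Qed.

End TrigonometricFacts.

(** * Cosine sums with unit frequencies under the random walk *)

Section TrigonometricSums.
Variables (R : realType) (m : nat).
Local Notation vec := 'rV[R]_m.
Local Notation lat := 'rV[int]_m.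

Definition trigsum (N : nat) (b : nat -> R) (r : nat -> vec) (th : nat -> R) (x : vec) : R :=
  \sum_(l < N) b l * cos (2 * pi * dotv (r l) x + th l).

(** Plane waves are eigenfunctions of the walk. *)
Lemma walk1_cos (xi p : vec) (th h : R) s (z : lat) :
  walk 1 s (fun w => cos (2 * pi * dotv xi (p + h *: emb R w) + th)) z =
  (\prod_(i <- s) cos (2 * pi * h * xi ord0 i)) *
    cos (2 * pi * dotv xi (p + h *: emb R z) + th).
Proof.
have unitE i : emb R (unitv i) = delta_mx ord0 i.
  by apply/rowP => k; rewrite !mxE; case: (_ && _).
have de i : dotv xi (delta_mx ord0 i) = xi ord0 i.
  rewrite /dotv (bigD1 i)//= big1 ?addr0 => [|k ki]; rewrite !mxE eqxx ?eqxx ?mulr1//.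
  by rewrite (negbTE ki) mulr0.
have st i w : (cos (2 * pi * dotv xi (p + h *: emb R (w + unitv i)) + th) +
    cos (2 * pi * dotv xi (p + h *: emb R (w - unitv i)) + th)) / 2 =
    cos (2 * pi * h * xi ord0 i) * cos (2 * pi * dotv xi (p + h *: emb R w) + th).
  rewrite !embD embN unitE !scalerDr scalerN !addrA !(dotvDr xi (_ + _)) dotvNr dotvZr de.
  set t := 2 * pi * dotv xi _ + th; set c := 2 * pi * h * xi ord0 i.
  have -> : 2 * pi * (dotv xi (p + h *: emb R w) + h * xi ord0 i) + th = t + c by rewrite /t /c; ring.
  have -> : 2 * pi * (dotv xi (p + h *: emb R w) - h * xi ord0 i) + th = t - c by rewrite /t /c; ring.
  by rewrite cosD cosB; field.
elim: s z => [|i s IH] z /=; first by rewrite big_nil mul1r.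
by rewrite big_cons /step !IH -mulrDr -mulrA st; ring.
Qed.

Lemma prod_cos (I : Type) (s : seq I) (x : I -> R) :
  `|\prod_(i <- s) cos (x i) - (1 - (\sum_(i <- s) x i ^+ 2) / 2)| <=
  2 * (\sum_(i <- s) x i ^+ 2) ^+ 2.
Proof.
have P1 (r : seq I) : `|\prod_(i <- r) cos (x i)| <= 1.
  elim: r => [|i r IH]; first by rewrite big_nil normr1.
  by rewrite big_cons normrM -[leRHS]mulr1 ler_pM// cos_max.
elim: s => [|i s IH]; first by rewrite !big_nil mul0r subr0 subrr normr0 expr0n mulr0.
have s0 : 0 <= \sum_(j <- s) x j ^+ 2 by apply: sumr_ge0 => j _; exact: sqr_ge0.
have c4 := cos_taylor4 (x i); have := P1 (i :: s).
rewrite !big_cons; move: IH c4 s0 (P1 s) (cos_max (x i)) (sqr_ge0 (x i)).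
rewrite (_ : x i ^+ 4 = (x i ^+ 2) ^+ 2); last by rewrite -exprM.
set P := \prod_(_ <- _) _; set S := \sum_(_ <- _) _; set c := cos _; set A := x i ^+ 2.
move=> IH c4 S0 P1' c1 A0 cP1; rewrite !ler_norml in IH c4 P1' c1 cP1 *.
move: IH c4 P1' c1 cP1 => /andP[i1 i2] /andP[c41 c42] /andP[p1 p2] /andP[c1 c2] /andP[q1 q2].
(* For large sums the error term exceeds everything, as the product is bounded by 1. *)
have [S2|S2] := leP 2 (A + S).
  have : 4 <= (A + S) ^+ 2 by rewrite expr2; nra.
  have : 2 * (A + S) <= (A + S) ^+ 2 by rewrite expr2; nra.
  by move=> ? ?; apply/andP; split; lra.
pose dl := P - (1 - S / 2); pose et := c - (1 - A / 2).
have -> : c * P - (1 - (A + S) / 2) = S * A / 4 + dl * c + et * (1 - S / 2).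
  by rewrite /dl /et; field.
have d1 : `|dl * c| <= 2 * S ^+ 2.
  rewrite normrM -[leRHS]mulr1; apply: ler_pM => //; rewrite ler_norml; apply/andP; split=> //; rewrite /dl; lra.
have e1 : `|et * (1 - S / 2)| <= A ^+ 2.
  rewrite normrM -[leRHS]mulr1; apply: ler_pM => //; rewrite ler_norml; apply/andP; split=> //; rewrite /et; lra.
rewrite !ler_norml in d1 e1; move: d1 e1 => /andP[? ?] /andP[? ?].
have SA : 0 <= S * A by rewrite mulr_ge0.
have A2 := sqr_ge0 A.
have -> : 2 * (A + S) ^+ 2 = 2 * A ^+ 2 + 4 * (S * A) + 2 * S ^+ 2 by ring.
by apply/andP; split; lra.
Qed.

Lemma cos_lip (x y : R) : `|cos x - cos y| <= `|x - y|.
Proof.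
have := @mvt_bound R (fun t => cos (y + t)) (fun t => - sin (y + t)) (x - y) 1.
rewrite addr0 (addrC y (x - y)) subrK mul1r; apply=> t; last by rewrite normrN sin_max.
exact: is_derive_cos_shift.
Qed.

(** For unit frequencies the squares [(2 pi h xi_i)^2] add up to [(2 pi h)^2], so all terms share
    the same eigenvalue up to [O(h^4)]. *)
Lemma trigsum_helmholtz N b (r : nat -> vec) th : (forall l, (l < N)%N -> sphere (r l)) ->
  exists C L, helmholtz C L (trigsum N b r th).
Proof.
move=> rS; pose B := \sum_(l < N) `|b l|.
have B0 : 0 <= B by exact: sumr_ge0.
have p0 : 0 <= pi :> R by exact: pi_ge0.
exists (B * (2 * (2 * pi) ^+ 4)), (B * (2 * pi * m%:R)); split.
- by rewrite !mulr_ge0// exprn_ge0// mulr_ge0.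
- by rewrite !mulr_ge0.
- move=> y y'; rewrite /trigsum -sumrB /B !mulr_suml.
  apply: le_trans (ler_norm_sum _ _ _) _; apply: ler_sum => l _.
  rewrite -mulrBr normrM -[leRHS]mulrA ler_wpM2l//; apply: le_trans (cos_lip _ _) _.
  have -> : 2 * pi * dotv (r l) y + th l - (2 * pi * dotv (r l) y' + th l) =
    2 * pi * dotv (r l) (y - y') by rewrite dotvBr; ring.
  rewrite normrM ger0_norm ?mulr_ge0// -mulrA ler_wpM2l ?mulr_ge0//.
  apply: le_trans (dotv_le _ _) _; rewrite -[leRHS]mulr1 mulrAC ler_wpM2l ?mulr_ge0//.
  by have := norm_le_enorm (r l); rewrite (rS l (ltn_ord l)).
move=> h p z h0; rewrite /trigsum walk1_sum mulr_sumr -sumrB /B !mulr_suml.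
apply: le_trans (ler_norm_sum _ _ _) _; apply: ler_sum => l _.
rewrite walk1Z walk1_cos; set P := \prod_(_ <- _) _; set c := cos _; set q := 1 - _.
have -> : b l * (P * c) - q * (b l * c) = b l * ((P - q) * c) by ring.
rewrite !normrM -[leRHS]mulrA ler_wpM2l//.
apply: le_trans (ler_wpM2l (normr_ge0 _) (cos_max _)) _; rewrite mulr1.
have sE : \sum_(i <- enum 'I_m) (2 * pi * h * r l ord0 i) ^+ 2 = (2 * pi * h) ^+ 2.
  under eq_bigr => i _ do rewrite exprMn.
  rewrite -mulr_sumr big_enum/= -[RHS]mulr1; congr (_ * _).
  have : dotv (r l) (r l) = 1 by rewrite -sqr_enorm (rS l (ltn_ord l)) expr1n.
  by rewrite /dotv => <-; apply: eq_bigr => i _; rewrite expr2.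
have := prod_cos (enum 'I_m) (fun i => 2 * pi * h * r l ord0 i).
rewrite sE (_ : (2 * pi * h) ^+ 2 / 2 = 2 * pi ^+ 2 * h ^+ 2); last by field.
by rewrite (_ : 2 * ((2 * pi * h) ^+ 2) ^+ 2 = 2 * (2 * pi) ^+ 4 * h ^+ 4)//; ring.
Qed.

End TrigonometricSums.

(** * Almost periodic functions *)

Section LatticeMeans.
Variables (R : realType) (m : nat) (h : R) (rr : nat -> 'rV[R]_m).
Hypothesis h0 : 0 < h.
Local Notation vec := 'rV[R]_m.
Local Notation lat := 'rV[int]_m.
Local Notation L rho := (lball h (0 : vec) rho).
Local Notation cnt rho := (latcount R (L rho)).

Definition freq (n : nat) (q : nat -> int) : vec := \sum_(l < n) (q l)%:~R *: rr l.

(** A plane wave of frequency [freq n q] is nontrivial on the lattice [h Z^m] exactly if some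
    coordinate of [h *: freq n q] is not an integer. *)
Hypothesis nonres : forall n q, (exists2 l, (l < n)%N & q l != 0) ->
  exists i, forall k : int, h * freq n q ord0 i != k%:~R.

Definition sumball (rho : R) (g : vec -> R) := latsum (L rho) (fun z => g (h *: emb R z)).

Definition meanlim (g : vec -> R) (c : R) := forall e, 0 < e ->
  \forall rho \near +oo, `|sumball rho g - c * cnt rho| <= e * cnt rho.

Lemma near_shift (P : R -> Prop) (c : R) :
  (\forall rho \near +oo, P rho) -> \forall rho \near +oo, P (rho + c).
Proof.
move=> [M [_ HM]]; exists (M - c); split; first exact: num_real.
by move=> x xM; apply: HM; lra.
Qed.

(** A shell of fixed width contains a vanishing proportion of the lattice points, because counts
    grow like [rho^m]. *)
Lemma count_shift (c e : R) : 0 < e ->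
  \forall rho \near +oo, `|cnt (rho + c) - cnt rho| <= e * cnt rho.
Proof.
move=> e0; have [kap [k0 Hk]] := lball_density m h0.
pose d := Num.min (kap / 2) (e * kap / 16).
have d0 : 0 < d by rewrite lt_min !mulr_gt0.
have dk : d <= kap / 2 by rewrite ge_min lexx.
have de : d <= e * kap / 16 by rewrite ge_min lexx orbT.
pose d' := Num.min 1 (e / 16).
have d'0 : 0 < d' by rewrite lt_min ltr01 divr_gt0.
have d'1 : d' <= 1 by rewrite ge_min lexx.
have d'e : d' <= e / 16 by rewrite ge_min lexx orbT.
near=> rho.
have r0 : 0 < rho by near: rho; exact: (nbhs_pinfty_gt (num_real _)).
have X0 : 0 < rho ^+ m by rewrite exprn_gt0.
have /andP[a1 a2] : (kap - d) * rho ^+ m <= cnt rho <= (kap + d) * rho ^+ m.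
  by near: rho; exact: Hk.
have /andP[b1 b2] : (kap - d) * (rho + c) ^+ m <= cnt (rho + c) <= (kap + d) * (rho + c) ^+ m.
  near: rho.
  exact: (@near_shift (fun s => (kap - d) * s ^+ m <= cnt s <= (kap + d) * s ^+ m) c (Hk _ d0)).
have : `|(rho + c) ^+ m - rho ^+ m| <= d' * rho ^+ m.
  by near: rho; exact: near_powD.
rewrite ler_norml => /andP[c1 c2].
set X := rho ^+ m in X0 a1 a2 c1 c2 *; set Y := (rho + c) ^+ m in b1 b2 c1 c2 *.
have cX : kap / 2 * X <= cnt rho by apply: le_trans a1; rewrite ler_wpM2r ?(ltW X0)//; lra.
have ecX : e * (kap / 2 * X) <= e * cnt rho by rewrite ler_wpM2l// ltW.
have dX : d * X <= e * kap / 16 * X by rewrite ler_wpM2r// ltW.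
have Y2 : Y <= 2 * X by have : d' * X <= X by [rewrite -[leRHS]mul1r ler_wpM2r ?(ltW X0)]; lra.
have YX1 : kap * (Y - X) <= kap * (e / 16 * X).
  rewrite ler_wpM2l ?(ltW k0)//; apply: le_trans c2 _; by rewrite ler_wpM2r ?(ltW X0).
have YX2 : kap * (X - Y) <= kap * (e / 16 * X).
  rewrite ler_wpM2l ?(ltW k0)//.
  have : d' * X <= e / 16 * X by rewrite ler_wpM2r ?(ltW X0).
  lra.
have dY : d * Y <= d * (2 * X) by rewrite ler_wpM2l// ltW.
apply/(le_trans _ ecX); rewrite ler_norml; apply/andP; split; lra.
Unshelve. all: by end_near. Qed.

Lemma cnt_ge0 rho : 0 <= cnt rho. Proof. exact: latcount_ge0. Qed.

Lemma finL rho : finite_set (L rho). Proof. exact: lball_finite. Qed.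

Lemma sumballD rho g g' : sumball rho (fun x => g x + g' x) = sumball rho g + sumball rho g'.
Proof. exact: latsumD. Qed.

Lemma sumballZ rho c g : sumball rho (fun x => c * g x) = c * sumball rho g.
Proof. exact: latsumZ. Qed.

Lemma sumball_le rho g g' : (forall x, g x <= g' x) -> sumball rho g <= sumball rho g'.
Proof. by move=> H; apply: ler_latsum => //; exact: finL. Qed.

Lemma sumball_cst rho c : sumball rho (fun=> c) = c * cnt rho.
Proof. exact: latsum_cst. Qed.

Lemma sumball_bound rho g e : (forall x, `|g x| <= e) -> `|sumball rho g| <= e * cnt rho.
Proof.
move=> H; apply: le_trans (ler_norm_latsum _ _) _.
by rewrite -latsum_cst; apply: ler_latsum => //; exact: finL.
Qed.

Lemma sumballB rho g g' : sumball rho (fun x => g x - g' x) = sumball rho g - sumball rho g'.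
Proof.
by rewrite sumballD -[in RHS]mulN1r -sumballZ; congr (_ + _); apply: eq_latsum => z; rewrite mulN1r.
Qed.

Lemma eq_meanlim g g' c : (forall x, g x = g' x) -> meanlim g c -> meanlim g' c.
Proof. by move=> /funext ->. Qed.

Lemma meanlim_cst c : meanlim (fun=> c) c.
Proof.
by move=> e e0; near=> rho; rewrite sumball_cst subrr normr0 mulr_ge0 ?cnt_ge0// ltW.
Unshelve. all: by end_near. Qed.

Lemma meanlimD g g' c c' : meanlim g c -> meanlim g' c' ->
  meanlim (fun x => g x + g' x) (c + c').
Proof.
move=> H H' e e0; have e2 : 0 < e / 2 by rewrite divr_gt0.
near=> rho; rewrite sumballD.
have -> : sumball rho g + sumball rho g' - (c + c') * cnt rho =
  (sumball rho g - c * cnt rho) + (sumball rho g' - c' * cnt rho) by ring.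
apply: le_trans (ler_normD _ _) _.
have -> : e * cnt rho = e / 2 * cnt rho + e / 2 * cnt rho by field.
by apply: lerD; near: rho; [exact: H|exact: H'].
Unshelve. all: by end_near. Qed.

Lemma meanlimZ a g c : meanlim g c -> meanlim (fun x => a * g x) (a * c).
Proof.
move=> H e e0; have ea : 0 < e / (`|a| + 1) by rewrite divr_gt0// ltr_wpDl.
near=> rho; rewrite sumballZ -mulrA -mulrBr normrM.
have : `|sumball rho g - c * cnt rho| <= e / (`|a| + 1) * cnt rho by near: rho; exact: H.
move=> /(ler_wpM2l (normr_ge0 a)) /le_trans; apply.
rewrite mulrA ler_wpM2r ?cnt_ge0//.
by rewrite mulrCA ger_pMr// ler_pdivrMr ?mul1r ?lerDl// ltr_wpDl.
Unshelve. all: by end_near. Qed.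

Lemma meanlim_sum (I : Type) (s : seq I) (g : I -> vec -> R) (c : I -> R) :
  (forall i, meanlim (g i) (c i)) ->
  meanlim (fun x => \sum_(i <- s) g i x) (\sum_(i <- s) c i).
Proof.
move=> H; elim: s => [|i s IH].
  rewrite big_nil; apply: (@eq_meanlim (fun=> 0)); last exact: meanlim_cst.
  by move=> x; rewrite big_nil.
rewrite big_cons; apply: (@eq_meanlim (fun x => g i x + \sum_(j <- s) g j x)).
  by move=> x; rewrite big_cons.
exact: meanlimD.
Qed.

Lemma meanlim_approx g c : (forall e, 0 < e -> exists g' c',
    [/\ meanlim g' c', forall x, `|g x - g' x| <= e & `|c - c'| <= e]) -> meanlim g c.
Proof.
move=> H e e0; have e3 : 0 < e / 3 by rewrite divr_gt0.
have [g' [c' [Hg' gg' cc']]] := H _ e3.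
near=> rho.
have -> : sumball rho g - c * cnt rho = sumball rho (fun x => g x - g' x) +
   (sumball rho g' - c' * cnt rho) + (c' - c) * cnt rho by rewrite sumballB; ring.
have -> : e * cnt rho = e / 3 * cnt rho + e / 3 * cnt rho + e / 3 * cnt rho by field.
apply: le_trans (ler_normD _ _) _; apply: lerD; last first.
  by rewrite normrM (ger0_norm (cnt_ge0 _)) ler_wpM2r ?cnt_ge0// distrC.
apply: le_trans (ler_normD _ _) _; apply: lerD; first exact: sumball_bound.
by near: rho; exact: Hg'.
Unshelve. all: by end_near. Qed.

(* Translating by h along a coordinate axis multiplies a nonresonant character
   by a number different from 1 but only affects a thin shell of the ball. *)
Lemma meanlim_cos (xi : vec) (th : R) :
  (exists i, forall k : int, h * xi ord0 i != k%:~R) ->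
  meanlim (fun x => cos (2 * pi * dotv xi x + th)) 0.
Proof.
move=> [i xik]; have h00 := h0; pose om := 2 * pi * h * xi ord0 i.
have p0 : 0 < pi :> R := pi_gt0 R.
have com : cos om != 1.
  apply/eqP => /cos_eq1[k omE]; have /eqP := xik k; apply.
  have : 2 * pi * (h * xi ord0 i - k%:~R) = 0 by move: omE; rewrite /om; lra.
  by move=> /eqP; rewrite mulf_eq0 gt_eqF ?mulr_gt0//= subr_eq0 => /eqP.
have com1 : 0 < 1 - cos om by rewrite subr_gt0 lt_neqAle com cos_le1.
pose C rho t := sumball rho (fun x => cos (2 * pi * dotv xi x + t)).
have unitE : emb R (unitv i) = delta_mx ord0 i.
  by apply/rowP => k; rewrite !mxE; case: (_ && _).
have du : dotv (delta_mx ord0 i : vec) (delta_mx ord0 i) = 1.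
  rewrite /dotv (bigD1 i)//= big1 ?addr0 => [|k ki]; rewrite !mxE eqxx ?eqxx ?mulr1//.
  by rewrite (negbTE ki) mulr0.
have de : dotv xi (delta_mx ord0 i) = xi ord0 i.
  rewrite /dotv (bigD1 i)//= big1 ?addr0 => [|k ki]; rewrite !mxE eqxx ?eqxx ?mulr1//.
  by rewrite (negbTE ki) mulr0.
(* A translation by [h] along the axis turns the phase by [om] and changes the set of summation only
   inside the shell between [rho - h] and [rho + h]. *)
have shell rho t (s : R) (e : lat) : emb R e = s *: delta_mx ord0 i -> `|s| = 1 ->
    `|C rho (t + s * om) - C rho t| <= 2 * (cnt (rho + h) - cnt (rho - h)).
  move=> eE s1.
  have -> : C rho (t + s * om) = latsum (lball h (0 + h *: emb R e) rho)
       (fun z => cos (2 * pi * dotv xi (h *: emb R z) + t)).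
    rewrite -(lball_shift h0); apply: eq_latsum => z.
    by rewrite embD scalerDr dotvDr eE !dotvZr de /om; congr cos; ring.
  have en : enorm (h *: emb R e) = h.
    by rewrite enormZ eE enormZ s1 mul1r /enorm du sqrtr1 mulr1 gtr0_norm.
  have key A g : L (rho - h) `<=` A -> A `<=` L (rho + h) -> (forall z, `|g z| <= 1) ->
      `|latsum A g - latsum (L (rho - h)) g| <= cnt (rho + h) - cnt (rho - h).
    move=> LA AL g1; have fA := sub_finite_set AL (finL _).
    rewrite (latsum_diff g fA LA) addrAC subrr add0r.
    apply: le_trans (ler_norm_latsum _ _) _.
    apply: (@le_trans _ _ (latcount R (A `\` L (rho - h)))).
      apply: ler_latsum => //; exact: sub_finite_set (@subDsetl _ _ _) fA.
    have H1 : latcount R A <= cnt (rho + h) by apply: ler_latcount => //; exact: finL.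
    by have := latsum_diff (fun=> 1 : R) fA LA; rewrite -!/(latcount R _); lra.
  set g := fun z => _; set A := lball _ _ _.
  have H1 := key A g; have H2 := key (L rho) g.
  rewrite -/(C rho t) in H2 *.
  have -> : latsum A g - C rho t = (latsum A g - latsum (L (rho - h)) g) -
     (C rho t - latsum (L (rho - h)) g) by ring.
  apply: le_trans (ler_normB _ _) _; rewrite mulr2n mulrDl mul1r; apply: lerD.
    apply: H1 => [||z]; last exact: cos_max.
      by apply: lball_sub; rewrite sub0r enormN add0r en; lra.
    by apply: lball_sub; rewrite subr0 add0r en; lra.
  apply: H2 => [||z]; last exact: cos_max.
    by apply: sub_lball; lra.
  by apply: sub_lball; lra.
have Cadd rho : C rho (th + 1 * om) + C rho (th + -1 * om) = 2 * cos om * C rho th.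
  rewrite /C -sumballD -sumballZ; apply: eq_latsum => z.
  by rewrite !addrA mul1r mulN1r cosD cosB; ring.
move=> e e0; pose d := Num.min 1 (e * (1 - cos om) / 4).
have d0 : 0 < d by rewrite lt_min ltr01 !mulr_gt0.
near=> rho; rewrite mul0r subr0 -/(C rho th).
have u1 := shell rho th 1 (unitv i).
have u2 := shell rho th (-1) (- unitv i).
have {}u1 := u1 (eq_ind_r (fun v => _ = v) unitE (scale1r _)) (normr1 _).
have {}u2 : `|C rho (th + -1 * om) - C rho th| <= 2 * (cnt (rho + h) - cnt (rho - h)).
  by apply: u2; rewrite ?normrN1// embN unitE scaleN1r.
have a1 : `|cnt (rho + h) - cnt rho| <= d * cnt rho by near: rho; exact: count_shift.
have a2 : `|cnt (rho + - h) - cnt rho| <= d * cnt rho by near: rho; exact: count_shift.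
(* The two shifted sums add up to [2 cos om] times the original one; since [cos om] differs from 1,
   small changes force a small sum. *)
have E : 2 * (1 - cos om) * C rho th =
  - (C rho (th + 1 * om) - C rho th) - (C rho (th + -1 * om) - C rho th).
  by have := Cadd rho; lra.
have dd : d <= e * (1 - cos om) / 4 by rewrite ge_min lexx orbT.
have ddc : d * cnt rho <= e * (1 - cos om) / 4 * cnt rho by rewrite ler_wpM2r ?cnt_ge0.
rewrite -(@ler_pM2l _ (2 * (1 - cos om))) ?mulr_gt0//.
rewrite -[X in X * `|_|](ger0_norm (ltW (mulr_gt0 (ltr0n R 2) com1))) -normrM E.
move: u1 u2 a1 a2; rewrite !ler_norml.
by move=> /andP[? ?] /andP[? ?] /andP[? ?] /andP[? ?]; apply/andP; split; lra.
Unshelve. all: by end_near. Qed.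

Definition trigpoly n (s : seq (R * (nat -> int) * R)) x : R :=
  \sum_(p <- s) p.1.1 * cos (2 * pi * dotv (freq n p.1.2) x + p.2).

(** Uniform limits of trigonometric polynomials in the first [n] directions: the substitute for
    functions of the first [n] independent variables. *)
Definition almost_periodic n (g : vec -> R) :=
  forall e, 0 < e -> exists s, forall x, `|g x - trigpoly n s x| <= e.

Lemma trigpoly_bound n s x : `|trigpoly n s x| <= \sum_(p <- s) `|p.1.1|.
Proof.
apply: le_trans (ler_norm_sum _ _ _) _; apply: ler_sum => p _.
by rewrite normrM -[leRHS]mulr1 ler_wpM2l// cos_max.
Qed.

Lemma freqD n q q' : freq n (fun l => q l + q' l) = freq n q + freq n q'.
Proof.
by rewrite /freq -big_split/=; apply: eq_bigr => l _; rewrite intrD scalerDl.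
Qed.

Lemma freqN n q : freq n (fun l => - q l) = - freq n q.
Proof.
by rewrite /freq -sumrN; apply: eq_bigr => l _; rewrite mulrNz scaleNr.
Qed.

Lemma trigpolyM n s s' : exists s'', forall x, trigpoly n s x * trigpoly n s' x = trigpoly n s'' x.
Proof.
elim: s => [|p s [s1 IH]].
  by exists [::] => x; rewrite /trigpoly !big_nil mul0r.
have [s2 H2] : exists s2, forall x,
    p.1.1 * cos (2 * pi * dotv (freq n p.1.2) x + p.2) * trigpoly n s' x = trigpoly n s2 x.
  elim: s' {IH} => [|p' s' [s2 IH]].
    by exists [::] => x; rewrite /trigpoly !big_nil mulr0.
  exists [:: (p.1.1 * p'.1.1 / 2, (fun l => p.1.2 l + p'.1.2 l), p.2 + p'.2),
     (p.1.1 * p'.1.1 / 2, (fun l => p.1.2 l + - p'.1.2 l), p.2 - p'.2) & s2] => x.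
  rewrite /trigpoly !big_cons -/(trigpoly n s2 x) -IH -/(trigpoly n s' x) /= !freqD freqN.
  rewrite !dotvDl dotvNl.
  set a := 2 * pi * dotv (freq n p.1.2) x + p.2.
  set b := 2 * pi * dotv (freq n p'.1.2) x + p'.2.
  have -> : 2 * pi * (dotv (freq n p.1.2) x + dotv (freq n p'.1.2) x) + (p.2 + p'.2) = a + b.
    by rewrite /a /b; ring.
  have -> : 2 * pi * (dotv (freq n p.1.2) x - dotv (freq n p'.1.2) x) + (p.2 - p'.2) = a - b.
    by rewrite /a /b; ring.
  by clearbody a b; rewrite cosD cosB; field.
exists (s2 ++ s1) => x; rewrite {1}/trigpoly big_cons -/(trigpoly n s x) mulrDl H2 IH.
by rewrite /trigpoly big_cat.
Qed.

Lemma almost_periodic_bounded n g : almost_periodic n g -> exists B, forall x, `|g x| <= B.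
Proof.
move=> /(_ 1 ltr01)[s Hs]; exists (\sum_(p <- s) `|p.1.1| + 1) => x.
rewrite -(subrK (trigpoly n s x) (g x)) addrC; apply: le_trans (ler_normD _ _) _.
by apply: lerD => //; exact: trigpoly_bound.
Qed.

Lemma almost_periodic_cst n c : almost_periodic n (fun=> c).
Proof.
move=> e e0; exists [:: (c, (fun=> 0), 0)] => x.
rewrite /trigpoly big_seq1/= /freq big1 => [|l _]; last by rewrite scale0r.
by rewrite dotvC dotv0r mulr0 addr0 cos0 mulr1 subrr normr0 ltW.
Qed.

Lemma almost_periodicD n g g' : almost_periodic n g -> almost_periodic n g' ->
  almost_periodic n (fun x => g x + g' x).
Proof.
move=> H H' e e0; have e2 : 0 < e / 2 by rewrite divr_gt0.
have [s Hs] := H _ e2; have [s' Hs'] := H' _ e2; exists (s ++ s') => x.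
rewrite /trigpoly big_cat/= -/(trigpoly n s x) -/(trigpoly n s' x) opprD addrACA.
by apply: le_trans (ler_normD _ _) _; have := Hs x; have := Hs' x; lra.
Qed.

Lemma almost_periodicM n g g' : almost_periodic n g -> almost_periodic n g' ->
  almost_periodic n (fun x => g x * g' x).
Proof.
move=> H H' e e0; have [B HB] := almost_periodic_bounded H.
have B0 : 0 <= B by apply: le_trans (HB 0).
have e1 : 0 < e / 2 / (B + 1) by rewrite !divr_gt0// ltr_wpDl.
have [s' Hs'] := H' _ e1.
pose B' := \sum_(p <- s') `|p.1.1|; have B'0 : 0 <= B' by exact: sumr_ge0.
have e2 : 0 < e / 2 / (B' + 1) by rewrite !divr_gt0// ltr_wpDl.
have [s Hs] := H _ e2; have [s'' Hs''] := trigpolyM n s s'; exists s'' => x.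
rewrite -Hs''.
have -> : g x * g' x - trigpoly n s x * trigpoly n s' x =
  g x * (g' x - trigpoly n s' x) + (g x - trigpoly n s x) * trigpoly n s' x by ring.
apply: le_trans (ler_normD _ _) _; rewrite !normrM.
have -> : e = (B + 1) * (e / 2 / (B + 1)) + e / 2 / (B' + 1) * (B' + 1).
  by field; rewrite !gt_eqF ?ltr_wpDl.
apply: lerD; apply: ler_pM => //; first by have := HB x; lra.
by have := trigpoly_bound n s' x; rewrite -/B'; lra.
Qed.

Lemma almost_periodic_limit n g : (forall e, 0 < e -> exists2 g', almost_periodic n g' &
  forall x, `|g x - g' x| <= e) -> almost_periodic n g.
Proof.
move=> H e e0; have e2 : 0 < e / 2 by rewrite divr_gt0.
have [g' Hg' gg'] := H _ e2; have [s Hs] := Hg' _ e2; exists s => x.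
rewrite -(subrK (g' x) (g x)) -addrA; apply: le_trans (ler_normD _ _) _.
by have := gg' x; have := Hs x; lra.
Qed.

Lemma almost_periodic_sum n K (g : nat -> vec -> R) :
  (forall k, almost_periodic n (g k)) -> almost_periodic n (fun x => \sum_(k < K) g k x).
Proof.
move=> H; elim: K => [|K IH].
  have -> : (fun x => \sum_(k < 0) g k x) = cst 0 by apply/funext => x; rewrite big_ord0.
  exact: almost_periodic_cst.
have -> : (fun x => \sum_(k < K.+1) g k x) = (fun x => \sum_(k < K) g k x + g K x).
  by apply/funext => x; rewrite big_ord_recr.
exact: almost_periodicD.
Qed.

Lemma almost_periodicX n g k : almost_periodic n g -> almost_periodic n (fun x => g x ^+ k).
Proof.
move=> H; elim: k => [|k IH].
  have -> : (fun x => g x ^+ 0) = cst 1 by apply/funext => x; rewrite expr0.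
  exact: almost_periodic_cst.
have -> : (fun x => g x ^+ k.+1) = (fun x => g x * g x ^+ k).
  by apply/funext => x; rewrite exprS.
exact: almost_periodicM.
Qed.

(** The Taylor series is used only for [|g| <= 1/2]; larger functions are reached by doubling the
    argument. *)
Lemma almost_periodic_cos n g : almost_periodic n g -> almost_periodic n (fun x => cos (g x)).
Proof.
move=> Hg; have [B HB] := almost_periodic_bounded Hg.
have [j Bj] : exists j, B <= 2 ^+ j / 2.
  exists (Num.bound `|B|).+1; rewrite exprS mulrAC divff// mul1r.
  apply: le_trans (ler_norm _) _; apply: le_trans (ltW (archi_boundP (normr_ge0 B))) _.
  by rewrite -natrX ler_nat ltnW// ltn_expl.
elim: j g B Hg HB Bj => [|j IH] g B Hg HB Bj.
  apply: almost_periodic_limit => e e0.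
  have [K HK] : exists K, (1 / 2) ^+ K <= e.
    have : (1 / 2) ^+ k @[k --> \oo] --> (0 : R).
      by apply: cvg_expr; rewrite ger0_norm; lra.
    move=> /cvgrPdist_le /(_ _ e0)[K _ /(_ K (leqnn _))]; rewrite sub0r normrN => HK.
    by exists K; apply: le_trans (ler_norm _) HK.
  exists (fun x => cos_taylor K 0 (g x)) => [|x]; last first.
    have := cos_taylor_bound K 0 (g x); rewrite add0r => /le_trans; apply.
    apply: le_trans HK; apply: lerXn2r; rewrite ?nnegrE//.
    by apply: le_trans (HB x) _; move: Bj; rewrite expr0.
  apply: (@almost_periodic_sum n K (fun k x => g x ^+ k / k`!%:R * cos (0 + k%:R * (pi / 2)))).
  move=> k; apply: almost_periodicM; last exact: almost_periodic_cst.
  by apply: almost_periodicM; [exact: almost_periodicX|exact: almost_periodic_cst].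
have Hg2 : almost_periodic n (fun x => 1 / 2 * g x).
  by apply: almost_periodicM => //; exact: almost_periodic_cst.
have := IH _ (B / 2) Hg2.
have -> : (fun x => cos (g x)) =
    (fun x => 2 * (cos (1 / 2 * g x) * cos (1 / 2 * g x)) + -1).
  apply/funext => x; rewrite -[in LHS](_ : (1 / 2 * g x) *+ 2 = g x).
    by rewrite cos_mulr2n expr2 -mulr_natr; ring.
  by rewrite -mulr_natr; field.
move=> H; apply: almost_periodicD; last exact: almost_periodic_cst.
apply: almost_periodicM; first exact: almost_periodic_cst.
have HC : almost_periodic n (fun x => cos (1 / 2 * g x)).
  apply: H => [x|]; last by move: Bj; rewrite exprS; lra.
  by rewrite normrM ger0_norm; have := HB x; lra.
exact: almost_periodicM.
Qed.

Lemma freq_extend n q (c : int) : exists q', [/\ freq n.+1 q' = freq n q + c%:~R *: rr n & q' n = c].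
Proof.
exists (fun l => if (l < n)%N then q l else c); split; last by rewrite ltnn.
rewrite /freq big_ord_recr/= ltnn; congr (_ + _).
by apply: eq_bigr => l _; rewrite ltn_ord.
Qed.

Lemma almost_periodicS n g : almost_periodic n g -> almost_periodic n.+1 g.
Proof.
move=> H e e0; have [s Hs] := H e e0.
have [s' Hs'] : exists s', forall x, trigpoly n s x = trigpoly n.+1 s' x.
  elim: s {Hs} => [|p s [s' IH]]; first by exists [::] => x; rewrite /trigpoly !big_nil.
  have [q [qE _]] := freq_extend n p.1.2 0.
  exists ((p.1.1, q, p.2) :: s') => x.
  rewrite /trigpoly !big_cons -/(trigpoly n s x) IH/= qE.
  by rewrite mulr0z scale0r addr0.
by exists s' => x; rewrite -Hs'.
Qed.

Lemma almost_periodic_last n th : almost_periodic n.+1 (fun x => cos (2 * pi * dotv (rr n) x + th)).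
Proof.
move=> e e0; exists [:: (1, (fun l => (l == n)%:R), th)] => x.
rewrite /trigpoly big_seq1/= mul1r /freq big_ord_recr/= eqxx mulr1z scale1r big1 ?add0r.
  by rewrite subrr normr0 ltW.
by move=> l _; rewrite ltn_eqF ?ltn_ord// scale0r.
Qed.

Lemma almost_periodic_trigsum N b th : almost_periodic N (trigsum N b rr th).
Proof.
elim: N => [|N IH].
  have -> : trigsum 0 b rr th = cst 0 by apply/funext => x; rewrite /trigsum big_ord0.
  exact: almost_periodic_cst.
have -> : trigsum N.+1 b rr th = fun x => trigsum N b rr th x +
    b N * cos (2 * pi * dotv (rr N) x + th N).
  by apply/funext => x; rewrite /trigsum big_ord_recr.
apply: almost_periodicD; first exact: almost_periodicS.
by apply: almost_periodicM; [exact: almost_periodic_cst|exact: almost_periodic_last].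
Qed.

(** After expansion every frequency contains [rr n] with coefficient [k] or [- k], hence is
    nonresonant and has mean 0. This replaces the independence of a new summand from the earlier
    ones. *)
Lemma meanlim_orth n g (k : int) th : k != 0 -> almost_periodic n g ->
  meanlim (fun x => g x * cos (k%:~R * (2 * pi * dotv (rr n) x) + th)) 0.
Proof.
move=> k0 Hg; apply: meanlim_approx => e e0; have [s Hs] := Hg e e0.
exists (fun x => trigpoly n s x * cos (k%:~R * (2 * pi * dotv (rr n) x) + th)), 0.
split; last by rewrite subrr normr0 ltW.
  2: by move=> x; rewrite -mulrBl normrM -[leRHS]mulr1 ler_pM// cos_max.
have -> : (0 : R) = \sum_(p <- s) 0 by rewrite big1.
apply: (@eq_meanlim (fun x => \sum_(p <- s) p.1.1 * cos (2 * pi * dotv (freq n p.1.2) x + p.2) *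
    cos (k%:~R * (2 * pi * dotv (rr n) x) + th))).
  by move=> x; rewrite -mulr_suml.
apply: meanlim_sum => p; have [q1 [q1E q1n]] := freq_extend n p.1.2 k.
have [q2 [q2E q2n]] := freq_extend n p.1.2 (- k).
have M1 : meanlim (fun x => cos (2 * pi * dotv (freq n.+1 q1) x + (p.2 + th))) 0.
  by apply: meanlim_cos; apply: nonres; exists n => //; rewrite q1n.
have M2 : meanlim (fun x => cos (2 * pi * dotv (freq n.+1 q2) x + (p.2 - th))) 0.
  by apply: meanlim_cos; apply: nonres; exists n => //; rewrite q2n oppr_eq0.
have := meanlimZ (p.1.1 / 2) (meanlimD M1 M2); rewrite addr0 mulr0.
apply: eq_meanlim => x; rewrite q1E q2E !dotvDl !dotvZl mulrNz mulNr.
set a := 2 * pi * dotv (freq n p.1.2) x + p.2.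
set b := k%:~R * (2 * pi * dotv (rr n) x) + th.
have -> : 2 * pi * (dotv (freq n p.1.2) x + k%:~R * dotv (rr n) x) + (p.2 + th) = a + b.
  by rewrite /a /b; ring.
have -> : 2 * pi * (dotv (freq n p.1.2) x - k%:~R * dotv (rr n) x) + (p.2 - th) = a - b.
  by rewrite /a /b; ring.
by clearbody a b; rewrite cosD cosB; field.
Qed.

(* The successive summands behave like independent random variables; in the
   last one  cos (b c)  and  sin (b c)  may be replaced by  1 - b^2 c^2 / 2
   and  b c  at the cost of  O(|b|^3). *)
Lemma mean_cos_trigsum N b psi th : (forall l, (l < N)%N -> `|b l| <= 1) -> forall e, 0 < e ->
  \forall rho \near +oo, `|sumball rho (fun x => cos (trigsum N b rr psi x + th)) -
    cos th * (\prod_(l < N) (1 - b l ^+ 2 / 4)) * cnt rho| <=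
    (2 * (\sum_(l < N) `|b l| ^+ 3) + e) * cnt rho.
Proof.
elim: N th => [|N IH] th b1 e e0.
  near=> rho; rewrite !big_ord0 mulr1 mulr0 add0r.
  have -> : (fun x => cos (trigsum 0 b rr psi x + th)) = (fun=> cos th).
    by apply/funext => x; rewrite /trigsum big_ord0 add0r.
  by rewrite sumball_cst subrr normr0 mulr_ge0 ?cnt_ge0// ltW.
have e3 : 0 < e / 3 by rewrite divr_gt0.
set beta := b N; have beta1 : `|beta| <= 1 by exact: b1.
pose Z x := trigsum N b rr psi x.
pose u x := 2 * pi * dotv (rr N) x.
pose g0 x := cos (Z x + th).
(* The square of the new cosine is split into its mean 1/2 and a second harmonic. [g1] and [g2]
   carry the second and the first harmonic, and both average to 0. *)
pose g1 x := cos (Z x + th) * cos (2%:~R * u x + (psi N) *+ 2).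
pose g2 x := cos (Z x + (th - pi / 2)) * cos (1%:~R * u x + psi N).
have APZ t : almost_periodic N (fun x => cos (Z x + t)).
  apply: almost_periodic_cos; apply: almost_periodicD; last exact: almost_periodic_cst.
  exact: almost_periodic_trigsum.
have M1 : meanlim g1 0 by exact: meanlim_orth.
have M2 : meanlim g2 0 by exact: meanlim_orth.
have M12 : meanlim (fun x => - (beta ^+ 2 / 4) * g1 x + - beta * g2 x) 0.
  by have := meanlimD (meanlimZ (- (beta ^+ 2 / 4)) M1) (meanlimZ (- beta) M2); rewrite !mulr0 addr0.
have appr x : `|cos (trigsum N.+1 b rr psi x + th) -
    ((1 - beta ^+ 2 / 4) * g0 x + (- (beta ^+ 2 / 4) * g1 x + - beta * g2 x))| <= 2 * `|beta| ^+ 3.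
  rewrite /trigsum big_ord_recr/= -/(trigsum N b rr psi x) -/(Z x) -/beta.
  rewrite /g0 /g1 /g2 -/(u x) mul1r.
  have -> : cos (Z x + (th - pi / 2)) = sin (Z x + th) by rewrite addrA cosBpihalf.
  have -> : 2 * u x + psi N *+ 2 = (u x + psi N) *+ 2 by rewrite mulrnDl mulr_natl.
  rewrite cos_mulr2n; set c := cos (u x + psi N); set A := Z x + th.
  have -> : Z x + beta * c + th = A + beta * c by rewrite /A; ring.
  clearbody A; have c1 : `|c| <= 1 by exact: cos_max.
  clearbody c; rewrite cosD -[c ^+ 2 *+ 2]mulr_natr.
  have -> : cos A * cos (beta * c) - sin A * sin (beta * c) -
    ((1 - beta ^+ 2 / 4) * cos A + (- (beta ^+ 2 / 4) * (cos A * (c ^+ 2 * 2 - 1)) + - beta * (sin A * c)))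
    = cos A * (cos (beta * c) - (1 - (beta * c) ^+ 2 / 2)) - sin A * (sin (beta * c) - beta * c).
    by field.
  have -> : 2 * `|beta| ^+ 3 = `|beta| ^+ 3 + `|beta| ^+ 3 by ring.
  apply: le_trans (ler_normB _ _) _; rewrite !normrM.
  have bc : `|beta * c| <= `|beta| by rewrite normrM -[leRHS]mulr1 ler_pM.
  have bc3 : `|beta * c| ^+ 3 <= `|beta| ^+ 3 by apply: lerXn2r; rewrite ?nnegrE.
  have bc4 : (beta * c) ^+ 4 <= `|beta| ^+ 3.
    have -> : (beta * c) ^+ 4 = `|beta * c| ^+ 4.
      by rewrite -normrX ger0_norm// exprn_even_ge0.
    rewrite exprS -[leRHS]mul1r; apply: ler_pM => //; exact: le_trans bc beta1.
  rewrite -[X in _ <= X + _]mul1r -[X in _ <= _ + X]mul1r; apply: lerD; apply: ler_pM => //.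
  - exact: cos_max.
  - exact: le_trans (cos_taylor4 _) bc4.
  - exact: sin_max.
  - exact: le_trans (sin_taylor3 _) bc3.
have b14 : 0 <= 1 - beta ^+ 2 / 4 <= 1.
  have : beta ^+ 2 <= 1.
    by rewrite -(real_normK (num_real _)) -(expr1n _ 2); apply: lerXn2r; rewrite ?nnegrE.
  by have := sqr_ge0 beta; move=> ? ?; apply/andP; split; lra.
have {}IH := IH th (fun l lN => b1 l (ltnW lN)) _ e3.
near=> rho; rewrite !big_ord_recr/= -/beta.
set Pi := \prod_(_ < _) _; set Sg := \sum_(_ < _) _.
have cn := cnt_ge0 rho.
have T1 : `|sumball rho g0 - cos th * Pi * cnt rho| <= (2 * Sg + e / 3) * cnt rho.
  by near: rho; exact: IH.
have T2 : `|sumball rho (fun x => - (beta ^+ 2 / 4) * g1 x + - beta * g2 x)| <= e / 3 * cnt rho.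
  have : `|sumball rho (fun x => - (beta ^+ 2 / 4) * g1 x + - beta * g2 x) - 0 * cnt rho| <= e / 3 * cnt rho.
    by near: rho; exact: M12.
  by rewrite mul0r subr0.
have T3 := sumball_bound rho appr; rewrite sumballB sumballD sumballZ in T3.
set X := sumball rho g0 in T1 T3.
set Y := sumball rho (fun x => - (beta ^+ 2 / 4) * g1 x + _) in T2 T3.
move: T3; set Q := sumball rho _ => T3.
have -> : Q - cos th * (Pi * (1 - beta ^+ 2 / 4)) * cnt rho =
  (Q - ((1 - beta ^+ 2 / 4) * X + Y)) + (1 - beta ^+ 2 / 4) * (X - cos th * Pi * cnt rho) + Y by ring.
have T1' : `|(1 - beta ^+ 2 / 4) * (X - cos th * Pi * cnt rho)| <= (2 * Sg + e / 3) * cnt rho.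
  rewrite normrM -[leRHS]mul1r; apply: ler_pM => //.
  by move: b14 => /andP[? ?]; rewrite ger0_norm.
apply: le_trans (ler_normD _ _) _.
apply: le_trans (lerD (ler_normD _ _) (lexx _)) _.
have -> : (2 * (Sg + `|beta| ^+ 3) + e) * cnt rho = 2 * `|beta| ^+ 3 * cnt rho +
  (2 * Sg + e / 3) * cnt rho + 2 * (e / 3 * cnt rho) by field.
have e3c : 0 <= e / 3 * cnt rho by rewrite mulr_ge0// ltW.
lra.
Unshelve. all: by end_near. Qed.

End LatticeMeans.

(** * Central limit theorem *)

Section CentralLimit.
Variables (R : realType) (m : nat) (h : R) (rr : nat -> 'rV[R]_m) (al : nat -> R).
Variables (phi : nat -> nat) (G : 'rV[R]_m -> R).
Hypothesis h0 : 0 < h.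
Local Notation vec := 'rV[R]_m.
Local Notation lat := 'rV[int]_m.
Local Notation cnt rho := (latcount R (lball h (0 : vec) rho)).
Hypothesis nonres : forall n q, (exists2 l, (l < n)%N & q l != 0) ->
  exists i, forall k : int, h * freq rr n q ord0 i != k%:~R.
Hypothesis phi0 : (0 < phi 0%N)%N.
Hypothesis phiS : forall k, (phi k < phi k.+1)%N.
Hypothesis covG : forall z,
  (fun k => (phi k)%:R^-1 * \sum_(l < phi k) cos (2 * pi * dotv (rr l) z)) @ \oo --> (G z : R).

(** The order of limits of the theorem: the radius from which [P k] holds may depend on [k]. *)
Definition evn (P : nat -> R -> Prop) := \forall k \near \oo, \forall rho \near +oo, P k rho.

Lemma evnI P Q : evn P -> evn Q -> evn (fun k rho => P k rho /\ Q k rho).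
Proof. by move=> HP HQ; near=> k; near=> rho; split; near: rho; near: k.
Unshelve. all: by end_near. Qed.

Lemma evnS (P Q : nat -> R -> Prop) : (forall k rho, P k rho -> Q k rho) -> evn P -> evn Q.
Proof. by move=> PQ HP; near=> k; near=> rho; apply: PQ; near: rho; near: k.
Unshelve. all: by end_near. Qed.

Definition field k : vec -> R :=
  trigsum (phi k) (fun=> Num.sqrt (2 / (phi k)%:R)) rr al.

Lemma phi_ge k : (k < phi k)%N.
Proof. by elim: k => // k IH; apply: leq_ltn_trans IH (phiS k). Qed.

Lemma phi_gt0 k : (0 < phi k)%N.
Proof. exact: leq_ltn_trans (leq0n k) (phi_ge k). Qed.

(** Telescoping, with [|1 - b - exp(-b)| <= b^2] and all factors in [[0, 1]]. *)
Lemma prod_one_minus (N : nat) (a : nat -> R) : (forall l, 0 <= a l <= 1) ->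
  `|\prod_(l < N) (1 - a l) - expR (- \sum_(l < N) a l)| <= \sum_(l < N) a l ^+ 2.
Proof.
move=> a01; elim: N => [|N IH]; first by rewrite !big_ord0 oppr0 expR0 subrr normr0.
rewrite !big_ord_recr/= opprD expRD.
set P := \prod_(_ < _) _ in IH *; set E := expR (- \sum_(_ < _) _) in IH *; set S := \sum_(_ < N) _ ^+ 2 in IH *.
have /andP[a0 a1] := a01 N; set b := a N in a0 a1 *.
have e1 : 0 <= E <= 1.
  by rewrite expR_ge0/= -[leRHS]expR0 ler_expR oppr_le0 sumr_ge0// => l _; case/andP: (a01 l).
have eb : `|(1 - b) - expR (- b)| <= b ^+ 2.
  have l1 := expR_ge1Dx (- b); have l2 := expR_ge1Dx b.
  have l3 : expR (- b) * (1 + b) <= 1.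
    rewrite -[leRHS](expR0) -(addNr b) expRD ler_wpM2l ?expR_ge0//.
  by rewrite ler_norml; apply/andP; split; nra.
have -> : P * (1 - b) - E * expR (- b) = (P - E) * (1 - b) + E * (1 - b - expR (- b)) by ring.
apply: le_trans (ler_normD _ _) _; rewrite !normrM; apply: lerD.
  by rewrite -[leRHS]mulr1; apply: ler_pM => //; rewrite ger0_norm; lra.
rewrite -[leRHS]mul1r; apply: ler_pM => //; rewrite ger0_norm; move: e1 => /andP[]; lra.
Qed.

(** For each frequency, a combination of shifted cosines is one cosine, whose amplitude and phase
    are the polar coordinates of the sum of the [t j] times unit vectors. *)
Lemma field_combination k (p : nat) (g : 'I_p -> vec) (t : 'I_p -> R) :
  exists amp psi, [/\ forall x, \sum_(j < p) t j * field k (x + g j) =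
      trigsum (phi k) (fun l => Num.sqrt (2 / (phi k)%:R) * amp l) rr psi x,
    forall l, 0 <= amp l <= \sum_(j < p) `|t j| &
    forall l, amp l ^+ 2 = \sum_(i < p) \sum_(j < p) t i * t j * cos (2 * pi * dotv (rr l) (g i - g j))].
Proof.
pose A l j := al l + 2 * pi * dotv (rr l) (g j).
pose C l := \sum_(j < p) t j * cos (A l j).
pose S l := \sum_(j < p) t j * sin (A l j).
pose amp l := Num.sqrt (C l ^+ 2 + S l ^+ 2).
have /choice[psi Hpsi] : forall l, exists psi, C l = amp l * cos psi /\ S l = amp l * sin psi.
  by move=> l; exact: polar.
have amp2 l : amp l ^+ 2 = C l ^+ 2 + S l ^+ 2 by rewrite sqr_sqrtr// addr_ge0 ?sqr_ge0.
have ampE l : amp l ^+ 2 = \sum_(i < p) \sum_(j < p) t i * t j * cos (2 * pi * dotv (rr l) (g i - g j)).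
  rewrite amp2 !expr2 /C /S !mulr_suml -big_split/=; apply: eq_bigr => i _.
  rewrite !mulr_sumr -big_split/=; apply: eq_bigr => j _.
  have -> : 2 * pi * dotv (rr l) (g i - g j) = A l i - A l j by rewrite dotvBr /A; ring.
  by rewrite cosB; ring.
exists amp, psi; split=> // [x|l].
- rewrite /field /trigsum.
  under eq_bigr => j _ do rewrite mulr_sumr.
  rewrite exchange_big/=; apply: eq_bigr => l _.
  have [HC HS] := Hpsi l.
  under eq_bigr => j _.
    have -> : 2 * pi * dotv (rr l) (x + g j) + al l = 2 * pi * dotv (rr l) x + A l j.
      by rewrite /A dotvDr; ring.
    over.
  set u := 2 * pi * dotv (rr l) x; clearbody u.
  have -> : Num.sqrt (2 / (phi k)%:R) * amp l * cos (u + psi l) =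
    Num.sqrt (2 / (phi k)%:R) * (cos u * (amp l * cos (psi l)) - sin u * (amp l * sin (psi l))).
    by rewrite cosD; ring.
  rewrite -HC -HS /C /S !mulr_sumr -sumrB mulr_sumr; apply: eq_bigr => j _.
  by rewrite cosD; ring.
- rewrite sqrtr_ge0/= -(ler_pXn2r (ltn0Sn 1)) ?nnegrE ?sqrtr_ge0 ?sumr_ge0// ampE.
  apply: le_trans (ler_norm _) _; rewrite expr2 mulr_suml.
  apply: le_trans (ler_norm_sum _ _ _) _; apply: ler_sum => i _; rewrite mulr_sumr.
  apply: le_trans (ler_norm_sum _ _ _) _; apply: ler_sum => j _.
  by rewrite !normrM -[leRHS]mulr1 ler_wpM2l ?mulr_ge0// cos_max.
Qed.

Lemma cvg_sum (I : finType) (u : I -> nat -> R) (l : I -> R) :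
  (forall i, u i @ \oo --> l i) -> (fun k => \sum_i u i k) @ \oo --> \sum_i l i.
Proof.
by move=> H; apply: cvg_big => //; exact: add_continuous.
Qed.

(** The lattice average is [cos th] times [prod (1 - b_l^2 / 4)] up to cubes, the product is
    [exp(- Qk / 2)] up to fourth powers, and [Qk] tends to [Q]. The errors vanish because the
    amplitudes are of order [N^{-1/2}]. *)
Lemma clt (p : nat) (g : 'I_p -> vec) (t : 'I_p -> R) (th e : R) : 0 < e ->
  let Q := \sum_(i < p) \sum_(j < p) t i * t j * G (g i - g j) in
  evn (fun k rho => `|sumball h rho (fun x => cos (\sum_(j < p) t j * field k (x + g j) + th))
     - cos th * expR (- (Q / 2)) * cnt rho| <= e * cnt rho).
Proof.
move=> e0 Q; pose B := \sum_(j < p) `|t j|; have B0 : 0 <= B by exact: sumr_ge0.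
pose Qk k := (phi k)%:R^-1 * \sum_(l < phi k)
   \sum_(i < p) \sum_(j < p) t i * t j * cos (2 * pi * dotv (rr l) (g i - g j)).
have QkQ : Qk @ \oo --> Q.
  have -> : Qk = fun k => \sum_(i < p) \sum_(j < p) t i * t j *
     ((phi k)%:R^-1 * \sum_(l < phi k) cos (2 * pi * dotv (rr l) (g i - g j))).
    apply/funext => k; rewrite /Qk exchange_big/= mulr_sumr; apply: eq_bigr => i _.
    rewrite exchange_big/= mulr_sumr; apply: eq_bigr => j _.
    by rewrite -mulr_sumr; ring.
  apply: cvg_sum => i; apply: cvg_sum => j.
  by apply: cvgM; [exact: cvg_cst|exact: covG].
have e4 : 0 < e / 4 by rewrite divr_gt0.
have cE : (fun k => expR (- (Qk k / 2))) @ \oo --> expR (- (Q / 2)).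
  have H2 : (fun k => - (Qk k / 2)) @ \oo --> - (Q / 2).
    by apply: cvgN; apply: cvgM; [exact: QkQ|exact: cvg_cst].
  exact: (cvg_comp _ _ H2 (@continuous_expR R _)).
have big : forall K : R, \forall k \near \oo, K <= (phi k)%:R.
  move=> K; near=> k; apply: (@le_trans _ _ k%:R); first by near: k; exact: nbhs_infty_ger.
  by rewrite ler_nat ltnW// phi_ge.
near=> k.
(* These three bounds make, in turn, the amplitudes at most 1, the sum of their cubes small and the
   sum of their fourth powers small. *)
have N1 : 2 * (B + 1) ^+ 2 <= (phi k)%:R by near: k; exact: big.
have NB : (32 * (B + 1) ^+ 3 / e) ^+ 2 <= (phi k)%:R by near: k; exact: big.
have NB' : (B + 1) ^+ 4 / e <= (phi k)%:R by near: k; exact: big.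
have eQ : `|expR (- (Q / 2)) - expR (- (Qk k / 2))| <= e / 4.
  by near: k; move/cvgrPdist_le : cE; apply.
have [amp [psi [Hf ampB amp2]]] := field_combination k g t.
have N0 : 0 < (phi k)%:R :> R by rewrite ltr0n phi_gt0.
set N := (phi k)%:R in N0 N1 NB NB' *.
pose s := Num.sqrt (2 / N); have s0 : 0 <= s by exact: sqrtr_ge0.
have s2 : s ^+ 2 = 2 / N by rewrite sqr_sqrtr// divr_ge0// ltW.
have sB1 : s * (B + 1) <= 1.
  rewrite -(ler_pXn2r (ltn0Sn 1)) ?nnegrE ?mulr_ge0 ?addr_ge0//.
  by rewrite exprMn s2 expr1n mulrAC ler_pdivrMr// mul1r.
have samp l : 0 <= s * amp l <= 1.
  have /andP[a0 aB] := ampB l; rewrite mulr_ge0//=; apply: le_trans sB1.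
  by rewrite ler_wpM2l//; rewrite -/B in aB; lra.
have b1 l : (l < phi k)%N -> `|s * amp l| <= 1.
  by move=> _; have /andP[? ?] := samp l; rewrite ger0_norm.
have H := mean_cos_trigsum h0 nonres psi th b1 e4.
near=> rho; have cn := cnt_ge0 m h rho.
have -> : (fun x => cos (\sum_(j < p) t j * field k (x + g j) + th)) =
   (fun x => cos (trigsum (phi k) (fun l => s * amp l) rr psi x + th)).
  by apply/funext => x; rewrite Hf.
have H' : `|sumball h rho (fun x => cos (trigsum (phi k) (fun l => s * amp l) rr psi x + th)) -
    cos th * (\prod_(l < phi k) (1 - (s * amp l) ^+ 2 / 4)) * cnt rho| <=
    (2 * (\sum_(l < phi k) `|s * amp l| ^+ 3) + e / 4) * cnt rho by near: rho; exact: H.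
have cubes : 2 * (\sum_(l < phi k) `|s * amp l| ^+ 3) <= e / 4.
  apply: (@le_trans _ _ (2 * \sum_(l < phi k) (s ^+ 3 * (B + 1) ^+ 3))).
    rewrite ler_wpM2l//; apply: ler_sum => l _; rewrite -exprMn; apply: lerXn2r;
      rewrite ?nnegrE ?mulr_ge0 ?addr_ge0//.
    have /andP[a0 aB] := ampB l; rewrite ger0_norm ?mulr_ge0//.
    by rewrite ler_wpM2l//; rewrite -/B in aB; lra.
  rewrite sumr_const card_ord -[_ *+ phi k]mulr_natl -/N.
  have B1 : 0 <= (B + 1) ^+ 3 by rewrite exprn_ge0// addr_ge0.
  have -> : 2 * (N * (s ^+ 3 * (B + 1) ^+ 3)) = 4 * (B + 1) ^+ 3 * s.
    by rewrite (exprS s 2) s2; field; rewrite gt_eqF.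
  have K0 : 0 <= 32 * (B + 1) ^+ 3 / e by rewrite mulr_ge0 ?invr_ge0 ?(ltW e0)// mulr_ge0.
  have : (32 * (B + 1) ^+ 3 / e) * s <= 2.
    rewrite -(ler_pXn2r (ltn0Sn 1)) ?nnegrE ?(mulr_ge0 K0)// [leLHS]exprMn s2.
    apply: (@le_trans _ _ (N * (2 / N))).
      by rewrite ler_wpM2r ?divr_ge0// ltW.
    by rewrite mulrCA divff ?gt_eqF//; lra.
  move=> /(ler_wpM2l (ltW e0)).
  have -> : e * (32 * (B + 1) ^+ 3 / e * s) = 32 * (B + 1) ^+ 3 * s by field; rewrite gt_eqF.
  lra.
have a01 l : 0 <= (s * amp l) ^+ 2 / 4 <= 1.
  have /andP[? ?] := samp l; rewrite divr_ge0 ?sqr_ge0//= ler_pdivrMr// mul1r.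
  have : (s * amp l) ^+ 2 <= 1 ^+ 2 by apply: lerXn2r; rewrite ?nnegrE.
  rewrite expr1n; lra.
have sumE : \sum_(l < phi k) (s * amp l) ^+ 2 / 4 = Qk k / 2.
  rewrite /Qk -/N -mulr_suml.
  have -> : \sum_(l < phi k) (s * amp l) ^+ 2 = 2 / N * \sum_(l < phi k)
     \sum_(i < p) \sum_(j < p) t i * t j * cos (2 * pi * dotv (rr l) (g i - g j)).
    by rewrite mulr_sumr; apply: eq_bigr => l _; rewrite exprMn s2 amp2.
  by field; rewrite gt_eqF.
have prodE := prod_one_minus (phi k) a01.
rewrite sumE in prodE.
have sq : \sum_(l < phi k) ((s * amp l) ^+ 2 / 4) ^+ 2 <= e / 4.
  apply: (@le_trans _ _ (\sum_(l < phi k) ((s * (B + 1)) ^+ 2 / 4) ^+ 2)).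
    apply: ler_sum => l _; apply: lerXn2r; rewrite ?nnegrE ?divr_ge0 ?sqr_ge0//.
    rewrite ler_wpM2r ?invr_ge0//; apply: lerXn2r; rewrite ?nnegrE ?mulr_ge0 ?addr_ge0//;
      have /andP[a0 aB] := ampB l => //.
    by rewrite ler_wpM2l//; rewrite -/B in aB; lra.
  rewrite sumr_const card_ord -[_ *+ phi k]mulr_natl -/N [(s * (B + 1)) ^+ 2]exprMn s2.
  have -> : N * ((2 / N * (B + 1) ^+ 2 / 4) ^+ 2) = (B + 1) ^+ 4 / N / 4.
    by field; rewrite gt_eqF.
  rewrite ler_wpM2r ?invr_ge0// ler_pdivrMr//.
  by move: NB'; rewrite ler_pdivrMr// mulrC.
set PR := \prod_(_ < _) _ in H' prodE.
have -> : sumball h rho (fun x => cos (trigsum (phi k) (fun l => s * amp l) rr psi x + th)) -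
   cos th * expR (- (Q / 2)) * cnt rho =
   (sumball h rho (fun x => cos (trigsum (phi k) (fun l => s * amp l) rr psi x + th)) -
    cos th * PR * cnt rho) + cos th * ((PR - expR (- (Qk k / 2))) -
       (expR (- (Q / 2)) - expR (- (Qk k / 2)))) * cnt rho by ring.
apply: le_trans (ler_normD _ _) _; rewrite !normrM (ger0_norm cn).
have c1 := cos_max th.
have d1 : `|PR - expR (- (Qk k / 2)) - (expR (- (Q / 2)) - expR (- (Qk k / 2)))| <= e / 2.
  by apply: le_trans (ler_normB _ _) _; lra.
have d2 : `|cos th| * `|PR - expR (- (Qk k / 2)) - (expR (- (Q / 2)) - expR (- (Qk k / 2)))| <= e / 2.
  by rewrite -[leRHS]mul1r; apply: ler_pM.
have d3 := ler_wpM2r cn d2.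
have d4 : (2 * (\sum_(l < phi k) `|s * amp l| ^+ 3) + e / 4) * cnt rho <= e / 2 * cnt rho.
  by rewrite ler_wpM2r//; lra.
have -> : e * cnt rho = e / 2 * cnt rho + e / 2 * cnt rho by field.
lra.
Unshelve. all: by end_near. Qed.

End CentralLimit.

(** * Gaussian integrals *)

Lemma cos_taylor2 (R : realType) (x : R) : `|cos x - 1| <= x ^+ 2.
Proof.
have := cos_taylor_bound 2 0 x; rewrite /cos_taylor !big_ord_recr big_ord0/=.
rewrite !add0r !mul0r cos0 !mul1r cos_pihalf mulr0 addr0.
by rewrite real_normK ?num_real// fact0 invr1 mulr1.
Qed.

Lemma sin_taylor2 (R : realType) (x : R) : `|sin x - x| <= x ^+ 2.
Proof.
have := cos_taylor_bound 2 (- (pi / 2)) x; rewrite /cos_taylor !big_ord_recr big_ord0/=.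
rewrite [- _ + x]addrC cosBpihalf !add0r !mul0r !addr0 !mul1r addNr cos0 cosN cos_pihalf.
by rewrite mulr0 add0r expr1 factE/= divr1 mulr1 real_normK ?num_real.
Qed.
Section GaussianCosine.
Variable R : realType.
Local Notation mu := (@lebesgue_measure R).

Lemma is_derive_quadratic (f : R -> R) x df C d0 : 0 < d0 ->
  (forall d, `|d| <= d0 -> `|f (x + d) - f x - d * df| <= C * d ^+ 2) -> is_derive x (1 : R) f df.
Proof.
move=> d00 H.
have C0 : 0 <= C.
  have := H d0; rewrite ger0_norm ?(ltW d00)// => /(_ (lexx _)) /(le_trans (normr_ge0 _)).
  by rewrite pmulr_lge0 ?exprn_gt0.
have cv : h^-1 *: (f (h *: (1 : R) + x) - f x) @[h --> (0 : R)^'] --> df.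
  apply/cvgrPdist_le => e e0; near=> h.
  have h0 : h != 0 by near: h; exact: nbhs_dnbhs_neq.
  have hd : `|h| <= Num.min d0 (e / (C + 1)).
    by near: h; apply: dnbhs0_le; rewrite lt_min d00 divr_gt0// ltr_wpDl.
  have /andP[hd1 hd2] : (`|h| <= d0) && (`|h| <= e / (C + 1)) by rewrite -le_min.
  have hp : 0 < `|h| by rewrite normr_gt0.
  rewrite distrC; have := H _ hd1; rewrite [h *: _]mulr1 [h + x]addrC.
  have -> : h^-1 *: (f (x + h) - f x) - df = h^-1 * (f (x + h) - f x - h * df).
    by rewrite [h^-1 *: _]/GRing.scale/=; field.
  rewrite normrM normfV ler_pdivrMl// => /le_trans; apply.
  rewrite -(real_normK (num_real h)) expr2 [leRHS]mulrC mulrA ler_wpM2r//.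
  move: hd2; rewrite ler_pdivlMr ?ltr_wpDl//; apply: le_trans.
  by rewrite mulrC ler_wpM2l// lerDl.
apply: DeriveDef; first by apply/cvg_ex; exists df.
exact: cvg_lim cv.
Unshelve. all: by end_near. Qed.

(** The Radon-Nikodym derivative agrees almost everywhere with the explicit density. *)
Lemma integral_normal_prob (s : R) (f : R -> \bar R) :
  (normal_prob 0 s).-integrable setT f ->
  (\int[normal_prob 0 s]_x f x = \int[mu]_x (f x * (normal_pdf 0 s x)%:E))%E.
Proof.
move=> intf; have mf := measurable_int _ intf.
rewrite -(Radon_Nikodym_change_of_variables (normal_prob_dominates 0 s))//=.
apply: ae_eq_integral => //.
- apply: emeasurable_funM => //; apply: (measurable_int mu).
  by apply: Radon_Nikodym_integrable; exact: normal_prob_dominates.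
- by apply: emeasurable_funM => //=; apply/measurable_EFinP; exact: measurable_normal_pdf.
- apply: ae_eqe_mul2l => /=.
  rewrite Radon_NikodymE//=; first exact: normal_prob_dominates.
  move=> abmu; case: cid => /= g [g1 g2 g3].
  apply: integral_ae_eq => //=.
  + by apply/measurable_EFinP; exact: measurable_normal_pdf.
  + by move=> E E01 mE; rewrite -g3.
Qed.

Variable s : R.
Hypothesis s0 : s != 0.
Local Notation v := (s ^+ 2).
Local Notation ph := (normal_pdf 0 s).

Let v0 : 0 < v. Proof. by rewrite exprn_even_gt0. Qed.

Definition wintegrable (g : R -> R) := mu.-integrable setT (fun x => (g x * ph x)%:E).
Definition wint (g : R -> R) : R := fine (\int[mu]_x (g x * ph x)%:E)%E.

(** The shifted Gaussian density is an exponential tilt of the original one, so the factor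
    [exp(d x - d^2 v / 2)] acts as a translation by [d v]. *)
Lemma normal_pdf_tilt d x : normal_pdf (d * v) s x = expR (d * x - d ^+ 2 * v / 2) * ph x.
Proof.
have v00 := v0; rewrite !normal_pdfE// [RHS]mulrCA; congr (normal_peak s * _).
rewrite /normal_fun -expRD; congr expR; rewrite subr0 -[v *+ 2]mulr_natr.
by field.
Qed.

Lemma normal_pdf_shift d x : normal_pdf (d * v) s (x + d * v) = ph x.
Proof. by rewrite !normal_pdfE// /normal_fun addrK subr0. Qed.

Lemma wintegrable_exp d : wintegrable (fun x => expR (d * x)) /\
  wint (fun x => expR (d * x)) = expR (d ^+ 2 * v / 2).
Proof.
have I := @integrable_normal_pdf R (d * v) s.
have E : (fun x => (expR (d * x) * ph x)%:E) =
   (fun x => (expR (d ^+ 2 * v / 2))%:E * (normal_pdf (d * v) s x)%:E)%E.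
  apply/funext => x; rewrite normal_pdf_tilt -EFinM mulrA -expRD; congr (expR _ * _)%:E.
  by ring.
split; first by rewrite /wintegrable E; exact: integrableZl.
by rewrite /wint E integralZl// integral_normal_pdf mule1.
Qed.

Lemma wintegrableD g g' : wintegrable g -> wintegrable g' -> wintegrable (fun x => g x + g' x).
Proof.
move=> I I'; have := integrableD measurableT I I'.
by apply: eq_integrable => // x _; rewrite mulrDl.
Qed.

Lemma wintegrableZ c g : wintegrable g -> wintegrable (fun x => c * g x).
Proof.
move=> I; have := integrableZl measurableT c I.
by apply: eq_integrable => // x _; rewrite -EFinM mulrA.
Qed.

Lemma wintD g g' : wintegrable g -> wintegrable g' -> wint (fun x => g x + g' x) = wint g + wint g'.
Proof.
move=> I I'; rewrite /wint -fineD ?integrable_fin_num//.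
by rewrite -integralD//; congr fine; apply: eq_integral => x _; rewrite mulrDl.
Qed.

Lemma wintZ c g : wintegrable g -> wint (fun x => c * g x) = c * wint g.
Proof.
move=> I; rewrite /wint -[c in RHS]/(fine c%:E) -fineM ?integrable_fin_num//.
by rewrite -integralZl//; congr fine; apply: eq_integral => x _; rewrite -EFinM mulrA.
Qed.

Lemma wint_le g g' : wintegrable g -> wintegrable g' -> (forall x, g x <= g' x) -> wint g <= wint g'.
Proof.
move=> I I' H; apply: fine_le; rewrite ?integrable_fin_num//.
by apply: le_integral => // x _; rewrite lee_fin ler_wpM2r// normal_pdf_ge0.
Qed.

Lemma wintegrable_cst c : wintegrable (fun=> c) /\ wint (fun=> c) = c.
Proof.
have [I E] := wintegrable_exp 0.
have -> : (fun=> c) = (fun x : R => c * expR (0 * x)).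
  by apply/funext => x; rewrite mul0r expR0 mulr1.
split; first exact: wintegrableZ.
by rewrite wintZ// E expr0n/= !mul0r expR0 mulr1.
Qed.

Lemma wintegrable_le (g g' : R -> R) : measurable_fun setT g -> wintegrable g' ->
  (forall x, `|g x| <= g' x) -> wintegrable g.
Proof.
move=> mg I H; apply: (le_integrable _ _ _ I) => //.
  by apply/measurable_EFinP; apply: measurable_funM => //; exact: measurable_normal_pdf.
move=> x _ /=; rewrite lee_fin !normrM ler_wpM2r//.
exact: le_trans (H x) (ler_norm _).
Qed.

Lemma wint_norm_le (g g' : R -> R) : measurable_fun setT g -> wintegrable g' ->
  (forall x, `|g x| <= g' x) -> `|wint g| <= wint g'.
Proof.
move=> mg I H; have Ig := wintegrable_le mg I H.
rewrite ler_norml; apply/andP; split; last by apply: wint_le => // x; exact: le_trans (ler_norm _) _.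
rewrite -mulN1r -wintZ//; apply: wint_le => //; first exact: wintegrableZ.
by move=> x; rewrite mulN1r lerNl; apply: le_trans (H x); rewrite -normrN ler_norm.
Qed.

Lemma measurable_cos_affine t th : measurable_fun setT (fun x : R => cos (t * x + th)).
Proof.
apply: measurableT_comp => //; first exact: measurable_realfun.continuous_measurable_fun (@continuous_cos R).
by apply: measurable_funD => //; exact: measurable_funM.
Qed.

Lemma wintegrable_cos t th : wintegrable (fun x => cos (t * x + th)).
Proof.
apply: (wintegrable_le (measurable_cos_affine t th) (wintegrable_cst 1).1) => x.
exact: cos_max.
Qed.

Lemma wintegrable_tilt d t th : wintegrable (fun x => cos (t * x + th) * expR (d * x - d ^+ 2 * v / 2)).
Proof.
have [I _] := wintegrable_exp d.
apply: (wintegrable_le _ (wintegrableZ (expR (- (d ^+ 2 * v / 2))) I)) => [|x].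
  apply: measurable_funM; first exact: measurable_cos_affine.
  apply: measurableT_comp => //; apply: measurable_funB => //; exact: measurable_funM.
rewrite normrM -expRD [- _ + _]addrC [X in _ * X]ger0_norm ?expR_ge0// -[leRHS]mul1r ler_wpM2r ?expR_ge0//.
exact: cos_max.
Qed.

Lemma wint_tilt d t th : wint (fun x => cos (t * x + th) * expR (d * x - d ^+ 2 * v / 2)) =
  wint (fun x => cos (t * x + (t * (d * v) + th))).
Proof.
pose F x := x + d * v.
(* The added 1 makes the integrand nonnegative, as the substitution rule requires; its contribution
   cancels at the end. *)
pose G x := (1 + cos (t * x + th)) * normal_pdf (d * v) s x.
have dF x : is_derive x (1 : R) F 1.
  rewrite /F; apply: is_derive_eq; by rewrite addr0.
have F'E : F^`()%classic = cst 1.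
  by apply/funext => x; rewrite derive1E derive_val.
have S : (\int[mu]_x (G x)%:E = \int[mu]_x (((G \o F) * F^`()%classic) x)%:E)%E.
  apply: increasing_ge0_integration_by_substitutionT.
  - by move=> x y xy; rewrite /F ltrD2r.
  - by rewrite F'E; exact: cst_continuous.
  - by rewrite F'E; exact: is_cvg_cst.
  - by rewrite F'E; exact: is_cvg_cst.
  - by move=> x; have [] := dF x.
  - by apply/cvgrNyPle => A; near=> x; rewrite /F -lerBrDr; near: x; exact: (nbhs_ninfty_le (num_real _)).
  - by apply/cvgryPge => A; near=> x; rewrite /F -lerBlDr; near: x; exact: (nbhs_pinfty_ge (num_real _)).
  - move=> x; apply: cvgM; last exact: continuous_normal_pdf.
    apply: cvgD; first exact: cvg_cst.
    apply: continuous_comp; last exact: continuous_cos.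
    by apply: cvgD; [apply: cvgM; [exact: cvg_cst|exact: cvg_id]|exact: cvg_cst].
  - move=> x; rewrite mulr_ge0 ?normal_pdf_ge0//.
have [I1 E1] := wintegrable_exp d; have [J1 J2] := wintegrable_cst 1.
pose e x := expR (d * x - d ^+ 2 * v / 2).
have eE : e = fun x => expR (- (d ^+ 2 * v / 2)) * expR (d * x).
  by apply/funext => x; rewrite /e addrC expRD.
have Ie : wintegrable e by rewrite eE; exact: wintegrableZ.
have e1 : wint e = 1 by rewrite eE wintZ// E1 -expRD addNr expR0.
have L : fine (\int[mu]_x (G x)%:E)%E = wint (fun x => e x + cos (t * x + th) * e x).
  by rewrite /wint; congr fine; apply: eq_integral => x _; rewrite /G normal_pdf_tilt -/(e x); congr EFin; ring.
have L' : fine (\int[mu]_x (((G \o F) * F^`()%classic) x)%:E)%E =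
    wint (fun x => 1 + cos (t * x + (t * (d * v) + th))).
  rewrite /wint; congr fine; apply: eq_integral => x _; rewrite F'E /=.
  rewrite [(_ * _)%R x](_ : _ = G (F x) * 1)// mulr1 /G /F normal_pdf_shift.
  by rewrite mulrDr addrA.
have := congr1 fine S; rewrite L L' wintD//; last exact: wintegrable_tilt.
rewrite wintD//; last exact: wintegrable_cos.
by rewrite e1 J2 => /addrI.
Unshelve. all: by end_near. Qed.

(** The majorant [exp(y) + exp(-y) - 2] of the second order remainders has an explicit Gaussian
    integral. *)
Lemma expR_hyperbolic (y : R) : y ^+ 2 <= 4 * (expR y + expR (- y) - 2) /\
  `|expR y - 1 - y| <= expR y + expR (- y) - 2.
Proof.
have e0 := expR_ge1Dx y; have e1 := expR_ge1Dx (- y).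
split; last by rewrite ger0_norm; lra.
wlog y0 : y e0 e1 / 0 <= y.
  move=> H; have [|y0] := lerP 0 y; first exact: H.
  have := H (- y); rewrite opprK sqrrN [expR (- y) + _]addrC; apply=> //.
  by rewrite oppr_ge0 ltW.
have h1 := expR_ge1Dx (y / 2).
have h2 : expR (- (y / 2)) <= 1 by rewrite -[leRHS]expR0 ler_expR oppr_le0 divr_ge0.
have -> : expR y + expR (- y) - 2 = (expR (y / 2) - expR (- (y / 2))) ^+ 2.
  have h3 : expR (y / 2) * expR (- (y / 2)) = 1 by rewrite -expRD subrr expR0.
  have h4 : expR y = expR (y / 2) * expR (y / 2) by rewrite -expRD; congr expR; field.
  have h5 : expR (- y) = expR (- (y / 2)) * expR (- (y / 2)) by rewrite -expRD; congr expR; field.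
  by rewrite h4 h5; move: h3; set a := expR (y / 2); set b := expR _ => h3; have -> : 2 = 2 * (a * b) by [rewrite h3 mulr1]; ring.
have : (y / 2) ^+ 2 <= (expR (y / 2) - expR (- (y / 2))) ^+ 2.
  by apply: lerXn2r; rewrite ?nnegrE ?divr_ge0//; lra.
by move: (expR (y / 2) - _) => q; rewrite exprMn; lra.
Qed.

(** The function [h] solves [h' = - t v h]. Its derivative is found without differentiating under
    the integral: the first order factor [d x] is replaced by [exp(d x - d^2 v / 2) - 1], whose
    integral against the sine is exact by translation. *)
Lemma wint_cos t th : wint (fun x => cos (t * x + th)) = cos th * expR (- (t ^+ 2 * v / 2)).
Proof.
have v00 := v0.
pose h t := wint (fun x => cos (t * x + th)).
pose g t := wint (fun x => cos (t * x + (th - pi / 2))).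
have key u d : d ^+ 2 * v <= 1 ->
    `|h (u + d) - h u - d * - (u * v * h u)| <= (19 * v + 2 * u ^+ 2 * v ^+ 2) * d ^+ 2.
  move=> dv.
  pose A x := u * x + th; pose y x := d * x.
  have g1 : `|g u| <= 1.
    by rewrite -[leRHS](wintegrable_cst 1).2; apply: wint_norm_le => [||x];
      [exact: measurable_cos_affine|exact: (wintegrable_cst 1).1|exact: cos_max].
  have h1 : `|h u| <= 1.
    by rewrite -[leRHS](wintegrable_cst 1).2; apply: wint_norm_le => [||x];
      [exact: measurable_cos_affine|exact: (wintegrable_cst 1).1|exact: cos_max].
  pose B x := 9 * (expR (d * x) + expR (- d * x) - 2) + d ^+ 2 * v / 2 * expR (d * x).
  have BE : B = fun x => (9 + d ^+ 2 * v / 2) * expR (d * x) + (9 * expR (- d * x) + -18).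
    by apply/funext => x; rewrite /B; ring.
  have [Id Ed] := wintegrable_exp d; have [In En] := wintegrable_exp (- d).
  have [Ic Ec] := wintegrable_cst (-18).
  have IB2 : wintegrable (fun x => 9 * expR (- d * x) + -18).
    by apply: wintegrableD => //; exact: wintegrableZ.
  have IB1 : wintegrable (fun x => (9 + d ^+ 2 * v / 2) * expR (d * x)) by exact: wintegrableZ.
  have IB : wintegrable B by rewrite BE; exact: wintegrableD.
  have EB : wint B <= 19 * (d ^+ 2 * v).
    rewrite BE wintD// wintD//; last exact: wintegrableZ.
    rewrite !wintZ// Ed En Ec sqrrN; set w := d ^+ 2 * v in dv *.
    have w0 : 0 <= w by rewrite mulr_ge0 ?sqr_ge0// ltW.
    have l1 := expR_ge1Dx (- (w / 2)).
    have l2 : expR (w / 2) * expR (- (w / 2)) = 1 by rewrite -expRD subrr expR0.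
    have l3 := expR_gt0 (w / 2).
    set E1 := expR (w / 2) in l2 l3 *; set E2 := expR _ in l1 l2.
    have l4 : E1 * (1 - w / 2) <= 1 by rewrite -[leRHS]l2 ler_wpM2l// ltW.
    have l5 : E1 * (1 / 2) <= 1 by apply: le_trans l4; rewrite ler_wpM2l ?(ltW l3)//; lra.
    have l6 : E1 * (w / 2) <= 2 * (w / 2) by rewrite ler_wpM2r ?divr_ge0//; lra.
    by nra.
  (* The first order terms in [d] cancel, and what is left is dominated by [B], of integral
     [O(d^2)]. *)
  pose D x := cos ((u + d) * x + th) + (-1 * cos (u * x + th) +
    (cos (u * x + (th - pi / 2)) * expR (d * x - d ^+ 2 * v / 2) + -1 * cos (u * x + (th - pi / 2)))).
  have I1 := wintegrable_cos (u + d) th; have I2 := wintegrableZ (-1) (wintegrable_cos u th).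
  have I3 := wintegrable_tilt d u (th - pi / 2).
  have I4 := wintegrableZ (-1) (wintegrable_cos u (th - pi / 2)).
  have I34 := wintegrableD I3 I4; have I234 := wintegrableD I2 I34.
  have mD : measurable_fun setT D.
    apply: measurable_funD; first exact: measurable_cos_affine.
    apply: measurable_funD; first by apply: measurable_funM => //; exact: measurable_cos_affine.
    apply: measurable_funD; last by apply: measurable_funM => //; exact: measurable_cos_affine.
    apply: measurable_funM; first exact: measurable_cos_affine.
    apply: measurableT_comp => //; apply: measurable_funB => //; exact: measurable_funM.
  have DB x : `|D x| <= B x.
    have sE : cos (u * x + (th - pi / 2)) = sin (A x) by rewrite addrA cosBpihalf.
    have cE : cos ((u + d) * x + th) = cos (A x) * cos (y x) - sin (A x) * sin (y x).
      by rewrite -cosD; congr cos; rewrite /A /y; ring.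
    rewrite /D sE cE -/(A x) -/(y x).
    have [k1 k2] := expR_hyperbolic (y x).
    have c2 := cos_taylor2 (y x); have s2 := sin_taylor2 (y x).
    have e2 : `|expR (y x) - expR (y x - d ^+ 2 * v / 2)| <= d ^+ 2 * v / 2 * expR (y x).
      have w0 : 0 <= d ^+ 2 * v / 2 by rewrite divr_ge0// mulr_ge0 ?sqr_ge0// ltW.
      rewrite expRD; have l1 := expR_ge1Dx (- (d ^+ 2 * v / 2)).
      have l2 : expR (- (d ^+ 2 * v / 2)) <= 1 by rewrite -[leRHS]expR0 ler_expR oppr_le0.
      have l3 := expR_gt0 (y x).
      have n1 : `|1 - expR (- (d ^+ 2 * v / 2))| <= d ^+ 2 * v / 2.
        by rewrite ger0_norm ?subr_ge0//; clear - l1; lra.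
      by rewrite -{1}[expR (y x)]mulr1 -mulrBr normrM (gtr0_norm l3) [leLHS]mulrC ler_wpM2r// ltW.
    have cA := cos_max (A x); have sA := sin_max (A x).
    set c := cos (A x) in cA *; set sn := sin (A x) in sA *.
    have -> : c * cos (y x) - sn * sin (y x) + (-1 * c +
      (sn * expR (y x - d ^+ 2 * v / 2) + -1 * sn)) =
      c * (cos (y x) - 1) - sn * ((sin (y x) - y x) - (expR (y x) - 1 - y x) + (expR (y x) - expR (y x - d ^+ 2 * v / 2))).
      by ring.
    apply: le_trans (ler_normB _ _) _; rewrite !normrM.
    have m1 : `|c| * `|cos (y x) - 1| <= y x ^+ 2 by rewrite -[leRHS]mul1r ler_pM.
    set Z := _ - _ + _.
    have mZ : `|Z| <= y x ^+ 2 + (expR (y x) + expR (- y x) - 2) + d ^+ 2 * v / 2 * expR (y x).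
      by apply: le_trans (ler_normD _ _) _; apply: lerD => //; apply: le_trans (ler_normB _ _) _; exact: lerD.
    have m2 : `|sn| * `|Z| <= `|Z| by rewrite -[leRHS]mul1r ler_wpM2r.
    by rewrite /B mulNr -/(y x); lra.
  have WD : wint D = h (u + d) - h u +
     (g u * (cos (u * (d * v)) - 1) + h u * sin (u * (d * v))).
    rewrite /D wintD// wintD// wintD// !wintZ; try exact: wintegrable_cos.
    rewrite wint_tilt -/(h (u + d)) -/(h u) -/(g u).
    have -> : (fun x => cos (u * x + (u * (d * v) + (th - pi / 2)))) =
      (fun x => cos (u * (d * v)) * cos (u * x + (th - pi / 2)) + sin (u * (d * v)) * cos (u * x + th)).
      apply/funext => x.
      have -> : u * x + (u * (d * v) + (th - pi / 2)) = u * x + th + u * (d * v) - pi / 2 by ring.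
      by rewrite cosBpihalf sinD [_ + (_ - _)]addrA cosBpihalf; ring.
    by rewrite wintD ?wintZ -?/(h u) -?/(g u); [ring|exact: wintegrable_cos..|
      exact: wintegrableZ (wintegrable_cos _ _)|exact: wintegrableZ (wintegrable_cos _ _)].
  have WB : `|wint D| <= 19 * (d ^+ 2 * v) by apply: le_trans EB; exact: wint_norm_le.
  rewrite WD in WB; set a := u * (d * v) in WB.
  have ca := cos_taylor2 a; have sa := sin_taylor2 a.
  have -> : h (u + d) - h u - d * - (u * v * h u) = (h (u + d) - h u +
     (g u * (cos a - 1) + h u * sin a)) - (g u * (cos a - 1) + h u * (sin a - a)).
    have -> : d * - (u * v * h u) = - (a * h u) by rewrite /a; ring.
    ring.
  apply: le_trans (ler_normB _ _) _.
  have n1 : `|g u * (cos a - 1)| <= a ^+ 2 by rewrite normrM -[leRHS]mul1r ler_pM.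
  have n2 : `|h u * (sin a - a)| <= a ^+ 2 by rewrite normrM -[leRHS]mul1r ler_pM.
  have n3 := ler_normD (g u * (cos a - 1)) (h u * (sin a - a)).
  have -> : (19 * v + 2 * u ^+ 2 * v ^+ 2) * d ^+ 2 = 19 * (d ^+ 2 * v) + 2 * a ^+ 2.
    by rewrite /a; ring.
  lra.
have dh u : is_derive u (1 : R) h (- (u * v * h u)).
  have q0 : 0 < Num.min 1 (1 / v) by rewrite lt_min ltr01 divr_gt0.
  apply: (is_derive_quadratic q0 (C := 19 * v + 2 * u ^+ 2 * v ^+ 2)) => d; rewrite le_min => /andP[d1 d2].
  apply: key; rewrite -ler_pdivlMr//; apply: le_trans d2.
  by rewrite -(real_normK (num_real d)) expr2 -[leRHS]mulr1 ler_wpM2l.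
(* The integrating factor of the differential equation. *)
pose k u := h u * expR (u ^+ 2 * v / 2).
have dk u : is_derive u (1 : R) k 0.
  have d2 : is_derive u (1 : R) (fun u => expR (u ^+ 2 * v / 2)) (u * v * expR (u ^+ 2 * v / 2)).
    have d1 : is_derive u (1 : R) (fun u => u ^+ 2 * v / 2) (u * v).
      have -> : (fun u => u ^+ 2 * v / 2) = (fun u : R => (v / 2) *: (u ^+ 2)).
        by apply/funext => z /=; rewrite /GRing.scale/=; ring.
      by apply: is_derive_eq; rewrite /GRing.scale/= mulr1; field.
    have -> : (fun u => expR (u ^+ 2 * v / 2)) = expR \o (fun u => u ^+ 2 * v / 2) by [].
    by apply: is_derive_eq; rewrite mulrC.
  have := @is_deriveM _ _ h _ u 1 _ _ (dh u) d2.
  move=> H; apply: (is_derive_eq (H : is_derive u 1 k _)).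
  by rewrite /GRing.scale/=; ring.
have := is_derive_0_is_cst t 0 dk.
rewrite /k expr0n/= !mul0r expR0 mulr1 => kt.
have h0E : h 0 = cos th.
  rewrite /h; have -> : (fun x => cos (0 * x + th)) = (fun=> cos th).
    by apply/funext => x; rewrite mul0r add0r.
  exact: (wintegrable_cst _).2.
rewrite -/(h t) -h0E -kt -mulrA -expRD subrr expR0 mulr1//.
Qed.

End GaussianCosine.

Lemma centered_gaussian_cos (R : realType) d (Omega : measurableType d) (P : probability Omega R)
    (X : Omega -> R) (v th : R) : centered_gaussian P X v ->
  (\int[P]_w (cos (X w + th))%:E = (cos th * expR (- (v / 2)))%:E)%E.
Proof.
move=> [mX [[-> X0]|[v0 HX]]].
  have -> : (\int[P]_w (cos (X w + th))%:E = \int[P]_w (cos th)%:E)%E.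
    apply: ae_eq_integral => //.
    - apply/measurable_EFinP; apply: measurableT_comp => //.
        exact: measurable_realfun.continuous_measurable_fun (@continuous_cos R).
      exact: measurable_funD.
    - by apply: filterS X0 => w Xw _ /=; rewrite Xw add0r.
  by rewrite integral_cst//= probability_setT mule1 mul0r oppr0 expR0 mulr1.
have s0 : Num.sqrt v != 0 by rewrite gt_eqF// sqrtr_gt0.
have mc : measurable_fun setT (fun x : R => (cos (x + th))%:E).
  apply/measurable_EFinP; apply: measurableT_comp => //.
    exact: measurable_realfun.continuous_measurable_fun (@continuous_cos R).
  exact: measurable_funD.
have bounded_int (dd : measure_display) (T : measurableType dd) (Q : probability T R) (f : T -> R) :
    measurable_fun setT f -> (forall x, `|f x| <= 1) -> Q.-integrable setT (EFin \o f).
  move=> mf f1; apply: (@le_integrable _ _ _ Q setT _ _ (cst 1%E)) => //.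
  - exact/measurable_EFinP.
  - by move=> x _ /=; rewrite normr1 lee_fin.
  - by apply/integrableP; split => //; rewrite integral_cst//= normr1 mul1e probability_setT ltry.
pose Y : {mfun Omega >-> measurableTypeR R} :=
  MeasurableFun.Pack (MeasurableFun.Class (@isMeasurableFun.Build _ _ Omega (measurableTypeR R) _ mX)).
have E : forall A, measurable A -> A `<=` [set: measurableTypeR R] ->
  distribution P Y A = normal_prob 0 (Num.sqrt v) A by move=> A mA _; exact: HX.
have intX : P.-integrable setT ((fun x => (cos (x + th))%:E) \o Y).
  apply: (bounded_int _ _ P (fun w => cos (X w + th))) => [|x]; last exact: cos_max.
  by move/measurable_EFinP : mc => mc; exact: (measurableT_comp mc).
have -> : (\int[P]_w (cos (X w + th))%:E)%E =
    (\int[normal_prob 0 (Num.sqrt v)]_x (cos (x + th))%:E)%E.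
  have E2 g := eq_measure_integral (f := g) _ E.
  by rewrite -E2 integral_distribution.
rewrite integral_normal_prob; last first.
  by apply: bounded_int => [|x]; [exact/measurable_EFinP|exact: cos_max].
have := wint_cos s0 1 th; rewrite /wint expr1n mul1r sqr_sqrtr ?(ltW v0)// => <-.
rewrite fineK; last first.
  by apply: integrable_fin_num => //; exact: (wintegrable_cos s0 1 th).
by apply: eq_integral => x _; rewrite mul1r EFinM.
Qed.

(** * Transfer between samples and the Gaussian field *)

Section Waves.
Variables (R : realType) (m : nat).
Local Notation vec := 'rV[R]_m.
Local Notation func := (vec -> R).
Implicit Types (Psi : func -> R) (f : func).

Definition wave (s : seq (R * vec)) (th : R) f : R := cos (\sum_(p <- s) p.1 * f p.2 + th).

Definition waves (q : seq (R * seq (R * vec) * R)) f : R := \sum_(a <- q) a.1.1 * wave a.1.2 a.2 f.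

(** The functionals to which the central limit theorem applies. They form an algebra closed under
    uniform limits, absolute value and maximum, rich enough to separate classes of windows. *)
Definition admissible Psi := forall e, 0 < e -> exists q, forall f, `|Psi f - waves q f| <= e.

Lemma waves_cons a q f : waves (a :: q) f = a.1.1 * wave a.1.2 a.2 f + waves q f.
Proof. by rewrite /waves big_cons. Qed.

Lemma waves_cat q q' f : waves (q ++ q') f = waves q f + waves q' f.
Proof. by rewrite /waves big_cat. Qed.

Lemma waves_bound q f : `|waves q f| <= \sum_(a <- q) `|a.1.1|.
Proof.
apply: le_trans (ler_norm_sum _ _ _) _; apply: ler_sum => a _.
by rewrite normrM -[leRHS]mulr1 ler_wpM2l// cos_max.
Qed.

Lemma wavesM q q' : exists q'', forall f, waves q f * waves q' f = waves q'' f.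
Proof.
elim: q => [|a q [q1 IH]].
  by exists [::] => f; rewrite /waves !big_nil mul0r.
have [q2 H2] : exists q2, forall f, a.1.1 * wave a.1.2 a.2 f * waves q' f = waves q2 f.
  elim: q' {IH} => [|a' q' [q2 IH]].
    by exists [::] => f; rewrite /waves !big_nil mulr0.
  pose N (s : seq (R * vec)) := [seq (- p.1, p.2) | p <- s].
  exists [:: (a.1.1 * a'.1.1 / 2, a.1.2 ++ a'.1.2, a.2 + a'.2),
     (a.1.1 * a'.1.1 / 2, a.1.2 ++ N a'.1.2, a.2 - a'.2) & q2] => f.
  rewrite !waves_cons -IH/= /wave !big_cat/= big_map/=.
  have -> : \sum_(p <- a'.1.2) - p.1 * f p.2 = - \sum_(p <- a'.1.2) p.1 * f p.2.
    by rewrite -sumrN; apply: eq_bigr => p _; rewrite mulNr.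
  set u := \sum_(p <- a.1.2) _; set v := \sum_(p <- a'.1.2) _.
  have -> : u + v + (a.2 + a'.2) = (u + a.2) + (v + a'.2) by ring.
  have -> : u - v + (a.2 - a'.2) = (u + a.2) - (v + a'.2) by ring.
  by set x := u + a.2; set y := v + a'.2; clearbody x y; rewrite cosD cosB; field.
exists (q2 ++ q1) => f; rewrite waves_cons mulrDl H2 IH.
by rewrite waves_cat.
Qed.

Lemma admissible_bounded Psi : admissible Psi -> exists2 B, 0 < B & forall f, `|Psi f| <= B.
Proof.
move=> /(_ 1 ltr01)[q Hq]; exists (\sum_(a <- q) `|a.1.1| + 1) => [|f].
  by rewrite ltr_wpDl// sumr_ge0.
rewrite -(subrK (waves q f) (Psi f)) addrC; apply: le_trans (ler_normD _ _) _.
by apply: lerD => //; exact: waves_bound.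
Qed.

Lemma admissible_wave s th : admissible (wave s th).
Proof.
move=> e e0; exists [:: (1, s, th)] => f.
by rewrite /waves big_seq1/= mul1r subrr normr0 ltW.
Qed.

Lemma admissible_cst c : admissible (fun=> c).
Proof.
move=> e e0; exists [:: (c, [::], 0)] => f.
by rewrite /waves big_seq1/= /wave big_nil addr0 cos0 mulr1 subrr normr0 ltW.
Qed.

Lemma admissibleD Psi Psi' : admissible Psi -> admissible Psi' ->
  admissible (fun f => Psi f + Psi' f).
Proof.
move=> H H' e e0; have e2 : 0 < e / 2 by rewrite divr_gt0.
have [s Hs] := H _ e2; have [s' Hs'] := H' _ e2; exists (s ++ s') => f.
rewrite waves_cat opprD addrACA.
by apply: le_trans (ler_normD _ _) _; have := Hs f; have := Hs' f; lra.
Qed.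

Lemma admissibleM Psi Psi' : admissible Psi -> admissible Psi' ->
  admissible (fun f => Psi f * Psi' f).
Proof.
move=> H H' e e0; have [B B0 HB] := admissible_bounded H.
have e1 : 0 < e / 2 / (B + 1) by rewrite !divr_gt0// ltr_wpDl// ltW.
have [s' Hs'] := H' _ e1.
pose B' := \sum_(a <- s') `|a.1.1|; have B'0 : 0 <= B' by exact: sumr_ge0.
have e2 : 0 < e / 2 / (B' + 1) by rewrite !divr_gt0// ltr_wpDl.
have [s Hs] := H _ e2; have [s'' Hs''] := wavesM s s'; exists s'' => f.
rewrite -Hs''.
have -> : Psi f * Psi' f - waves s f * waves s' f =
  Psi f * (Psi' f - waves s' f) + (Psi f - waves s f) * waves s' f by ring.
apply: le_trans (ler_normD _ _) _; rewrite !normrM.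
have -> : e = (B + 1) * (e / 2 / (B + 1)) + e / 2 / (B' + 1) * (B' + 1).
  by field; rewrite !gt_eqF ?ltr_wpDl// ltW.
apply: lerD; apply: ler_pM => //; first by have := HB f; lra.
by have := waves_bound s' f; rewrite -/B'; lra.
Qed.

Lemma admissible_limit Psi : (forall e, 0 < e -> exists2 Psi', admissible Psi' &
  forall f, `|Psi f - Psi' f| <= e) -> admissible Psi.
Proof.
move=> H e e0; have e2 : 0 < e / 2 by rewrite divr_gt0.
have [g' Hg' gg'] := H _ e2; have [s Hs] := Hg' _ e2; exists s => f.
rewrite -(subrK (g' f) (Psi f)) -addrA; apply: le_trans (ler_normD _ _) _.
by have := gg' f; have := Hs f; lra.
Qed.

Lemma eq_admissible Psi Psi' : (forall f, Psi f = Psi' f) -> admissible Psi -> admissible Psi'.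
Proof. by move=> E H e e0; have [q Hq] := H e e0; exists q => f; rewrite -E. Qed.

Lemma admissible_sum (I : Type) (s : seq I) (Psi : I -> func -> R) :
  (forall i, admissible (Psi i)) -> admissible (fun f => \sum_(i <- s) Psi i f).
Proof.
move=> H; elim: s => [|i s IH].
  by apply: (@eq_admissible (fun=> 0)) => [f|]; [rewrite big_nil|exact: admissible_cst].
apply: (@eq_admissible (fun f => Psi i f + \sum_(j <- s) Psi j f)) => [f|].
  by rewrite big_cons.
exact: admissibleD.
Qed.

(* The iteration a -> a + (x^2 - a^2)/2 converges to |x|, uniformly for |x| <= 1. *)
Lemma admissible_abs Psi : admissible Psi -> admissible (fun f => `|Psi f|).
Proof.
move=> H; have [B B0 HB] := admissible_bounded H.
pose X f := B^-1 * Psi f.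
have AX : admissible X by apply: admissibleM => //; exact: admissible_cst.
have X1 f : `|X f| <= 1 by rewrite normrM gtr0_norm ?invr_gt0// ler_pdivrMl// mulr1.
suff AX' : admissible (fun f => `|X f|).
  apply: (@eq_admissible (fun f => B * `|X f|)) => [f|].
    by rewrite normrM (gtr0_norm (x := B^-1)) ?invr_gt0// mulrA divff ?gt_eqF// mul1r.
  by apply: admissibleM => //; exact: admissible_cst.
pose it n f := iter n (fun a => a + (X f ^+ 2 - a ^+ 2) / 2) 0.
have ait n : admissible (it n).
  elim: n => [|n IH]; first exact: admissible_cst.
  apply: (@eq_admissible (fun f => it n f + (X f * X f + -1 * (it n f * it n f)) * 2^-1)) => [f|].
    by rewrite /it/= !expr2 mulN1r.
  apply: admissibleD => //; apply: admissibleM; last exact: admissible_cst.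
  apply: admissibleD; first exact: admissibleM.
  by apply: admissibleM; [exact: admissible_cst|exact: admissibleM].
(* The third bound yields [n (|X f| - it n f) <= 2], uniformly in [f]. *)
have itB n f : [/\ 0 <= it n f, it n f <= `|X f| &
    (`|X f| - it n f) * (1 + n%:R * `|X f| / 2) <= `|X f|].
  have x1 := X1 f; have x0 := normr_ge0 (X f).
  have -> : it n f = iter n (fun a => a + (`|X f| ^+ 2 - a ^+ 2) / 2) 0.
    by rewrite /it real_normK ?num_real.
  set x := `|X f| in x0 x1 *.
  elim: n => [|n [a0 ax H1]] /=; first by split => //; rewrite !mul0r addr0 mulr1 subr0.
  set a := iter n _ 0 in a0 ax H1 *.
  have E : x - (a + (x ^+ 2 - a ^+ 2) / 2) = (x - a) * (1 - (x + a) / 2) by field.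
  have xa : 0 <= x - a by lra.
  have q0 : 0 <= 1 - (x + a) / 2 by lra.
  split.
  - have : a ^+ 2 <= x ^+ 2 by apply: lerXn2r; rewrite ?nnegrE.
    lra.
  - by rewrite -subr_ge0 E mulr_ge0.
  rewrite E; apply: le_trans H1; rewrite -mulrA ler_wpM2l// -[n.+1%:R]natr1.
  have n0 : 0 <= n%:R :> R by [].
  set N := n%:R in n0 *.
  have p1 : (1 - (x + a) / 2) * (1 + (N + 1) * x / 2) <= (1 - x / 2) * (1 + (N + 1) * x / 2).
    rewrite ler_wpM2r//; last lra.
    by rewrite addr_ge0// divr_ge0// mulr_ge0// addr_ge0.
  apply: le_trans p1 _; have p2 : 0 <= N * (x * x) by rewrite !mulr_ge0.
  have p3 : 0 <= x * x by rewrite mulr_ge0.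
  lra.
apply: admissible_limit => e e0.
pose n := (Num.bound (2 / e)).+1; exists (it n) => // f.
have [i0 i1 i2] := itB n f; rewrite ger0_norm ?subr_ge0//.
have ne : 2 / e <= n%:R.
  apply: le_trans (ltW (archi_boundP _)) _; first by rewrite divr_ge0// ltW.
  by rewrite ler_nat.
have [x0|x0] := eqVneq `|X f| 0; first by move: i0 i1; rewrite x0 => *; lra.
have xp : 0 < `|X f| by rewrite lt_neqAle eq_sym x0/=.
set x := `|X f| in i1 i2 xp *; set D := x - it n f in i2 *.
have D0 : 0 <= D by rewrite subr_ge0.
have h1 : D * (n%:R * x / 2) <= x.
  by apply: le_trans i2; rewrite ler_wpM2l// lerDr.
have h2 : D * n%:R <= 2.
  by rewrite -(ler_pM2r xp); move: h1; set y := n%:R; lra.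
have h3 : D * (2 / e) <= 2 by apply: le_trans h2; rewrite ler_wpM2l.
move: h3; rewrite mulrA ler_pdivrMr//; lra.
Qed.

Lemma admissible_max Psi Psi' : admissible Psi -> admissible Psi' ->
  admissible (fun f => Num.max (Psi f) (Psi' f)).
Proof.
move=> H H'.
apply: (@eq_admissible (fun f => (Psi f + Psi' f + `|Psi f + -1 * Psi' f|) * 2^-1)) => [f|].
  by rewrite maxr_absE mulN1r.
apply: admissibleM; last exact: admissible_cst.
apply: admissibleD; first exact: admissibleD.
apply: admissible_abs; apply: admissibleD => //.
by apply: admissibleM => //; exact: admissible_cst.
Qed.

Definition netted (S : set func) (gs : seq vec) (del : R) := exists (q : nat) (fs : nat -> func),
  (forall i, (i < q)%N -> S (fs i)) /\
  forall f, S f -> exists2 i, (i < q)%N & forall g, g \in gs -> `|f g - fs i g| <= del.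

(** Cells are formed by the integer parts of the scaled values at the finitely many points; the
    centres are taken in [S] itself. *)
Lemma finite_net (gs : seq vec) (M del : R) (S : set func) : 0 < del ->
  (forall f g, S f -> g \in gs -> `|f g| <= M) -> netted S gs del.
Proof.
move=> del0; elim: gs S => [|g gs IH] S HM.
  have [[f0 Sf0]|none] := pselect (exists f, S f).
    by exists 1%N, (fun=> f0); split => // f _; exists 0%N.
  by exists 0%N, (fun _ _ => 0); split => // f Sf; exfalso; apply: none; exists f.
pose cell c : set func := [set f | S f /\ Num.floor ((f g + M) / del) = c%:Z].
have netc c : netted (cell c) (g :: gs) del.
  have [|q [fs [H1 H2]]] := IH (cell c).
    by move=> f x [Sf _] xg; apply: HM => //; rewrite inE xg orbT.
  exists q, fs; split => // f fc; have [i iq Hi] := H2 f fc; exists i => // x.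
  rewrite inE => /orP[/eqP->|xg]; last exact: Hi.
  have [_ c1] := fc; have [_ c2] := H1 i iq.
  have l1 := ge_floor ((f g + M) / del); have l2 := floorD1_gt ((f g + M) / del).
  have l3 := ge_floor ((fs i g + M) / del); have l4 := floorD1_gt ((fs i g + M) / del).
  rewrite c1 in l1 l2; rewrite c2 in l3 l4.
  rewrite ler_pdivlMr// in l1; rewrite ltr_pdivrMr// in l2.
  rewrite ler_pdivlMr// in l3; rewrite ltr_pdivrMr// in l4.
  rewrite intrD !mulrDl in l2 l4.
  rewrite ler_norml; apply/andP; split; lra.
pose U C : set func := [set f | S f /\ exists2 c, (c < C)%N & cell c f].
have netU C : netted (U C) (g :: gs) del.
  elim: C => [|C [q [fs [H1 H2]]]].
    by exists 0%N, (fun _ _ => 0); split => // f [_ [c]].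
  have [q' [fs' [H1' H2']]] := netc C.
  exists (q + q')%N, (fun i => if (i < q)%N then fs i else fs' (i - q)%N); split=> [i iq|f [Sf [c cC fc]]].
    case: ltnP => iq'.
      by have [? [c ? ?]] := H1 i iq'; split => //; exists c => //; exact: ltnW.
    have lt : (i - q < q')%N by rewrite ltn_subLR.
    by have HH := H1' _ lt; split; [case: HH|exists C].
  move: cC; rewrite ltnS leq_eqVlt => /orP[/eqP cC|cC].
    rewrite cC in fc; have [i iq Hi] := H2' f fc; exists (q + i)%N; first by rewrite ltn_add2l.
    by move=> x xg; rewrite ltnNge leq_addr/= addKn; exact: Hi.
  have [|i iq Hi] := H2 f; first by split => //; exists c.
  by exists i => [|x xg]; [exact: ltn_addr|rewrite iq; exact: Hi].
have [q [fs [H1 H2]]] := netU (Num.bound (`|2 * M| / del + 1)).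
exists q, fs; split=> [i iq|f Sf]; first by have [] := H1 i iq.
apply: H2; split => //.
have fM := HM f g Sf (mem_head _ _).
have f0 : 0 <= (f g + M) / del.
  by rewrite divr_ge0 ?(ltW del0)//; move: fM; rewrite ler_norml; lra.
have fl0 : (0 <= Num.floor ((f g + M) / del))%R by rewrite floor_ge0.
exists `|Num.floor ((f g + M) / del)|%N; last by split => //=; rewrite gez0_abs.
have : (`|Num.floor ((f g + M) / del)|%N)%:R < (Num.bound (`|2 * M| / del + 1))%:R :> R.
  apply: (@le_lt_trans _ _ (`|2 * M| / del + 1)); last by apply: archi_boundP; rewrite addr_ge0// divr_ge0// ltW.
  rewrite pmulrn gez0_abs//; apply: le_trans (ge_floor _) _.
  apply: (@le_trans _ _ (`|2 * M| / del)); last by rewrite lerDl.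
  rewrite ler_wpM2r ?invr_ge0 ?(ltW del0)//; apply: le_trans (ler_norm _).
  by move: fM; rewrite ler_norml; lra.
by rewrite ltr_nat.
Qed.

(** Values are compared through the sine of a small multiple, because admissible functionals are
    bounded. *)
Definition sindist (sig : R) (gs : seq vec) f f' := \sum_(g <- gs) `|sin (sig * f g) - sin (sig * f' g)|.

Lemma admissible_sindist sig gs f' : admissible (fun f => sindist sig gs f f').
Proof.
apply: admissible_sum => g; apply: admissible_abs.
apply: admissibleD; last exact: admissible_cst.
apply: eq_admissible (admissible_wave [:: (sig, g)] (- (pi / 2))) => f.
by rewrite /wave big_seq1/= cosBpihalf.
Qed.

(** A continuous cut-off: 1 within [del] of the net and 0 beyond [2 del], in the distance
    [sindist]. *)
Fixpoint netest (sig del : R) (gs : seq vec) (fs : nat -> func) (q : nat) f : R :=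
  if q is q'.+1 then Num.max (netest sig del gs fs q' f)
    (1 - Num.max 0 (del^-1 * sindist sig gs f (fs q') - 1)) else 0.

Lemma netest_admissible sig del gs fs q : admissible (netest sig del gs fs q).
Proof.
elim: q => [|q IH] /=; first exact: admissible_cst.
apply: admissible_max => //; apply: (@eq_admissible (fun f => 1 + -1 * Num.max 0
  (del^-1 * sindist sig gs f (fs q) + -1))) => [f|]; first by rewrite mulN1r.
apply: admissibleD; first exact: admissible_cst.
apply: admissibleM; first exact: admissible_cst.
apply: admissible_max; first exact: admissible_cst.
apply: admissibleD; last exact: admissible_cst.
by apply: admissibleM; [exact: admissible_cst|exact: admissible_sindist].
Qed.

Lemma netest01 sig del gs fs q f : 0 <= netest sig del gs fs q f <= 1.
Proof.
elim: q => [|q /andP[H1 H2]] /=; first by rewrite lexx ler01.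
by rewrite le_max H1/= ge_max H2/= gerBl le_max lexx.
Qed.

Lemma netest_eq1 sig del gs fs q f i : 0 < del -> (i < q)%N -> sindist sig gs f (fs i) <= del ->
  netest sig del gs fs q f = 1.
Proof.
move=> del0; elim: q => // q IH; rewrite ltnS leq_eqVlt => /orP[/eqP iq|iq] H.
  apply/eqP; rewrite eq_le; have /andP[_ ->] := netest01 sig del gs fs q.+1 f.
  rewrite /= le_max; apply/orP; right; rewrite (_ : Num.max 0 _ = 0) ?subr0//.
  by apply/max_idPl; rewrite subr_le0 ler_pdivrMl// mulr1 -iq.
apply/eqP; rewrite eq_le; have /andP[_ ->] := netest01 sig del gs fs q.+1 f.
by rewrite /= le_max IH// lexx.
Qed.

Lemma netest_gt0 sig del gs fs q f : 0 < del -> 0 < netest sig del gs fs q f ->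
  exists2 i, (i < q)%N & sindist sig gs f (fs i) <= 2 * del.
Proof.
move=> del0; elim: q => [|q IH] /=; first by rewrite ltxx.
rewrite lt_max => /orP[/IH[i iq Hi]|]; first by exists i => //; exact: ltnW.
rewrite subr_gt0 gt_max => /andP[_]; rewrite ltrBlDr ltr_pdivrMl// => H.
by exists q => //; lra.
Qed.

Lemma sin_lip (x y : R) : `|sin x - sin y| <= `|x - y|.
Proof. by have := cos_lip (x - pi / 2) (y - pi / 2); rewrite !cosBpihalf opprD opprK addrACA addNr addr0. Qed.

(** Near 0 the slope of the sine is bounded below; this recovers differences of values from
    differences of sines. *)
Lemma sin_expand (x y : R) : `|x| <= 1 / 2 -> `|y| <= 1 / 2 -> `|x - y| <= 2 * `|sin x - sin y|.
Proof.
move=> x1 y1; pose a := (x + y) / 2; pose b := (x - y) / 2.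
have E : sin x - sin y = 2 * (cos a * sin b).
  have -> : x = a + b by rewrite /a /b; field.
  have -> : y = a - b by rewrite /a /b; field.
  by rewrite sinD sinB; ring.
have a1 : `|a| <= 1 / 2.
  have := ler_normD x y; rewrite /a normrM normfV (ger0_norm (x := 2))//; lra.
have b1 : `|b| <= 1 / 2.
  have := ler_normB x y; rewrite /b normrM normfV (ger0_norm (x := 2))//; lra.
have sq z : `|z| <= 1 / 2 -> `|z| ^+ 2 <= 1 / 2 * `|z|.
  by move=> z1; rewrite expr2 ler_wpM2r.
have ca : 3 / 4 <= cos a.
  have := cos_taylor2 a; rewrite -(real_normK (num_real a)) ler_norml => /andP[h1 _].
  have : `|a| ^+ 2 <= (1 / 2) ^+ 2 by apply: lerXn2r; rewrite ?nnegrE.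
  lra.
have sb : 3 / 4 * `|b| <= `|sin b|.
  have h1 := sin_taylor3 b.
  have h2 : `|b| <= `|sin b| + `|sin b - b|.
    by rewrite -{1}[b](subKr (sin b)); apply: ler_normB.
  have h3 : `|b| ^+ 3 <= 1 / 4 * `|b|.
    rewrite exprSr ler_wpM2r//.
    have : `|b| ^+ 2 <= (1 / 2) ^+ 2 by apply: lerXn2r; rewrite ?nnegrE.
    lra.
  lra.
rewrite E !normrM (ger0_norm (x := 2))// (ger0_norm (x := cos a)); last lra.
have -> : `|x - y| = 2 * `|b| by rewrite /b normrM normfV (ger0_norm (x := 2))//; field.
have : 3 / 4 * (3 / 4 * `|b|) <= cos a * `|sin b| by apply: ler_pM => //; rewrite mulr_ge0.
by have := normr_ge0 b; lra.
Qed.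

(** An admissible Urysohn function for [S], built on a finite net of [S] as seen on the grid. *)
Lemma class_test (S : set func) (gs : seq vec) (M sig del : R) : 0 < sig -> 0 < del ->
  (forall f g, S f -> g \in gs -> `|f g| <= M) ->
  exists Psi, [/\ admissible Psi, forall f, 0 <= Psi f <= 1, forall f, S f -> Psi f = 1 &
    forall f, 0 < Psi f -> exists2 f', S f' &
      forall g, g \in gs -> `|sin (sig * f g) - sin (sig * f' g)| <= 2 * del].
Proof.
move=> sig0 del0 HM.
(* With this spacing of the net, the sine differences over all of [gs] add up to at most [del]. *)
have d0 : 0 < del / (sig * ((size gs)%:R + 1)).
  by rewrite divr_gt0// mulr_gt0// ltr_wpDl.
have [q [fs [H1 H2]]] := finite_net d0 HM.
exists (netest sig del gs fs q); split.
- exact: netest_admissible.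
- exact: netest01.
- move=> f Sf; have [i iq Hi] := H2 f Sf; apply: (netest_eq1 del0 iq).
  have : sindist sig gs f (fs i) <= \sum_(g <- gs) (del / ((size gs)%:R + 1)).
    rewrite /sindist big_seq [leRHS]big_seq; apply: ler_sum => g gg.
    apply: le_trans (sin_lip _ _) _; rewrite -mulrBr normrM gtr0_norm//.
    apply: le_trans (ler_wpM2l (ltW sig0) (Hi g gg)) _.
    by rewrite invfM mulrCA [sig * (_ * _)]mulrA divff ?gt_eqF// mul1r.
  move/le_trans; apply; rewrite big_const_seq count_predT iter_addr addr0.
  rewrite -[_ *+ size gs]mulr_natr -mulrA ler_piMr ?(ltW del0)// mulrC ler_pdivrMr ?ltr_wpDl//.
  by rewrite mul1r lerDl.
- move=> f /(netest_gt0 del0)[i iq Hi]; exists (fs i); first exact: H1.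
  move=> g gg; apply: le_trans Hi; rewrite /sindist (big_rem g)//=.
  by rewrite lerDl sumr_ge0.
Qed.

Lemma cube_grid (W e : R) : 0 <= W -> 0 < e -> exists gs : seq vec,
  (forall g, g \in gs -> `|g| <= W) /\ forall y, `|y| <= W -> exists2 g, g \in gs & `|y - g| <= e.
Proof.
move=> W0 e0.
(* Clipping moves grid points into the cube without increasing their distance to points of the
   cube. *)
pose clip (x : vec) : vec := \row_i Num.max (- W) (Num.min W (x ord0 i)).
have clipW x : `|clip x| <= W.
  apply: norm_le_coord => // i; rewrite mxE ler_norml le_max lexx/= ge_max.
  by rewrite ge_min lexx/= andbT; lra.
have clipy x y : `|y| <= W -> `|y - clip x| <= `|y - x|.
  move=> yW; apply: norm_le_coord => // i; apply: le_trans (coord_le_norm (y - x) i).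
  have := le_trans (coord_le_norm y i) yW; rewrite !mxE; set a := y ord0 i; set b := x ord0 i.
  rewrite ler_norml => /andP[a1 a2]; have [bW|bW] := lerP W b.
    have -> : Num.max (- W) W = W by apply/max_idPr; lra.
    by rewrite !ler0_norm; lra.
  have [bW'|bW'] := lerP (- W) b; first by [].
  by rewrite !ger0_norm; lra.
pose K := (Num.bound (W / e)).+1.
have [fb _] := finite_box R m K.
exists [seq clip (e *: emb R z) | z <- fset_set [set z : 'rV[int]_m | forall i, `|z ord0 i| <= K%:Z]].
split=> [g /mapP[z _ ->]|y yW]; first exact: clipW.
exists (clip (e *: emb R (round e y))); last first.
  by apply: le_trans (clipy _ _ yW) _; exact: round_norm.
apply: map_f; rewrite in_fset_set// inE/= => i; rewrite mxE.
have yi := le_trans (coord_le_norm y i) yW.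
have WK : W / e <= K%:R - 1.
  by rewrite /K -natr1 addrK; apply: ltW; apply: archi_boundP; rewrite divr_ge0// ltW.
have a1 : `|y ord0 i / e| <= K%:R - 1.
  by apply: le_trans WK; rewrite normrM normfV (gtr0_norm e0) ler_wpM2r// invr_ge0 ltW.
have l1 := ge_floor (y ord0 i / e); have l2 := floorD1_gt (y ord0 i / e).
rewrite intrD in l2; rewrite -(ler_int R) intr_norm; move: a1; rewrite !ler_norml => /andP[a1 a2].
by apply/andP; split; rewrite -?pmulrn; lra.
Qed.

End Waves.

(** * Frequencies of sample windows against probabilities for the field *)

Section Transfer.
Variables (R : realType) (m : nat) (h : R) (rr : nat -> 'rV[R]_m) (al : nat -> R).
Variables (phi : nat -> nat) (G : 'rV[R]_m -> R).
Hypothesis h0 : 0 < h.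
Local Notation vec := 'rV[R]_m.
Local Notation func := (vec -> R).
Local Notation cnt rho := (latcount R (lball h (0 : vec) rho)).
Hypothesis nonres : forall n q, (exists2 l, (l < n)%N & q l != 0) ->
  exists i, forall k : int, h * freq rr n q ord0 i != k%:~R.
Hypothesis phi0 : (0 < phi 0%N)%N.
Hypothesis phiS : forall k, (phi k < phi k.+1)%N.
Hypothesis covG : forall z,
  (fun k => (phi k)%:R^-1 * \sum_(l < phi k) cos (2 * pi * dotv (rr l) z)) @ \oo --> (G z : R).
Variables (d : measure_display) (Omega : measurableType d) (P : probability Omega R).
Variable F : Omega -> func.
Hypothesis gau : forall (k : nat) (xs : 'I_k -> vec) (cs : 'I_k -> R),
  centered_gaussian P (fun w => \sum_(i < k) cs i * F w (xs i))
    (\sum_(i < k) \sum_(j < k) cs i * cs j * G (xs i - xs j)).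

Definition expect (Psi : func -> R) : R := fine (\int[P]_w (Psi (F w))%:E)%E.

Definition at_point k (x : vec) : func := fun y => field rr al phi k (x + y).

Definition hits (S : set func) k rho := sumball h rho (fun x => \1_S (at_point k x)).

Lemma bounded_integrable (f : Omega -> R) B : measurable_fun setT f -> (forall w, `|f w| <= B) ->
  P.-integrable setT (EFin \o f).
Proof.
move=> mf fB; apply: (@le_integrable _ _ _ P setT _ _ (cst B%:E)) => //.
- exact/measurable_EFinP.
- by move=> x _ /=; rewrite lee_fin; apply: le_trans (fB x) (ler_norm _).
- by apply/integrableP; split => //; rewrite integral_cst//= probability_setT mule1 ltry.
Qed.

Lemma wave_as_sum s (th : R) (f : func) :
  wave s th f = cos (\sum_(i < size s) (tnth (in_tuple s) i).1 * f (tnth (in_tuple s) i).2 + th).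
Proof. by rewrite /wave big_tnth. Qed.

Lemma measurable_wave s th : measurable_fun setT (fun w => wave s th (F w)).
Proof.
have [mX _] := gau (fun i => (tnth (in_tuple s) i).2) (fun i => (tnth (in_tuple s) i).1).
have -> : (fun w => wave s th (F w)) = (fun w => cos (\sum_(i < size s)
    (tnth (in_tuple s) i).1 * F w (tnth (in_tuple s) i).2 + th)).
  by apply/funext => w; exact: wave_as_sum.
apply: measurableT_comp.
  exact: continuous_measurable_fun (@continuous_cos R).
exact: measurable_funD.
Qed.

Lemma measurable_waves q : measurable_fun setT (fun w => waves q (F w)).
Proof.
apply: measurable_sum => a; apply: measurable_funM => //; exact: measurable_wave.
Qed.

Lemma measurable_admissible Psi : admissible Psi -> measurable_fun setT (fun w => Psi (F w)).
Proof.
move=> H.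
have e0 n : 0 < (n.+1%:R^-1 : R) by rewrite invr_gt0.
have /choice[q Hq] : forall n : nat, exists q, forall f, `|Psi f - waves q f| <= n.+1%:R^-1.
  by move=> n; exact: H.
apply: (measurable_fun_cvg (h := fun n w => waves (q n) (F w))).
  by move=> n; exact: measurable_waves.
move=> w _; apply/cvgrPdist_le => e ep; near=> n; apply: le_trans (Hq _ _) _.
by apply: ltW; near: n; exact: (near_infty_natSinv_lt (PosNum ep)).
Unshelve. all: by end_near. Qed.

Lemma admissible_integrable Psi : admissible Psi -> P.-integrable setT (EFin \o (fun w => Psi (F w))).
Proof.
move=> H; have [B _ HB] := admissible_bounded H.
exact: bounded_integrable (measurable_admissible H) (fun w => HB (F w)).
Qed.

Lemma expectD Psi Psi' : admissible Psi -> admissible Psi' ->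
  expect (fun f => Psi f + Psi' f) = expect Psi + expect Psi'.
Proof.
move=> H H'; have I := admissible_integrable H; have I' := admissible_integrable H'.
rewrite /expect -fineD ?integrable_fin_num// -integralD//.
Qed.

Lemma expectZ c Psi : admissible Psi -> expect (fun f => c * Psi f) = c * expect Psi.
Proof.
move=> H; have I := admissible_integrable H.
by rewrite /expect -[c in RHS]/(fine c%:E) -fineM ?integrable_fin_num// -integralZl.
Qed.

Lemma expect_le Psi Psi' : admissible Psi -> admissible Psi' ->
  (forall f, Psi f <= Psi' f) -> expect Psi <= expect Psi'.
Proof.
move=> H H' HH; have I := admissible_integrable H; have I' := admissible_integrable H'.
by apply: fine_le; rewrite ?integrable_fin_num//; apply: le_integral => // w _; rewrite lee_fin.
Qed.

Lemma expect_cst c : expect (fun=> c) = c.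
Proof. by rewrite /expect integral_cst//= probability_setT mule1. Qed.

Lemma expect_close Psi Psi' e : admissible Psi -> admissible Psi' ->
  (forall f, `|Psi f - Psi' f| <= e) -> `|expect Psi - expect Psi'| <= e.
Proof.
move=> H H' HH; rewrite ler_distl; apply/andP; split.
  rewrite lerBlDr -[e]expect_cst -expectD//; last exact: admissible_cst.
  apply: expect_le => // [|f]; first by apply: admissibleD => //; exact: admissible_cst.
  by have := HH f; rewrite ler_distl; lra.
rewrite -[e]expect_cst -expectD//; last exact: admissible_cst.
apply: expect_le => // [|f]; first by apply: admissibleD => //; exact: admissible_cst.
by have := HH f; rewrite ler_distl; lra.
Qed.

Definition transfers Psi := forall e, 0 < e -> evn (fun k rho =>
  `|sumball h rho (fun x => Psi (at_point k x)) - expect Psi * cnt rho| <= e * cnt rho).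

(** The sample average, by [clt], and the expectation, by [centered_gaussian_cos], are given by the
    same Gaussian expression. *)
Lemma transfers_wave s th : transfers (wave s th).
Proof.
move=> e e0.
have := clt al h0 nonres phi0 phiS covG (fun i => (tnth (in_tuple s) i).2)
  (fun i => (tnth (in_tuple s) i).1) th e0.
set Q := \sum_(i < _) _ => H.
have -> : expect (wave s th) = cos th * expR (- (Q / 2)).
  rewrite /expect -[RHS]/(fine (cos th * expR (- (Q / 2)))%:E); congr fine.
  rewrite -(centered_gaussian_cos th (gau _ _)).
  by apply: eq_integral => w _; rewrite wave_as_sum.
apply: evnS H => k rho; set A := sumball _ _ _; set B := sumball _ _ _.
suff -> : A = B by [].
by apply: eq_latsum => z; rewrite wave_as_sum.
Qed.

Lemma transfersD Psi Psi' : admissible Psi -> admissible Psi' -> transfers Psi -> transfers Psi' ->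
  transfers (fun f => Psi f + Psi' f).
Proof.
move=> A A' H H' e e0; have e2 : 0 < e / 2 by rewrite divr_gt0.
apply: evnS (evnI (H _ e2) (H' _ e2)) => k rho [H1 H2]; rewrite expectD// sumballD.
set a := sumball _ _ _ in H1 *; set b := sumball _ _ _ in H2 *.
have -> : a + b - (expect Psi + expect Psi') * cnt rho =
  (a - expect Psi * cnt rho) + (b - expect Psi' * cnt rho) by ring.
by apply: le_trans (ler_normD _ _) _; lra.
Qed.

Lemma transfersZ c Psi : admissible Psi -> transfers Psi -> transfers (fun f => c * Psi f).
Proof.
move=> A H e e0; have e2 : 0 < e / (`|c| + 1) by rewrite divr_gt0// ltr_wpDl.
apply: evnS (H _ e2) => k rho H1; rewrite expectZ// sumballZ.
set a := sumball _ _ _ in H1 *.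
have -> : c * a - c * expect Psi * cnt rho = c * (a - expect Psi * cnt rho) by ring.
rewrite normrM; apply: le_trans (ler_wpM2l (normr_ge0 c) H1) _.
rewrite mulrA ler_wpM2r ?cnt_ge0// mulrA ler_pdivrMr ?ltr_wpDl// mulrC ler_wpM2l ?(ltW e0)//.
by rewrite lerDl.
Qed.

Lemma admissible_waves q : admissible (@waves R m q).
Proof.
apply: admissible_sum => a; apply: admissibleM; first exact: admissible_cst.
exact: admissible_wave.
Qed.

Lemma transfers_waves q : transfers (@waves R m q).
Proof.
elim: q => [|a q IH].
  move=> e e0; near=> k; near=> rho.
  have -> : @waves R m [::] = fun=> 0 by apply/funext => f; rewrite /waves big_nil.
  by rewrite expect_cst sumball_cst subrr normr0 mulr_ge0 ?cnt_ge0// ltW.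
have -> : waves (a :: q) = (fun f => a.1.1 * wave a.1.2 a.2 f + waves q f).
  by apply/funext => f; rewrite waves_cons.
apply: transfersD => //.
- by apply: admissibleM; [exact: admissible_cst|exact: admissible_wave].
- exact: admissible_waves.
- by apply: transfersZ; [exact: admissible_wave|exact: transfers_wave].
Unshelve. all: by end_near. Qed.

Lemma transfers_admissible Psi : admissible Psi -> transfers Psi.
Proof.
move=> A e e0; have e3 : 0 < e / 3 by rewrite divr_gt0.
have [q Hq] := A _ e3; have AW := admissible_waves q.
have E := expect_close A AW Hq.
apply: evnS (transfers_waves q e3) => k rho H1; have c0 := cnt_ge0 m h rho.
have : `|sumball h rho (fun x => Psi (at_point k x) - waves q (at_point k x))| <= e / 3 * cnt rho.
  by apply: sumball_bound => // x; exact: Hq.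
rewrite sumballB; set a := sumball _ _ _; set b := sumball _ _ _ in H1 * => H2.
have -> : a - expect Psi * cnt rho = (a - b) + (b - expect (waves q) * cnt rho) -
  (expect Psi - expect (waves q)) * cnt rho by ring.
apply: le_trans (ler_normB _ _) _; rewrite normrM (ger0_norm c0).
have E' := ler_wpM2r c0 E.
by have := ler_normD (a - b) (b - expect (waves q) * cnt rho); lra.
Qed.

Lemma expect_positivity Psi : admissible Psi -> (forall f, 0 <= Psi f <= 1) ->
  measurable [set w : Omega | 0 < Psi (F w)] /\ ((expect Psi)%:E <= P [set w : Omega | (0 < Psi (F w))%R])%E.
Proof.
move=> A H; have mP := measurable_admissible A.
have mA : measurable [set w : Omega | 0 < Psi (F w)].
  have := mP measurableT `]0, +oo[%classic (measurable_itv _); rewrite setTI.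
  by congr measurable; apply/seteqP; split => w /=; rewrite in_itv/= andbT.
split => //; rewrite /expect fineK; last by apply: integrable_fin_num => //; exact: admissible_integrable.
rewrite -[leRHS]mul1e -integral_cst//= [leRHS]integral_mkcond/=.
apply: ge0_le_integral => //=.
- by move=> w _; rewrite lee_fin; case/andP: (H (F w)).
- exact/measurable_EFinP.
- by apply/(measurable_restrictT _ mA).
- move=> w _; rewrite patchE; case: ifPn => [_|]; first by rewrite lee_fin; case/andP: (H (F w)).
  by rewrite notin_setE/= => /negP; rewrite -leNgt lee_fin.
Qed.

Lemma expect_ge Psi (A : set Omega) : admissible Psi -> (forall f, 0 <= Psi f <= 1) ->
  measurable A -> (forall w, A w -> Psi (F w) = 1) -> (P A <= (expect Psi)%:E)%E.
Proof.
move=> AP H mA HA; have mP := measurable_admissible AP.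
rewrite /expect fineK; last by apply: integrable_fin_num => //; exact: admissible_integrable.
rewrite -[leLHS]mul1e -integral_cst//= [leLHS]integral_mkcond/=.
apply: ge0_le_integral => //=.
- by move=> w _; rewrite patchE; case: ifPn.
- by apply/(measurable_restrictT _ mA).
- exact/measurable_EFinP.
- move=> w _; rewrite patchE; case: ifPn => [|_]; last by rewrite lee_fin; case/andP: (H (F w)).
  by rewrite inE => /HA ->.
Qed.

Lemma sumball_indic_le (S : set func) (Psi : func -> R) k rho : (forall f, S f -> Psi f = 1) -> (forall f, 0 <= Psi f <= 1) ->
  hits S k rho <= sumball h rho (fun x => Psi (at_point k x)).
Proof.
move=> H1 H2; apply: sumball_le => // x; rewrite indicE.
have [/set_mem/H1 ->//|_] := boolP (_ \in S).
by have /andP[] := H2 (at_point k x).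
Qed.

Lemma bounded_on_cube (f : func) W : continuous f -> exists T, forall y, `|y| <= W -> `|f y| <= T.
Proof.
move=> cf.
have cpt : compact [set y : vec | `|y| <= W].
  apply: bounded_closed_compact.
    by exists W; split; [exact: num_real|move=> M WM y /= /le_trans; apply; exact: ltW].
  have -> : [set y : vec | `|y| <= W] = closed_ball_ (@Num.norm _ _) (0 : vec) W.
    by apply/seteqP; split => y; rewrite /closed_ball_/= sub0r normrN.
  exact: closed_closed_ball_.
have [T [_ HT]] := compact_bounded (continuous_compact (continuous_subspaceT cf) cpt).
exists (T + 1) => y yW; apply: (HT (T + 1)); first by rewrite ltrDl.
by exists y.
Qed.

(** Closeness to [S] involves uncountably many values and need not be an event. The tests [Psi n] on
    finer and finer grids give events; on their limit superior a continuous path is a limit of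
    functions of [S] and inherits their regularity, and continuity of the measure from above bounds
    the frequency by the probability. *)
Lemma transfer_up (S : set func) W M eta : 0 <= W -> 0 < M -> 0 < eta ->
  (forall f, S f -> regular_on W M f) ->
  exists A : set Omega, [/\ measurable A,
    forall w, A w -> continuous (F w) -> regular_on W M (F w) /\
      exists2 f, S f & forall y, `|y| <= W -> `|F w y - f y| <= eta &
    forall e, 0 < e -> evn (fun k rho => hits S k rho <= (fine (P A) + e) * cnt rho)].
Proof.
move=> W0 M0 eta0 Sreg.
pose ep (n : nat) : R := n.+1%:R^-1.
have ep0 n : 0 < ep n by rewrite invr_gt0.
have /choice[gs Hgs] : forall n, exists gs : seq vec, (forall g, g \in gs -> `|g| <= W) /\
   forall y, `|y| <= W -> exists2 g, g \in gs & `|y - g| <= ep n.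
  by move=> n; exact: cube_grid.
(* The sine scale [ep n] tends to 0, so that the values of any given continuous path are eventually
   in the range of [sin_expand]. A sine tolerance [2 ep^2] means an error [4 ep] in the values. *)
have /choice[Psi HPsi] : forall n, exists Psi, [/\ admissible Psi, forall f, 0 <= Psi f <= 1,
    forall f, S f -> Psi f = 1 & forall f, 0 < Psi f -> exists2 f', S f' &
    forall g, g \in gs n -> `|sin (ep n * f g) - sin (ep n * f' g)| <= 2 * (ep n * ep n)].
  move=> n; apply: (@class_test _ _ S (gs n) M) => //; first by rewrite mulr_gt0.
  by move=> f g Sf /(Hgs n).1; have [+ _ _] := Sreg f Sf; apply.
pose A n := [set w | 0 < Psi n (F w)].
have mA n : measurable (A n) by have [a b _ _] := HPsi n; have [] := expect_positivity a b.
have PA n : ((expect (Psi n))%:E <= P (A n))%E.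
  by have [a b _ _] := HPsi n; have [] := expect_positivity a b.
have mU n : measurable (\bigcup_(k >= n) A k) by exact: bigcup_measurable.
have mL : measurable (lim_sup_set A) by exact: bigcap_measurable.
exists (lim_sup_set A); split => // [w Aw cF|e e0].
  have [T HT] := bounded_on_cube W cF.
  have close n0 : exists n, [/\ (n0 <= n)%N & exists2 f, S f &
      forall g, g \in gs n -> `|F w g - f g| <= 4 * ep n].
    have [K HK] : exists K : nat, `|T| + M <= K%:R / 2.
      exists (Num.bound (2 * (`|T| + M))).
      rewrite ler_pdivlMr// mulrC; apply: ltW; apply: archi_boundP.
      by rewrite mulr_ge0// addr_ge0// ltW.
    have [n /= nK An] := Aw (maxn n0 K) I.
    exists n; split; first exact: leq_trans (leq_maxl _ _) nK.
    have [_ _ _ /(_ _ An)[f Sf Hf]] := HPsi n; exists f => // g gg.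
    have gW := (Hgs n).1 g gg.
    have small a : `|a| <= `|T| + M -> `|ep n * a| <= 1 / 2.
      move=> aTM; rewrite normrM gtr0_norm// ler_pdivrMl//; apply: le_trans aTM _.
      apply: le_trans HK _; rewrite mul1r ler_wpM2r ?invr_ge0// ler_nat.
      by apply: ltnW; rewrite ltnS; apply: leq_trans (leq_maxr _ _) nK.
    have s1 : `|ep n * F w g| <= 1 / 2.
      apply: small; apply: le_trans (HT g gW) _; apply: le_trans (ler_norm _) _; rewrite lerDl ltW//.
    have s2 : `|ep n * f g| <= 1 / 2.
      apply: small; have [+ _ _] := Sreg f Sf => /(_ g gW) /le_trans; apply; rewrite lerDr//.
    have := sin_expand s1 s2; rewrite -mulrBr normrM gtr0_norm// => H.
    rewrite -(ler_pM2l (ep0 n)); apply: le_trans H _.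
    apply: le_trans (ler_wpM2l _ (Hf g gg)) _ => //; set x := ep n; lra.
  have epe e : 0 < e -> exists n0, forall n, (n0 <= n)%N -> ep n <= e.
    move=> e0; have [N _ HN] := near_infty_natSinv_lt (PosNum e0).
    by exists N => n nN; apply: ltW; exact: HN.
  have approx (y : vec) e : `|y| <= W -> 0 < e -> exists n0, forall n, (n0 <= n)%N -> forall g, g \in gs n ->
      `|y - g| <= ep n -> `|F w y - F w g| <= e.
    move=> yW e0; have /cvgrPdist_le /(_ e e0) := cF y.
    move=> /nbhs_ballP[r /= r0 Hr].
    have [n0 Hn0] := epe (r / 2) (divr_gt0 r0 (ltr0Sn _ _)).
    exists n0 => n nn0 g _ yg; apply: Hr.
    rewrite -ball_normE/=; apply: le_lt_trans yg _; apply: le_lt_trans (Hn0 n nn0) _; lra.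
  have common (ys : seq vec) e : (forall y, y \in ys -> `|y| <= W) -> 0 < e -> exists f,
     S f /\ forall y, y \in ys -> `|F w y - f y| <= e.
    move=> ysW e0.
    have e4 : 0 < e / 4 by rewrite divr_gt0.
    have [n1 Hn1] : exists n1, forall n, (n1 <= n)%N -> forall y, y \in ys -> forall g, g \in gs n ->
        `|y - g| <= ep n -> `|F w y - F w g| <= e / 4.
      elim: ys ysW => [|y ys IH] ysW; first by exists 0%N.
      have [|n1 H1] := IH; first by move=> z zy; apply: ysW; rewrite inE zy orbT.
      have [n2 H2] := approx y (e / 4) (ysW y (mem_head _ _)) e4.
      exists (maxn n1 n2) => n; rewrite geq_max => /andP[nn1 nn2] z.
      by rewrite inE => /orP[/eqP ->|zy]; [exact: H2|exact: H1].
    have e2 : 0 < e / 4 / (4 + M) by rewrite !divr_gt0// addr_gt0.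
    have [n2 Hn2] := epe _ e2.
    have [n [nn [f Sf Hf]]] := close (maxn n1 n2).
    move: nn; rewrite geq_max => /andP[nn1 nn2].
    exists f; split => // y yy; have yW := ysW y yy.
    have [g gg yg] := (Hgs n).2 y yW.
    have b1 := Hn1 n nn1 y yy g gg yg; have b2 := Hf g gg.
    have [_ Lf _] := Sreg f Sf; have b3 := Lf g y ((Hgs n).1 g gg) yW.
    have b4 : M * `|g - y| <= M * ep n by rewrite distrC ler_wpM2l// ltW.
    have b5 : (4 + M) * ep n <= e / 4.
      by have := Hn2 n nn2; rewrite ler_pdivlMr ?addr_gt0// mulrC.
    have -> : F w y - f y = (F w y - F w g) + (F w g - f g) + (f g - f y) by ring.
    apply: le_trans (ler_normD _ _) _; have := ler_normD (F w y - F w g) (F w g - f g).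
    have := ep0 n; lra.
  (* Bounds that hold on [S] and involve finitely many values pass to the path. *)
  have limit_le (ys : seq vec) (X : func -> R) c B : 0 <= B -> (forall y, y \in ys -> `|y| <= W) ->
      (forall f f' e, (forall y, y \in ys -> `|f y - f' y| <= e) -> `|X f - X f'| <= B * e) ->
      (forall f, S f -> `|X f| <= c) -> `|X (F w)| <= c.
    move=> B0 ysW HX HS; apply/ler_addgt0Pr => e e0.
    have eB : 0 < e / (B + 1) by rewrite divr_gt0// ltr_wpDl.
    have [f [Sf Hf]] := common ys _ ysW eB.
    rewrite -(subrK (X f) (X (F w))) addrC; apply: le_trans (ler_normD _ _) _; apply: lerD; first exact: HS.
    apply: le_trans (HX _ _ _ Hf) _; rewrite mulrCA -[leRHS]mulr1 ler_wpM2l ?(ltW e0)//.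
    by rewrite ler_pdivrMr ?ltr_wpDl// mul1r lerDl.
  have FR : regular_on W M (F w).
    split=> [y yW|y z yW zW|y v yW1 yW2].
    - apply: (limit_le [:: y] (fun f => f y) _ 1) => // [x|f f' e Hf|f /Sreg[+ _ _]]; last exact.
        by rewrite inE => /eqP ->.
      by rewrite mul1r; apply: Hf; rewrite inE.
    - apply: (limit_le [:: y; z] (fun f => f y - f z) _ 2) => // [x|f f' e Hf|f /Sreg[_ + _]]; last exact.
        by rewrite !inE => /orP[] /eqP ->.
      have -> : f y - f z - (f' y - f' z) = (f y - f' y) - (f z - f' z) by ring.
      apply: le_trans (ler_normB _ _) _.
      by have := Hf y; have := Hf z; rewrite !inE !eqxx orbT => /(_ isT) ? /(_ isT) ?; lra.
    - have yW : `|y| <= W.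
        have -> : y = 2^-1 *: ((y + v) + (y - v)).
          by rewrite addrACA subrr addr0 -[y + y]mulr2n -[y *+ 2]scaler_nat scalerA mulVf ?scale1r ?pnatr_eq0.
        rewrite normrZ ger0_norm ?invr_ge0//; have := ler_normD (y + v) (y - v); lra.
      apply: (limit_le [:: y + v; y - v; y] (fun f => f (y + v) + f (y - v) - 2 * f y) _ 4) => //
         [x|f f' e Hf|f /Sreg[_ _ +]]; last exact.
        by rewrite !inE => /or3P[] /eqP ->.
      have h1 := Hf (y + v); have h2 := Hf (y - v); have h3 := Hf y.
      rewrite !inE !eqxx ?orbT in h1 h2 h3.
      have {}h1 := h1 isT; have {}h2 := h2 isT; have {}h3 := h3 isT.
      have -> : f (y + v) + f (y - v) - 2 * f y - (f' (y + v) + f' (y - v) - 2 * f' y) =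
        (f (y + v) - f' (y + v)) + (f (y - v) - f' (y - v)) - 2 * (f y - f' y) by ring.
      apply: le_trans (ler_normB _ _) _; rewrite normrM (ger0_norm (x := 2))//.
      have := ler_normD (f (y + v) - f' (y + v)) (f (y - v) - f' (y - v)); lra.
  split => //.
  have e2 : 0 < eta / (4 + 2 * M) by rewrite divr_gt0// addr_gt0// mulr_gt0.
  have [n0 Hn0] := epe _ e2; have [n [nn [f Sf Hf]]] := close n0.
  exists f => // y yW; have [g gg yg] := (Hgs n).2 y yW.
  have [_ Lf _] := Sreg f Sf; have [_ LF _] := FR.
  have gW := (Hgs n).1 g gg.
  have b1 := LF y g yW gW; have b2 := Hf g gg; have b3 := Lf g y gW yW.
  have b4 : M * `|y - g| <= M * ep n by rewrite ler_wpM2l// ltW.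
  rewrite (distrC g y) in b3.
  have b5 : (4 + 2 * M) * ep n <= eta.
    by have := Hn0 n nn; rewrite ler_pdivlMr ?addr_gt0 ?mulr_gt0// mulrC.
  have -> : F w y - f y = (F w y - F w g) + (F w g - f g) + (f g - f y) by ring.
  apply: le_trans (ler_normD _ _) _; have := ler_normD (F w y - F w g) (F w g - f g).
  lra.
have e2 : 0 < e / 2 by rewrite divr_gt0.
have [n Hn] : exists n, (P (\bigcup_(k >= n) A k) <= P (lim_sup_set A) + (e / 2)%:E)%E.
  have cv : P (\bigcup_(k >= n) A k) @[n --> \oo] --> P (lim_sup_set A).
    by apply: lim_sup_set_cvg => //; rewrite ltey_eq fin_num_measure.
  have fL : P (lim_sup_set A) \is a fin_num by exact: fin_num_measure.
  move: cv; rewrite -(fineK fL) => /fine_cvgP[_ /cvgrPdist_le/(_ _ e2)[N _ HN]].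
  exists N; have := HN N (leqnn N) => /=; rewrite distrC => /(le_trans (ler_norm _)).
  by rewrite lerBlDr addrC -lee_fin EFinD fineK// fin_num_measure.
have [a b c _] := HPsi n.
apply: evnS (transfers_admissible a e2) => k rho H.
have c0 := cnt_ge0 m h rho.
have H1 := sumball_indic_le k rho c b.
have H2 : expect (Psi n) <= fine (P (lim_sup_set A)) + e / 2.
  rewrite -lee_fin EFinD [(fine (P _))%:E]fineK ?fin_num_measure//; apply: le_trans Hn.
  apply: le_trans (PA n) _; apply: le_measure; rewrite ?inE//.
  by apply: (bigcup_sup (i := n)) => /=.
have H3 := ler_wpM2r c0 H2.
move: H; rewrite ler_distl => /andP[_ H4].
lra.
Qed.

Lemma transfer_down (S : set func) (A : set Omega) W M eta e : 0 <= W -> 0 < M -> 0 < eta ->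
  (forall f, S f -> regular_on W M f) -> measurable A -> (forall w, A w -> S (F w)) -> 0 < e ->
  evn (fun k rho => (fine (P A) - e) * cnt rho <= hits [set f | ~ regular_on W M f \/
    exists2 f', S f' & forall y, `|y| <= W -> `|f y - f' y| <= eta] k rho).
Proof.
move=> W0 M0 eta0 Sreg mA HA e0.
have d0 : 0 < eta / (4 * M) by rewrite divr_gt0// mulr_gt0.
have [gs [gsW gsD]] := cube_grid m W0 d0.
(* Scales values bounded by [M] into the range of [sin_expand]. *)
pose sig := (2 * M)^-1; have sig0 : 0 < sig by rewrite invr_gt0 mulr_gt0.
have del0 : 0 < sig * eta / 8 by rewrite divr_gt0// mulr_gt0.
have [|Psi [a b c Hpos]] := class_test (S := S) (gs := gs) (M := M) sig0 del0.
  by move=> f g /Sreg[+ _ _] /gsW; apply.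
have E : fine (P A) <= expect Psi.
  rewrite -lee_fin fineK ?fin_num_measure//.
  by apply: expect_ge => // w /HA; exact: c.
apply: evnS (transfers_admissible a e0) => k rho; rewrite ler_distl => /andP[H _].
have c0 := cnt_ge0 m h rho; have E' := ler_wpM2r c0 E.
apply: (@le_trans _ _ (sumball h rho (fun x => Psi (at_point k x)))); first lra.
apply: sumball_le => // x; rewrite indicE.
have /andP[p0 p1] := b (at_point k x).
have [_|] := boolP (_ \in _); first exact: p1.
rewrite notin_setE/= => /not_orP[/contrapT [R1 R2 R3] nclose].
rewrite leNgt; apply/negP => /Hpos[f' Sf' Hf']; apply: nclose; exists f' => // y yW.
have [g gg yg] := gsD y yW; have gW := gsW g gg; have [F1 F2 F3] := Sreg f' Sf'.
have small z : `|z| <= M -> `|sig * z| <= 1 / 2.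
  move=> zM; rewrite normrM gtr0_norm// ler_pdivrMl ?mulr_gt0//; lra.
have := sin_expand (small _ (R1 g gW)) (small _ (F1 g gW)).
rewrite -mulrBr normrM gtr0_norm// => h1.
have h2 := Hf' g gg.
have h3 : `|at_point k x g - f' g| <= eta / 2 by rewrite -(ler_pM2l sig0); lra.
have h4 := R2 y g yW gW; have h5 := F2 g y gW yW; rewrite (distrC g y) in h5.
have h6 : M * `|y - g| <= eta / 4.
  by apply: le_trans (ler_wpM2l (ltW M0) yg) _; rewrite le_eqVlt; apply/orP; left; apply/eqP; field; rewrite gt_eqF.
have -> : at_point k x y - f' y = (at_point k x y - at_point k x g) + (at_point k x g - f' g) + (f' g - f' y) by ring.
apply: le_trans (ler_normD _ _) _.
have := ler_normD (at_point k x y - at_point k x g) (at_point k x g - f' g); lra.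
Qed.

End Transfer.

(** * Regularity of typical samples *)

Lemma trigsum_shift (R : realType) m N b (rr : nat -> 'rV[R]_m) th p x :
  trigsum N b rr th (x + p) = trigsum N b rr (fun l => th l + 2 * pi * dotv (rr l) p) x.
Proof.
by apply: eq_bigr => l _; rewrite dotvDr mulrDr; congr (_ * cos _); ring.
Qed.

Lemma cube_cover (R : realType) m (del : R) : 0 < del -> exists2 C, 0 < C & forall W, 1 <= W ->
  exists2 gs : seq 'rV[R]_m, (size gs)%:R <= C * W ^+ m &
    forall y : 'rV[R]_m, `|y| <= W -> exists2 g, g \in gs & `|y - g| <= del.
Proof.
move=> d0; have c0 : 0 < 2 / del + 5 by rewrite addr_gt0// divr_gt0.
exists ((2 / del + 5) ^+ m) => [|W W1]; first by rewrite exprn_gt0.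
have W0 : 0 <= W / del by rewrite divr_ge0 ?(ltW d0)//; lra.
pose K := (Num.trunc (W / del)).+1.
have [t1 t2] : (Num.trunc (W / del))%:R <= W / del /\ W / del < K%:R.
  by have /andP[] := truncn_itv W0.
have K2 : K%:R <= W / del + 1 by rewrite /K -natr1 lerD2r.
have [fb cb] := finite_box R m K.+1.
exists [seq del *: emb R z | z <- fset_set [set z : 'rV[int]_m | forall i, `|z ord0 i| <= K.+1%:Z]].
  rewrite size_map; rewrite latcountE in cb; apply: le_trans cb _.
  have cW : 0 <= (2 / del + 5) * W by rewrite mulr_ge0 ?(ltW c0)//; lra.
  rewrite -exprMn; apply: lerXn2r; rewrite ?nnegrE ?addr_ge0//.
  have -> : (2 / del + 5) * W = 2 * (W / del) + 5 * W by field; rewrite gt_eqF.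
  rewrite -[K.+1%:R]natr1; lra.
move=> y yW; exists (del *: emb R (round del y)); last exact: round_norm.
apply: map_f; rewrite in_fset_set// inE/= => i; rewrite mxE.
have yi := le_trans (coord_le_norm y i) yW.
have a1 : `|y ord0 i / del| <= K%:R.
  apply: le_trans (ltW t2); rewrite normrM normfV (gtr0_norm d0) ler_wpM2r// invr_ge0 ltW//.
have l1 := ge_floor (y ord0 i / del); have l2 := floorD1_gt (y ord0 i / del).
rewrite intrD in l2; rewrite -(ler_int R) intr_norm.
have -> : (K.+1%:Z)%:~R = K%:R + 1 :> R by rewrite natr1.
move: a1; rewrite !ler_norml => /andP[a1 a2].
by apply/andP; split; lra.
Qed.

Section MeanRegularity.
Variables (R : realType) (m : nat) (h : R) (rr : nat -> 'rV[R]_m) (al : nat -> R).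
Variables (phi : nat -> nat).
Hypothesis h0 : 0 < h.
Local Notation vec := 'rV[R]_m.
Local Notation cnt rho := (latcount R (lball h (0 : vec) rho)).
Hypothesis nonres : forall n q, (exists2 l, (l < n)%N & q l != 0) ->
  exists i, forall k : int, h * freq rr n q ord0 i != k%:~R.
Hypothesis phi0 : (0 < phi 0%N)%N.
Hypothesis phiS : forall k, (phi k < phi k.+1)%N.
Hypothesis rr1 : forall l, enorm (rr l) = 1.
Hypothesis m1 : (1 <= m)%N.

(** Cross terms with the new frequency average to 0, and the square of its cosine to 1/2. *)
Lemma meanlim_trigsum_sqr N b th :
  meanlim h (fun x => trigsum N b rr th x ^+ 2) (2^-1 * \sum_(l < N) b l ^+ 2).
Proof.
elim: N => [|N IH].
  apply: (@eq_meanlim _ _ _ (fun=> 0)) => [x|]; first by rewrite /trigsum big_ord0 expr0n.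
  by rewrite big_ord0 mulr0; exact: meanlim_cst.
pose Z x := trigsum N b rr th x.
pose u x := 2 * pi * dotv (rr N) x.
have M1 : meanlim h (fun x => Z x * cos (1%:~R * u x + th N)) 0.
  apply: meanlim_orth => //; exact: almost_periodic_trigsum.
have M2 : meanlim h (fun x => 1 * cos (2%:~R * u x + (th N) *+ 2)) 0.
  apply: meanlim_orth => //; exact: almost_periodic_cst.
have := meanlimD IH (meanlimD (meanlim_cst m h (b N ^+ 2 / 2))
  (meanlimD (meanlimZ (2 * b N) M1) (meanlimZ (b N ^+ 2 / 2) M2))).
rewrite !mulr0 !addr0 big_ord_recr/= mulrDr [2^-1 * b N ^+ 2]mulrC.
apply: eq_meanlim => x; rewrite /trigsum big_ord_recr/= -/(trigsum N b rr th x) -/(Z x) -/(u x).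
rewrite !mul1r; have -> : 2%:~R * u x + th N *+ 2 = (u x + th N) *+ 2.
  by rewrite mulrnDl mulr_natl.
by rewrite cos_mulr2n -[_ *+ 2]mulr_natr; field.
Qed.

Definition word_prod (w : seq 'I_m) (x : vec) : R := \prod_(i <- w) x ord0 i.

(** The partial derivative of the sample field along the word [w], divided by [(2 pi)^|w|]: a
    derivative multiplies each term by a coordinate of its frequency and turns the phase by
    [pi / 2]. *)
Definition partial k (w : seq 'I_m) : vec -> R :=
  trigsum (phi k) (fun l => Num.sqrt (2 / (phi k)%:R) * word_prod w (rr l)) rr
    (fun l => al l + (size w)%:R * (pi / 2)).

Fixpoint partials k (j : nat) (w : seq 'I_m) (x : vec) : R :=
  if j is j'.+1 then \sum_(i < m) partials k j' (i :: w) x else `|partial k w x|.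

Lemma partial_nil k : partial k [::] = field rr al phi k.
Proof.
apply/funext => x; apply: eq_bigr => l _.
by rewrite /word_prod big_nil mulr1 mul0r addr0.
Qed.

Lemma rr_coord l i : `|rr l ord0 i| <= 1.
Proof. by apply: le_trans (coord_le_norm _ i) _; rewrite -(rr1 l); exact: norm_le_enorm. Qed.

Lemma word_prod_le1 w l : `|word_prod w (rr l)| <= 1.
Proof.
rewrite /word_prod; elim: w => [|i w IH]; first by rewrite big_nil normr1.
by rewrite big_cons normrM -[leRHS]mulr1 ler_pM// rr_coord.
Qed.

(** From [|a| <= (1 + a^2) / 2] and a mean square at most 1. The bound is independent of the order
    of the derivative and of [k]. *)
Lemma mean_partial k w p :
  \forall rho \near +oo, sumball h rho (fun x => `|partial k w (x + p)|) <= 2 * cnt rho.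
Proof.
have H := meanlim_trigsum_sqr (phi k) (fun l => Num.sqrt (2 / (phi k)%:R) * word_prod w (rr l))
  (fun l => al l + (size w)%:R * (pi / 2) + 2 * pi * dotv (rr l) p).
have N0 : 0 < (phi k)%:R :> R by rewrite ltr0n phi_gt0.
set c := 2^-1 * _ in H; have c1 : c <= 1.
  rewrite /c; apply: (@le_trans _ _ (2^-1 * \sum_(l < phi k) (2 / (phi k)%:R))).
    rewrite ler_wpM2l ?invr_ge0//; apply: ler_sum => l _.
    rewrite exprMn sqr_sqrtr ?divr_ge0// -[leRHS]mulr1 ler_wpM2l ?divr_ge0//.
    by rewrite -(real_normK (num_real _)) -(expr1n _ 2); apply: lerXn2r; rewrite ?nnegrE// word_prod_le1.
  rewrite sumr_const card_ord -[_ *+ phi k]mulr_natr le_eqVlt; apply/orP; left; apply/eqP.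
  by field; rewrite gt_eqF.
have {}H := H _ ltr01.
near=> rho; have c0 := cnt_ge0 m h rho.
have : `|sumball h rho (fun x => partial k w (x + p) ^+ 2) - c * cnt rho| <= 1 * cnt rho.
  have -> : (fun x => partial k w (x + p) ^+ 2) = (fun x => trigsum (phi k)
    (fun l => Num.sqrt (2 / (phi k)%:R) * word_prod w (rr l)) rr
    (fun l => al l + (size w)%:R * (pi / 2) + 2 * pi * dotv (rr l) p) x ^+ 2).
    by apply/funext => x; rewrite /partial trigsum_shift.
  by near: rho; exact: H.
rewrite ler_distl mul1r => /andP[_ H2].
have H3 : sumball h rho (fun x => `|partial k w (x + p)|) <=
    sumball h rho (fun x => 2^-1 * (1 + partial k w (x + p) ^+ 2)).
  apply: sumball_le => // x; set a := partial k w _.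
  by rewrite -(real_normK (num_real a)); have := sqr_ge0 (`|a| - 1); set y := `|a|; lra.
rewrite sumballZ sumballD sumball_cst in H3.
have := ler_wpM2r c0 c1; lra.
Unshelve. all: by end_near. Qed.

Lemma mean_partials k j w p :
  \forall rho \near +oo, sumball h rho (fun x => partials k j w (x + p)) <= 2 * m%:R ^+ j * cnt rho.
Proof.
elim: j w => [|j IH] w.
  by near=> rho; rewrite expr0 mulr1 /=; near: rho; exact: mean_partial.
near=> rho.
have H : forall i, sumball h rho (fun x => partials k j (i :: w) (x + p)) <= 2 * m%:R ^+ j * cnt rho.
  by near: rho; apply: filter_forall => i; exact: IH.
rewrite /sumball/= latsum_sum; apply: le_trans (ler_sum _ (fun i _ => H i)) _.
rewrite sumr_const card_ord -[_ *+ m]mulr_natl exprS le_eqVlt; apply/orP; left; apply/eqP; ring.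
Unshelve. all: by end_near. Qed.

Lemma taylor_term k j w x (y : vec) del : `|y| <= del ->
  `|\sum_(l < phi k) Num.sqrt (2 / (phi k)%:R) * word_prod w (rr l) * dotv (rr l) y ^+ j *
     cos (2 * pi * dotv (rr l) x + (al l + (size w + j)%:R * (pi / 2)))| <= del ^+ j * partials k j w x.
Proof.
move=> yd; have d0 : 0 <= del := le_trans (normr_ge0 _) yd.
elim: j w => [|j IH] w /=.
  rewrite expr0 mul1r /partial /trigsum le_eqVlt; apply/orP; left; apply/eqP; congr Num.norm.
  by apply: eq_bigr => l _; rewrite expr0 mulr1 addn0.
set S := \sum_(l < phi k) _.
have -> : S = \sum_(i < m) y ord0 i * \sum_(l < phi k) Num.sqrt (2 / (phi k)%:R) *
    word_prod (i :: w) (rr l) * dotv (rr l) y ^+ j *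
    cos (2 * pi * dotv (rr l) x + (al l + (size (i :: w) + j)%:R * (pi / 2))).
  under eq_bigr => i _ do rewrite mulr_sumr.
  rewrite exchange_big/=; apply: eq_bigr => l _.
  rewrite exprSr /= addnS addSn; set c := cos _.
  have -> : Num.sqrt (2 / (phi k)%:R) * word_prod w (rr l) * (dotv (rr l) y ^+ j * dotv (rr l) y) * c =
     dotv (rr l) y * (Num.sqrt (2 / (phi k)%:R) * word_prod w (rr l) * dotv (rr l) y ^+ j * c) by ring.
  rewrite {1}/dotv mulr_suml; apply: eq_bigr => i _.
  by rewrite /word_prod big_cons; ring.
apply: le_trans (ler_norm_sum _ _ _) _; rewrite mulr_sumr; apply: ler_sum => i _.
rewrite normrM exprS -mulrA; apply: ler_pM => //.
by apply: le_trans (coord_le_norm y i) _.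
Qed.

(** The supremum over a cell is bounded by the Taylor series in the derivatives at its centre. As
    derivatives of all orders have bounded mean, the series is dominated by a geometric one of ratio
    [2 pi m del]. This plays the part of a Sobolev inequality. *)
Lemma cell_bound k w p del : 0 < del -> 2 * pi * m%:R * del <= 1 / 2 ->
  exists2 B : vec -> R, forall x y, `|y| <= del -> `|partial k w (x + p + y)| <= B x &
   \forall rho \near +oo, sumball h rho B <= 5 * cnt rho.
Proof.
move=> d0 del1; have pi00 : 0 < (pi : R) := pi_gt0 R.
pose c := (phi k)%:R * Num.sqrt (2 / (phi k)%:R) : R.
have cc : 0 <= c by rewrite mulr_ge0// sqrtr_ge0.
(* The order [K] of the expansion depends on [k], but the final bound [5 = 2 * 2 + 1] does not. *)
have [K HK] : exists K, c * (1 / 2) ^+ K <= 1.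
  have : (1 / 2) ^+ k @[k --> \oo] --> (0 : R).
    by apply: cvg_expr; rewrite ger0_norm; lra.
  have e0 : 0 < 1 / (c + 1) by rewrite divr_gt0// ltr_wpDl.
  move=> /cvgrPdist_le /(_ _ e0)[K _ /(_ K (leqnn _))]; rewrite sub0r normrN => HK.
  exists K; have {}HK := le_trans (ler_norm _) HK.
  apply: le_trans (ler_wpM2l cc HK) _; rewrite mulrA mulr1 ler_pdivrMr ?ltr_wpDl//; lra.
exists (fun x => \sum_(j < K) (2 * pi * del) ^+ j * partials k j w (x + p) + 1) => [x y yd|].
  pose s l := 2 * pi * dotv (rr l) y.
  pose A l := 2 * pi * dotv (rr l) (x + p) + (al l + (size w)%:R * (pi / 2)).
  pose b l := Num.sqrt (2 / (phi k)%:R) * word_prod w (rr l).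
  have s1 l : `|s l| <= 1 / 2.
    rewrite /s normrM ger0_norm ?mulr_ge0 ?(ltW pi00)//.
    apply: le_trans del1; rewrite -!mulrA; do 2! (rewrite ler_wpM2l ?(ltW pi00)//).
    rewrite /dotv; apply: le_trans (ler_norm_sum _ _ _) _.
    apply: (@le_trans _ _ (\sum_(i < m) del)); last by rewrite sumr_const card_ord mulr_natl.
    apply: ler_sum => i _; rewrite normrM -[leRHS]mul1r ler_pM// ?rr_coord//.
    exact: le_trans (coord_le_norm y i) yd.
  have -> : partial k w (x + p + y) = \sum_(l < phi k) b l * cos (A l + s l).
    by apply: eq_bigr => l _; rewrite dotvDr; congr (_ * cos _); rewrite /A /s; ring.
  have -> : \sum_(l < phi k) b l * cos (A l + s l) =
    \sum_(l < phi k) b l * cos_taylor K (A l) (s l) +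
    \sum_(l < phi k) b l * (cos (A l + s l) - cos_taylor K (A l) (s l)).
    by rewrite -big_split/=; apply: eq_bigr => l _; ring.
  apply: le_trans (ler_normD _ _) _; apply: lerD; last first.
    apply: le_trans HK; apply: le_trans (ler_norm_sum _ _ _) _.
    apply: (@le_trans _ _ (\sum_(l < phi k) Num.sqrt (2 / (phi k)%:R) * (1 / 2) ^+ K)).
      apply: ler_sum => l _; rewrite normrM; apply: ler_pM => //.
        by rewrite normrM ger0_norm ?sqrtr_ge0// -[leRHS]mulr1 ler_wpM2l ?sqrtr_ge0// word_prod_le1.
      by apply: le_trans (cos_taylor_bound _ _ _) _; apply: lerXn2r; rewrite ?nnegrE.
    by rewrite sumr_const card_ord -[_ *+ phi k]mulr_natl /c mulrA.
  have -> : \sum_(l < phi k) b l * cos_taylor K (A l) (s l) = \sum_(j < K) (2 * pi) ^+ j / j`!%:R *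
     \sum_(l < phi k) b l * dotv (rr l) y ^+ j *
     cos (2 * pi * dotv (rr l) (x + p) + (al l + (size w + j)%:R * (pi / 2))).
    under [RHS]eq_bigr => j _ do rewrite mulr_sumr.
    rewrite exchange_big/=; apply: eq_bigr => l _; rewrite /cos_taylor mulr_sumr; apply: eq_bigr => j _.
    have -> : 2 * pi * dotv (rr l) (x + p) + (al l + (size w + j)%:R * (pi / 2)) = A l + j%:R * (pi / 2).
      by rewrite /A natrD; ring.
    by rewrite /s exprMn; ring.
  apply: le_trans (ler_norm_sum _ _ _) _; apply: ler_sum => j _.
  rewrite normrM [(2 * pi * del) ^+ j]exprMn -[leRHS]mulrA; apply: ler_pM => //; last exact: taylor_term.
  rewrite ger0_norm; last by rewrite divr_ge0// exprn_ge0// mulr_ge0// ltW.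
  rewrite ler_pdivrMr ?ltr0n ?fact_gt0// -[leLHS]mulr1 ler_wpM2l//.
    by rewrite exprn_ge0// mulr_ge0// ltW.
  by rewrite ler1n fact_gt0.
near=> rho; have c0 := cnt_ge0 m h rho.
have H : forall j : 'I_K, sumball h rho (fun x => partials k j w (x + p)) <= 2 * m%:R ^+ j * cnt rho.
  by near: rho; apply: filter_forall => j; exact: mean_partials.
rewrite sumballD sumball_cst mul1r /sumball latsum_sum.
have HS : \sum_(j < K) latsum (lball h 0 rho) (fun z => (2 * pi * del) ^+ j * partials k j w (h *: emb R z + p)) <=
    \sum_(j < K) (1 / 2) ^+ j * (2 * cnt rho).
  apply: ler_sum => j _; rewrite latsumZ; apply: le_trans (ler_wpM2l _ (H j)) _.
    by rewrite exprn_ge0// !mulr_ge0// ltW.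
  have -> : (2 * pi * del) ^+ j * (2 * m%:R ^+ j * cnt rho) = (2 * pi * m%:R * del) ^+ j * (2 * cnt rho).
    by rewrite [2 * pi * m%:R * del]mulrAC [(_ * m%:R) ^+ j]exprMn; ring.
  rewrite ler_wpM2r ?mulr_ge0//; apply: lerXn2r; rewrite ?nnegrE//.
  by rewrite !mulr_ge0// ltW.
have geo n : \sum_(j < n) (1 / 2) ^+ j <= 2 - 2 * (1 / 2) ^+ n :> R.
  elim: n => [|n IH]; first by rewrite big_ord0 expr0 mulr1 subrr.
  rewrite big_ord_recr/= exprS; move: IH; lra.
have geo2 : \sum_(j < K) (1 / 2) ^+ j <= 2 :> R.
  by apply: le_trans (geo K) _; rewrite gerBl mulr_ge0// exprn_ge0.
rewrite -mulr_suml in HS; have := ler_wpM2r c0 geo2; set X := \sum_(j < K) _ in HS *.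
set Y := \sum_(j < K) _ in HS *; lra.
Unshelve. all: by end_near. Qed.

Lemma is_derive_partial k w (x v : vec) (t : R) :
  is_derive t (1 : R) (fun t => partial k w (x + t *: v))
    (2 * pi * \sum_(i < m) v ord0 i * partial k (i :: w) (x + t *: v)).
Proof.
pose b l := Num.sqrt (2 / (phi k)%:R) * word_prod w (rr l).
pose a l := 2 * pi * dotv (rr l) x + (al l + (size w)%:R * (pi / 2)).
pose c l := 2 * pi * dotv (rr l) v.
have E : (fun t => partial k w (x + t *: v)) = (fun t => \sum_(l < phi k) b l * cos (a l + c l * t)).
  apply/funext => u; apply: eq_bigr => l _; rewrite dotvDr dotvZr; congr (_ * cos _).
  by rewrite /a /c; ring.
have D l : is_derive t (1 : R) (fun t => b l * cos (a l + c l * t)) (b l * (- sin (a l + c l * t) * c l)).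
  have d1 : is_derive t (1 : R) (fun t => a l + c l * t) (c l).
    by apply: is_derive_eq; rewrite /GRing.scale/= ?mulr1 ?addr0 ?add0r ?mul0r ?scaler0; ring.
  have d2 : is_derive t (1 : R) (cos \o (fun t => a l + c l * t)) (- sin (a l + c l * t) * c l).
    by apply: is_derive_eq; rewrite /GRing.scale/=; ring.
  have -> : (fun t => b l * cos (a l + c l * t)) = b l \*: (cos \o (fun t => a l + c l * t)) by [].
  exact: is_deriveZ.
have := is_derive_sum (fun l : 'I_(phi k) => D l).
have -> : \sum_(l < phi k) (fun t => b l * cos (a l + c l * t)) = (fun t => \sum_(l < phi k) b l * cos (a l + c l * t)).
  by apply/funext => u; rewrite fct_sumE.
rewrite E => H; apply: (is_derive_eq H).
rewrite mulr_sumr; under [RHS]eq_bigr => i _ do rewrite /partial /trigsum !mulr_sumr.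
rewrite exchange_big/=; apply: eq_bigr => l _.
have -> : - sin (a l + c l * t) = cos (2 * pi * dotv (rr l) (x + t *: v) + (al l + (size w).+1%:R * (pi / 2))).
  rewrite -cosDpihalf; congr cos; rewrite dotvDr dotvZr /a /c -natr1; ring.
rewrite /c {2}/dotv mulr_sumr !mulr_sumr; apply: eq_bigr => i _.
by rewrite /b /word_prod big_cons; ring.
Qed.

Lemma derivative_bound k i0 (v : vec) B (y : vec) : 0 <= B ->
  (forall i, `|partial k (i :: i0) y| <= B) ->
  `|2 * pi * \sum_(i < m) v ord0 i * partial k (i :: i0) y| <= 2 * pi * m%:R * B * `|v|.
Proof.
have pi00 : 0 < (pi : R) := pi_gt0 R.
move=> B0 HB; rewrite normrM ger0_norm ?mulr_ge0 ?(ltW pi00)// -!mulrA.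
do 2! (rewrite ler_wpM2l ?(ltW pi00)//).
apply: le_trans (ler_norm_sum _ _ _) _.
apply: (@le_trans _ _ (\sum_(i < m) B * `|v|)); last by rewrite sumr_const card_ord mulr_natl.
by apply: ler_sum => i _; rewrite normrM mulrC ler_pM// coord_le_norm.
Qed.

Lemma partial_lip k w x W B (y z : vec) : 0 <= B ->
  (forall i (y : vec), `|y| <= W -> `|partial k (i :: w) (x + y)| <= B) ->
  `|y| <= W -> `|z| <= W -> `|partial k w (x + y) - partial k w (x + z)| <= 2 * pi * m%:R * B * `|y - z|.
Proof.
(* The segment is parametrised by [[-1, 1]] from its midpoint, because [mvt_bound] asks for a
   derivative bound on an interval symmetric about 0. *)
move=> B0 HB yW zW; pose c := 2^-1 *: (y + z); pose v := 2^-1 *: (y - z).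
have cy : y = c + v.
  by rewrite /c /v -scalerDr addrACA subrr addr0 -[y + y]mulr2n -[y *+ 2]scaler_nat scalerA mulVf ?scale1r ?pnatr_eq0.
have cz : z = c - v.
  rewrite /c /v -scalerBr opprB [y + z + _]addrC addrA subrK.
  by rewrite -[z + z]mulr2n -[z *+ 2]scaler_nat scalerA mulVf ?scale1r ?pnatr_eq0.
have vE : `|y - z| = 2 * `|v| by rewrite /v normrZ ger0_norm ?invr_ge0//; field.
have yz : y - z = 2 *: v by rewrite /v scalerA divff ?scale1r ?pnatr_eq0.
clearbody c v.
have seg (t : R) : `|t| <= 1 -> `|c + t *: v| <= W.
  move=> t1; have -> : c + t *: v = z + ((1 + t) / 2) *: (y - z).
    rewrite yz {1}cz.
    rewrite scalerA divfK ?pnatr_eq0// scalerDl scale1r addrA subrK//.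
  apply: norm_segment => //; move: t1; rewrite ler_norml => /andP[? ?].
  by apply/andP; split; lra.
pose g t := partial k w (x + c + t *: v).
have H s : `|s| <= 1 -> `|g s - g 0| <= 2 * pi * m%:R * B * `|v| * `|s|.
  move=> s1; apply: mvt_bound => [t|t ts]; first exact: is_derive_partial.
  apply: derivative_bound => // i; rewrite -addrA; apply: HB; apply: seg; exact: le_trans ts s1.
have -> : partial k w (x + y) = g 1 by rewrite /g scale1r -addrA -cy.
have -> : partial k w (x + z) = g (-1) by rewrite /g scaleN1r -addrA -cz.
have H1 := H 1; have H2 := H (-1); rewrite !normrN !normr1 !mulr1 in H1 H2.
have -> : g 1 - g (-1) = (g 1 - g 0) - (g (-1) - g 0) by ring.
apply: le_trans (ler_normB _ _) _; rewrite vE.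
by have := H1 (lexx _); have := H2 (lexx _); lra.
Qed.

(** The second difference is the integral of a difference of first derivatives, to which
    [partial_lip] applies; so words of length at most 2 suffice. *)
Lemma partial_regular k x W B : 0 <= B ->
  (forall w (y : vec), (size w <= 2)%N -> `|y| <= W -> `|partial k w (x + y)| <= B) ->
  regular_on W (2 * (2 * pi * m%:R) ^+ 2 * B) (at_point rr al phi k x).
Proof.
move=> B0 HB; have pi00 : 2 <= (pi : R) := pi_ge2 R.
set a := 2 * pi * m%:R; have a4 : 1 <= a.
  have mm : 1 <= m%:R :> R by rewrite ler1n.
  by rewrite /a -[leLHS]mulr1; apply: ler_pM => //; lra.
have a0 : 0 <= a by lra.
have a2 : 1 <= a ^+ 2 by rewrite expr_ge1// (le_trans ler01).
have aa : a <= a ^+ 2 by rewrite expr2 ler_peMr// (le_trans ler01).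
have B1 : B <= 2 * a ^+ 2 * B by rewrite ler_peMl//; lra.
have fE y : at_point rr al phi k x y = partial k [::] (x + y) by rewrite partial_nil.
split=> [y yW|y z yW zW|y v yW1 yW2]; rewrite !fE.
- by apply: le_trans B1; exact: HB.
- apply: le_trans (partial_lip B0 _ yW zW) _; first by move=> i y' y'W; apply: HB.
  rewrite ler_wpM2r// ler_wpM2r// -/a; lra.
- pose g t := partial k [::] (x + y + t *: v) + partial k [::] (x + y + t *: (- v)) - 2 * partial k [::] (x + y).
  pose dg t := 2 * pi * (\sum_(i < m) v ord0 i * partial k [:: i] (x + y + t *: v)) +
    2 * pi * (\sum_(i < m) (- v) ord0 i * partial k [:: i] (x + y + t *: (- v))).
  have dgE t : is_derive t (1 : R) g (dg t).
    have d1 := is_derive_partial k [::] (x + y) v t; have d2 := is_derive_partial k [::] (x + y) (- v) t.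
    have d3 : is_derive t (1 : R) (fun=> - (2 * partial k [::] (x + y))) 0 by exact: is_derive_cst.
    have := is_deriveD (is_deriveD d1 d2) d3; rewrite addr0 => H; exact: H.
  have seg (t : R) : `|t| <= 1 -> `|y + t *: v| <= W.
    move=> t1; have -> : y + t *: v = (y - v) + ((1 + t) / 2) *: ((y + v) - (y - v)).
      rewrite opprB [y + v + _]addrC addrA subrK -[v + v]mulr2n -[v *+ 2]scaler_nat scalerA divfK ?pnatr_eq0//.
      by rewrite scalerDl scale1r addrA subrK.
    apply: norm_segment => //; move: t1; rewrite ler_norml => /andP[? ?].
    by apply/andP; split; lra.
  have dgB t : `|t| <= `|1 : R| -> `|dg t| <= 2 * a ^+ 2 * B * `|v| ^+ 2.
    rewrite normr1 => t1.
    have -> : dg t = 2 * pi * \sum_(i < m) v ord0 i * (partial k [:: i] (x + (y + t *: v)) - partial k [:: i] (x + (y + (- t) *: v))).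
      rewrite /dg -mulrDr -big_split/=; congr (_ * _); apply: eq_bigr => i _.
      by rewrite mxE scaleNr scalerN !addrA; ring.
    have L i : `|partial k [:: i] (x + (y + t *: v)) - partial k [:: i] (x + (y + (- t) *: v))| <= a * B * (2 * `|v|).
      have tN : `|- t| <= 1 by rewrite normrN.
      have HBi j (y' : vec) : `|y'| <= W -> `|partial k [:: j; i] (x + y')| <= B by move=> ?; apply: HB.
      apply: le_trans (partial_lip B0 HBi (seg t t1) (seg (- t) tN)) _.
      rewrite -/a ler_wpM2l ?(mulr_ge0 a0 B0)//.
      have -> : y + t *: v - (y + - t *: v) = (2 * t) *: v.
        by rewrite opprD addrACA subrr add0r -scaleNr opprK -scalerDl mulr_natl mulr2n.
      by rewrite normrZ normrM ger0_norm// -mulrA ler_wpM2l// ler_piMl.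
    rewrite normrM ger0_norm; last by rewrite mulr_ge0//; lra.
    apply: (@le_trans _ _ (2 * pi * \sum_(i < m) `|v| * (a * B * (2 * `|v|)))).
      rewrite ler_wpM2l//; first by rewrite mulr_ge0//; lra.
      apply: le_trans (ler_norm_sum _ _ _) _; apply: ler_sum => i _; rewrite normrM.
      by apply: ler_pM => //; exact: coord_le_norm.
    rewrite sumr_const card_ord -[_ *+ m]mulr_natl le_eqVlt; apply/orP; left; apply/eqP.
    by rewrite /a; ring.
  have := mvt_bound dgE dgB; rewrite normr1 mulr1 /g !scale1r !scale0r addr0.
  have -> : partial k [::] (x + y) + partial k [::] (x + y) - 2 * partial k [::] (x + y) = 0 by ring.
  by rewrite subr0 -!addrA.
Qed.

(** Markov's inequality for the sum of the cell bounds over a cover of the cube by [O(W^m)] cells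
    and over all words of length at most 2. *)
Lemma mean_regular : exists2 C, 0 < C & forall W M, 1 <= W -> 0 < M ->
  evn (fun k rho => hits h rr al phi [set f | ~ regular_on W M f] k rho <= C * W ^+ m / M * cnt rho).
Proof.
have pi00 : 0 < (pi : R) := pi_gt0 R.
have mm : 0 < m%:R :> R by rewrite ltr0n.
pose del : R := (4 * pi * m%:R)^-1.
have d0 : 0 < del by rewrite invr_gt0 !mulr_gt0.
have del1 : 2 * pi * m%:R * del <= 1 / 2.
  rewrite /del; set q := 4 * pi * m%:R; have q0 : 0 < q by rewrite /q !mulr_gt0.
  have -> : 2 * pi * m%:R = q / 2 by rewrite /q; field.
  by rewrite mulrAC divff ?gt_eqF.
have [C0 C00 HC] := cube_cover m d0.
pose nw : R := 1 + m%:R + m%:R * m%:R.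
pose c : R := 2 * (2 * pi * m%:R) ^+ 2.
have c0 : 0 < c by rewrite mulr_gt0// exprn_gt0// !mulr_gt0.
have nw0 : 0 < nw by rewrite /nw; have := mulr_gt0 mm mm; lra.
exists (5 * nw * C0 * c) => [|W M W1 M0]; first by rewrite !mulr_gt0.
have [gs gsz Hgs] := HC W W1.
pose words : seq (seq 'I_m) := [:: [::]] ++ [seq [:: i] | i <- enum 'I_m] ++
  [seq [:: i; j] | i <- enum 'I_m, j <- enum 'I_m].
have wordsz : (size words)%:R = nw.
  rewrite /words !size_cat size_map size_allpairs size_enum_ord /= natrD natrD natrM.
  by rewrite /nw addrA.
have wordsP w : (size w <= 2)%N -> w \in words.
  case: w => [|i [|j [|]]]//= _; rewrite !mem_cat ?inE//.
    by rewrite (map_f (fun i => [:: i])) ?mem_enum// orbT.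
  apply/orP; right; apply/orP; right; apply/allpairsP; exists (i, j).
  by rewrite !mem_enum.
near=> k.
have /choice[Bf HBf] : forall wg : seq 'I_m * vec, exists Bf : vec -> R,
   (forall x y, `|y| <= del -> `|partial k wg.1 (x + wg.2 + y)| <= Bf x) /\
   \forall rho \near +oo, sumball h rho Bf <= 5 * cnt rho.
  by move=> wg; have [Bf H1 H2] := cell_bound k wg.1 wg.2 d0 del1; exists Bf.
pose pairs := [seq (w, g) | w <- words, g <- gs].
have near_all (s : seq (seq 'I_m * vec)) : \forall rho \near +oo,
    \sum_(a <- s) sumball h rho (Bf a) <= (size s)%:R * (5 * cnt rho).
  elim: s => [|a s IH]; first by near=> rho; rewrite big_nil mul0r.
  near=> rho; rewrite big_cons /= -natr1 mulrDl mul1r addrC; apply: lerD.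
    by near: rho; exact: IH.
  by near: rho; exact: (HBf a).2.
near=> rho.
have Hsum : \sum_(a <- pairs) sumball h rho (Bf a) <= (size pairs)%:R * (5 * cnt rho).
  by near: rho; exact: near_all.
have cn := cnt_ge0 m h rho.
have Bf0 a x : 0 <= Bf a x.
  by apply: le_trans (normr_ge0 _) ((HBf a).1 x 0 _); rewrite normr0 ltW.
have B0 : 0 < M / c by rewrite divr_gt0.
have key x : \1_[set f | ~ regular_on W M f] (at_point rr al phi k x) <= (M / c)^-1 * \sum_(a <- pairs) Bf a x.
  rewrite indicE; have [|_] := boolP (_ \in _); last first.
    by rewrite mulr_ge0 ?invr_ge0 ?(ltW B0)// sumr_ge0.
  rewrite inE/= => nreg; rewrite leNgt; apply/negP; rewrite ltr_pdivrMl// mulr1 => small.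
  apply: nreg; have -> : M = c * (M / c) by field; rewrite gt_eqF.
  apply: partial_regular; first exact: ltW.
  move=> w y w2 yW; have [g gg yg] := Hgs y yW.
  have -> : x + y = x + g + (y - g) by rewrite -addrA (addrC g) subrK.
  apply: le_trans ((HBf (w, g)).1 x _ yg) _; apply: le_trans (ltW small).
  have inp : (w, g) \in pairs by apply/allpairsP; exists (w, g); split => //; exact: wordsP.
  by rewrite (big_rem _ inp)/= lerDl sumr_ge0.
apply: le_trans (sumball_le h0 rho key) _.
rewrite sumballZ /sumball latsum_sum.
have szE : (size pairs)%:R <= nw * (C0 * W ^+ m).
  rewrite size_allpairs natrM wordsz ler_wpM2l// ltW//.
apply: le_trans (ler_wpM2l _ Hsum) _; first by rewrite invr_ge0 ltW.
have -> : 5 * nw * C0 * c * W ^+ m / M * cnt rho = (M / c)^-1 * (nw * (C0 * W ^+ m) * (5 * cnt rho)).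
  by field; rewrite !gt_eqF.
by rewrite ler_wpM2l ?invr_ge0 ?(ltW B0)// ler_wpM2r// mulr_ge0.
Unshelve. all: by end_near. Qed.

End MeanRegularity.

(** * Nondegeneracy of the Gaussian field *)

Section SmallBall.
Variable R : realType.

(** This is [iter_stepE] in dimension one, applied to a cosine, which is an eigenfunction of the
    walk. *)
Lemma cos_pow_expand (A Y : R) T : cos A * cos Y ^+ T =
  \sum_(j < T.+1) 'C(T, j)%:R / 2 ^+ T * cos (A + (2 * j%:R - T%:R) * Y).
Proof.
pose u (z : 'rV[int]_1) := cos (A + (z ord0 ord0)%:~R * Y).
have st T' z : iter T' (step ord0) u z = u z * cos Y ^+ T'.
  elim: T' z => [|T' IH] z; first by rewrite expr0 mulr1.
  rewrite /= /step !IH /u !mxE eqxx/= intrB !intrD.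
  rewrite -mulrDl exprS !mulrDl !mul1r ?mulNr ?mul1r !addrA.
  by set a := A + _; clearbody a; rewrite cosD cosB; field.
have := iter_stepE T ord0 u 0; rewrite st {1}/u mxE mul0r addr0 => ->.
apply: eq_bigr => j _; congr (_ * cos (A + _ * Y)); rewrite add0r.
have e : forall c : int, (unitv ord0 *~ c : 'rV[int]_1) ord0 ord0 = c.
  have en : forall n : nat, (unitv ord0 *+ n : 'rV[int]_1) ord0 ord0 = n%:Z.
    by move=> n; rewrite mulmxnE /unitv !mxE !eqxx/= -[LHS]/(n%:R) natz.
  case=> n; first exact: en.
  by rewrite NegzE mulrNz mxE; congr (- _); exact: en.
by rewrite e intrB intrM.
Qed.

Lemma geometric_half n : \sum_(j < n) (1 / 2 : R) ^+ j <= 2.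
Proof.
have H : \sum_(j < n) (1 / 2 : R) ^+ j <= 2 - 2 * (1 / 2) ^+ n.
  elim: n => [|n IH]; first by rewrite big_ord0 expr0 mulr1 subrr.
  by rewrite big_ord_recr/= exprS; move: IH; lra.
by apply: le_trans H _; rewrite gerBl mulr_ge0// exprn_ge0.
Qed.

(** The term at distance [d] from the middle is [exp(- 2 d^2) <= 2^{-d}], which leaves two geometric
    series. *)
Lemma gauss_sum N : \sum_(j < N.*2.+1) expR (- ((2 * j%:R - N.*2%:R) ^+ 2 / 2)) <= 4 :> R.
Proof.
have term (x : R) (d : nat) : x ^+ 2 = (2 * d%:R) ^+ 2 -> expR (- (x ^+ 2 / 2)) <= (1 / 2) ^+ d.
  move=> ->; have -> : (2 * d%:R) ^+ 2 / 2 = 2 * d%:R ^+ 2 :> R by field.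
  have e2 : expR (- 1) <= 1 / 2 :> R.
    rewrite expRN div1r lef_pV2 ?posrE ?expR_gt0//.
    by have := expR_ge1Dx (1 : R); lra.
  apply: (@le_trans _ _ (expR (- 1) ^+ d)); last by apply: lerXn2r; rewrite ?nnegrE ?expR_ge0.
  rewrite -expRM_natl -mulr_natl ler_expR mulrN1 lerN2.
  have -> : d%:R = (d%:R : R) * 1 by rewrite mulr1.
  have [->|d0] := posnP d; first by rewrite !mul0r expr0n mulr0.
  have d1 : 1 <= d%:R :> R by rewrite ler1n.
  by nra.
have -> : N.*2.+1 = (N + N.+1)%N by rewrite -addnn addnS.
rewrite big_split_ord/=; have -> : 4 = 2 + 2 :> R by ring.
apply: lerD; last first.
  apply: le_trans _ (geometric_half N.+1); apply: ler_sum => j _; apply: term.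
  by rewrite natrD -addnn natrD; ring.
rewrite (reindex_inj rev_ord_inj)/=; apply: le_trans _ (geometric_half N.+1).
rewrite big_ord_recl/= expr0; apply: le_trans _ (_ : \sum_(j < N) (1 / 2) ^+ (bump 0 j) <= _); last by rewrite lerDr.
apply: ler_sum => j _; apply: term; rewrite /bump add1n natrB ?ltn_ord// -addnn natrD; ring.
Qed.

(** Prepares a Fourier proof that a Gaussian variable of variance at least 1 lies in [[-a, a]] with
    probability [O(a)]. With [N] about [1 / (4 a^2)], [cos^{2N}] is at least 1/2 on [[-a, a]], its
    Fourier coefficients are at most [kernel N <= 2 a], and the Gaussian factors sum to at most
    4. *)
Lemma kernel_sum (a : R) : 0 < a -> exists N,
  (forall x, `|x| <= a -> 1 / 2 <= cos x ^+ N.*2) /\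
  \sum_(j < N.*2.+1) 'C(N.*2, j)%:R / 2 ^+ N.*2 * expR (- ((2 * j%:R - N.*2%:R) ^+ 2 / 2)) <= 8 * a.
Proof.
move=> a0; have [a2|a2] := lerP a (1 / 2); last first.
  (* For [a > 1/2] the constant function already satisfies the bound. *)
  exists 0%N; split=> [x _|]; first by rewrite expr0; lra.
  rewrite big_ord_recl big_ord0 addr0 bin0 expr0 divr1 mul1r mulr0 subrr expr0n/= mul0r oppr0 expR0; lra.
have q0 : 0 <= (4 * a ^+ 2)^-1 by rewrite invr_ge0 mulr_ge0// sqr_ge0.
have a20 : 0 < a ^+ 2 by rewrite exprn_gt0.
pose N := Num.trunc (4 * a ^+ 2)^-1; exists N.
have [n1 n2] : N%:R <= (4 * a ^+ 2)^-1 /\ (4 * a ^+ 2)^-1 < N.+1%:R by have /andP[] := truncn_itv q0.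
have m1 : N%:R * (4 * a ^+ 2) <= 1 by rewrite -ler_pdivlMr ?mulr_gt0// mul1r.
have m2 : 1 < N.+1%:R * (4 * a ^+ 2) by rewrite -ltr_pdivrMr ?mulr_gt0// mul1r.
split=> [x xa|].
  have x2 : x ^+ 2 <= a ^+ 2 by rewrite -(real_normK (num_real x)); apply: lerXn2r; rewrite ?nnegrE// ltW.
  have c1 : 1 - a ^+ 2 <= cos x by have := cos_taylor2 x; rewrite ler_norml; lra.
  have a21 : a ^+ 2 <= 1 / 4.
    by have : a ^+ 2 <= (1 / 2) ^+ 2 by [apply: lerXn2r; rewrite ?nnegrE// ltW]; lra.
  have bern n : 1 - n%:R * a ^+ 2 <= (1 - a ^+ 2) ^+ n.
    elim: n => [|n IH]; first by rewrite mul0r subr0 expr0.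
    rewrite [(1 - a ^+ 2) ^+ n.+1]exprS -natr1; have : (1 - a ^+ 2) * (1 - n%:R * a ^+ 2) <= (1 - a ^+ 2) * (1 - a ^+ 2) ^+ n.
      by rewrite ler_wpM2l//; lra.
    have : 0 <= n%:R * (a ^+ 2 * a ^+ 2) :> R by rewrite !mulr_ge0// ltW.
    lra.
  apply: (@le_trans _ _ ((1 - a ^+ 2) ^+ N.*2)).
    by apply: le_trans _ (bern _); rewrite -addnn natrD; lra.
  by apply: lerXn2r; rewrite ?nnegrE; lra.
apply: (@le_trans _ _ (\sum_(j < N.*2.+1) kernel R N * expR (- ((2 * j%:R - N.*2%:R) ^+ 2 / 2)))).
  apply: ler_sum => j _; rewrite ler_wpM2r ?expR_ge0// /kernel ler_wpM2r ?invr_ge0 ?exprn_ge0//.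
  by rewrite ler_nat bin_central.
rewrite -mulr_sumr.
have kb : kernel R N <= 2 * a.
  rewrite -(ler_pXn2r (ltn0Sn 1)) ?nnegrE ?kernel_ge0 ?mulr_ge0 ?(ltW a0)//.
  have := kernel_sqr R N; set K := kernel R N ^+ 2 => HK.
  have K0 : 0 <= K by exact: sqr_ge0.
  have : 1 <= N.*2.+1%:R * (4 * a ^+ 2).
    have -> : N.*2.+1%:R = 2 * N.+1%:R - 1 :> R by rewrite -natr1 -[N.+1%:R]natr1 -addnn natrD; ring.
    have : a ^+ 2 <= (1 / 2) ^+ 2 by apply: lerXn2r; rewrite ?nnegrE// ltW.
    lra.
  move=> /(ler_wpM2l K0); rewrite mulr1 => /le_trans; apply.
  rewrite exprMn; have -> : 2 ^+ 2 * a ^+ 2 = 1 * (4 * a ^+ 2) by ring.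
  have -> : K * (N.*2.+1%:R * (4 * a ^+ 2)) = K * N.*2.+1%:R * (4 * a ^+ 2) by ring.
  by rewrite ler_wpM2r// mulr_ge0// ltW.
have -> : 8 * a = 2 * a * 4 by ring.
apply: ler_pM (gauss_sum N); rewrite ?kernel_ge0 ?sumr_ge0// => j _; exact: expR_ge0.
Qed.

Variable m : nat.
Local Notation vec := 'rV[R]_m.
Local Notation func := (vec -> R).
Variables (d : measure_display) (Omega : measurableType d) (P : probability Omega R).
Variable F : Omega -> func.
Variable G : vec -> R.
Hypothesis gau : forall (k : nat) (xs : 'I_k -> vec) (cs : 'I_k -> R),
  centered_gaussian P (fun w => \sum_(i < k) cs i * F w (xs i))
    (\sum_(i < k) \sum_(j < k) cs i * cs j * G (xs i - xs j)).

Definition functional (s : seq (R * vec)) (f : func) : R := \sum_(a <- s) a.1 * f a.2.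

(* The variables  functional (Y i) F  have covariance matrix at least the identity. *)
Lemma small_ball p (Y : nat -> seq (R * vec)) (a : nat -> R) (A : set Omega) :
  (forall (tau : nat -> R) th, `|expect P F (fun f => cos (\sum_(i < p) tau i * functional (Y i) f + th))| <=
     expR (- (\sum_(i < p) tau i ^+ 2 / 2))) ->
  (forall i, 0 < a i) -> measurable A ->
  (forall w, A w -> forall i, (i < p)%N -> `|functional (Y i) (F w)| <= a i) ->
  fine (P A) <= \prod_(i < p) (16 * a i).
Proof.
move=> HQ a0 mA HA.
have /choice[N HN] := fun i => kernel_sum (a0 i).
pose Psi n (tau : nat -> R) th (f : func) := cos (\sum_(i < p) tau i * functional (Y i) f + th) *
  \prod_(i < n) cos (functional (Y i) f) ^+ (N i).*2.
pose scale c (s : seq (R * vec)) := [seq (c * q.1, q.2) | q <- s].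
have scaleE c s f : functional (scale c s) f = c * functional s f.
  by rewrite /functional big_map mulr_sumr; apply: eq_bigr => q _; rewrite mulrA.
have adm0 (tau : nat -> R) th : admissible (fun f : func => cos (\sum_(i < p) tau i * functional (Y i) f + th)).
  pose s := flatten [seq scale (tau (nat_of_ord i)) (Y i) | i <- enum 'I_p].
  apply: eq_admissible (admissible_wave s th) => f; rewrite /wave; congr (cos (_ + _)).
  rewrite /s big_flatten/= big_map -big_enum/=; apply: eq_bigr => i _.
  by rewrite -/(functional _ f) scaleE.
have admc i : admissible (fun f : func => cos (functional (Y i) f)).
  by apply: eq_admissible (admissible_wave (Y i) 0) => f; rewrite /wave addr0.
have admX (X : func -> R) n : admissible X -> admissible (fun f => X f ^+ n).
  move=> AX; elim: n => [|n IH].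
    by apply: eq_admissible (@admissible_cst R m 1) => f; rewrite expr0.
  by apply: eq_admissible (admissibleM AX IH) => f; rewrite exprS.
have adm n (tau : nat -> R) th : admissible (Psi n tau th).
  apply: admissibleM => //; elim: n => [|n IH].
    by apply: eq_admissible (@admissible_cst R m 1) => f; rewrite big_ord0.
  by apply: eq_admissible (admissibleM IH (admX _ _ (admc n))) => f; rewrite big_ord_recr.
have key n (tau : nat -> R) th : (n <= p)%N -> (forall i, (i < n)%N -> tau i = 0) ->
    `|expect P F (Psi n tau th)| <= \prod_(i < n) (8 * a i) * expR (- (\sum_(i < p) tau i ^+ 2 / 2)).
  elim: n tau th => [|n IH] tau th np tau0.
    rewrite big_ord0 mul1r; have -> : Psi 0%N tau th = fun f => cos (\sum_(i < p) tau i * functional (Y i) f + th).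
      by apply/funext => f; rewrite /Psi big_ord0 mulr1.
    exact: HQ.
  pose c j : R := 2 * j%:R - (N n).*2%:R.
  pose tj j i := if i == n then c j else tau i.
  have taun : tau n = 0 by exact: tau0.
  have sumE j f : \sum_(i < p) tj j i * functional (Y i) f =
      \sum_(i < p) tau i * functional (Y i) f + c j * functional (Y n) f.
    rewrite (bigD1 (Ordinal np))//= [in RHS](bigD1 (Ordinal np))//= taun mul0r add0r addrC.
    rewrite /tj eqxx; congr (_ + _); apply: eq_bigr => i; rewrite -val_eqE/= => /negbTE ->//.
  have sumQ j : \sum_(i < p) tj j i ^+ 2 / 2 = \sum_(i < p) tau i ^+ 2 / 2 + c j ^+ 2 / 2.
    rewrite (bigD1 (Ordinal np))//= [in RHS](bigD1 (Ordinal np))//= taun expr0n/= mul0r add0r addrC.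
    rewrite /tj eqxx; congr (_ + _); apply: eq_bigr => i; rewrite -val_eqE/= => /negbTE ->//.
  have PsiE : Psi n.+1 tau th = fun f => \sum_(j < (N n).*2.+1) 'C((N n).*2, j)%:R / 2 ^+ (N n).*2 * Psi n (tj j) th f.
    apply/funext => f; rewrite /Psi big_ord_recr/= [_ * cos _ ^+ _]mulrC mulrA cos_pow_expand mulr_suml.
    apply: eq_bigr => j _; rewrite -[LHS]mulrA; congr (_ * (cos _ * _)).
    by rewrite sumE -/(c j); ring.
  have expS J : expect P F (fun f => \sum_(j < J) 'C((N n).*2, j)%:R / 2 ^+ (N n).*2 * Psi n (tj j) th f) =
      \sum_(j < J) 'C((N n).*2, j)%:R / 2 ^+ (N n).*2 * expect P F (Psi n (tj j) th).
    elim: J => [|J IHJ].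
      rewrite big_ord0 -[RHS](expect_cst P F 0); congr expect.
      by apply/funext => f; rewrite big_ord0.
    rewrite big_ord_recr/= -IHJ -(expectZ gau)// -(expectD gau).
    - by congr expect; apply/funext => f; rewrite big_ord_recr.
    - by apply: admissible_sum => j; apply: admissibleM => //; exact: admissible_cst.
    - by apply: admissibleM => //; exact: admissible_cst.
  rewrite PsiE expS; apply: le_trans (ler_norm_sum _ _ _) _.
  rewrite [\prod_(i < n.+1) _]big_ord_recr/= -[leRHS]mulrA; set Pi := \prod_(_ < n) _; set E := expR _.
  have Pi0 : 0 <= Pi by apply: prodr_ge0 => i _; rewrite mulr_ge0// ltW.
  apply: (@le_trans _ _ (\sum_(j < (N n).*2.+1) Pi * E *
     ('C((N n).*2, j)%:R / 2 ^+ (N n).*2 * expR (- ((2 * j%:R - (N n).*2%:R) ^+ 2 / 2))))).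
    apply: ler_sum => j _.
    have b0 : 0 <= 'C((N n).*2, j)%:R / 2 ^+ (N n).*2 :> R by rewrite divr_ge0// exprn_ge0.
    rewrite normrM ger0_norm// [leRHS]mulrCA ler_wpM2l//.
    apply: le_trans (IH (tj j) th (ltnW np) _) _.
      by move=> i iN; rewrite /tj ltn_eqF// tau0// ltnW.
    by rewrite sumQ opprD expRD -/E -/Pi -/(c j) mulrA.
  rewrite -mulr_sumr -mulrA ler_wpM2l// mulrC ler_wpM2r ?expR_ge0//.
  exact: (HN n).2.
have := key p (fun=> 0) 0 (leqnn p) (fun _ _ => erefl).
have -> : \sum_(i < p) 0 ^+ 2 / 2 = 0 :> R by rewrite big1// => i _; rewrite expr0n mul0r.
rewrite oppr0 expR0 mulr1 => H.
pose Q (f : func) := \prod_(i < p) cos (functional (Y i) f) ^+ (N i).*2.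
have PsiQ : Psi p (fun=> 0) 0 = Q.
  by apply/funext => f; rewrite /Psi big1 ?addr0 ?cos0 ?mul1r// => i _; rewrite mul0r.
rewrite PsiQ in H; have AQ : admissible Q by rewrite -PsiQ.
have pow01 (x : R) n : `|x| <= 1 -> 0 <= x ^+ n.*2 <= 1.
  move=> x1; have -> : x ^+ n.*2 = (`|x| ^+ 2) ^+ n by rewrite real_normK ?num_real// -exprM mul2n.
  by rewrite exprn_ge0 ?sqr_ge0//= exprn_ile1 ?sqr_ge0// exprn_ile1.
have Q01 f : 0 <= Q f <= 1.
  rewrite /Q; apply/andP; split.
    by apply: prodr_ge0 => i _; have /andP[] := pow01 _ (N i) (cos_max (functional (Y i) f)).
  by apply: prodr_ile1 => i _; exact: pow01 (cos_max _).
(* Each factor of [Q] is at least 1/2 on the event, so [2^p Q] dominates its indicator; truncation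
   at 1 gives the range required by [expect_ge]. *)
pose Q2 f := Num.min 1 (2 ^+ p * Q f).
have AQ2 : admissible Q2.
  apply: (@eq_admissible _ _ (fun f => -1 * Num.max (-1) (-1 * (2 ^+ p * Q f)))) => [f|].
    by rewrite /Q2 !mulN1r oppr_max !opprK.
  apply: admissibleM; first exact: admissible_cst.
  apply: admissible_max; first exact: admissible_cst.
  apply: admissibleM; first exact: admissible_cst.
  by apply: admissibleM => //; exact: admissible_cst.
have p20 : 0 <= 2 ^+ p :> R by rewrite exprn_ge0.
have Q201 f : 0 <= Q2 f <= 1.
  have /andP[q0 q1] := Q01 f; rewrite /Q2 ge_min lexx andbT le_min ler01/=.
  by rewrite mulr_ge0.
have : (P A <= (expect P F Q2)%:E)%E.
  apply: (expect_ge gau) => // w Aw; apply/min_idPl.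
  rewrite [leLHS](_ : 1 = \prod_(i < p) 1); last by rewrite big1.
  have -> : 2 ^+ p * Q (F w) = \prod_(i < p) (2 * cos (functional (Y i) (F w)) ^+ (N i).*2).
    by rewrite big_split/= prodr_const card_ord.
  apply: ler_prod => i _; rewrite ler01/=.
  have := (HN i).1 _ (HA w Aw i (ltn_ord i)); lra.
rewrite -[P A]fineK ?fin_num_measure// lee_fin => /le_trans; apply.
apply: (@le_trans _ _ (2 ^+ p * expect P F Q)).
  rewrite -(expectZ gau)//; apply: (expect_le gau) => //.
    by apply: admissibleM => //; exact: admissible_cst.
  by move=> f; rewrite /Q2 ge_min lexx orbT.
apply: (@le_trans _ _ (2 ^+ p * \prod_(i < p) (8 * a i))).
  by rewrite ler_wpM2l//; apply: le_trans (ler_norm _) H.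
rewrite -[2 ^+ p](_ : \prod_(i < p) 2 = _); last by rewrite prodr_const card_ord.
rewrite -big_split/= le_eqVlt; apply/orP; left; apply/eqP; apply: eq_bigr => i _; ring.
Qed.

End SmallBall.

Lemma lim_le2 (R : realType) (u v : nat -> R) (a b : R) : u @ \oo --> a -> v @ \oo --> b ->
  (forall k, u k <= v k) -> a <= b.
Proof.
move=> ua vb H; apply/ler_addgt0Pr => e e0; have e2 : 0 < e / 2 by rewrite divr_gt0.
move/cvgrPdist_le : ua => /(_ _ e2)[N1 _ H1]; move/cvgrPdist_le : vb => /(_ _ e2)[N2 _ H2].
have := H1 (maxn N1 N2) (leq_maxl _ _); have := H2 (maxn N1 N2) (leq_maxr _ _).
have := H (maxn N1 N2); rewrite /= !ler_distl => ? /andP[? ?] /andP[? ?]; lra.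
Qed.

Lemma lim_unique (R : realType) (u : nat -> R) (a b : R) : u @ \oo --> a -> u @ \oo --> b -> a = b.
Proof. by move=> ua ub; apply/eqP; rewrite eq_le (lim_le2 ua ub)// (lim_le2 ub ua). Qed.

(** * The limit of the second moments of the frequencies *)

Section SpectralForm.
Variables (R : realType) (m : nat) (rr : nat -> 'rV[R]_m) (phi : nat -> nat).
Local Notation vec := 'rV[R]_m.
Variable Gm : 'I_m -> 'I_m -> R.
Hypothesis phi0 : (0 < phi 0%N)%N.
Hypothesis phiS : forall k, (phi k < phi k.+1)%N.
Hypothesis rr1 : forall l, enorm (rr l) = 1.

Definition average k (u : nat -> R) : R := (phi k)%:R^-1 * \sum_(l < phi k) u l.

Hypothesis covM : forall i j, average k (fun l => rr l ord0 i * rr l ord0 j) @[k --> \oo] --> Gm i j.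

(** The limit of the averages of [<r_l, u> <r_l, v>]. It is nonnegative but possibly degenerate, as
    the limit measure may be carried by a proper subspace. *)
Definition gam (u v : vec) : R := \sum_i \sum_j u ord0 i * v ord0 j * Gm i j.

Lemma averageD k u u' : average k (fun l => u l + u' l) = average k u + average k u'.
Proof. by rewrite /average big_split mulrDr. Qed.

Lemma averageZ k c u : average k (fun l => c * u l) = c * average k u.
Proof. by rewrite /average -mulr_sumr mulrCA. Qed.

Lemma average_sum k (I : finType) (u : I -> nat -> R) :
  average k (fun l => \sum_i u i l) = \sum_i average k (u i).
Proof. by rewrite /average exchange_big mulr_sumr. Qed.

Lemma average_le k u u' : (forall l, u l <= u' l) -> average k u <= average k u'.
Proof. by move=> H; rewrite ler_wpM2l ?invr_ge0//; apply: ler_sum. Qed.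

Lemma average_cst k c : average k (fun=> c) = c.
Proof.
have N0 : (phi k)%:R != 0 :> R by rewrite pnatr_eq0 -lt0n phi_gt0.
by rewrite /average sumr_const card_ord -[c *+ phi k]mulr_natl mulrA mulVf ?mul1r.
Qed.

Lemma eq_average k u u' : (forall l, u l = u' l) -> average k u = average k u'.
Proof. by move=> H; rewrite /average; congr (_ * _); apply: eq_bigr. Qed.

Lemma gam_lim u v : average k (fun l => dotv (rr l) u * dotv (rr l) v) @[k --> \oo] --> gam u v.
Proof.
have -> : (fun k => average k (fun l => dotv (rr l) u * dotv (rr l) v)) =
    fun k => \sum_i \sum_j u ord0 i * v ord0 j * average k (fun l => rr l ord0 i * rr l ord0 j).
  apply/funext => k; rewrite (@eq_average k _ (fun l => \sum_i \sum_j u ord0 i * v ord0 j * (rr l ord0 i * rr l ord0 j))).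
    rewrite average_sum; apply: eq_bigr => i _; rewrite average_sum; apply: eq_bigr => j _.
    by rewrite averageZ.
  move=> l; rewrite /dotv mulr_suml; apply: eq_bigr => i _.
  by rewrite mulr_sumr; apply: eq_bigr => j _; ring.
apply: cvg_sum => i; apply: cvg_sum => j; apply: cvgM; [exact: cvg_cst|exact: covM].
Qed.

Lemma gamC u v : gam u v = gam v u.
Proof.
apply: (lim_unique (@gam_lim u v)).
have -> : (fun k => average k (fun l => dotv (rr l) u * dotv (rr l) v)) =
  (fun k => average k (fun l => dotv (rr l) v * dotv (rr l) u)).
  by apply/funext => k; apply: eq_average => l; rewrite mulrC.
exact: gam_lim.
Qed.

Lemma gamDl u u' v : gam (u + u') v = gam u v + gam u' v.
Proof.
rewrite /gam -big_split/=; apply: eq_bigr => i _; rewrite -big_split/=; apply: eq_bigr => j _.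
by rewrite mxE; ring.
Qed.

Lemma gamZl c u v : gam (c *: u) v = c * gam u v.
Proof.
rewrite /gam mulr_sumr; apply: eq_bigr => i _; rewrite mulr_sumr; apply: eq_bigr => j _.
by rewrite mxE; ring.
Qed.

Lemma gam_suml n (c : nat -> R) (w : nat -> vec) v :
  gam (\sum_(i < n) c i *: w i) v = \sum_(i < n) c i * gam (w i) v.
Proof.
elim: n => [|n IH]; last by rewrite !big_ord_recr/= gamDl IH gamZl.
by rewrite !big_ord0 /gam big1// => i _; rewrite big1// => j _; rewrite mxE !mul0r.
Qed.

Lemma gam_ge0 u : 0 <= gam u u.
Proof.
apply: (lim_le2 (u := fun=> 0) (cvg_cst 0) (@gam_lim u u)) => k.
by rewrite -(average_cst k 0); apply: average_le => l; exact: sqr_ge0.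
Qed.

Lemma gam_le u v : `|gam u v| <= enorm u * enorm v.
Proof.
have b (l : nat) : `|dotv (rr l) u * dotv (rr l) v| <= enorm u * enorm v.
  have c w : `|dotv (rr l) w| <= enorm w by have := cauchy_schwarz (rr l) w; rewrite rr1 mul1r.
  by rewrite normrM; apply: ler_pM.
rewrite ler_norml; apply/andP; split.
- apply: (lim_le2 (u := fun=> - (enorm u * enorm v)) (cvg_cst _) (@gam_lim u v)) => k; rewrite -(average_cst k (- _)); apply: average_le => l.
  by have := b l; rewrite ler_norml => /andP[].
- apply: (lim_le2 (v := fun=> enorm u * enorm v) (@gam_lim u v) (cvg_cst _)) => k; rewrite -(average_cst k (_ * _)); apply: average_le => l.
  by have := b l; rewrite ler_norml => /andP[].
Qed.

Definition gam_orthonormal n (v : nat -> vec) :=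
  forall i j, (i < n)%N -> (j < n)%N -> gam (v i) (v j) = (i == j)%:R.

Definition gam_residue n (v : nat -> vec) x := x - \sum_(i < n) gam x (v i) *: v i.

(** Pairing a vanishing combination with each [v j] kills its coefficients; this holds for a
    degenerate form too. *)
Lemma gam_orthonormal_size n v : gam_orthonormal n v -> (n <= m)%N.
Proof.
move=> ov; pose V := \matrix_(i < n) v i.
have rf : row_free V.
  apply: inj_row_free => u uV; apply/rowP => j; rewrite mxE.
  have : gam (u *m V) (v j) = 0.
    by rewrite uV /gam big1// => i _; rewrite big1// => j' _; rewrite mxE !mul0r.
  have -> : u *m V = \sum_(i < n) u ord0 i *: v i.
    rewrite mulmx_sum_row; apply: eq_bigr => i _; congr (_ *: _).
    by apply/rowP => q; rewrite !mxE.
  pose c i := if insub i is Some i' then u ord0 i' : R else 0.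
  have cE (i : 'I_n) : u ord0 i = c i by rewrite /c valK.
  rewrite (eq_bigr (fun i : 'I_n => c i *: v i)) => [|i _]; last by rewrite cE.
  rewrite gam_suml (bigD1 j)//= ov// eqxx mulr1 big1 ?addr0 -?cE// => i ij.
  by rewrite ov// (negbTE (ij : val i != val j)) mulr0.
by move: rf; rewrite /row_free => /eqP <-; exact: rank_leq_col.
Qed.

Lemma gam_residue_orth n v x j : gam_orthonormal n v -> (j < n)%N -> gam (gam_residue n v x) (v j) = 0.
Proof.
move=> ov jn; rewrite /gam_residue gamDl -[- \sum_(i < n) _]scaleN1r gamZl (gam_suml n (fun i => gam x (v i)) v).
rewrite (bigD1 (Ordinal jn))//= ov// eqxx mulr1 big1 ?addr0 ?mulN1r ?subrr// => i ij.
by rewrite ov// (negbTE (ij : val i != j)) mulr0.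
Qed.

Lemma gam_extend n v x : gam_orthonormal n v -> gam (gam_residue n v x) (gam_residue n v x) != 0 ->
  exists v', gam_orthonormal n.+1 v'.
Proof.
move=> ov; set u := gam_residue n v x => xn0.
have u0 : 0 < gam u u by rewrite lt_neqAle eq_sym xn0 gam_ge0.
pose c := (Num.sqrt (gam u u))^-1; exists (fun i => if (i < n)%N then v i else c *: u).
have c2 : c * (c * gam u u) = 1.
  by rewrite mulrA -expr2 /c exprVn sqr_sqrtr ?(ltW u0)// mulVf ?gt_eqF.
have uv j : (j < n)%N -> gam u (v j) = 0 by exact: gam_residue_orth.
move=> i j; rewrite !ltnS [(i <= n)%N]leq_eqVlt [(j <= n)%N]leq_eqVlt => /orP[/eqP ->|ni] /orP[/eqP ->|nj]; rewrite ?ltnn ?ni ?nj ?eqxx.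
- by rewrite gamZl gamC gamZl c2.
- by rewrite gamZl uv// mulr0 gtn_eqF.
- by rewrite gamC gamZl uv// mulr0 ltn_eqF.
- exact: ov.
Qed.

(** The Gram-Schmidt process cannot reach [m + 1] vectors, and where it stops every residue is null
    for the form. *)
Lemma gam_basis : exists n v, gam_orthonormal n v /\ forall x, gam (gam_residue n v x) (gam_residue n v x) = 0.
Proof.
have [//|none] := pselect (exists n v, gam_orthonormal n v /\
  forall x, gam (gam_residue n v x) (gam_residue n v x) = 0).
have [v /gam_orthonormal_size] : exists v, gam_orthonormal m.+1 v; last by rewrite ltnn.
elim: m.+1 => [|n [v ov]]; first by exists (fun=> 0).
have /existsNP[x /eqP xn0] : ~ forall x, gam (gam_residue n v x) (gam_residue n v x) = 0.
  by move=> H; apply: none; exists n, v.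
exact: gam_extend ov xn0.
Qed.

End SpectralForm.

(** * Variances of values and difference quotients of the field *)

Section GaussianNondegeneracy.
Variables (R : realType) (m : nat) (rr : nat -> 'rV[R]_m) (phi : nat -> nat).
Local Notation vec := 'rV[R]_m.
Local Notation func := (vec -> R).
Variables (G : vec -> R) (Gm : 'I_m -> 'I_m -> R).
Hypothesis phi0 : (0 < phi 0%N)%N.
Hypothesis phiS : forall k, (phi k < phi k.+1)%N.
Hypothesis rr1 : forall l, enorm (rr l) = 1.
Hypothesis covM : forall i j, average phi k (fun l => rr l ord0 i * rr l ord0 j) @[k --> \oo] --> Gm i j.
Hypothesis covG : forall z, average phi k (fun l => cos (2 * pi * dotv (rr l) z)) @[k --> \oo] --> (G z : R).
Variables (d : measure_display) (Omega : measurableType d) (P : probability Omega R).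
Variable F : Omega -> func.
Hypothesis gau : forall (k : nat) (xs : 'I_k -> vec) (cs : 'I_k -> R),
  centered_gaussian P (fun w => \sum_(i < k) cs i * F w (xs i))
    (\sum_(i < k) \sum_(j < k) cs i * cs j * G (xs i - xs j)).

Local Notation gm := (gam Gm).

Definition cosf l : func := fun x => cos (2 * pi * dotv (rr l) x).
Definition sinf l : func := fun x => sin (2 * pi * dotv (rr l) x).

(** The variance of a functional is the limit of the averages of its squared modulus on plane
    waves. *)
Lemma expect_functional s : exists Q, (forall th, expect P F (wave s th) = cos th * expR (- (Q / 2))) /\
  average phi k (fun l => functional s (cosf l) ^+ 2 + functional s (sinf l) ^+ 2) @[k --> \oo] --> Q.
Proof.
pose c i := (tnth (in_tuple s) i).1; pose g i := (tnth (in_tuple s) i).2.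
exists (\sum_(i < size s) \sum_(j < size s) c i * c j * G (g i - g j)); split=> [th|].
  rewrite /expect -[RHS]/(fine (cos th * expR (- (_ / 2)))%:E); congr fine.
  rewrite -(centered_gaussian_cos th (gau g c)).
  by apply: eq_integral => w _; rewrite wave_as_sum.
have fE f : functional s f = \sum_(i < size s) c i * f (g i) by rewrite /functional big_tnth.
have -> : (fun k => average phi k (fun l => functional s (cosf l) ^+ 2 + functional s (sinf l) ^+ 2)) =
    fun k => \sum_(i < size s) \sum_(j < size s) c i * c j *
       average phi k (fun l => cos (2 * pi * dotv (rr l) (g i - g j))).
  apply/funext => k.
  rewrite (@eq_average _ _ _ _ (fun l => \sum_(i < size s) \sum_(j < size s) c i * c j * cos (2 * pi * dotv (rr l) (g i - g j)))).
    rewrite average_sum; apply: eq_bigr => i _; rewrite average_sum; apply: eq_bigr => j _.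
    by rewrite averageZ.
  move=> l; rewrite !fE !expr2 !mulr_suml -big_split/=; apply: eq_bigr => i _.
  rewrite !mulr_sumr -big_split/=; apply: eq_bigr => j _.
  rewrite dotvBr mulrBr cosB /cosf /sinf; ring.
by apply: cvg_sum => i; apply: cvg_sum => j; apply: cvgM; [exact: cvg_cst|exact: covG].
Qed.

(** The increment has variance the limit of the averages of [2 - 2 cos(2 pi <r_l, u>)], which is at
    most a multiple of [gm u u]. *)
Lemma kernel_invariance (u x : vec) : gm u u = 0 -> {ae P, forall w, F w (x + u) = F w x}.
Proof.
move=> u0.
pose xs (i : 'I_2) := if i == ord0 then x + u else x.
pose cs (i : 'I_2) : R := if i == ord0 then 1 else -1.
have [_] := gau xs cs; set v := \sum_(i < 2) _.
suff v0 : v = 0.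
  case=> [[_ H]|[]]; last by rewrite v0 ltxx.
  apply: filterS H => w; rewrite !big_ord_recl big_ord0 /cs /xs/= addr0 mul1r mulN1r.
  by move/eqP; rewrite subr_eq0 => /eqP.
have vE : v = G 0 + G 0 - G u - G (- u).
  rewrite /v !big_ord_recl !big_ord0 /cs /xs/= !addr0 !subrr.
  have -> : x - (x + u) = - u by rewrite opprD addrA subrr add0r.
  by rewrite [x + u]addrC addrK; ring.
have L : average phi k (fun l => 2 - 2 * cos (2 * pi * dotv (rr l) u)) @[k --> \oo] --> v.
  have -> : (fun k => average phi k (fun l => 2 - 2 * cos (2 * pi * dotv (rr l) u))) =
    (fun k => average phi k (fun l => cos (2 * pi * dotv (rr l) 0)) + average phi k (fun l => cos (2 * pi * dotv (rr l) 0))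
      - average phi k (fun l => cos (2 * pi * dotv (rr l) u)) - average phi k (fun l => cos (2 * pi * dotv (rr l) (- u)))).
    apply/funext => k; rewrite (@eq_average _ _ _ _ (fun l => (cos (2 * pi * dotv (rr l) 0) + cos (2 * pi * dotv (rr l) 0)) +
        (-1 * cos (2 * pi * dotv (rr l) u) + -1 * cos (2 * pi * dotv (rr l) (- u))))).
      by rewrite !averageD !averageZ !mulN1r addrA.
    by move=> l; rewrite dotv0r mulr0 cos0 dotvNr mulrN cosN; ring.
  rewrite vE; apply: cvgB; last exact: covG.
  apply: cvgB; last exact: covG.
  by apply: cvgD; exact: covG.
have L0 : average phi k (fun l => 2 * (2 * pi) ^+ 2 * (dotv (rr l) u * dotv (rr l) u)) @[k --> \oo] --> (0 : R).
  have -> : (fun k => average phi k (fun l => 2 * (2 * pi) ^+ 2 * (dotv (rr l) u * dotv (rr l) u))) =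
    (fun k => 2 * (2 * pi) ^+ 2 * average phi k (fun l => dotv (rr l) u * dotv (rr l) u)).
    by apply/funext => k; rewrite averageZ.
  have E : 0 = 2 * (2 * pi) ^+ 2 * gm u u by rewrite u0 mulr0.
  rewrite [X in _ --> X]E.
  by apply: cvgM; [exact: cvg_cst|exact: gam_lim].
apply: (lim_unique L); apply: (squeeze_cvgr _ (cvg_cst 0) L0).
near=> k; apply/andP; split.
  rewrite -(average_cst phi0 phiS k 0); apply: average_le => l.
  by have := cos_le1 (2 * pi * dotv (rr l) u); lra.
apply: average_le => l; have := cos_taylor2 (2 * pi * dotv (rr l) u); rewrite ler_norml => /andP[h _].
by move: h; rewrite exprMn -expr2; lra.
Unshelve. all: by end_near. Qed.

(** The value at [x] and symmetric difference quotients along the [v j]; the symmetry makes them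
    uncorrelated with the value. *)
Definition probe (x : vec) (t : R) (v : nat -> vec) (i : nat) : seq (R * vec) :=
  if i is j.+1 then [:: (t^-1, x + t *: v j); (- t^-1, x - t *: v j)] else [:: (1, x)].

(** On a plane wave of frequency [r] the combination has squared modulus [tau_0^2 + S^2], with [S]
    close to [4 pi <r, u>]. The averages of [<r, u>^2] tend to the sum [T] of the other [tau_i^2],
    so the variance exceeds [tau_0^2 + T] with room for the error of the difference quotients. *)
Lemma probe_variance n v V x t : gam_orthonormal Gm n v -> 0 < t -> 0 < V -> (forall i, (i < n)%N -> enorm (v i) <= V) ->
  16 * pi ^+ 3 * V ^+ 3 * t ^+ 2 * n.+1%:R <= 1 ->
  forall (tau : nat -> R) th, `|expect P F (fun f => cos (\sum_(i < n.+1) tau i * functional (probe x t v i) f + th))| <=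
     expR (- (\sum_(i < n.+1) tau i ^+ 2 / 2)).
Proof.
move=> ov t0 V0 vV small tau th.
pose scale c (s : seq (R * vec)) := [seq (c * q.1, q.2) | q <- s].
have scaleE c s f : functional (scale c s) f = c * functional s f.
  by rewrite /functional big_map mulr_sumr; apply: eq_bigr => q _; rewrite mulrA.
pose s := flatten [seq scale (tau (nat_of_ord i)) (probe x t v i) | i <- enum 'I_n.+1].
have sE f : functional s f = \sum_(i < n.+1) tau i * functional (probe x t v i) f.
  rewrite /functional /s big_flatten/= big_map -big_enum/=; apply: eq_bigr => i _.
  by rewrite -/(functional _ f) scaleE.
have -> : (fun f => cos (\sum_(i < n.+1) tau i * functional (probe x t v i) f + th)) = wave s th.
  by apply/funext => f; rewrite -sE.
have [Q [HQ LQ]] := expect_functional s.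
rewrite HQ normrM (ger0_norm (expR_ge0 _)) -[leRHS]mul1r; apply: ler_pM => //; first exact: cos_max.
rewrite ler_expR lerN2 -mulr_suml ler_wpM2r ?invr_ge0//.
rewrite big_ord_recl/=; set T := \sum_(i < n) _.
have TE : T = \sum_(i < n) tau i.+1 ^+ 2 by [].
have T0 : 0 <= T by apply: sumr_ge0 => i _; exact: sqr_ge0.
pose u := \sum_(i < n) tau i.+1 *: v i.
have guu : gm u u = T.
  rewrite /u (gam_suml Gm n (fun i => tau i.+1)) TE; apply: eq_bigr => i _; rewrite (gamC covM).
  rewrite (gam_suml Gm n (fun i => tau i.+1)) (bigD1 i)//= ov// eqxx mulr1 big1 ?addr0 ?expr2// => j ji.
  by rewrite ov// (negbTE (ji : val j != val i)) mulr0.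
have pi2 := pi_ge2 R; have pi00 : 0 < (pi : R) := pi_gt0 R.
pose S l := \sum_(i < n) tau i.+1 * (2 / t * sin (2 * pi * (t * dotv (rr l) (v i)))).
have fsE l : functional s (cosf l) ^+ 2 + functional s (sinf l) ^+ 2 = tau 0%N ^+ 2 + S l ^+ 2.
  pose al := 2 * pi * dotv (rr l) x.
  have cE : functional s (cosf l) = tau 0%N * cos al - sin al * S l.
    rewrite sE big_ord_recl/= /functional big_seq1/= mul1r; congr (_ + _).
    rewrite /S mulr_sumr -sumrN; apply: eq_bigr => i _; rewrite /bump/= ?add1n ?add0n big_cons big_seq1/= /cosf.
    rewrite ?add0n dotvDr dotvBr !dotvZr; pose b := 2 * pi * (t * dotv (rr l) (v i)).
    have -> : 2 * pi * (dotv (rr l) x + t * dotv (rr l) (v i)) = al + b by rewrite /al /b; ring.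
    have -> : 2 * pi * (dotv (rr l) x - t * dotv (rr l) (v i)) = al - b by rewrite /al /b; ring.
    rewrite -/b; clearbody b al.
    by rewrite cosD cosB; field; rewrite gt_eqF.
  have sE' : functional s (sinf l) = tau 0%N * sin al + cos al * S l.
    rewrite sE big_ord_recl/= /functional big_seq1/= mul1r; congr (_ + _).
    rewrite /S mulr_sumr; apply: eq_bigr => i _; rewrite /bump/= ?add1n ?add0n big_cons big_seq1/= /sinf.
    rewrite ?add0n dotvDr dotvBr !dotvZr; pose b := 2 * pi * (t * dotv (rr l) (v i)).
    have -> : 2 * pi * (dotv (rr l) x + t * dotv (rr l) (v i)) = al + b by rewrite /al /b; ring.
    have -> : 2 * pi * (dotv (rr l) x - t * dotv (rr l) (v i)) = al - b by rewrite /al /b; ring.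
    rewrite -/b; clearbody b al.
    by rewrite sinD sinB; field; rewrite gt_eqF.
  rewrite cE sE'; have := cos2Dsin2 al; set ca := cos al; set sa := sin al => cs.
  have -> : (tau 0%N * ca - sa * S l) ^+ 2 + (tau 0%N * sa + ca * S l) ^+ 2 =
     (ca ^+ 2 + sa ^+ 2) * (tau 0%N ^+ 2 + S l ^+ 2) by ring.
  by rewrite cs mul1r.
have Slow l : 8 * pi ^+ 2 * (dotv (rr l) u * dotv (rr l) u) - T <= S l ^+ 2.
  pose D := dotv (rr l) u.
  have DE : D = \sum_(i < n) tau i.+1 * dotv (rr l) (v i).
    by rewrite /D dotvC dotv_suml; apply: eq_bigr => i _; rewrite dotvZl dotvC.
  pose q := 16 * pi ^+ 3 * V ^+ 3 * t ^+ 2.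
  have q0 : 0 <= q by rewrite !mulr_ge0// ?exprn_ge0// ltW.
  have Eb : `|S l - 4 * pi * D| <= q * \sum_(i < n) `|tau i.+1|.
    rewrite DE /S mulr_sumr -sumrB mulr_sumr; apply: le_trans (ler_norm_sum _ _ _) _; apply: ler_sum => i _.
    pose w := dotv (rr l) (v i); pose b := 2 * pi * (t * w).
    have wV : `|w| <= V.
      by apply: le_trans (cauchy_schwarz _ _) _; rewrite rr1 mul1r; exact: vV.
    have -> : tau i.+1 * (2 / t * sin (2 * pi * (t * dotv (rr l) (v i)))) - 4 * pi * (tau i.+1 * dotv (rr l) (v i)) =
      tau i.+1 * (2 / t * (sin b - b)) by rewrite -/w -/b /b; field; rewrite gt_eqF.
    rewrite normrM mulrC ler_wpM2r// normrM ger0_norm ?divr_ge0 ?(ltW t0)//.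
    have b3 : `|b| <= 2 * pi * (t * V).
      rewrite /b normrM (ger0_norm (x := 2 * pi)) ?mulr_ge0 ?(ltW pi00)// ler_wpM2l ?mulr_ge0 ?(ltW pi00)//.
      by rewrite normrM gtr0_norm// ler_wpM2l// ltW.
    have b4 : `|b| ^+ 3 <= (2 * pi * (t * V)) ^+ 3.
      by apply: lerXn2r; rewrite ?nnegrE ?mulr_ge0 ?(ltW pi00) ?(ltW t0) ?(ltW V0).
    apply: le_trans (ler_wpM2l _ (le_trans (sin_taylor3 b) b4)) _; first by rewrite divr_ge0 ?(ltW t0).
    by rewrite le_eqVlt; apply/orP; left; apply/eqP; rewrite /q; field; rewrite gt_eqF.
  have sum2 : (\sum_(i < n) `|tau i.+1|) ^+ 2 <= n%:R * T.
    rewrite expr2 mulr_suml; under eq_bigr => i _ do rewrite mulr_sumr.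
    apply: (@le_trans _ _ (\sum_(i < n) \sum_(j < n) (tau i.+1 ^+ 2 / 2 + tau j.+1 ^+ 2 / 2))).
      apply: ler_sum => i _; apply: ler_sum => j _.
      rewrite -(real_normK (num_real (tau i.+1))) -(real_normK (num_real (tau j.+1))).
      by have := sqr_ge0 (`|tau i.+1| - `|tau j.+1|); set a := `|tau i.+1|; set b := `|tau j.+1|; lra.
    under eq_bigr => i _ do rewrite big_split/= sumr_const card_ord -[_ *+ n]mulr_natl.
    rewrite big_split/= sumr_const card_ord -[X in _ + X]mulr_natl -mulr_sumr -!mulr_suml -TE.
    by rewrite le_eqVlt; apply/orP; left; apply/eqP; field.
  have qn : q ^+ 2 * n%:R <= 1.
    have q1 : q * n.+1%:R <= 1 by exact: small.
    have n0 : 0 <= n%:R :> R by [].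
    rewrite -natr1 in q1; have q2 : 0 <= q * n%:R by rewrite mulr_ge0.
    by rewrite expr2 -mulrA -[leRHS]mulr1; apply: ler_pM => //; lra.
  have E2 : (S l - 4 * pi * D) ^+ 2 <= T.
    rewrite -(real_normK (num_real _)).
    apply: (@le_trans _ _ ((q * \sum_(i < n) `|tau i.+1|) ^+ 2)).
      by apply: lerXn2r; rewrite ?nnegrE// mulr_ge0// sumr_ge0.
    rewrite exprMn; apply: le_trans (ler_wpM2l (sqr_ge0 q) sum2) _.
    by rewrite mulrA -[leRHS]mul1r ler_wpM2r.
  (* With [x = 4 pi D], expanding this square gives [S^2 >= x^2 / 2 - (S - x)^2]. *)
  rewrite -/D; have : 0 <= (2 * (S l - 4 * pi * D) + 4 * pi * D) ^+ 2 by exact: sqr_ge0.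
  move: E2; lra.
have L2 : average phi k (fun l => 8 * pi ^+ 2 * (dotv (rr l) u * dotv (rr l) u) + (tau 0%N ^+ 2 - T)) @[k --> \oo]
    --> 8 * pi ^+ 2 * T + (tau 0%N ^+ 2 - T).
  have -> : (fun k => average phi k (fun l => 8 * pi ^+ 2 * (dotv (rr l) u * dotv (rr l) u) + (tau 0%N ^+ 2 - T))) =
    (fun k => 8 * pi ^+ 2 * average phi k (fun l => dotv (rr l) u * dotv (rr l) u) + (tau 0%N ^+ 2 - T)).
    by apply/funext => k; rewrite averageD averageZ (average_cst phi0 phiS).
  apply: cvgD; last exact: cvg_cst.
  by rewrite -guu; apply: cvgM; [exact: cvg_cst|exact: gam_lim].
have : 8 * pi ^+ 2 * T + (tau 0%N ^+ 2 - T) <= Q.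
  apply: (lim_le2 L2 LQ) => k; apply: average_le => l; rewrite fsE.
  by have := Slow l; lra.
apply: le_trans.
have : 4 <= pi ^+ 2 :> R by have : 2 ^+ 2 <= pi ^+ 2 :> R by [apply: lerXn2r; rewrite ?nnegrE// ltW]; lra.
by move=> /(ler_wpM2r T0); lra.
Qed.

End GaussianNondegeneracy.

Lemma union_bound (R : realType) d (Omega : measurableType d) (P : probability Omega R)
    (I : finType) (B : I -> set Omega) (A : set Omega) : measurable A -> (forall i, measurable (B i)) ->
  (forall w, A w -> exists i, B i w) -> fine (P A) <= \sum_i fine (P (B i)).
Proof.
move=> mA mB HA; rewrite -big_enum/=.
have : forall w, A w -> exists2 i, i \in enum I & B i w.
  by move=> w /HA[i Bi]; exists i => //; rewrite mem_enum.
elim: (enum I) A mA {HA} => [|i s IH] A mA HA.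
  have -> : A = set0 by apply/seteqP; split => // w Aw; case: (HA w Aw) => i; rewrite in_nil.
  by rewrite measure0 big_nil.
rewrite big_cons -lee_fin EFinD !fineK ?fin_num_measure//.
have mA' : measurable (A `\` B i) by exact: measurableD.
apply: (@le_trans _ _ (P (B i `|` (A `\` B i)))).
  apply: le_measure; rewrite ?inE//; first exact: measurableU.
  by move=> w Aw; have [?|?] := pselect (B i w); [left|right].
apply: le_trans (measureU2 _ _ _) _ => //; rewrite leeD2l//.
rewrite -[leLHS]fineK ?fin_num_measure// lee_fin; apply: IH => // w [/HA[j]].
rewrite inE => /orP[/eqP ->//|js Bj _]; by exists j.
Qed.

Lemma ae_all (T : eqType) d (Omega : measurableType d) (R : realType) (P : {measure set Omega -> \bar R})
    (s : seq T) (Q : T -> Omega -> Prop) :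
  (forall x, x \in s -> {ae P, forall w, Q x w}) -> {ae P, forall w, forall x, x \in s -> Q x w}.
Proof.
elim: s => [|x s IH] H; first by apply: aeW => w x; rewrite in_nil.
have H1 := H x (mem_head _ _).
have H2 := IH (fun y ys => H y (ltac:(by rewrite inE ys orbT))).
by apply: filterS2 H1 H2 => w Qx Qs y; rewrite inE => /orP[/eqP ->|/Qs].
Qed.

Lemma ord_of_bounded_int (c : int) (K : nat) : `|c| <= K%:Z -> exists j : 'I_(2 * K).+1, (j : nat)%:Z = c + K%:Z.
Proof.
move=> cK; have lt : (`|(c + K%:Z)%R|%N < (2 * K).+1)%N by lia.
by exists (Ordinal lt) => /=; lia.
Qed.

Lemma scaled_floor (R : realType) (s x : R) : 0 < s -> `|s * (Num.floor (x / s))%:~R - x| <= s.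
Proof.
move=> s0; have l1 := ge_floor (x / s); have l2 := floorD1_gt (x / s).
rewrite intrD in l2; rewrite ler_pdivlMr// in l1; rewrite ltr_pdivrMr// in l2.
by rewrite ler_norml; apply/andP; split; lra.
Qed.

(** * Probability that the field has a degenerate zero *)

Section NondegeneracyProbability.
Variables (R : realType) (m : nat) (rr : nat -> 'rV[R]_m) (phi : nat -> nat).
Local Notation vec := 'rV[R]_m.
Local Notation func := (vec -> R).
Variables (G : vec -> R) (Gm : 'I_m -> 'I_m -> R).
Hypothesis phi0 : (0 < phi 0%N)%N.
Hypothesis phiS : forall k, (phi k < phi k.+1)%N.
Hypothesis rr1 : forall l, enorm (rr l) = 1.
Hypothesis covM : forall i j, average phi k (fun l => rr l ord0 i * rr l ord0 j) @[k --> \oo] --> Gm i j.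
Hypothesis covG : forall z, average phi k (fun l => cos (2 * pi * dotv (rr l) z)) @[k --> \oo] --> (G z : R).
Variables (d : measure_display) (Omega : measurableType d) (P : probability Omega R).
Variable F : Omega -> func.
Hypothesis gau : forall (k : nat) (xs : 'I_k -> vec) (cs : 'I_k -> R),
  centered_gaussian P (fun w => \sum_(i < k) cs i * F w (xs i))
    (\sum_(i < k) \sum_(j < k) cs i * cs j * G (xs i - xs j)).

Lemma measurable_functional s : measurable_fun setT (fun w => functional s (F w)).
Proof.
have [mX _] := gau (fun i => (tnth (in_tuple s) i).2) (fun i => (tnth (in_tuple s) i).1).
have -> // : (fun w => functional s (F w)) = (fun w => \sum_(i < size s)
    (tnth (in_tuple s) i).1 * F w (tnth (in_tuple s) i).2).
by apply/funext => w; rewrite /functional big_tnth.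
Qed.

(* Degenerate zeros are detected on a net of the subspace spanned by the  v i,
   of dimension n: along the kernel of  gam  the field is almost surely constant. *)
Lemma gaussian_nondegenerate : exists t0 C, [/\ 0 < t0, 0 < C & forall W M t (A : set Omega),
  1 <= W -> 1 <= M -> 0 < t -> t <= t0 -> measurable A ->
  (forall w, A w -> exists2 y, `|y| <= W & `|F w y| <= 5 * (M * t ^+ 2) /\
     forall v, `|v| <= t -> `|F w (y + v) - F w y| <= 18 * (M * t ^+ 2)) ->
  fine (P A) <= C * W ^+ m * M ^+ m.+1 * t ^+ 2].
Proof.
have pi00 : 0 < (pi : R) := pi_gt0 R.
have [n [v [ov res0]]] := gam_basis phi0 phiS covM.
have nm := gam_orthonormal_size ov.
pose V : R := \sum_(i < n) enorm (v i) + 1.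
have sV : 0 <= \sum_(i < n) enorm (v i) by apply: sumr_ge0 => i _; exact: enorm_ge0.
have V1 : 1 <= V by rewrite /V; lra.
have V0 : 0 < V by lra.
have vV i : (i < n)%N -> enorm (v i) <= V.
  move=> ilt; rewrite /V (bigD1 (Ordinal ilt))//= -addrA lerDl addr_ge0//.
  by apply: sumr_ge0 => j _; exact: enorm_ge0.
pose q : R := 16 * pi ^+ 3 * V ^+ 3 * n.+1%:R.
have q0 : 0 < q by rewrite !mulr_gt0// exprn_gt0.
pose C1 : R := 8 * m%:R * V ^+ 2 + 5.
have C10 : 0 < C1.
  have : 0 <= 8 * m%:R * V ^+ 2 by apply: mulr_ge0; [rewrite mulr_ge0|rewrite sqr_ge0].
  by rewrite /C1; lra.
have big0 : 0 < 2304 * V by apply: (mulr_gt0 _ V0); rewrite ltr0n.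
have big1 : 0 < (368 : R) by rewrite ltr0n.
exists (Num.min 1 q^-1), (368 * (C1 * (2304 * V)) ^+ n); split.
- by rewrite lt_min ltr01 invr_gt0.
- exact: (mulr_gt0 big1 (exprn_gt0 _ (mulr_gt0 C10 big0))).
move=> W M t A W1 M1 t0; rewrite le_min => /andP[t1 tq] mA HA.
have W0 : 0 < W by lra.
have M0 : 0 < M by lra.
(* With this net spacing the steps [s *: v i] have length at most [t / 4], and [s <= t] meets the
   smallness condition of [probe_variance]. *)
pose s := t / (4 * V); have s0 : 0 < s by rewrite divr_gt0// mulr_gt0.
have sV4 : s * V = t / 4 by rewrite /s; field; rewrite gt_eqF.
have st : s <= t by rewrite ler_pdivrMr ?mulr_gt0// ler_peMr ?(ltW t0)//; lra.
have small : 16 * pi ^+ 3 * V ^+ 3 * s ^+ 2 * n.+1%:R <= 1.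
  have -> : 16 * pi ^+ 3 * V ^+ 3 * s ^+ 2 * n.+1%:R = q * s ^+ 2 by rewrite /q; ring.
  rewrite -ler_pdivlMl// mulr1; apply: (le_trans (le_trans _ st) tq).
  by rewrite expr2 -[leRHS]mulr1 ler_wpM2l ?(ltW s0)// (le_trans st).
have t40 : 0 < t / 4 by rewrite divr_gt0.
have [gs [gsW gsD]] := cube_grid m (ltW W0) t40.
have X0 : 0 <= m%:R * W * V / s by rewrite divr_ge0 ?(ltW s0)// !mulr_ge0 ?(ltW W0) ?(ltW V0).
pose K := (Num.trunc (m%:R * W * V / s)).+1.
have [K1 K2] : (Num.trunc (m%:R * W * V / s))%:R <= m%:R * W * V / s /\ m%:R * W * V / s < K%:R.
  by have /andP[] := truncn_itv X0.
pose xc (f : {ffun 'I_n -> 'I_(2 * K).+1}) : vec := \sum_(i < n) (s * ((f i)%:R - K%:R)) *: v i.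
pose zs : seq vec := 0 :: [seq s *: v (nat_of_ord i) | i <- enum 'I_n] ++ [seq - (s *: v (nat_of_ord i)) | i <- enum 'I_n].
have sv i : (i < n)%N -> `|s *: v i| <= t / 4.
  move=> ilt; rewrite normrZ gtr0_norm// -sV4 ler_wpM2l ?(ltW s0)//.
  exact: le_trans (norm_le_enorm _) (vV i ilt).
have zsP z : z \in zs -> `|z| <= t / 4.
  rewrite inE mem_cat => /or3P[/eqP ->|/mapP[i _ ->]|/mapP[i _ ->]]; first by rewrite normr0 ltW.
    exact: sv.
  by rewrite normrN; exact: sv.
pose kap := gam_residue Gm n v.
pose good w := forall f, f \in enum {: {ffun 'I_n -> 'I_(2 * K).+1}} -> forall g, g \in gs -> forall z, z \in zs ->
  F w (xc f + z + kap g) = F w (xc f + z).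
have ae_good : {ae P, forall w, good w}.
  apply: ae_all => f _; apply: ae_all => g _; apply: ae_all => z _.
  exact: (kernel_invariance phi0 phiS covM covG gau _ (res0 g)).
(* The value at the net point is bounded with [23 = 5 + 18], and the difference quotient by
   [2 * 18 M t^2 / s = 144 V M t]. *)
pose a (i : nat) : R := if i is _.+1 then 144 * V * M * t else 23 * (M * t ^+ 2).
have a0 i : 0 < a i.
  case: i => [|i]; rewrite /a; first by apply: (mulr_gt0 _ (mulr_gt0 M0 (exprn_gt0 _ t0))); rewrite ltr0n.
  by apply: (mulr_gt0 (mulr_gt0 (mulr_gt0 _ V0) M0) t0); rewrite ltr0n.
pose B f : set Omega := [set w | forall i : 'I_n.+1, `|functional (probe (xc f) s v i) (F w)| <= a i].
have mB f : measurable (B f).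
  have -> : B f = \bigcap_(i in [set: 'I_n.+1]) ((fun w => functional (probe (xc f) s v i) (F w)) @^-1` `[- a i, a i]%classic).
    apply/seteqP; split => w /=.
      by move=> H i _ /=; rewrite in_itv/= -ler_norml; exact: H.
    by move=> H i; have := H i I; rewrite /= in_itv/= -ler_norml.
  apply: fin_bigcap_measurable => [|i _]; first exact: finite_finset.
  by rewrite -[X in measurable X]setTI; apply: (measurable_functional _) => //; exact: measurable_itv.
have PB f : fine (P (B f)) <= 368 * (M * t ^+ 2) * (2304 * V * M * t) ^+ n.
  apply: le_trans (small_ball gau (Y := probe (xc f) s v) (p := n.+1) (a := a) _ a0 (mB f) _) _.
  - by apply: (probe_variance phi0 phiS rr1 covM covG gau (xc f) ov s0 V0 vV small).
  - by move=> w Bw i ilt; exact: (Bw (Ordinal ilt)).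
  rewrite big_ord_recl/= (eq_bigr (fun=> 2304 * V * M * t)) => [|i _]; last by rewrite /a/=; ring.
  by rewrite prodr_const card_ord le_eqVlt; apply/orP; left; apply/eqP; ring.
have [N0 [mN0 PN0 HN0]] := ae_good.
have mA' : measurable (A `\` N0) by exact: measurableD.
have PA : fine (P A) <= fine (P (A `\` N0)).
  rewrite -lee_fin !fineK ?fin_num_measure//.
  apply: (@le_trans _ _ (P (N0 `|` (A `\` N0)))).
    apply: le_measure; rewrite ?inE//; first exact: measurableU.
    by move=> w Aw; have [?|?] := pselect (N0 w); [left|right].
  apply: (le_trans (measureU2 _ mN0 mA')).
  by rewrite -[X in (_ <= X)%E]add0e; apply: leeD; rewrite // -[leRHS]PN0.
have cover : forall w, (A `\` N0) w -> exists f, B f w.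
  move=> w [Aw nN]; have gw : good w by apply: contrapT => ng; apply: nN; apply: HN0.
  have [y yW [Fy Fyv]] := HA w Aw; have [g gg yg] := gsD y yW.
  have gb i : (i < n)%N -> `|gam Gm g (v i) / s| <= m%:R * W * V / s.
    move=> ilt; rewrite normrM normfV (gtr0_norm s0) ler_wpM2r ?invr_ge0 ?(ltW s0)//.
    apply: le_trans (gam_le phi0 phiS rr1 covM g (v i)) _; apply: ler_pM; rewrite ?enorm_ge0// ?vV//.
    by apply: le_trans (enorm_le_norm _) _; rewrite ler_wpM2l// gsW.
  pose c i := Num.floor (gam Gm g (v i) / s).
  have cK i : (i < n)%N -> (`|c i| <= K%:Z)%R.
    move=> ilt; have := gb i ilt; rewrite !ler_norml => /andP[b1 b2]; apply/andP; split.
      by rewrite /c floor_ge_int rmorphN/= -pmulrn; apply: le_trans b1; rewrite lerN2 ltW.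
    rewrite -(ler_int R) -pmulrn; apply: le_trans (ge_floor _) _; exact: le_trans b2 (ltW K2).
  have cf : forall i : 'I_n, exists j : 'I_(2 * K).+1, (j : nat)%:Z = c i + K%:Z.
    by move=> i; exact: ord_of_bounded_int (cK i (ltn_ord i)).
  have [f Hf] := choice cf.
  pose ff := [ffun i => f i] : {ffun 'I_n -> 'I_(2 * K).+1}.
  have ffE i : ((ff i)%:R - K%:R : R) = (c i)%:~R.
    rewrite ffunE; have := congr1 (fun x : int => x%:~R : R) (Hf i); rewrite intrD -!pmulrn => ->; ring.
  have ffm : ff \in enum {: {ffun 'I_n -> 'I_(2 * K).+1}} by rewrite mem_enum.
  have close : `|xc ff - \sum_(i < n) gam Gm g (v i) *: v i| <= t / 4.
    rewrite /xc -sumrB -sV4.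
    apply: le_trans (ler_norm_sum _ _ _) _.
    apply: (@le_trans _ _ (\sum_(i < n) s * enorm (v i))); last by rewrite -mulr_sumr ler_wpM2l ?(ltW s0)// /V lerDl.
    apply: ler_sum => i _; rewrite -scalerBl normrZ ffE; apply: ler_pM => //; last exact: norm_le_enorm.
    exact: scaled_floor.
  (* The net point, moved by the null component of [g] and by [z], is at distance at most [3 t / 4]
     from the degenerate point [y]. *)
  have near_y z : z \in zs -> `|F w (xc ff + z) - F w y| <= 18 * (M * t ^+ 2).
    move=> zz; rewrite -(gw ff ffm g gg z zz).
    have -> : xc ff + z + kap g = y + ((g - y) + (xc ff - \sum_(i < n) gam Gm g (v i) *: v i) + z).
      rewrite /kap /gam_residue; set S := \sum_(i < n) _.
      apply/eqP; rewrite -subr_eq0; apply/eqP; rewrite !opprD !opprK.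
      by apply/rowP => j; rewrite !mxE; set a1 := xc ff _ _; set a2 := S _ _; ring.
    apply: Fyv; apply: le_trans (ler_normD _ _) _.
    have h1 := ler_normD (g - y) (xc ff - \sum_(i < n) gam Gm g (v i) *: v i).
    have h2 := zsP z zz; rewrite (distrC y g) in yg; clear - h1 h2 yg close t0; lra.
  have zs0 : 0 \in zs by rewrite inE eqxx.
  have zsp i : (i < n)%N -> s *: v i \in zs.
    move=> ilt; rewrite inE mem_cat; apply/orP; right; apply/orP; left; apply/mapP.
    by exists (Ordinal ilt); rewrite ?mem_enum.
  have zsn i : (i < n)%N -> - (s *: v i) \in zs.
    move=> ilt; rewrite inE mem_cat; apply/orP; right; apply/orP; right; apply/mapP.
    by exists (Ordinal ilt); rewrite ?mem_enum.
  exists ff => -[[|i] ilt] /=; rewrite /functional.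
    rewrite big_seq1/= mul1r; have n0 := near_y 0 zs0; rewrite addr0 in n0.
    have n1 := ler_normD (F w (xc ff) - F w y) (F w y); rewrite subrK in n1.
    by clear - n0 n1 Fy; lra.
  rewrite big_cons big_seq1/= mulNr -mulrBr normrM gtr0_norm ?invr_gt0// ler_pdivrMl//.
  have il : (i < n)%N by rewrite -ltnS.
  have n1 := near_y _ (zsp i il); have n2 := near_y _ (zsn i il).
  have n3 := ler_normB (F w (xc ff + s *: v i) - F w y) (F w (xc ff - s *: v i) - F w y).
  rewrite opprB addrA subrK in n3.
  have -> : s * (144 * V * M * t) = 36 * (M * t ^+ 2) by rewrite /s; field; rewrite gt_eqF.
  by clear - n1 n2 n3; lra.
apply: (le_trans PA); apply: (le_trans (union_bound P mA' mB cover)).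
apply: (le_trans (ler_sum _ (fun f _ => PB f))).
rewrite sumr_const card_ffun !card_ord -[_ *+ _]mulr_natl natrX.
(* The net has [O((W / t)^n)] points and each event has probability [O(M t^2 (M t)^n)]; a factor
   [t^2] remains. *)
have KB : (2 * K).+1%:R <= C1 * W / t.
  rewrite -natr1 natrM.
  have h1 : K%:R <= m%:R * W * V / s + 1 by rewrite /K -natr1 lerD2r.
  have h2 : m%:R * W * V / s = 4 * m%:R * V ^+ 2 * (W / t) by rewrite /s; field; rewrite !gt_eqF.
  have h3 : 1 <= W / t by rewrite ler_pdivlMr// mul1r (le_trans t1).
  have -> : C1 * W / t = 8 * m%:R * V ^+ 2 * (W / t) + 5 * (W / t) by rewrite /C1; field; rewrite gt_eqF.
  by rewrite h2 in h1; lra.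
apply: (@le_trans _ _ ((C1 * W / t) ^+ n * (368 * (M * t ^+ 2) * (2304 * V * M * t) ^+ n))).
  have c1 : 0 <= 368 * (M * t ^+ 2) by exact: (mulr_ge0 (ltW big1) (mulr_ge0 (ltW M0) (sqr_ge0 _))).
  have c2 : 0 <= 2304 * V * M * t. by exact: (mulr_ge0 (mulr_ge0 (ltW big0) (ltW M0)) (ltW t0)).
  apply: ler_wpM2r; first exact: (mulr_ge0 c1 (exprn_ge0 _ c2)).
  by apply: lerXn2r; rewrite ?nnegrE// divr_ge0 ?mulr_ge0 ?(ltW C10) ?(ltW W0) ?(ltW t0).
have -> : (C1 * W / t) ^+ n * (368 * (M * t ^+ 2) * (2304 * V * M * t) ^+ n) =
  368 * (C1 * (2304 * V)) ^+ n * (W ^+ n * M ^+ n.+1 * t ^+ 2).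
  have -> : (C1 * W / t) ^+ n * (368 * (M * t ^+ 2) * (2304 * V * M * t) ^+ n) =
    368 * (M * t ^+ 2) * ((C1 * W / t) * (2304 * V * M * t)) ^+ n by rewrite [((C1 * W / t) * _) ^+ n]exprMn; ring.
  have -> : (C1 * W / t) * (2304 * V * M * t) = (C1 * (2304 * V)) * (W * M) by field; rewrite gt_eqF.
  move: (C1 * (2304 * V)) => D0.
  by rewrite [(D0 * _) ^+ n]exprMn [(W * M) ^+ n]exprMn [M ^+ n.+1]exprS; ring.
have E0 : 0 <= 368 * (C1 * (2304 * V)) ^+ n.
  exact: (mulr_ge0 (ltW big1) (exprn_ge0 _ (mulr_ge0 (ltW C10) (ltW big0)))).
move: (368 * _) E0 => E E0.
rewrite -[leRHS]mulrA -[leRHS]mulrA; apply: (ler_wpM2l E0); rewrite mulrA.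
apply: (ler_wpM2r (sqr_ge0 _)); apply: ler_pM.
- exact: exprn_ge0 (ltW W0).
- exact: exprn_ge0 (ltW M0).
- exact: ler_weXn2l.
- exact: ler_weXn2l.
Qed.

End NondegeneracyProbability.

(** * Counting nodal domains *)

Lemma fset_set_count (R : realType) (T : choiceType) (A B : set T) : finite_set B -> A `<=` B ->
  (#|` fset_set A|)%:R = \sum_(C <- fset_set B) (`[< A C >])%:R :> R.
Proof.
move=> fB AB; have fA := sub_finite_set AB fB.
have p : perm_eq (fset_set A) [seq C <- fset_set B | `[< A C >]].
  apply: uniq_perm; rewrite ?filter_uniq ?fset_uniq// => C.
  rewrite mem_filter !in_fset_set//; apply/idP/andP => [|[/asboolP AC _]].
    by move=> /set_mem AC; split; [exact/asboolP|exact/mem_set/AB].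
  exact: mem_set.
rewrite (perm_size p) size_filter -sum1_count big_mkcond natr_sum.
by apply: eq_bigr => C _; case: (`[< A C >]).
Qed.

Lemma sum_seq_cst (R : realType) (T : Type) (s : seq T) (c : R) : \sum_(z <- s) c = c * (size s)%:R.
Proof. by rewrite big_const_seq count_predT iter_addr_0 mulr_natr. Qed.

Lemma fibre_count (R : realType) (T : eqType) (T' : choiceType) (s : seq T) (g : T -> T') (A : set T') (c : R) :
  finite_set A -> (forall D, D \in s -> A (g D)) ->
  (forall z, A z -> (size [seq D <- s | g D == z])%:R <= c) -> (size s)%:R <= c * (#|` fset_set A|)%:R.
Proof.
move=> fA sA H.
have -> : (size s)%:R = \sum_(z <- fset_set A) (size [seq D <- s | g D == z])%:R :> R.
  rewrite (eq_bigr (fun z => \sum_(D <- s) (g D == z)%:R)) => [|z _]; last first.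
    rewrite size_filter -sum1_count big_mkcond natr_sum.
    by apply: eq_bigr => D _; case: (g D == z).
  rewrite exchange_big/= -sum1_size natr_sum !big_seq; apply: eq_bigr => D /sA AgD.
  rewrite (bigD1_seq (g D)) ?fset_uniq ?in_fset_set ?inE//= eqxx big1 ?addr0// => z.
  by rewrite eq_sym => /negPf ->.
rewrite -sum_seq_cst !big_seq; apply: ler_sum => z.
by rewrite in_fset_set// inE; exact: H.
Qed.

Lemma atleast_fset (T : choiceType) (D : set T) : finite_set D -> atleast D #|` fset_set D|.
Proof.
move=> fD; exists (fset_set D); split => [|//|C]; first exact: fset_uniq.
by rewrite in_fset_set// inE.
Qed.

Lemma atleast_le_card (T : choiceType) (D : set T) k : finite_set D -> atleast D k -> (k <= #|` fset_set D|)%N.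
Proof.
move=> fD [s [us <- sD]]; apply: uniq_leq_size => // C /sD DC.
by rewrite in_fset_set// inE.
Qed.

Section DomainCounting.
Variables (R : realType) (m : nat).
Local Notation vec := 'rV[R]_m.
Local Notation lat := 'rV[int]_m.
Implicit Types (f : vec -> R) (x y p q : vec) (B D : set vec).

Definition shift q f : vec -> R := fun y => f (q + y).

Lemma shiftK q f : shift (- q) (shift q f) = f.
Proof. by apply/funext => y; rewrite /shift addrA subrr add0r. Qed.

Lemma continuous_translation q : continuous (fun y : vec => q + y).
Proof. move=> y; have H := @cvgD R vec vec (nbhs y) _ (fun=> q) id q y (cvg_cst _) (@cvg_id _ (nbhs y)).
exact: H. Qed.

Lemma continuous_shift q f : continuous f -> continuous (shift q f).
Proof.
move=> cf y; apply: continuous_comp; last exact: cf.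
exact: continuous_translation.
Qed.

Lemma domain_shift_sub f q x y : domain (shift q f) x y -> domain f (q + x) (q + y).
Proof.
move=> [C [Cx CA cC] Cy]; exists ((fun y => q + y) @` C); last by exists y.
split; first by exists x.
  by move=> _ [z Cz <-]; exact: CA.
apply: connected_continuous_connected => //; apply: continuous_subspaceT => z.
exact: continuous_translation.
Qed.

Lemma domain_shift f q x : domain (shift q f) x = [set y | domain f (q + x) (q + y)].
Proof.
apply/seteqP; split => y; first exact: domain_shift_sub.
move=> /= H; have := @domain_shift_sub (shift q f) (- q) (q + x) (q + y).
by rewrite shiftK !addKr; exact.
Qed.

Lemma closure_shift D q y : closure D y -> closure [set z | D (q + z)] (y - q).
Proof.
move=> Dy; pose K : set vec := [set y | closure [set z | D (q + z)] (y - q)].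
have cK : closed K.
  apply: (@preimage_closed _ _ (fun y : vec => y - q)); last exact: closed_closure.
  move=> z _.
  have H := @cvgD R vec vec (nbhs z) _ id (fun=> - q) z (- q) (@cvg_id _ (nbhs z)) (cvg_cst _).
  exact: H.
move: Dy; rewrite closureE => /(_ K); apply; split => // z Dz.
by apply: subset_closure => /=; rewrite addrC subrK.
Qed.

Lemma atleast_shift f q B k : atleast (ndomains (shift q f) B) k ->
  atleast (ndomains f [set y | B (y - q)]) k.
Proof.
apply: (@atleast_map _ _ _ _ (fun C => [set y | C (y - q)])) => [C [[x fx ->] CB]|C C' _ _ E].
  have E : [set y | domain (shift q f) x (y - q)] = domain f (q + x).
    by rewrite domain_shift; apply/seteqP; split => y /=; rewrite [q + (y - q)]addrC subrK.
  rewrite E; split; first by exists (q + x).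
  move=> y cy; have H := @closure_shift _ q y cy; apply: CB; rewrite domain_shift; exact: H.
apply/seteqP; split => y Cy.
  have : [set y | C (y - q)] (q + y) by rewrite /= addrC addKr.
  by rewrite E /= addrC addKr.
have : [set y | C' (y - q)] (q + y) by rewrite /= addrC addKr.
by rewrite -E /= addrC addKr.
Qed.

Lemma atleast_shift_eball f q (rho : R) k : atleast (ndomains (shift q f) (eball 0 rho)) k <->
  atleast (ndomains f (eball q rho)) k.
Proof.
split=> [/atleast_shift|H].
  have -> // : [set y | eball 0 rho (y - q)] = eball q rho.
  by apply/seteqP; split => y; rewrite /eball/= subr0.
have := @atleast_shift (shift q f) (- q) (eball q rho) k; rewrite shiftK => /(_ H).
have -> // : [set y | eball q rho (y - - q)] = eball 0 rho.
by apply/seteqP; split => y; rewrite /eball/= opprK addrK subr0.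
Qed.

Lemma regular_on_shift W W' M q f : `|q| + W' <= W -> regular_on W M f -> regular_on W' M (shift q f).
Proof.
move=> qW [r1 r2 r3].
have qy y : `|y| <= W' -> `|q + y| <= W by move=> yW; apply: le_trans (ler_normD _ _) _; lra.
split => [y yW|y z yW zW|y v yv ymv]; rewrite /shift.
- exact/r1/qy.
- by have := r2 _ _ (qy _ yW) (qy _ zW); rewrite opprD addrACA subrr add0r.
- by rewrite !addrA; apply: r3; rewrite -addrA; exact: qy.
Qed.

Lemma nondegenerate_on_shift W W' M t u s q f : `|q| + W' <= W ->
  nondegenerate_on W M t u s f -> nondegenerate_on W' M t u s (shift q f).
Proof.
move=> qW H y yW fy; have [||v vt Hv] := H (q + y).
- by apply: le_trans (ler_normD _ _) _; lra.
- exact: fy.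
by exists v => //; rewrite /shift addrA.
Qed.

Lemma nondegenerate_weaken W M t f : 0 < M ->
  nondegenerate_on W M t 4 16 f -> nondegenerate_on W M t 3 14 f.
Proof.
move=> M0 H y yW fy; have q0 : 0 <= M * t ^+ 2 by rewrite mulr_ge0 ?sqr_ge0 ?ltW.
have [||v vt Hv] := H y => //; first by lra.
by exists v => //; lra.
Qed.

Definition ncount f B : nat := #|` fset_set (ndomains f B)|.

Lemma summit_of_domain f C B (M : R) : continuous f -> (forall y, B y -> `|y| <= M) -> ndomains f B C ->
  exists p, [/\ f p != 0, C = domain f p, C p & forall y, C y -> `|f y| <= `|f p|].
Proof.
move=> cf BM [[x fx ->] CB].
have DM y : domain f x y -> `|y| <= M by move=> xy; exact/BM/CB/subset_closure.
wlog fx0 : f x fx cf CB DM / 0 < f x => [H|].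
  have [f0|f0] := ltP 0 (f x); first exact: H.
  have [|||||p] := H (fun y => - f y) x.
  - by move=> /= /eqP; rewrite oppr_eq0 => /eqP.
  - exact: continuous_oppf.
  - by rewrite domainN.
  - by rewrite domainN.
  - by rewrite oppr_gt0 lt_neqAle f0 andbT; apply/eqP.
  rewrite !domainN => -[fp E xp Hp]; exists p; split => //; first by rewrite -oppr_eq0.
  by move=> y xy; have := Hp y xy; rewrite !normrN.
have [p xp Hp] := domain_max cf fx0 DM.
have fp := domain_gt0 cf fx0 xp.
exists p; split => //; first by rewrite gt_eqF.
  exact: same_domain.
by move=> y xy; rewrite !gtr0_norm ?Hp//; exact: domain_gt0 xy.
Qed.

Lemma summits_near q C L f (s : seq (set vec)) : helmholtz C L f -> uniq s ->
  (forall D, D \in s -> exists p, [/\ f p != 0, D = domain f p, `|p - q| <= 1 &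
     forall y, D y -> `|f y| <= `|f p|]) ->
  (size s)%:R <= 2 * volbound m (3 : R).
Proof.
move=> hf us Hs; pose T D : set vec := [set y | D (q + y)].
have injT D D' : T D = T D' -> D = D'.
  move=> E; apply/seteqP; split => y Dy.
    have : T D (y - q) by rewrite /T/= addrC subrK.
    by rewrite E /T/= addrC subrK.
  have : T D' (y - q) by rewrite /T/= addrC subrK.
  by rewrite -E /T/= addrC subrK.
have := @summits_in_cell _ _ C L (shift q f) (map T s) (helmholtz_translate q hf).
rewrite size_map map_inj_in_uniq => [|D D' _ _]; last exact: injT.
apply => // _ /mapP[D Ds ->]; have [p [fp E pq Hp]] := Hs D Ds.
have qp : q + (p - q) = p by rewrite addrC subrK.
exists (p - q); rewrite /shift qp; split => //.
- by rewrite /T E -/(shift q f) domain_shift qp.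
- by move=> y; rewrite /T/= => /Hp.
Qed.

End DomainCounting.

(** * Double counting of domains and lattice windows *)

Section LatticeOfDomains.
Variables (R : realType) (m : nat) (h : R).
Hypothesis h0 : 0 < h.
Hypothesis h1 : h <= 1.
Local Notation vec := 'rV[R]_m.
Local Notation lat := 'rV[int]_m.
Local Notation cnt rho := (latcount R (lball h (0 : vec) rho)).
Variables (C L : R) (f : vec -> R).
Hypothesis hf : helmholtz C L f.
Implicit Types (x y p q : vec) (D : set vec) (rho : R).

Let cf : continuous f := helmholtz_continuous hf.

Definition summit_at D p := [/\ f p != 0, D = domain f p, D p & forall y, D y -> `|f y| <= `|f p|].
(** A chosen maximum point of [|f|], which assigns the domain to one lattice cell; by [topP] the
    default 0 is irrelevant for domains in a ball. *)
Definition top D : vec := xget 0 (summit_at D).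

Lemma eball_norm rho y : eball 0 rho y -> `|y| <= rho.
Proof. by rewrite /eball/= subr0 => /ltW; apply: le_trans (norm_le_enorm _). Qed.

Lemma topP rho D : ndomains f (eball 0 rho) D -> summit_at D (top D).
Proof.
move=> DB; have [p Hp] := summit_of_domain cf (@eball_norm rho) DB.
exact: (xgetI _ Hp).
Qed.

(** Tops that round to the same lattice point are within distance [h <= 1] of it, so [summits_near]
    bounds their number. *)
Lemma cells_bound (A : set lat) (s : seq (set vec)) : finite_set A -> uniq s ->
  (forall D, D \in s -> summit_at D (top D) /\ A (round h (top D))) ->
  (size s)%:R <= 2 * volbound m (3 : R) * latcount R A.
Proof.
move=> fA us Hs; rewrite latcountE; apply: (fibre_count (g := fun D => round h (top D))) => //.
  by move=> D /Hs[].
move=> z Az; apply: (summits_near (q := h *: emb R z) hf); first exact: filter_uniq.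
move=> D; rewrite mem_filter => /andP[/eqP <- /Hs[[fp E Dp Hp] _]].
by exists (top D); split => //; exact: le_trans (round_norm h0 _) h1.
Qed.

Lemma round_ball rho D : ndomains f (eball 0 rho) D ->
  lball h 0 (rho + m%:R * h) (round h (top D)).
Proof.
move=> DB; have [_ _ Dp _] := topP DB.
have pB : eball 0 rho (top D) by case: DB => _; apply; exact: subset_closure.
move: pB; rewrite /lball /eball/= !subr0 => pB.
have := ler_enormB (h *: emb R (round h (top D))) (top D); rewrite enormB.
have := round_enorm h0 (top D); lra.
Qed.

Lemma domains_atleast rho k : atleast (ndomains f (eball 0 rho)) k ->
  k%:R <= 2 * volbound m (3 : R) * cnt (rho + m%:R * h).
Proof.
move=> [s [us <- sD]]; apply: cells_bound => //; first exact: lball_finite.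
by move=> D /sD DB; split; [exact: topP DB|exact: round_ball].
Qed.

Lemma domains_finite rho : finite_set (ndomains f (eball 0 rho)).
Proof.
pose K := (Num.trunc (2 * volbound m (3 : R) * cnt (rho + m%:R * h))).+1.
apply: (proj1 (@atleast_finite _ _ K _)) => /domains_atleast H.
have v0 : 0 <= 2 * volbound m (3 : R) * cnt (rho + m%:R * h) by apply: le_trans H.
have /andP[_ H2] := truncn_itv v0; rewrite -/K in H2.
by move: H; rewrite -natr1; lra.
Qed.

Lemma eball_sub x y (r1 r2 : R) : enorm (x - y) + r1 <= r2 -> eball x r1 `<=` eball y r2.
Proof.
move=> H z; rewrite /eball/= => zx; have := ler_enormD (z - x) (x - y).
by rewrite addrA subrK; lra.
Qed.

Lemma domains_finite_at x rho : finite_set (ndomains f (eball x rho)).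
Proof.
apply: (sub_finite_set _ (domains_finite (rho + enorm x))); apply: ndomainsS.
by apply: eball_sub; rewrite subr0 addrC.
Qed.

Lemma ncount_sum x rho (r : R) : enorm x + rho <= r -> (ncount f (eball x rho))%:R =
  \sum_(D <- fset_set (ndomains f (eball 0 r))) (`[< ndomains f (eball x rho) D >])%:R :> R.
Proof.
move=> H; apply: fset_set_count; first exact: domains_finite.
by apply: ndomainsS; apply: eball_sub; rewrite subr0.
Qed.

Lemma latsum_asbool (A : set lat) (Q : lat -> Prop) : finite_set A ->
  latsum A (fun z => (`[< Q z >])%:R : R) = latcount R [set z | A z /\ Q z].
Proof.
move=> fA; rewrite latcountE (@fset_set_count R _ _ A) => [||z []]//.
rewrite /latsum !big_seq; apply: eq_bigr => z; rewrite in_fset_set// inE => Az.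
by congr (_ %:R); congr nat_of_bool; apply/asboolP/asboolP => [?|[]].
Qed.

(** A domain is seen only from windows that contain its top, and there are at most [cnt (rho + m h)]
    of these. *)
Lemma count_lower r rho : latsum (lball h (0 : vec) r) (fun z => (ncount f (eball (h *: emb R z) rho))%:R) <=
  (ncount f (eball 0 (r + rho)))%:R * cnt (rho + m%:R * h).
Proof.
have fL := lball_finite h0 (0 : vec) r.
apply: (@le_trans _ _ (latsum (lball h (0 : vec) r) (fun z =>
  \sum_(D <- fset_set (ndomains f (eball 0 (r + rho)))) (`[< ndomains f (eball (h *: emb R z) rho) D >])%:R))).
  apply: ler_latsum => // z; rewrite /lball/= subr0 => zr.
  by rewrite -ncount_sum// lerD2r ltW.
rewrite latsum_sum /ncount mulrC -sum_seq_cst !big_seq; apply: ler_sum => D.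
rewrite in_fset_set ?inE; last exact: domains_finite.
move=> DB; have [_ _ Dp _] := topP DB.
rewrite latsum_asbool//; apply: le_trans (lball_count_le h0 (top D) rho).
apply: ler_latcount; first exact: lball_finite.
move=> z [_ [_ DB']]; have := DB' _ (subset_closure Dp).
by rewrite /eball /lball/= enormB.
Qed.

Lemma vol_shift n (w : lat) (A : set vec) (s : R) : (0 < n)%N -> 0 <= s -> A `<=` cube 0 s ->
  vol n [set y | A (mesh R m n *: emb R w + y)] = vol n A.
Proof.
move=> n0 s0 As; rewrite /vol; congr (_ * _).
have fA : finite_set [set z : lat | A (mesh R m n *: emb R z)].
  apply: sub_finite_set (cube_finite m n0 s0).1; move=> z; exact: As.
rewrite /latcount -[RHS](addr0) addr0 -[RHS]/(latsum _ ((fun=> 1) \o (fun z => z + - w))).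
rewrite [RHS]latsum_shift//; congr latsum; apply/seteqP; split => z /=;
  by rewrite opprK embD scalerDr addrC.
Qed.

Lemma closure_cube D p (w : R) : D `<=` cube p w -> closure D `<=` cube p w.
Proof.
move=> Dw y cy; rewrite /cube/=; apply/ler_addgt0Pr => e e0.
have [z [Dz]] := cy _ (nbhsx_ballx y e e0); rewrite -ball_normE/= => yz.
have := ler_normD (y - z) (z - p); rewrite addrA subrK; have := Dw z Dz; rewrite /cube/=; lra.
Qed.

(* A small domain is seen from every lattice point in a ball around its top. *)
Lemma local_count r rho (w : R) (s : seq (set vec)) : 0 <= w -> uniq s ->
  (forall D, D \in s -> ndomains f (eball 0 r) D /\ D `<=` cube (top D) w) ->
  (size s)%:R * cnt (rho - m%:R * w - m%:R * h) <=
  latsum (lball h (0 : vec) (r + rho)) (fun z => (ncount f (eball (h *: emb R z) rho))%:R).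
Proof.
move=> w0 us Hs; set A := lball h 0 (r + rho).
have fA : finite_set A by exact: lball_finite.
pose T := fset_set (ndomains f (eball 0 (r + rho + rho))).
apply: (@le_trans _ _ (latsum A (fun z =>
  \sum_(D <- T) (`[< ndomains f (eball (h *: emb R z) rho) D >])%:R))); last first.
  apply: ler_latsum => // z; rewrite /A /lball/= subr0 => zr.
  by rewrite (@ncount_sum _ rho (r + rho + rho))// lerD2r ltW.
rewrite latsum_sum mulrC -sum_seq_cst.
(* For negative [rho] the lattice ball counted on the left is empty. *)
have [rho0|rho0] := ltP rho 0.
  rewrite big1_seq => [|D /andP[_ /Hs[DB _]]]; last first.
    rewrite latcountE (_ : lball _ _ _ = set0) ?fset_set0//.
    apply/seteqP; split => z //; rewrite /lball/= => H.
    have := enorm_ge0 (h *: emb R z - 0).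
    have : 0 <= m%:R * w :> R by rewrite mulr_ge0.
    have : 0 <= m%:R * h :> R by rewrite mulr_ge0// ltW.
    lra.
  by apply: sumr_ge0 => D _; apply: latsum_ge0 => z.
have sT D : D \in s -> D \in T.
  move=> /Hs[DB _]; rewrite in_fset_set; last exact: domains_finite.
  by rewrite inE; apply: ndomainsS DB; apply: eball_sub; rewrite subrr enorm0; lra.
have p1 : perm_eq [seq D <- T | D \in s] s.
  apply: uniq_perm; rewrite ?filter_uniq ?fset_uniq// => D.
  by rewrite mem_filter; case sD : (D \in s); rewrite // sT.
apply: (@le_trans _ _ (\sum_(D <- s) latsum A (fun z => (`[< ndomains f (eball (h *: emb R z) rho) D >])%:R))); last first.
  rewrite -(perm_big _ p1)/= big_filter [leRHS](bigID (fun D => D \in s))/= lerDl.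
  by apply: sumr_ge0 => D _; apply: latsum_ge0 => z.
rewrite !big_seq; apply: ler_sum => D /Hs[DB Dw].
rewrite latsum_asbool//; apply: le_trans (lball_count_ge h0 (top D) _) _.
have [_ _ Dp _] := topP DB.
have pB : enorm (top D) < r.
  by have := (proj2 DB) _ (subset_closure Dp); rewrite /eball/= subr0.
apply: ler_latcount.
  by apply: sub_finite_set fA => z [].
move=> z; rewrite /lball/= => zp.
have mw : 0 <= m%:R * w by rewrite mulr_ge0.
split.
  by rewrite /A /lball/= subr0; have := ler_enormB (h *: emb R z) (top D); lra.
split; first by case: DB.
move=> y /(closure_cube Dw); rewrite /cube/= => yw.
rewrite /eball/=; have := ler_enormD (y - top D) (top D - h *: emb R z).
rewrite addrA subrK (enormB (top D)).
have := enorm_le_norm (y - top D).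
have : m%:R * `|y - top D| <= m%:R * w by rewrite ler_wpM2l.
lra.
Qed.

Definition good W M t (g : vec -> R) := regular_on (W + 1) M g /\ nondegenerate_on W M t 4 16 g.

(** Each of these domains has volume at least [P / 4] by [long_domain_volume], and together they
    share the volume of a cube of radius [r]; for large [P] they are few. *)
Lemma long_count r (W M t : R) (P J : nat) (s : seq (set vec)) : 0 <= r -> (0 < P)%N ->
  0 < M -> 0 < t -> t <= 1 -> (1 / 2) ^+ J <= t ^+ 2 -> W = P%:R * (6 * J%:R + 6) -> uniq s ->
  (forall D, D \in s -> [/\ ndomains f (eball 0 r) D,
     good (W + 2) M t (shift (h *: emb R (round h (top D))) f) & ~ D `<=` cube (top D) (W + 1)]) ->
  (size s)%:R <= 4 / P%:R * volbound m r.
Proof.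
move=> r0 P0 M0 t0 t1 Jt WE us Hs.
have P0' : 0 < P%:R :> R by rewrite ltr0n.
have W0 : 0 <= W by rewrite WE mulr_ge0// addr_ge0// mulr_ge0.
have e0 : 0 < M * (1 / 2) ^+ J / 8 by rewrite divr_gt0// mulr_gt0// exprn_gt0// divr_gt0.
have [C0 L0 _ _] := hf.
have [n [n0 mn1 n1 errn]] := filter_ex (err_small m C0 L0 e0).
pose Q D := D `&` cube (0 : vec) r.
have Dr D : ndomains f (eball 0 r) D -> D `<=` cube 0 r.
  by move=> [_ DB] y Dy; rewrite /cube/= subr0; apply: eball_norm; exact/DB/subset_closure.
have big D : D \in s -> P%:R / 4 <= vol n (Q D).
  move=> /Hs[DB [rg ng] nD]; have [fp E Dp Hp] := topP DB.
  have [c Dc cp] : exists2 c, D c & W + 1 < `|c - top D|.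
    apply: contrapT => H; apply: nD => y Dy; rewrite /cube/= leNgt; apply/negP => yp.
    by apply: H; exists y.
  (* The centre is put on the mesh lattice, whose translations preserve [vol]. It is within 2 of the
     centre of the good window, whence the margin in [W + 2]. *)
  pose w := round (mesh R m n) (top D); pose q := mesh R m n *: emb R w.
  have mesh0 := mesh_gt0 R m n0.
  have pq : `|top D - q| <= 1 by apply: le_trans (round_norm mesh0 _) n1.
  have ph : `|top D - h *: emb R (round h (top D))| <= 1 by apply: le_trans (round_norm h0 _) h1.
  set zz := h *: emb R _ in rg ng ph.
  have qz : `|q - zz| <= 2.
    have -> : q - zz = (q - top D) + (top D - zz) by rewrite addrA subrK.
    by apply: le_trans (ler_normD _ _) _; rewrite distrC; lra.
  have sE : shift q f = shift (q - zz) (shift zz f).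
    by apply/funext => y; rewrite /shift addrA [zz + _]addrC subrK.
  have rq : regular_on (W + 1) M (shift q f).
    by rewrite sE; apply: (regular_on_shift _ rg); lra.
  have nq : nondegenerate_on W M t 3 14 (shift q f).
    apply: nondegenerate_weaken M0 _.
    by rewrite sE; apply: (nondegenerate_on_shift _ ng); lra.
  have qx : q + (top D - q) = top D by rewrite addrC subrK.
  have hq := helmholtz_translate q hf.
  have DE : domain (shift q f) (top D - q) = [set y | D (q + y)] by rewrite domain_shift qx -E.
  have cq : W <= `|c - q|.
    have := ler_normD (c - q) (q - top D); rewrite addrA subrK (distrC q); lra.
  have := @long_domain_volume _ _ C L (shift q f) (W + 1) W M t (top D - q) (top D - q) (c - q) P J n hq.
  rewrite -WE; move=> /(_ M0 t0 t1 rq nq) H.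
  have {}H : P%:R / 4 <= vol n (domain (shift q f) (top D - q) `&` cube 0 W).
    apply: H => //.
    - by lra.
    - by rewrite DE/= qx.
    - by rewrite DE/= addrC subrK.
    - by rewrite /nonzero /shift/= qx; apply/eqP.
  apply: le_trans H _; rewrite DE -[leRHS](@vol_shift n w _ r)//; last by move=> y [].
  apply: (@vol_le _ _ _ _ _ (r + `|q|)) => //.
  - by rewrite addr_ge0.
  - move=> y [_]; rewrite /cube/= !subr0 -/q => yr.
    by have := ler_normB (q + y) q; rewrite [q + y - q]addrAC subrr add0r; lra.
  - by move=> y [/= Dy _]; split => //; exact: Dr Dy.
have tot : \sum_(D <- s) vol n (Q D) <= vol n (cube (0 : vec) r).
  apply: (@vol_disjoint _ _ _ _ _ _ _ r) => // [D|y]; first by move=> y [].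
  apply: (same_domain_sum (f := f)) => // [D|D y'].
    by move=> /Hs[[[x _ ->] _] _ _]; exists x.
  by case.
have := (cube_finite m n0 r0).2.
have : (size s)%:R * (P%:R / 4) <= \sum_(D <- s) vol n (Q D).
  by rewrite mulrC -sum_seq_cst !big_seq; apply: ler_sum.
move=> b1 b2; have b3 := le_trans b1 (le_trans tot b2).
have -> : 4 / P%:R * volbound m r = volbound m r / (P%:R / 4) by field; rewrite gt_eqF.
by rewrite ler_pdivlMr// divr_gt0.
Qed.

(** Domains are sorted into small ones, counted by [local_count], long ones with a bad window,
    boundedly many per bad lattice point, and long ones with a good window, few by volume. *)
Lemma count_upper r rho (W M t : R) (P J : nat) : 0 <= r -> (0 < P)%N ->
  0 < M -> 0 < t -> t <= 1 -> (1 / 2) ^+ J <= t ^+ 2 -> W = P%:R * (6 * J%:R + 6) ->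
  (ncount f (eball 0 r))%:R * cnt (rho - m%:R * (W + 1) - m%:R * h) <=
  latsum (lball h (0 : vec) (r + rho)) (fun z => (ncount f (eball (h *: emb R z) rho))%:R) +
  cnt (rho - m%:R * (W + 1) - m%:R * h) * (2 * volbound m (3 : R) *
    latcount R [set z | lball h (0 : vec) (r + m%:R * h) z /\ ~ good (W + 2) M t (shift (h *: emb R z) f)] +
    4 / P%:R * volbound m r).
Proof.
move=> r0 P0 M0 t0 t1 Jt WE; set g := cnt _; have g0 : 0 <= g by exact: latcount_ge0.
have W0 : 0 <= W by rewrite WE mulr_ge0// addr_ge0// mulr_ge0.
pose S := fset_set (ndomains f (eball 0 r)).
have SP D : D \in S -> ndomains f (eball 0 r) D.
  by rewrite in_fset_set ?inE//; exact: domains_finite.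
pose loc D := `[< D `<=` cube (top D) (W + 1) >].
pose bad D := `[< ~ good (W + 2) M t (shift (h *: emb R (round h (top D))) f) >].
have -> : ncount f (eball 0 r) = (size [seq D <- S | loc D] + (size [seq D <- [seq D <- S | ~~ loc D] | bad D] +
    size [seq D <- [seq D <- S | ~~ loc D] | ~~ bad D]))%N.
  by rewrite !size_filter count_predC size_filter count_predC.
rewrite !natrD mulrDl lerD//.
  apply: local_count; rewrite ?filter_uniq ?fset_uniq ?addr_ge0// => D.
  by rewrite mem_filter => /andP[/asboolP lD /SP].
rewrite mulrC ler_wpM2l//; apply: lerD.
  apply: cells_bound; rewrite ?filter_uniq ?fset_uniq//.
    by apply: sub_finite_set (lball_finite h0 (0 : vec) (r + m%:R * h)) => z [].
  move=> D; rewrite !mem_filter => /and3P[/asboolP bD _ /SP DB].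
  by split; [exact: topP DB|split; [exact: round_ball|]].
apply: (@long_count r W M t P J) => //; first by rewrite !filter_uniq ?fset_uniq.
move=> D; rewrite !mem_filter => /and3P[/asboolP bD /asboolP lD /SP DB]; split => //.
exact: contrapT.
Qed.

End LatticeOfDomains.

Lemma esum_card (R : realType) (T : choiceType) (D : set T) : finite_set D ->
  (\esum_(C in D) 1 = ((#|` fset_set D|)%:R : R)%:E)%E.
Proof.
move=> fD; rewrite esum_fset// fsbig_finite//= sumEFin.
by rewrite big_const_seq count_predT iter_addr addr0.
Qed.

Lemma esum_gt_atleast (R : realType) (T : choiceType) (D : set T) (j : nat) :
  ((j%:R : R)%:E < \esum_(C in D) 1)%E -> atleast D j.+1.
Proof.
move=> H; apply: contrapT => /atleast_finite[fD Dj]; move: H.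
by rewrite esum_card// lte_fin ltr_nat ltnNge Dj.
Qed.

Lemma atleast_sum (T : choiceType) (D : set T) (b : nat -> bool) (B : nat) :
  (forall j, (j < B)%N -> b j -> atleast D j.+1) -> atleast D (\sum_(j < B) b j).
Proof.
elim: B => [_|B IH H]; first by rewrite big_ord0; exists [::]; split.
rewrite big_ord_recr/=; case bB : (b B).
  apply: atleastW (H B (ltnSn _) bB).
  rewrite addn1 ltnS; have := @leq_sum _ (index_enum 'I_B) xpredT (fun i => nat_of_bool (b i)) (fun=> 1%N) (fun i _ => leq_b1 _).
  by rewrite sum1_card card_ord.
by rewrite addn0; apply: IH => j jB; apply: H; exact: ltnW.
Qed.

Lemma sum_ltn (n B : nat) : (\sum_(j < B) (j < n) = minn n B)%N.
Proof. by elim: B => [|B IH]; rewrite ?big_ord0 ?big_ord_recr/= ?IH; lia. Qed.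

(** A discrete layer cake bound. *)
Lemma le_sum_ltn (R : realType) (B : nat) (x : R) : 0 <= x <= B%:R ->
  x <= \sum_(j < B) (Order.lt (j%:R : R) x)%:R.
Proof.
elim: B => [|B IH] /andP[x0 xB]; first by rewrite big_ord0.
rewrite big_ord_recr/=; have [Bx|xB'] := ltP B%:R x; last by rewrite addr0 IH ?x0.
rewrite (eq_bigr (fun=> 1)) => [|j _]; first by rewrite sumr_const card_ord natr1.
by rewrite (le_lt_trans _ Bx)// ler_nat ltnW.
Qed.

Lemma open_eball (R : realType) (m : nat) (x : 'rV[R]_m) (rho : R) : open (eball x rho).
Proof.
rewrite openE => y; rewrite /eball/= => yr; apply/nbhs_ballP.
have m0 : 0 <= m%:R :> R by [].
pose e := (rho - enorm (y - x)) / (m%:R + 1).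
have m10 : 0 < m%:R + 1 :> R by lra.
exists e => /=; first by rewrite divr_gt0// subr_gt0.
move=> z; rewrite -ball_normE/= distrC => /ltW ze.
have := ler_enormD (z - y) (y - x); rewrite addrA subrK; have := enorm_le_norm (z - y).
have : m%:R * `|z - y| <= m%:R * e by rewrite ler_wpM2l.
have : (m%:R + 1) * e = rho - enorm (y - x) by rewrite /e; field; rewrite gt_eqF.
have : 0 < e by rewrite divr_gt0// subr_gt0.
lra.
Qed.

Section ProbabilityTools.
Variables (R : realType) (d : measure_display) (Omega : measurableType d) (P : probability Omega R).

Lemma ae_part (A : set Omega) (Q : Omega -> Prop) : measurable A -> {ae P, forall w, Q w} ->
  exists A', [/\ measurable A', forall w, A' w -> A w /\ Q w & P A' = P A].
Proof.
move=> mA [N [mN PN HN]]; exists (A `\` N); split; first exact: measurableD.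
  by move=> w [Aw nN]; split => //; apply: contrapT => nQ; apply: nN; exact: HN.
apply/eqP; rewrite eq_le; apply/andP; split.
  exact: (le_measure P (mem_set (measurableD mA mN)) (mem_set mA) (@subDsetl _ _ _)).
apply: (@le_trans _ _ (P (N `|` (A `\` N)))).
  apply: le_measure; rewrite ?inE//; first by apply: measurableU => //; exact: measurableD.
  by move=> w Aw; have [?|?] := pselect (N w); [left|right].
apply: (le_trans (measureU2 _ mN (measurableD mA mN))).
by rewrite -[X in (_ <= X)%E]add0e; apply: leeD; rewrite // -[leRHS]PN.
Qed.

(** The integral of a nonnegative function is a supremum over simple functions below it. This form
    applies to the nodal count, whose measurability is not established. *)
Lemma ge0_integral_mono (f1 f2 : Omega -> \bar R) : (forall w, (0 <= f1 w)%E) ->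
  (forall w, (f1 w <= f2 w)%E) -> (\int[P]_w f1 w <= \int[P]_w f2 w)%E.
Proof.
move=> f10 f12; have f20 w : (0 <= f2 w)%E by exact: le_trans (f12 w).
rewrite !ge0_integralTE//; apply: ereal_sup_le => _ [g Hg <-].
by exists g => // w; exact: le_trans (Hg w) (f12 w).
Qed.

Lemma integral_sum_indic (B : nat) (A : nat -> set Omega) : (forall j, measurable (A j)) ->
  (\int[P]_w (\sum_(j < B) \1_(A j) w)%:E = (\sum_(j < B) fine (P (A j)))%:E)%E.
Proof.
move=> mA.
rewrite (eq_integral (fun w => \sum_(j < B) (\1_(A j) w)%:E))%E => [|w _]; last by rewrite sumEFin.
rewrite ge0_integral_sum//; last by move=> j; apply: measurableT_comp => //; exact: measurable_indic.
rewrite -sumEFin; apply: eq_bigr => j _.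
by rewrite integral_indic// setIT fineK// fin_num_measure.
Qed.

End ProbabilityTools.

(** * Window averages of the sample against the mean for the field *)

Section DomainStatistics.
Variables (R : realType) (m : nat) (h : R) (rr : nat -> 'rV[R]_m) (al : nat -> R).
Variables (phi : nat -> nat) (G : 'rV[R]_m -> R) (Gm : 'I_m -> 'I_m -> R).
Hypothesis h0 : 0 < h.
Hypothesis h1 : h <= 1.
Hypothesis m1 : (1 <= m)%N.
Local Notation vec := 'rV[R]_m.
Local Notation func := (vec -> R).
Local Notation cnt rho := (latcount R (lball h (0 : vec) rho)).
Hypothesis nonres : forall n q, (exists2 l, (l < n)%N & q l != 0) ->
  exists i, forall k : int, h * freq rr n q ord0 i != k%:~R.
Hypothesis phi0 : (0 < phi 0%N)%N.
Hypothesis phiS : forall k, (phi k < phi k.+1)%N.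
Hypothesis rr1 : forall l, enorm (rr l) = 1.
Hypothesis covM : forall i j, average phi k (fun l => rr l ord0 i * rr l ord0 j) @[k --> \oo] --> Gm i j.
Hypothesis covG : forall z, average phi k (fun l => cos (2 * pi * dotv (rr l) z)) @[k --> \oo] --> (G z : R).
Variables (d : measure_display) (Omega : measurableType d) (P : probability Omega R).
Variable F : Omega -> func.
Hypothesis gau : forall (k : nat) (xs : 'I_k -> vec) (cs : 'I_k -> R),
  centered_gaussian P (fun w => \sum_(i < k) cs i * F w (xs i))
    (\sum_(i < k) \sum_(j < k) cs i * cs j * G (xs i - xs j)).
Hypothesis Fc : {ae P, forall w, continuous (F w)}.

Local Notation hit := (hits h rr al phi).
Local Notation fld := (field rr al phi).

Lemma field_helmholtz k : exists C L, helmholtz C L (fld k).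
Proof. by apply: trigsum_helmholtz => l _; exact: rr1. Qed.

Lemma at_point_continuous k x : continuous (at_point rr al phi k x).
Proof.
have [C [L H]] := field_helmholtz k.
exact: continuous_shift (helmholtz_continuous H).
Qed.

Lemma hits_sub (S S1 S2 : set func) k r : (forall f, continuous f -> S f -> S1 f \/ S2 f) ->
  hit S k r <= hit S1 k r + hit S2 k r.
Proof.
move=> H; rewrite /hits -sumballD; apply: (sumball_le h0) => x.
have := @at_point_continuous k x; set f := at_point _ _ _ _ _ => cfx; rewrite !indicE.
have [Sf|nS] := pselect (S f); last by rewrite (memNset nS) addr_ge0.
rewrite (mem_set Sf).
by have [S1f|S2f] := H _ cfx Sf; [rewrite (mem_set S1f) lerDl|rewrite (mem_set S2f) lerDr].
Qed.

(** Both filters are proper. This is how statements about the field alone are deduced from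
    samples. *)
Lemma evn_cst (Q : Prop) : evn (R := R) (fun _ _ => Q) -> Q.
Proof. by move=> H; have [k Hk] := filter_ex H; have [r] := filter_ex Hk. Qed.

Lemma evn_all (B : nat) (Q : nat -> nat -> R -> Prop) : (forall j, evn (Q j)) ->
  evn (fun k r => forall j, (j < B)%N -> Q j k r).
Proof.
move=> H; elim: B => [|B IH].
  by apply: nearW => k; apply: nearW => r j.
apply: evnS (evnI IH (H B)) => k r [H1 H2] j; rewrite ltnS leq_eqVlt => /predU1P[->//|].
exact: H1.
Qed.

Lemma cnt_gt0 : \forall r \near +oo, 0 < cnt r.
Proof.
near=> r; apply: (@lt_le_trans _ _ (latcount R [set (0 : 'rV[int]_m)])).
  by rewrite latcountE fset_set1 cardfs1.
apply: ler_latcount; first exact: lball_finite.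
move=> _ ->; rewrite /lball/=; have -> : h *: emb R (0 : 'rV[int]_m) - 0 = 0 :> vec.
  by rewrite subr0; apply/rowP => i; rewrite !mxE/= mulr0.
by rewrite enorm0; near: r; exact: (nbhs_pinfty_gt (num_real _)).
Unshelve. all: by end_near. Qed.

Lemma evn_cnt_gt0 : evn (fun _ r => 0 < cnt r).
Proof. by apply: nearW => k; exact: cnt_gt0. Qed.

(** A window fails by irregularity, bounded by [mean_regular], or by degeneracy, transferred to the
    field within [M t^2]; the latter turns the constants 4 and 16 into the 5 and 18 of
    [gaussian_nondegenerate]. *)
Lemma bad_bound : exists C t0, [/\ 0 < C, 0 < t0 & forall W M t e, 1 <= W -> 1 <= M ->
  0 < t -> t <= t0 -> 0 < e ->
  evn (fun k r => hit [set f | ~ good W M t f] k r <= (C * W ^+ m * (M^-1 + M ^+ m.+1 * t ^+ 2) + e) * cnt r)].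
Proof.
have [C1 C10 reg] := mean_regular al h0 nonres phi0 phiS rr1 m1.
have [t0 [C2 [t00 C20 H2]]] := gaussian_nondegenerate phi0 phiS rr1 covM covG gau.
exists (C1 * 2 ^+ m + C2), (Num.min t0 1); split; [|by rewrite lt_min t00 ltr01|].
  by rewrite addr_gt0// mulr_gt0// exprn_gt0.
move=> W M t e W1 M1 t0'; rewrite le_min => /andP[tt0 t1] e0.
have W0 : 0 < W by lra.
have M0 : 0 < M by lra.
pose S := [set f : func | regular_on (W + 1) M f /\ ~ nondegenerate_on W M t 4 16 f].
have q0 : 0 < M * t ^+ 2 by rewrite mulr_gt0// exprn_gt0.
have W10 : 0 <= W + 1 by lra.
have [A [mA HA evA]] := transfer_up al h0 nonres phi0 phiS covG gau (S := S) W10 M0 q0 (fun f Sf => proj1 Sf).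
have [A' [mA' HA' PA']] := ae_part mA Fc.
have PA : fine (P A) <= C2 * W ^+ m * M ^+ m.+1 * t ^+ 2.
  rewrite -PA'; apply: (H2 _ _ _ _ W1 M1 t0' tt0 mA') => w /HA'[Aw cF].
  have [_ [f [_ nd] Ff]] := HA w Aw cF.
  have [y [yW [fy Hy]]] : exists y, `|y| <= W /\ `|f y| <= 4 * (M * t ^+ 2) /\
      forall v, `|v| <= t -> `|f (y + v) - f y| < 16 * (M * t ^+ 2).
    apply: contrapT => H; apply: nd => y yW fy; apply: contrapT => Hv; apply: H.
    exists y; do 2!split => //; move=> v vt; rewrite ltNge; apply/negP => Hge.
    by apply: Hv; exists v.
  exists y => //; have Fy := Ff y (le_trans yW (ler_wpDr ler01 (lexx W))).
  split.
    by have := ler_normD (F w y - f y) (f y); rewrite subrK; lra.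
  move=> v vt; have tt1 : `|y + v| <= W + 1.
    by apply: le_trans (ler_normD _ _) _; lra.
  have Fyv := Ff _ tt1; have := Hy v vt.
  have := ler_normD (F w (y + v) - f (y + v)) (f (y + v) - F w y); rewrite addrA subrK.
  have := ler_normB (f (y + v) - f y) (F w y - f y); rewrite opprB addrA subrK.
  lra.
have regW := reg (W + 1) M (ler_wpDl (ltW W0) (lexx 1)) M0.
apply: evnS (evnI regW (evA _ e0)) => k r [H3 H4].
apply: (le_trans (@hits_sub _ [set f | ~ regular_on (W + 1) M f] S k r _)).
  move=> f _ /= nf; have [rf|] := pselect (regular_on (W + 1) M f); last by left.
  by right; split => // nd; apply: nf.
apply: le_trans (lerD H3 H4) _; rewrite -mulrDl; apply: ler_wpM2r; first exact: cnt_ge0.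
have Wm : (W + 1) ^+ m <= 2 ^+ m * W ^+ m.
  by rewrite -exprMn; apply: lerXn2r; rewrite ?nnegrE//; lra.
have Wm0 : 0 <= W ^+ m by rewrite exprn_ge0// ltW.
have b1 : C1 * (W + 1) ^+ m / M <= C1 * 2 ^+ m * W ^+ m / M.
  by rewrite ler_wpM2r ?invr_ge0 ?(ltW M0)// -mulrA ler_wpM2l ?(ltW C10).
have Q0 : 0 <= M ^+ m.+1 * t ^+ 2 by rewrite mulr_ge0 ?sqr_ge0// exprn_ge0// ltW.
have b2 : 0 <= C1 * 2 ^+ m * W ^+ m * (M ^+ m.+1 * t ^+ 2).
  by apply: mulr_ge0 Q0; apply: mulr_ge0 Wm0; apply: mulr_ge0 (ltW C10) (exprn_ge0 _ _).
have b3 : 0 <= C2 * W ^+ m / M by rewrite mulr_ge0 ?invr_ge0 ?(ltW M0)// mulr_ge0 ?(ltW C20).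
have -> : (C1 * 2 ^+ m + C2) * W ^+ m * (M^-1 + M ^+ m.+1 * t ^+ 2) =
  C1 * 2 ^+ m * W ^+ m / M + C1 * 2 ^+ m * W ^+ m * (M ^+ m.+1 * t ^+ 2) + C2 * W ^+ m / M +
  C2 * W ^+ m * M ^+ m.+1 * t ^+ 2 by ring.
lra.
Qed.

(** First [M] is fixed against the term [1 / M], then [t] against [M^(m+1) t^2]. *)
Lemma good_parameters W e : 1 <= W -> 0 < e -> exists M t, [/\ 1 <= M, 0 < t, 2 * m%:R * t <= 1 &
  evn (fun k r => hit [set f | ~ good W M t f] k r <= e * cnt r)].
Proof.
move=> W1 e0; have [C [t0 [C0 t00 H]]] := bad_bound.
have W0 : 0 < W by lra.
pose D := C * W ^+ m; have D0 : 0 < D by rewrite mulr_gt0// exprn_gt0.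
pose M := 1 + 4 * D / e.
have M1 : 1 <= M by rewrite lerDl divr_ge0 ?(ltW e0)// mulr_ge0 ?(ltW D0).
have M0 : 0 < M by lra.
have Mm0 : 0 < 4 * D * M ^+ m.+1 by rewrite !mulr_gt0// exprn_gt0.
have m0 : 0 < 2 * m%:R :> R by rewrite mulr_gt0// ltr0n.
pose t := Num.min t0 (Num.min (2 * m%:R)^-1 (e / (4 * D * M ^+ m.+1))).
have tpos : 0 < t by rewrite !lt_min t00 invr_gt0 m0 divr_gt0.
have tt0 : t <= t0 by rewrite ge_min lexx.
have tm : 2 * m%:R * t <= 1.
  by rewrite -ler_pdivlMl// mulr1 !ge_min lexx orbT.
have te : 4 * D * M ^+ m.+1 * t <= e.
  by rewrite mulrC -ler_pdivlMr// !ge_min lexx !orbT.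
have t1 : t <= 1.
  have : 1 <= m%:R :> R by rewrite ler1n.
  by move=> ?; nra.
exists M, t; split => //.
have e4 : 0 < e / 4 by rewrite divr_gt0.
apply: evnS (H W M t _ W1 M1 tpos tt0 e4) => k r; move/le_trans; apply.
apply: ler_wpM2r; first exact: cnt_ge0.
rewrite -/D mulrDr.
have b1 : D / M <= e / 4.
  rewrite ler_pdivrMr// /M; have -> : e / 4 * (1 + 4 * D / e) = e / 4 + D by field; rewrite gt_eqF.
  lra.
have b2 : D * (M ^+ m.+1 * t ^+ 2) <= e / 4.
  have -> : D * (M ^+ m.+1 * t ^+ 2) = D * M ^+ m.+1 * t * t by ring.
  have : D * M ^+ m.+1 * t * t <= D * M ^+ m.+1 * t.
    rewrite ler_piMr//.
    exact: (mulr_ge0 (mulr_ge0 (ltW D0) (exprn_ge0 _ (ltW M0))) (ltW tpos)).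
  lra.
lra.
Qed.

(** The condition [2 m t <= 1] converts a displacement [2 t] in the supremum norm into at most 1 in
    the Euclidean radius. *)
Lemma stability_eball (f g : func) rho M t j : 0 <= rho -> 0 < M -> 0 < t -> 2 * m%:R * t <= 1 ->
  continuous f -> continuous g -> regular_on (rho + 1 + 1) M f -> nondegenerate_on (rho + 1) M t 3 14 f ->
  (forall y, `|y| <= rho + 1 + 1 -> `|g y - f y| <= M * t ^+ 2 / 2) ->
  atleast (ndomains f (eball 0 rho)) j -> atleast (ndomains g (eball 0 (rho + 1))) j.
Proof.
move=> rho0 M0 t0 tm cf cg rf nf fg.
have q0 : 0 < M * t ^+ 2 by rewrite mulr_gt0// exprn_gt0.
have m1' : 1 <= m%:R :> R by rewrite ler1n.
have t2 : 2 * t <= 1 by apply: le_trans tm; rewrite -mulrA ler_wpM2l// ler_peMl// ltW.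
apply: (@stability _ _ rho (rho + 1 + 1) (rho + 1) M t) => //.
- lra.
- lra.
- lra.
- exact: eball_norm.
- move=> y z; rewrite /eball/= !subr0 => yr yz.
  have b1 := ler_enormB z y; have b2 := enorm_le_norm (z - y); rewrite distrC in b2.
  have : m%:R * `|y - z| <= m%:R * (2 * t) by rewrite ler_wpM2l.
  lra.
- by move=> y yW; apply: le_lt_trans (fg y yW) _; lra.
Qed.

Local Notation nd k rho x := ((ncount (fld k) (eball x rho))%:R : R).

Lemma at_point_atleast k x rho j : atleast (ndomains (at_point rr al phi k x) (eball 0 rho)) j <->
  (j <= ncount (fld k) (eball x rho))%N.
Proof.
have [C [L H]] := field_helmholtz k.
split=> [/atleast_shift_eball|jn]; first exact: (atleast_le_card (domains_finite_at h0 h1 H _ _)).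
apply/atleast_shift_eball; apply: atleastW jn _; apply: atleast_fset.
exact: (domains_finite_at h0 h1 H).
Qed.

(** The bound of [domains_atleast] contains only a volume constant and a lattice count, not the
    constants [C] and [L] of the sample, which depend on [k]. *)
Lemma ncount_bounded rho : exists2 K : nat, (0 < K)%N & forall k x, (ncount (fld k) (eball x rho) <= K)%N.
Proof.
pose B := 2 * volbound m (3 : R) * cnt (rho + m%:R * h).
have B0 : 0 <= B.
  have [C [L H]] := field_helmholtz 0.
  by apply: le_trans (domains_atleast h0 h1 H (k := 0%N) _); [|exists [::]; split].
exists (Num.trunc B).+1 => // k x.
have [C [L H]] := field_helmholtz k.
have H1 := domains_atleast h0 h1 (helmholtz_translate x H) (proj2 (at_point_atleast k x rho _) (leqnn _)).
have /andP[_ H2] := truncn_itv B0.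
by rewrite -(ler_nat R); apply: le_trans H1 (ltW H2).
Qed.

(** The layers [X > j], restricted to paths close to good functions, are transferred down to the
    sample, where stability yields [j + 1] domains in a window of radius larger by 1. The layers add
    up to the integral of [X]. *)
Lemma lower_mean rho (X : Omega -> R) (B : nat) e : 0 <= rho -> 0 < e -> measurable_fun setT X ->
  (forall w, 0 <= X w <= B%:R) -> (forall w, ((X w)%:E <= nodal_count (F w) (eball0 rho))%E) ->
  evn (fun k r => (fine (\int[P]_w (X w)%:E)%E - e) * cnt r <= sumball h r (fun x => nd k (rho + 1) x)).
Proof.
move=> rho0 e0 mX X0 XN.
pose e1 := e / (4 * B.+1%:R).
have B1 : 0 < B.+1%:R :> R by rewrite ltr0n.
have e10 : 0 < e1 by rewrite divr_gt0// mulr_gt0.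
have Be1 : B.+1%:R * e1 = e / 4 by rewrite /e1; field; rewrite gt_eqF.
have W1 : 1 <= rho + 1 by lra.
have [M [t [M1 t0 tm evbad]]] := good_parameters W1 e10.
have M0 : 0 < M by lra.
have q0 : 0 < M * t ^+ 2 / 2 by rewrite divr_gt0// mulr_gt0// exprn_gt0.
have W0 : 0 <= rho + 1 + 1 by lra.
have m1' : 1 <= m%:R :> R by rewrite ler1n.
have t2 : 2 * t <= 1 by apply: le_trans tm; rewrite -mulrA ler_wpM2l// ler_peMl// ltW.
have tW : rho + 1 + t <= rho + 1 + 1 by lra.
have rt : rho + 2 * t <= rho + 1 by lra.
have [A0 [mA0 HA0 evA0]] := transfer_up al h0 nonres phi0 phiS covG gau
  (S := [set f | good (rho + 1) M t f]) W0 M0 q0 (fun f Sf => proj1 Sf).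
(* Nearly all sample windows are good, so [transfer_up] forces the event of paths close to good
   functions to have probability near 1. *)
have PA0 : 1 - 2 * e1 <= fine (P A0).
  apply: evn_cst; apply: evnS (evnI evn_cnt_gt0 (evnI evbad (evA0 _ e10))) => k r [c0 [H1 H2]].
  have H3 : hit setT k r <= hit [set f | ~ good (rho + 1) M t f] k r + hit [set f | good (rho + 1) M t f] k r.
    apply: hits_sub => f _ _.
    by have [gf|] := pselect (good (rho + 1) M t f); [right|left].
  have H4 : hit setT k r = cnt r.
    rewrite /hits -[RHS]mul1r -sumball_cst; congr sumball; apply/funext => x.
    by rewrite indicT.
  have : 1 * cnt r <= (fine (P A0) + e1 + e1) * cnt r by lra.
  by rewrite ler_pM2r//; lra.
have [A1 [mA1 HA1 PA1]] := ae_part mA0 Fc.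
pose E j := A1 `&` [set w | j%:R < X w].
have mXj j : measurable [set w | j%:R < X w].
  rewrite -[X in measurable X]setTI.
  have -> : [set w | j%:R < X w] = X @^-1` `]j%:R, +oo[%classic.
    by apply/seteqP; split => w; rewrite /= in_itv/= andbT.
  exact: mX.
have mE j : measurable (E j) by exact: measurableI.
pose S (j : nat) : set func := [set f | [/\ continuous f, regular_on (rho + 1 + 1) M f,
  nondegenerate_on (rho + 1) M t 3 14 f & atleast (ndomains f (eball 0 rho)) j.+1]].
have ES j w : E j w -> S j (F w).
  move=> [/HA1[A0w cF] jX]; have [rF [f [rf nf] Ff]] := HA0 w A0w cF.
  split => //; first exact: (nondegenerate_perturb M0 t0 tW rt Ff nf).
  apply: (@esum_gt_atleast R); rewrite -(nodal_domainsE cF); last exact: open_eball.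
  by apply: lt_le_trans (XN w); rewrite lte_fin.
have evS j := transfer_down al h0 nonres phi0 phiS covG gau (S := S j) W0 M0 q0
  (fun f (Sf : S j f) => let: And4 _ r _ _ := Sf in r) (mE j) (ES j) e10.
apply: evnS (evnI evbad (@evn_all B _ evS)) => k r [H1 H2].
pose T j : set func := [set f | (j < #|` fset_set (ndomains f (eball 0 (rho + 1)))|)%N].
have H3 j : (j < B)%N -> (fine (P (E j)) - 2 * e1) * cnt r <=
    sumball h r (fun x => (j < ncount (fld k) (eball x (rho + 1)))%N%:R).
  move=> jB; have := H2 j jB; set U := [set f | _] => H3.
  have : hit U k r <= hit [set f | ~ good (rho + 1) M t f] k r +
      sumball h r (fun x => (j < ncount (fld k) (eball x (rho + 1)))%N%:R).
    rewrite /hits -sumballD; apply: (sumball_le h0) => x.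
    have := @at_point_continuous k x; set f := at_point _ _ _ _ _ => cfx; rewrite !indicE.
    have [Uf|nU] := pselect (U f); last by rewrite (memNset nU) addr_ge0.
    rewrite (mem_set Uf).
    have [gf|ng] := pselect (good (rho + 1) M t f); last by rewrite [_ \in _]mem_set ?lerDl.
    rewrite [_ \in _](_ : _ = false) ?add0r; last by apply: memNset.
    have [|[f' [cf' rf' nf' af'] ff']] := Uf; first by case: gf.
    have := stability_eball rho0 M0 t0 tm cf' cfx rf' nf' ff' af'.
    by move=> /at_point_atleast ->.
  by lra.
have H4 : \sum_(j < B) (fine (P (E j)) - 2 * e1) * cnt r <= sumball h r (fun x => nd k (rho + 1) x).
  apply: le_trans (ler_sum _ (fun (j : 'I_B) _ => H3 j (ltn_ord j))) _.
  rewrite /sumball -latsum_sum; apply: ler_latsum; first exact: lball_finite.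
  by move=> z _; rewrite -natr_sum sum_ltn ler_nat geq_minl.
apply: le_trans H4; rewrite -mulr_suml; apply: ler_wpM2r; first exact: cnt_ge0.
have XE : fine (\int[P]_w (X w)%:E)%E <= \sum_(j < B) fine (P [set w | j%:R < X w]).
  have I1 := integral_sum_indic P B mXj.
  have I2 : (\int[P]_w (X w)%:E <= \int[P]_w (\sum_(j < B) \1_([set w | j%:R < X w]) w)%:E)%E.
    apply: ge0_integral_mono => w; rewrite lee_fin; first by case/andP: (X0 w).
    apply: le_trans (le_sum_ltn (X0 w)) _; apply: ler_sum => j _.
    by rewrite indicE; case jX : (Order.lt _ _) => //; rewrite mem_set.
  rewrite I1 in I2; have I0 : (0 <= \int[P]_w (X w)%:E)%E.
    by apply: integral_ge0 => w _; rewrite lee_fin; case/andP: (X0 w).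
  rewrite -lee_fin fineK// ge0_fin_numE//; exact: le_lt_trans I2 (ltry _).
have PE (j : 'I_B) : fine (P [set w | j%:R < X w]) <= fine (P (E j)) + 2 * e1.
  have mC : measurable (~` A1) by exact: measurableC.
  have sub : [set w | j%:R < X w] `<=` E j `|` ~` A1.
    by move=> w jX; have [Aw|nA] := pselect (A1 w); [left|right].
  have := le_measure P (mem_set (mXj j)) (mem_set (measurableU _ _ (mE j) mC)) sub.
  move=> /le_trans/(_ (measureU2 _ (mE j) mC)).
  rewrite -[leLHS]fineK ?fin_num_measure// -[X in (X + _)%E]fineK ?fin_num_measure//.
  rewrite -[X in (_ + X)%E]fineK ?fin_num_measure// -EFinD lee_fin.
  have : fine (P (~` A1)) = 1 - fine (P A1).
    by rewrite probability_setC// -[X in fine (_ - X)]fineK ?fin_num_measure.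
  rewrite PA1; lra.
have := le_trans XE (ler_sum _ (fun j _ => PE j)); rewrite !big_split/= !sumr_const card_ord.
rewrite -[2 * e1 *+ B]mulr_natr -[- (2 * e1) *+ B]mulr_natr.
have : B.+1%:R * e1 = B%:R * e1 + e1 by rewrite -natr1; ring.
lra.
Qed.

(** The layers of good sample windows are transferred up; on the resulting events a continuous path
    itself has [j + 1] domains in the enlarged ball. Bad windows are rare and carry at most [K]
    domains each. *)
Lemma upper_mean rho (I : R) e : 0 <= rho -> 0 < e ->
  (\int[P]_w nodal_count (F w) (eball0 (rho + 1)) = I%:E)%E ->
  evn (fun k r => sumball h r (fun x => nd k rho x) <= (I + e) * cnt r).
Proof.
move=> rho0 e0 IE.
have [K K0 HK] := ncount_bounded rho.
pose e1 := e / (4 * K.+1%:R).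
have K1 : 0 < K.+1%:R :> R by rewrite ltr0n.
have e10 : 0 < e1 by rewrite divr_gt0// mulr_gt0.
have Ke1 : K.+1%:R * e1 = e / 4 by rewrite /e1; field; rewrite gt_eqF.
have W1 : 1 <= rho + 1 by lra.
have [M [t [M1 t0 tm evbad]]] := good_parameters W1 e10.
have M0 : 0 < M by lra.
have q0 : 0 < M * t ^+ 2 / 2 by rewrite divr_gt0// mulr_gt0// exprn_gt0.
have W0 : 0 <= rho + 1 + 1 by lra.
pose S (j : nat) : set func := [set f | [/\ continuous f, good (rho + 1) M t f &
  atleast (ndomains f (eball 0 rho)) j.+1]].
have [A0 HA0] := choice (fun j => transfer_up al h0 nonres phi0 phiS covG gau (S := S j) W0 M0 q0
  (fun f (Sf : S j f) => let: And3 _ g _ := Sf in proj1 g)).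
have mA0 j : measurable (A0 j) by case: (HA0 j).
have [A1 HA1] := choice (fun j => ae_part (mA0 j) Fc).
have mA1 j : measurable (A1 j) by case: (HA1 j).
have YI : \sum_(j < K) fine (P (A0 j)) <= I.
  rewrite -lee_fin -IE.
  have -> : \sum_(j < K) fine (P (A0 j)) = \sum_(j < K) fine (P (A1 j)).
    by apply: eq_bigr => j _; case: (HA1 j) => _ _ ->.
  rewrite -integral_sum_indic//; apply: ge0_integral_mono => w.
  - by rewrite lee_fin; apply: sumr_ge0.
  -
    have [cF|ncF] := pselect (continuous (F w)); last first.
      rewrite big1 => [|j _]; first by apply: esum_ge0.
      by rewrite indicE memNset// => Aw; case: (HA1 j) => _ /(_ w Aw)[].
    rewrite /nodal_count (nodal_domainsE cF); last exact: open_eball.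
    have -> : \sum_(j < K) \1_(A1 j) w = (\sum_(j < K) (`[< A1 j w >] : nat))%:R :> R.
      by rewrite natr_sum; apply: eq_bigr => j _; rewrite indicE;
        have [Aw|nA] := pselect (A1 j w); [rewrite mem_set ?asboolT|rewrite memNset ?asboolF].
    apply/atleast_esum; apply: (atleast_sum (b := fun j => `[< A1 j w >])) => j _ /asboolP Aw.
    have [_ /(_ w Aw)[A0w _] _] := HA1 j.
    have [_ /(_ w A0w cF)[_ [f [cf [rf nf] af] Ff]] _] := HA0 j.
    have nf' := nondegenerate_weaken M0 nf.
    by apply: (stability_eball rho0 M0 t0 tm cf cF rf nf' Ff).
have evA j : evn (fun k r => hit (S j) k r <= (fine (P (A0 j)) + e1) * cnt r).
  by have [_ _ H] := HA0 j; exact: H.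
apply: evnS (evnI evbad (@evn_all K _ evA)) => k r [H1 H2].
have H3 : sumball h r (fun x => nd k rho x) <=
    \sum_(j < K) hit (S j) k r + K%:R * hit [set f | ~ good (rho + 1) M t f] k r.
  rewrite /hits /sumball -latsumZ -latsum_sum -latsumD; apply: ler_latsum; first exact: lball_finite.
  move=> z _; set x := h *: emb R z.
  have cfx := @at_point_continuous k x; rewrite [X in _ + K%:R * X]indicE.
  have s0 : 0 <= \sum_(j < K) \1_(S j) (at_point rr al phi k x) :> R by apply: sumr_ge0.
  have [gf|ng] := pselect (good (rho + 1) M t (at_point rr al phi k x)); last first.
    by rewrite [_ \in [set f | ~ _]]mem_set// mulr1; apply: ler_wpDl s0 _; rewrite ler_nat HK.
  apply: ler_wpDr; first by rewrite mulr_ge0.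
  rewrite -[X in X%:R](minn_idPl (HK k x)) -sum_ltn natr_sum; apply: ler_sum => j _.
  case jn: (_ < _)%N => //; rewrite indicE mem_set//; split => //.
  exact/at_point_atleast.
apply: le_trans H3 _.
have H4 : \sum_(j < K) hit (S j) k r <= \sum_(j < K) (fine (P (A0 j)) + e1) * cnt r.
  by apply: ler_sum => j _; exact: H2.
have H5 : K%:R * hit [set f | ~ good (rho + 1) M t f] k r <= K%:R * (e1 * cnt r) by rewrite ler_wpM2l.
apply: le_trans (lerD H4 H5) _; rewrite -mulr_suml mulrA -mulrDl; apply: ler_wpM2r; first exact: cnt_ge0.
rewrite big_split/= sumr_const card_ord -mulr_natl.
have : K.+1%:R * e1 = K%:R * e1 + e1 by rewrite -natr1; ring.
lra.
Qed.

End DomainStatistics.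

(** * The limiting density *)

Import HBNNSimple.

Lemma nnsfun_bounded (R : realType) d (Omega : measurableType d) (g : {nnsfun Omega >-> R}) :
  exists B : nat, forall w, 0 <= g w <= B%:R.
Proof.
have [M [_ HM]] := simple_bounded g.
have M0 : 0 <= `|M| + 1 by rewrite addr_ge0.
exists (Num.trunc (`|M| + 1)).+1 => w; rewrite fun_ge0/=.
have /andP[_ H] := truncn_itv M0.
apply: le_trans (ltW H); apply: le_trans (ler_norm _) _; apply: HM => //.
by rewrite (le_lt_trans (ler_norm _))// ltrDl.
Qed.

(* Along  M = (W + 2)^(m+1)  and  t = 2^-j  the first summand is  O(1/j)  and
   the second decays exponentially. *)
Lemma scale_parameters (R : realType) (m P : nat) (C t0 e : R) : (0 < P)%N -> 0 < C -> 0 < t0 -> 0 < e ->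
  exists (J : nat) (M t : R), let W := P%:R * (6 * J%:R + 6) in
    [/\ 1 <= M, 0 < t <= 1, t <= t0, (1 / 2) ^+ J <= t ^+ 2 &
      C * (W + 2) ^+ m * (M^-1 + M ^+ m.+1 * t ^+ 2) <= e].
Proof.
move=> P0 C0 t00 e0.
have P1 : 1 <= P%:R :> R by rewrite ler1n.
(* With [M = (W + 2)^(m+1)], the factor [(W + 2)^m M^(m+1)] is [(W + 2)^K]. *)
pose K := (m + m.+1 * m.+1)%N.
pose A : R := P%:R * (4 * K.+1%:R + 6) + 2.
have A1 : 1 <= A by rewrite /A; have : 0 <= K.+1%:R :> R by []; nra.
have A0 : 0 < A by lra.
have AK0 : 0 < A ^+ K by rewrite exprn_gt0.
pose x := Num.max (2 * C * A ^+ K / e) (Num.max (2 * C / e) t0^-1).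
have [N HN] : exists N : nat, x <= N%:R.
  by exists (Num.trunc `|x|).+1; have /andP[_ H] := truncn_itv (normr_ge0 x);
    exact: le_trans (ler_norm _) (ltW H).
move: HN; rewrite !ge_max => /and3P[N1 N2 N3].
(* The multiple [K + 1] makes [t^2 = 4^{- i (K + 1)}] beat [(W + 2)^K <= A^K 4^{i K}] by a factor
   [4^i], and [J = 2 j] gives [2^{-J} = t^2]. *)
pose i := N.+1; pose j := (K.+1 * i)%N; pose J := (2 * j)%N.
pose W : R := P%:R * (6 * J%:R + 6).
have iN : N%:R <= i%:R :> R by rewrite ler_nat.
have i1 : 1 <= i%:R :> R by rewrite ler1n.
have jE : j%:R = K.+1%:R * i%:R :> R by rewrite natrM.
have ij : i%:R <= j%:R :> R by rewrite jE ler_peMl ?ler1n.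
have JE : J%:R = 2 * j%:R :> R by rewrite natrM.
have Wi : i%:R <= W + 2 by rewrite /W JE; nra.
have W0 : 0 < W + 2 by lra.
have WA : W + 2 <= A * (1 + 3 * i%:R).
  rewrite /W /A JE jE; have : 0 <= K.+1%:R :> R by [].
  set k := K.+1%:R; move=> k0.
  have -> : (P%:R * (4 * k + 6) + 2) * (1 + 3 * i%:R) =
    P%:R * (6 * (2 * (k * i%:R)) + 6) + 2 + (P%:R * (4 * k) + P%:R * 18 * i%:R + 6 * i%:R) by ring.
  rewrite lerDl !addr_ge0 ?mulr_ge0//.
pose M := (W + 2) ^+ m.+1; pose t : R := (1 / 2) ^+ j.
have M1 : 1 <= M by apply: exprn_ege1; lra.
have bern n : 1 + n%:R <= (2 : R) ^+ n.
  elim: n => [|n IH]; first by rewrite addr0 expr0.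
  by rewrite exprS -natr1; have : 0 <= n%:R :> R by []; lra.
have bern4 : 1 + 3 * i%:R <= (4 : R) ^+ i.
  elim: (i) => [|n IH]; first by rewrite mulr0 addr0 expr0.
  by rewrite exprS -natr1; have : 0 <= n%:R :> R by []; lra.
have tE : t = (2 ^+ j)^-1 by rewrite /t expr_div_n expr1n div1r.
have h2 : 0 <= (1 / 2 : R) <= 1 by rewrite divr_ge0// ler_pdivrMr// mul1r ler1n.
have tpos : 0 < t by rewrite tE invr_gt0 exprn_gt0.
exists J, M, t => /=; split => //.
- by rewrite tpos exprn_ile1 ?(andP h2).1 ?(andP h2).2.
- rewrite tE -[leRHS]invrK lef_pV2 ?posrE ?invr_gt0 ?exprn_gt0//.
  by have := bern j; lra.
- by rewrite /t /J mulnC exprM.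
rewrite -/W mulrDr.
have b1 : C * (W + 2) ^+ m * M^-1 <= e / 2.
  have -> : C * (W + 2) ^+ m * M^-1 = C / (W + 2).
    by rewrite /M exprS; field; rewrite gt_eqF// expf_neq0// gt_eqF.
  rewrite ler_pdivrMr//.
  have : 2 * C <= e * i%:R by rewrite [leRHS]mulrC -ler_pdivrMr// (le_trans N2).
  have : e * i%:R <= e * (W + 2) by rewrite ler_wpM2l// ltW.
  lra.
have b2 : C * (W + 2) ^+ m * (M ^+ m.+1 * t ^+ 2) <= e / 2.
  have -> : C * (W + 2) ^+ m * (M ^+ m.+1 * t ^+ 2) = C * (W + 2) ^+ K * t ^+ 2.
    by rewrite /M -exprM mulrA -[C * _ * _]mulrA -exprD.
  have t2 : t ^+ 2 = (((4 : R) ^+ i) ^+ K.+1)^-1.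
    have -> : (4 : R) = 2 ^+ 2 by rewrite expr2; ring.
    rewrite tE exprVn -!exprM /j; congr (_^-1); congr (_ ^+ _).
    by rewrite [(i * K.+1)%N]mulnC mulnC.
  have i0 : 0 < 1 + 3 * i%:R :> R by lra.
  have q0 : 0 < (4 : R) ^+ i by rewrite exprn_gt0.
  have c1 : (W + 2) ^+ K <= A ^+ K * ((4 : R) ^+ i) ^+ K.
    rewrite -exprMn; apply: lerXn2r; rewrite ?nnegrE ?(ltW W0)//; first by rewrite mulr_ge0// ltW.
    by apply: (le_trans WA); rewrite ler_wpM2l// ltW.
  rewrite t2 ler_pdivrMr ?exprn_gt0// exprS.
  have c2 : C * (W + 2) ^+ K <= C * (A ^+ K * ((4 : R) ^+ i) ^+ K) by rewrite ler_wpM2l// ltW.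
  apply: le_trans c2 _.
  have -> : C * (A ^+ K * ((4 : R) ^+ i) ^+ K) = C * A ^+ K * ((4 : R) ^+ i) ^+ K by ring.
  rewrite [leRHS]mulrA; apply: ler_wpM2r; first by rewrite exprn_ge0// ltW.
  have : 2 * C * A ^+ K <= e * i%:R by rewrite [leRHS]mulrC -ler_pdivrMr// (le_trans N1).
  have : e * i%:R <= e * 4 ^+ i by apply: ler_wpM2l; [exact: ltW|lra].
  lra.
lra.
Qed.

Section LimitDensity.
Variables (R : realType) (m : nat) (h : R) (rr : nat -> 'rV[R]_m) (al : nat -> R).
Variables (phi : nat -> nat) (G : 'rV[R]_m -> R) (Gm : 'I_m -> 'I_m -> R).
Hypothesis h0 : 0 < h.
Hypothesis h1 : h <= 1.
Hypothesis m1 : (1 <= m)%N.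
Local Notation vec := 'rV[R]_m.
Local Notation func := (vec -> R).
Local Notation cnt rho := (latcount R (lball h (0 : vec) rho)).
Hypothesis nonres : forall n q, (exists2 l, (l < n)%N & q l != 0) ->
  exists i, forall k : int, h * freq rr n q ord0 i != k%:~R.
Hypothesis phi0 : (0 < phi 0%N)%N.
Hypothesis phiS : forall k, (phi k < phi k.+1)%N.
Hypothesis rr1 : forall l, enorm (rr l) = 1.
Hypothesis covM : forall i j, average phi k (fun l => rr l ord0 i * rr l ord0 j) @[k --> \oo] --> Gm i j.
Hypothesis covG : forall z, average phi k (fun l => cos (2 * pi * dotv (rr l) z)) @[k --> \oo] --> (G z : R).
Variables (d : measure_display) (Omega : measurableType d) (P : probability Omega R).
Variable F : Omega -> func.
Hypothesis gau : forall (k : nat) (xs : 'I_k -> vec) (cs : 'I_k -> R),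
  centered_gaussian P (fun w => \sum_(i < k) cs i * F w (xs i))
    (\sum_(i < k) \sum_(j < k) cs i * cs j * G (xs i - xs j)).
Hypothesis Fc : {ae P, forall w, continuous (F w)}.

Local Notation fld := (field rr al phi).
Local Notation nd k rho x := ((ncount (fld k) (eball x rho))%:R : R).

Definition mean_count rho : R := fine (\int[P]_w nodal_count (F w) (eball0 rho))%E.

Let lower := lower_mean al h0 h1 m1 nonres phi0 phiS rr1 covM covG gau Fc.
Let upper := upper_mean al h0 h1 m1 nonres phi0 phiS rr1 covM covG gau Fc.

Lemma evn_shift (Q : nat -> R -> Prop) c : evn Q -> evn (fun k r => Q k (r + c)).
Proof. by apply: filterS => k; exact: near_shift. Qed.

Lemma evn_near (Q : R -> Prop) : (\forall r \near +oo, Q r) -> evn (fun _ r => Q r).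
Proof. by move=> H; apply: nearW. Qed.

Lemma nodal_count_ge0 w rho : (0 <= nodal_count (F w) (eball0 rho))%E.
Proof. by apply: esum_ge0. Qed.

(** The mean is finite: through [lower_mean], simple functions below the count have integrals
    bounded by the uniform sample bound plus 1. *)
Lemma mean_countE rho : 0 <= rho ->
  (\int[P]_w nodal_count (F w) (eball0 rho) = (mean_count rho)%:E)%E.
Proof.
move=> rho0; rewrite fineK//; have [K _ HK] := ncount_bounded al phi h0 h1 rr1 (rho + 1).
rewrite ge0_fin_numE; last by apply: integral_ge0 => w _; exact: nodal_count_ge0.
apply: (@le_lt_trans _ _ (K.+1%:R)%:E); last exact: ltry.
rewrite ge0_integralTE; last by move=> w; exact: nodal_count_ge0.
apply: ge_ereal_sup => _ [g Hg <-]; rewrite -integralT_nnsfun.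
have [B HB] := nnsfun_bounded g.
have mg : measurable_fun setT g by [].
have gB : (\int[P]_w (g w)%:E)%E = (fine (\int[P]_w (g w)%:E)%E)%:E.
  rewrite fineK// ge0_fin_numE; last by apply: integral_ge0 => w _; rewrite lee_fin fun_ge0.
  apply: (@le_lt_trans _ _ (\int[P]_w (B%:R : R)%:E)%E).
    by apply: ge0_integral_mono => w; rewrite lee_fin; case/andP: (HB w).
  by rewrite integral_cst//= probability_setT mule1 ltry.
rewrite gB lee_fin; apply: evn_cst.
apply: evnS (evnI (evn_cnt_gt0 m h0) (lower rho0 ltr01 mg HB Hg)) => k r [c0 H].
have : sumball h r (fun x => nd k (rho + 1) x) <= K%:R * cnt r.
  by rewrite -sumball_cst; apply: (sumball_le h0) => x; rewrite ler_nat.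
move=> /(le_trans H); rewrite ler_pM2r// -natr1; lra.
Qed.

Lemma mean_count_ge0 rho : 0 <= mean_count rho.
Proof. by apply/fine_ge0/integral_ge0 => w _; exact: nodal_count_ge0. Qed.

(** A simple function below the count captures the mean up to 1/2; [lower_mean] passes to the sample
    and [count_lower] from windows to the large ball. *)
Lemma density_lower rho : 0 <= rho -> evn (fun k r =>
  (mean_count rho - 1) * cnt r <= nd k (r + (rho + 1)) 0 * cnt (rho + 1 + m%:R * h)).
Proof.
move=> rho0; have IE := mean_countE rho0.
have half0 : 0 < 1 / 2 :> R by lra.
have [g [gN gI]] : exists g : {nnsfun Omega >-> R},
    (forall w, ((g w)%:E <= nodal_count (F w) (eball0 rho))%E) /\
    mean_count rho - 1 / 2 <= fine (\int[P]_w (g w)%:E)%E.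
  have [_ [g Hg <-]] : exists2 y, [set sintegral P (g : Omega -> R) | g in [set g : {nnsfun Omega >-> R} |
      forall w, ((g w)%:E <= nodal_count (F w) (eball0 rho))%E]] y & ((mean_count rho - 1 / 2)%:E < y)%E.
    apply: ereal_sup_gt; have E := ge0_integralTE P (fun w => nodal_count_ge0 w rho).
    by apply: (@lt_le_trans _ _ (mean_count rho)%:E); [rewrite lte_fin; lra|rewrite -IE E].
  move=> lt; exists g; split => //.
  have gle : (\int[P]_w (g w)%:E <= (mean_count rho)%:E)%E.
    rewrite -IE; apply: ge0_integral_mono => w; last exact: Hg.
    by rewrite lee_fin fun_ge0.
  have gI : (\int[P]_w (g w)%:E)%E = (fine (\int[P]_w (g w)%:E)%E)%:E.
    rewrite fineK// ge0_fin_numE; first exact: le_lt_trans gle (ltry _).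
    by apply: integral_ge0 => w _; rewrite lee_fin fun_ge0.
  by rewrite -lee_fin -gI integralT_nnsfun ltW.
have [B HB] := nnsfun_bounded g.
have mg : measurable_fun setT g by [].
apply: evnS (lower rho0 half0 mg HB gN) => k r H.
have [C [L Hf]] := field_helmholtz al phi rr1 k.
have := count_lower h0 h1 Hf r (rho + 1).
apply: le_trans; apply: le_trans H; apply: ler_wpM2r; first exact: cnt_ge0.
lra.
Qed.

Lemma count_power : exists2 C, 0 < C & forall r, 1 <= r -> cnt (r + m%:R * h) <= C * r ^+ m.
Proof.
pose C : R := (2 * (1 + m%:R) / h + 1) ^+ m.
have mh0 : 0 <= m%:R * h by rewrite mulr_ge0// ltW.
have mh1 : m%:R * h <= m%:R by rewrite ler_piMr.
exists C => [|r r1]; first by rewrite exprn_gt0// addr_gt0// divr_gt0// mulr_gt0// ltr_wpDr.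
apply: le_trans (lball_count_ub m h0 _) _; first by lra.
rewrite /C -exprMn; apply: lerXn2r; rewrite ?nnegrE.
- by rewrite addr_ge0// mulr_ge0// divr_ge0 ?(ltW h0)//; lra.
- by rewrite mulr_ge0 ?addr_ge0 ?divr_ge0 ?(ltW h0) ?mulr_ge0 ?addr_ge0//; lra.
- have -> : (2 * (1 + m%:R) / h + 1) * r = 2 * ((1 + m%:R) * r / h) + r by ring.
  apply: lerD => //; rewrite ler_wpM2l// ler_wpM2r ?invr_ge0 ?(ltW h0)//.
  by rewrite mulrDl mul1r lerD2l (le_trans mh1)// ler_peMr.
Qed.

(** The number [P] is chosen against the long domains, then [J], [M], [t] against the bad windows.
    The resulting loss [c] in the radius does not depend on [rho], so it disappears when [rho] is
    large. *)
Lemma density_upper e : 0 < e -> exists c, forall rho, 0 <= rho -> evn (fun k r =>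
  nd k r 0 * cnt (rho - c) <= (mean_count (rho + 1) + 1) * cnt (r + rho) + cnt (rho - c) * (e * r ^+ m)).
Proof.
move=> e0.
have [Cb [t0 [Cb0 t00 bad]]] := bad_bound al h0 m1 nonres phi0 phiS rr1 covM covG gau Fc.
have tau0 : 0 < Num.sqrt (tau R m) by rewrite sqrtr_gt0 tau_gt0.
pose C6 : R := (2 / Num.sqrt (tau R m) + 1) ^+ m.
have C60 : 0 < C6 by rewrite exprn_gt0// addr_gt0// divr_gt0.
have C6P r : 1 <= r -> volbound m r <= C6 * r ^+ m.
  move=> r1; rewrite /volbound /C6 -exprMn; apply: lerXn2r; rewrite ?nnegrE.
  - by rewrite addr_ge0// divr_ge0 ?(ltW tau0)// mulr_ge0//; lra.
  - by rewrite mulr_ge0 ?addr_ge0 ?divr_ge0 ?(ltW tau0)//; lra.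
  - have -> : (2 / Num.sqrt (tau R m) + 1) * r = 2 * r / Num.sqrt (tau R m) + r by ring.
    by rewrite lerD2l.
pose V3 : R := volbound m 3.
have V30 : 0 < V3 by rewrite exprn_gt0// addr_gt0// divr_gt0.
have [C7 C70 C7P] := count_power.
have [Pn Pn1] : exists Pn : nat, 8 * C6 / e <= Pn.+1%:R.
  exists (Num.trunc (8 * C6 / e)).
  have x0 : 0 <= 8 * C6 / e by rewrite divr_ge0 ?(ltW e0)// mulr_ge0// ltW.
  by have /andP[_ H] := truncn_itv x0; exact: ltW.
have e20 : 0 < e / (8 * (V3 * C7)) by rewrite divr_gt0// mulr_gt0// mulr_gt0.
have [J [M [t [M1 /andP[tpos t1] tt0 Jt Hbad]]]] := scale_parameters m (ltn0Sn Pn) Cb0 t00 e20.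
set W := Pn.+1%:R * (6 * J%:R + 6) in Hbad.
have W0 : 0 <= W by rewrite mulr_ge0// addr_ge0// mulr_ge0.
have M0 : 0 < M by lra.
have W21 : 1 <= W + 2 by lra.
exists (m%:R * (W + 1) + m%:R * h) => rho rho0.
have up := upper rho0 ltr01 (mean_countE (addr_ge0 rho0 ler01)).
have r1 : evn (fun _ r => (1 : R) <= r) by apply: evn_near; exact: nbhs_pinfty_ge (num_real _).
apply: evnS (evnI r1 (evnI (evn_shift rho up) (evn_shift (m%:R * h) (bad _ _ _ _ W21 M1 tpos tt0 e20)))) => k r [r1' [H1 H2]].
have [C [L Hf]] := field_helmholtz al phi rr1 k.
have r0 : 0 <= r by lra.
have := count_upper h0 h1 Hf rho r0 (ltn0Sn Pn) M0 tpos t1 Jt (erefl W).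
have -> : rho - (m%:R * (W + 1) + m%:R * h) = rho - m%:R * (W + 1) - m%:R * h by rewrite opprD addrA.
move=> /le_trans; apply; apply: lerD; first exact: H1.
apply: ler_wpM2l; first exact: latcount_ge0.
have H3 : latcount R [set z | lball h (0 : vec) (r + m%:R * h) z /\ ~ good (W + 2) M t (shift (h *: emb R z) (fld k))] <=
   (e / (8 * (V3 * C7)) + e / (8 * (V3 * C7))) * (C7 * r ^+ m).
  rewrite -(@latsum_asbool _ _ (lball h (0 : vec) (r + m%:R * h))); last exact: lball_finite.
  apply: le_trans (_ : hits h rr al phi [set f | ~ good (W + 2) M t f] k (r + m%:R * h) <= _).
    apply: ler_latsum; first exact: lball_finite.
    move=> z _; rewrite indicE; case: asboolP => // ng.
    by rewrite [_ \in _]mem_set.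
  apply: (le_trans H2); apply: (@le_trans _ _ ((e / (8 * (V3 * C7)) + e / (8 * (V3 * C7))) * cnt (r + m%:R * h))).
    by apply: ler_wpM2r; [exact: latcount_ge0|rewrite lerD2r].
  by apply: ler_wpM2l; [lra|exact: C7P].
have H4 : 2 * V3 * latcount R [set z | lball h (0 : vec) (r + m%:R * h) z /\ ~ good (W + 2) M t (shift (h *: emb R z) (fld k))] <=
   e / 2 * r ^+ m.
  apply: le_trans (_ : 2 * V3 * ((e / (8 * (V3 * C7)) + e / (8 * (V3 * C7))) * (C7 * r ^+ m)) <= _).
    by apply: ler_wpM2l => //; rewrite mulr_ge0// ltW.
  by rewrite le_eqVlt; apply/orP; left; apply/eqP; field; rewrite !gt_eqF.
have H5 : 4 / Pn.+1%:R * volbound m r <= e / 2 * r ^+ m.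
  apply: le_trans (_ : 4 / Pn.+1%:R * (C6 * r ^+ m) <= _).
    by apply: ler_wpM2l; [rewrite divr_ge0|exact: C6P].
  rewrite mulrA; apply: ler_wpM2r; first by rewrite exprn_ge0.
  rewrite mulrAC ler_pdivrMr ?ltr0n//; rewrite ler_pdivrMr// in Pn1; lra.
have -> : e * r ^+ m = e / 2 * r ^+ m + e / 2 * r ^+ m by field.
exact: lerD H4 H5.
Qed.

(** Exchanges lattice counts for powers of the radius, absorbing bounded shifts in a factor
    [1 + dl]. *)
Lemma count_ratio kappa (dl c : R) : 0 < kappa -> 0 < dl -> dl <= 1 ->
  (forall e, 0 < e -> \forall r \near +oo, (kappa - e) * r ^+ m <= cnt r <= (kappa + e) * r ^+ m) ->
  \forall r \near +oo, cnt (r + c) <= (1 + dl) * kappa * r ^+ m /\ kappa * r ^+ m <= (1 + dl) * cnt (r + c).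
Proof.
move=> k0 d0 d1 H.
have e0 : 0 < dl / 8 by rewrite divr_gt0.
have ke0 : 0 < kappa * (dl / 8) by rewrite mulr_gt0.
have cs := count_shift m h0 c e0.
near=> r.
have /andP[a1 a2] : (kappa - kappa * (dl / 8)) * r ^+ m <= cnt r <= (kappa + kappa * (dl / 8)) * r ^+ m.
  by near: r; exact: H.
have : `|cnt (r + c) - cnt r| <= dl / 8 * cnt r by near: r.
have r1 : 1 <= r by near: r; exact: nbhs_pinfty_ge (num_real _).
have : 0 <= r ^+ m by rewrite exprn_ge0//; lra.
move: (r ^+ m) (cnt r) (cnt (r + c)) a1 a2 => x y z a1 a2 x0.
rewrite ler_norml => /andP[b1 b2].
have kx : 0 <= kappa * x by rewrite mulr_ge0// ltW.
have y0 : 0 <= y by apply: le_trans a1; nra.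
set v := kappa * x in kx *.
have a1' : v - dl / 8 * v <= y by move: a1; rewrite /v; lra.
have a2' : y <= v + dl / 8 * v by move: a2; rewrite /v; lra.
have -> : (1 + dl) * kappa * x = v + dl * v by rewrite /v; ring.
have dv : dl * (dl * v) <= dl * v by rewrite ler_wpM2l ?(ltW d0)// ler_piMl.
have dv0 : 0 <= dl * v by rewrite mulr_ge0 ?(ltW d0).
have dy : dl * y <= dl * v + dl / 8 * (dl * v).
  have : dl * y <= dl * (v + dl / 8 * v) by rewrite ler_wpM2l// ltW.
  lra.
have dy2 : dl * v - dl / 8 * (dl * v) <= dl * y.
  have : dl * (v - dl / 8 * v) <= dl * y by rewrite ler_wpM2l// ltW.
  lra.
split; first by lra.
have dz : (1 + dl) * (y - dl / 8 * y) <= (1 + dl) * z by apply: ler_wpM2l; lra.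
have ddy : dl * (dl * y) <= dl * y by rewrite ler_wpM2l ?(ltW d0)// ler_piMl.
by lra.
Unshelve. all: by end_near. Qed.

Lemma count_growth : exists2 C, 0 < C & forall k r, 1 <= r -> nd k r 0 <= C * r ^+ m.
Proof.
pose V3 : R := volbound m 3.
have V30 : 0 < V3 by rewrite exprn_gt0// addr_gt0// divr_gt0// sqrtr_gt0 tau_gt0.
have [C7 C70 C7P] := count_power.
exists (2 * V3 * C7) => [|k r r1]; first by rewrite !mulr_gt0.
have [C [L Hf]] := field_helmholtz al phi rr1 k.
have fD := domains_finite h0 h1 Hf r.
apply: le_trans (domains_atleast h0 h1 Hf (atleast_fset fD)) _.
rewrite -[leRHS]mulrA; apply: ler_wpM2l; first by rewrite mulr_ge0// ltW.
exact: C7P.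
Qed.

Let u rho := mean_count rho / rho ^+ m.

(** The factors [kappa] on the two sides of the double counting cancel; the errors go into
    [(1 + dl/3)^2 <= 1 + dl] and [1 / rho^m <= dl]. *)
Lemma mean_le_sample (dl : R) : 0 < dl -> dl <= 1 -> \forall rho \near +oo, evn (fun k r =>
  u rho <= (1 + dl) * (nd k r 0 / r ^+ m) + dl).
Proof.
move=> d0 d1; have [kappa [k0 Hk]] := lball_density m h0.
have e0 : 0 < dl / 3 by rewrite divr_gt0.
have e1 : dl / 3 <= 1 by lra.
have cr c := count_ratio c k0 e0 e1 Hk.
have c1 := cr (1 + m%:R * h).
near=> rho.
have r1 : 1 <= rho by near: rho; exact: nbhs_pinfty_ge (num_real _).
have rd : dl^-1 <= rho by near: rho; exact: nbhs_pinfty_ge (num_real _).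
have [a1 _] : cnt (rho + (1 + m%:R * h)) <= (1 + dl / 3) * kappa * rho ^+ m /\
  kappa * rho ^+ m <= (1 + dl / 3) * cnt (rho + (1 + m%:R * h)) by near: rho.
have rho0 : 0 <= rho by lra.
have rm0 : 0 < rho ^+ m by rewrite exprn_gt0//; lra.
have rm : dl^-1 <= rho ^+ m.
  by apply: (le_trans rd); rewrite -[leLHS]expr1; apply: ler_weXn2l.
have R1 : evn (fun _ r => (1 : R) <= r) by apply: evn_near; exact: nbhs_pinfty_ge (num_real _).
apply: evnS (evnI R1 (evnI (evn_near (cr (- (rho + 1)))) (evn_shift (- (rho + 1)) (density_lower rho0)))) => k r [r1' [[_ b1] b2]].
rewrite subrK in b2; set n := nd k r 0 in b2 *.
have n0 : 0 <= n by [].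
have r0 : 0 < r ^+ m by rewrite exprn_gt0//; lra.
rewrite addrA in a1.
have I1 : 1 / rho ^+ m <= dl by rewrite ler_pdivrMr// -ler_pdivrMl// mulr1.
have nr0 : 0 <= n / r ^+ m by rewrite divr_ge0// ltW.
have [I0|I0] := ltP (mean_count rho) 1.
  apply: (@le_trans _ _ dl); last by rewrite lerDr mulr_ge0//; lra.
  by apply: le_trans I1; rewrite ler_wpM2r ?invr_ge0 ?(ltW rm0)// ltW.
have I00 : 0 <= mean_count rho - 1 by lra.
have s1 : (mean_count rho - 1) * (kappa * r ^+ m) <= (1 + dl / 3) * (n * ((1 + dl / 3) * kappa * rho ^+ m)).
  apply: (@le_trans _ _ ((1 + dl / 3) * ((mean_count rho - 1) * cnt (r - (rho + 1))))).
    by rewrite [leRHS]mulrCA; apply: ler_wpM2l.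
  apply: ler_wpM2l; first by lra.
  by apply: (le_trans b2); apply: ler_wpM2l.
have s2 : (mean_count rho - 1) / rho ^+ m <= (1 + dl / 3) ^+ 2 * (n / r ^+ m).
  rewrite ler_pdivrMr//.
  have -> : (1 + dl / 3) ^+ 2 * (n / r ^+ m) * rho ^+ m =
    ((1 + dl / 3) * (n * ((1 + dl / 3) * kappa * rho ^+ m))) / (kappa * r ^+ m).
    by field; rewrite !gt_eqF.
  by rewrite ler_pdivlMr// mulr_gt0.
have s3 : (1 + dl / 3) ^+ 2 * (n / r ^+ m) <= (1 + dl) * (n / r ^+ m).
  apply: ler_wpM2r => //.
  have : dl * dl <= dl by rewrite ler_piMr// ltW.
  by rewrite expr2; lra.
have -> : u rho = (mean_count rho - 1) / rho ^+ m + 1 / rho ^+ m by rewrite /u; ring.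
by apply: lerD => //; exact: le_trans s2 s3.
Unshelve. all: by end_near. Qed.

Lemma sample_le_mean (dl : R) : 0 < dl -> dl <= 1 -> \forall rho \near +oo, evn (fun k r =>
  nd k r 0 / r ^+ m <= (1 + dl) * u rho + dl).
Proof.
move=> d0 d1; have [kappa [k0 Hk]] := lball_density m h0.
have e0 : 0 < dl / 3 by rewrite divr_gt0.
have e1 : dl / 3 <= 1 by lra.
have cr c := count_ratio c k0 e0 e1 Hk.
have e40 : 0 < dl / 4 by rewrite divr_gt0.
have [c Hc] := density_upper e40.
have c1 := cr (- 1 - c).
near=> rho.
have r1 : 1 <= rho by near: rho; exact: nbhs_pinfty_ge (num_real _).
have rd : (dl / 4)^-1 <= rho by near: rho; exact: nbhs_pinfty_ge (num_real _).
have [_ a1] : cnt (rho + (- 1 - c)) <= (1 + dl / 3) * kappa * rho ^+ m /\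
  kappa * rho ^+ m <= (1 + dl / 3) * cnt (rho + (- 1 - c)) by near: rho.
have rho0 : 0 <= rho - 1 by lra.
have rm0 : 0 < rho ^+ m by rewrite exprn_gt0//; lra.
have rm : (dl / 4)^-1 <= rho ^+ m.
  by apply: (le_trans rd); rewrite -[leLHS]expr1; apply: ler_weXn2l.
have R1 : evn (fun _ r => (1 : R) <= r) by apply: evn_near; exact: nbhs_pinfty_ge (num_real _).
apply: evnS (evnI R1 (evnI (evn_near (cr (rho - 1))) (Hc _ rho0))) => k r [r1' [[b1 _] b2]].
rewrite subrK in b2; rewrite addrA in a1; set n := nd k r 0 in b2 *.
set g := cnt (rho - 1 - c) in a1 b2.
have r0 : 0 < r ^+ m by rewrite exprn_gt0//; lra.
have I1 : 1 / rho ^+ m <= dl / 4 by rewrite ler_pdivrMr// -ler_pdivrMl// mulr1.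
have I0 := mean_count_ge0 rho.
have u0 : 0 <= u rho by rewrite divr_ge0// ltW.
have [ns|ns] := leP n (dl / 4 * r ^+ m).
  rewrite ler_pdivrMr//; apply: (le_trans ns); apply: ler_wpM2r; first exact: ltW.
  have : 0 <= (1 + dl) * u rho by rewrite mulr_ge0//; lra.
  lra.
have n0 : 0 <= n - dl / 4 * r ^+ m by lra.
have s1 : (n - dl / 4 * r ^+ m) * (kappa * rho ^+ m) <= (1 + dl / 3) * ((mean_count rho + 1) * ((1 + dl / 3) * kappa * r ^+ m)).
  apply: (@le_trans _ _ ((1 + dl / 3) * ((n - dl / 4 * r ^+ m) * g))).
    by rewrite [leRHS]mulrCA; apply: ler_wpM2l.
  apply: ler_wpM2l; first by lra.
  apply: (@le_trans _ _ ((mean_count rho + 1) * cnt (r + (rho - 1)))); first by lra.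
  by apply: ler_wpM2l => //; lra.
have s2 : (n - dl / 4 * r ^+ m) / r ^+ m <= (1 + dl / 3) ^+ 2 * ((mean_count rho + 1) / rho ^+ m).
  rewrite ler_pdivrMr//.
  have -> : (1 + dl / 3) ^+ 2 * ((mean_count rho + 1) / rho ^+ m) * r ^+ m =
    ((1 + dl / 3) * ((mean_count rho + 1) * ((1 + dl / 3) * kappa * r ^+ m))) / (kappa * rho ^+ m).
    by field; rewrite !gt_eqF.
  by rewrite ler_pdivlMr// mulr_gt0.
have E1 : (n - dl / 4 * r ^+ m) / r ^+ m = n / r ^+ m - dl / 4 by field; rewrite gt_eqF.
have E2 : (mean_count rho + 1) / rho ^+ m = u rho + 1 / rho ^+ m by rewrite /u; ring.
have q2 : (1 + dl / 3) ^+ 2 <= 1 + dl.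
  have : dl * dl <= dl by rewrite ler_piMr// ltW.
  by rewrite expr2; lra.
have s3 : (1 + dl / 3) ^+ 2 * ((mean_count rho + 1) / rho ^+ m) <= (1 + dl) * (u rho + dl / 4).
  apply: ler_pM => //; first exact: sqr_ge0.
    by rewrite E2 addr_ge0// divr_ge0// ltW.
  by rewrite E2 lerD2l.
have : dl * dl <= dl by rewrite ler_piMr// ltW.
have := le_trans s2 s3; rewrite E1; lra.
Unshelve. all: by end_near. Qed.

(** Any two normalised means at large radii are close to the same sample densities, hence to each
    other. The limit is the supremum of the eventual lower bounds of [u], and the sample densities
    inherit it. *)
Lemma limit_density : exists c : R, (u rho @[rho --> +oo] --> c) /\
  forall e, 0 < e -> evn (fun k r => `|nd k r 0 / r ^+ m - c| <= e).
Proof.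
have [Cg Cg0 Hg] := count_growth.
have R1 : evn (fun _ r => (1 : R) <= r) by apply: evn_near; exact: nbhs_pinfty_ge (num_real _).
have nu : evn (fun k r => 0 <= nd k r 0 / r ^+ m <= Cg).
  apply: evnS R1 => k r r1; have r0 : 0 < r ^+ m by rewrite exprn_gt0//; lra.
  by rewrite divr_ge0 ?(ltW r0)//= ler_pdivrMr// Hg.
pose B := 2 * Cg + 1.
have uB : \forall rho \near +oo, 0 <= u rho <= B.
  have H := mean_le_sample ltr01 (lexx _); near=> rho.
  have r1 : 1 <= rho by near: rho; exact: nbhs_pinfty_ge (num_real _).
  have Hr : evn (fun k r => u rho <= (1 + 1) * (nd k r 0 / r ^+ m) + 1) by near: rho.
  have -> /= : 0 <= u rho by rewrite divr_ge0 ?mean_count_ge0// exprn_ge0//; lra.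
  by apply: evn_cst; apply: evnS (evnI nu Hr) => k r [/andP[_ n1] H1]; rewrite /B; lra.
have both e : 0 < e -> \forall rho \near +oo, evn (fun k r => `|nd k r 0 / r ^+ m - u rho| <= e).
  move=> e0; pose dl := Num.min 1 (e / (2 * (B + 1))).
  have B1 : 0 < B + 1 by rewrite /B; lra.
  have d0 : 0 < dl by rewrite lt_min ltr01 divr_gt0// mulr_gt0.
  have d1 : dl <= 1 by rewrite ge_min lexx.
  have de : dl * (B + 1) <= e.
    have : dl <= e / (2 * (B + 1)) by rewrite ge_min lexx orbT.
    rewrite ler_pdivlMr ?mulr_gt0//; nra.
  have H1 := mean_le_sample d0 d1; have H2 := sample_le_mean d0 d1.
  near=> rho.
  have /andP[u0 u1] : 0 <= u rho <= B by near: rho.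
  have K1 : evn (fun k r => u rho <= (1 + dl) * (nd k r 0 / r ^+ m) + dl) by near: rho; exact: H1.
  have K2 : evn (fun k r => nd k r 0 / r ^+ m <= (1 + dl) * u rho + dl) by near: rho; exact: H2.
  apply: evnS (evnI nu (evnI K1 K2)) => k r [/andP[n0 n1] [a1 a2]].
  have b1 : dl * (nd k r 0 / r ^+ m) <= dl * B by apply: ler_wpM2l; [exact: ltW|rewrite /B; lra].
  have b2 : dl * u rho <= dl * B by rewrite ler_wpM2l// ltW.
  by rewrite ler_norml; apply/andP; split; lra.
pose A : set R := [set x | \forall rho \near +oo, x <= u rho].
have A0 : A 0 by apply: filterS uB => rho /andP[].
have supA : has_sup A.
  split; first by exists 0.
  exists B => x Ax; have [rho [xu /andP[_ ub]]] := filter_ex (filterI Ax uB).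
  exact: le_trans xu ub.
have key e : 0 < e -> \forall rho \near +oo, `|u rho - sup A| <= e.
  move=> e0; have e2 : 0 < e / 2 by rewrite divr_gt0.
  have He := both _ e2; have close : \forall rho \near +oo, forall rho', evn (fun k r => `|nd k r 0 / r ^+ m - u rho'| <= e / 2) ->
    `|u rho - u rho'| <= e.
    apply: filterS He => rho Hr rho' Hr'; apply: evn_cst; apply: evnS (evnI Hr Hr') => k r [a1 a2].
    have := ler_normD (u rho - nd k r 0 / r ^+ m) (nd k r 0 / r ^+ m - u rho'); rewrite addrA subrK.
    by rewrite (distrC (u rho) (nd k r 0 / _)); lra.
  apply: filterS close => rho Hr; rewrite ler_norml; apply/andP; split.
    have : sup A <= u rho + e.
      apply: sup_le_ub; first by exists 0.
      move=> x Ax; have [rho' [xu Hr']] := filter_ex (filterI Ax He).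
      by have := Hr _ Hr'; rewrite ler_norml => /andP[]; lra.
    lra.
  have : u rho - e <= sup A.
    apply: ub_le_sup; first by case: supA.
    by apply: filterS He => rho' Hr'; have := Hr _ Hr'; rewrite ler_norml => /andP[]; lra.
  lra.
exists (sup A); split.
  apply/cvgrPdist_le => e e0; apply: filterS (key e e0) => rho; by rewrite distrC.
move=> e e0; have e2 : 0 < e / 2 by rewrite divr_gt0.
have [rho [a1 a2]] := filter_ex (filterI (key _ e2) (both _ e2)).
apply: evnS a2 => k r a2.
have := ler_normD (nd k r 0 / r ^+ m - u rho) (u rho - sup A); rewrite addrA subrK; lra.
Unshelve. all: by end_near. Qed.

End LimitDensity.

(** * The random waves *)

Lemma omega_vol_gt0 (R : realType) k : 0 < omega_vol R k.
Proof.
suff : 0 < omega_vol R k /\ 0 < omega_vol R k.+1 by case.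
elim: k => [|k [IH1 IH2]]; first by split; rewrite /= ?ltr01 ?ltr0n.
split=> //=; apply: mulr_gt0 => //; rewrite divr_gt0 ?mulr_gt0 ?pi_gt0 ?ltr0n//.
Qed.

Section Model.
Variables (R : realType) (m : nat) (r : int -> 'rV[R]_m) (a : int -> R[i]).
Hypothesis hr_sph : forall n : nat, (0 < n)%N -> sphere (r n%:Z).
Hypothesis hr_sym : forall n : nat, (0 < n)%N -> r (- n%:Z) = - r n%:Z.
Hypothesis hr_indep : forall (N : nat) (q : nat -> rat),
  \sum_(1 <= n < N.+1) ratr (q n) *: r n%:Z = 0 -> forall n : nat, (1 <= n <= N)%N -> q n = 0.
Hypothesis ha_abs : forall n : int, n != 0 -> `|a n| = 1.
Hypothesis ha_sym : forall n : nat, (0 < n)%N -> a (- n%:Z) = conjc (a n%:Z).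

Definition direction (l : nat) : 'rV[R]_m := r l.+1%:Z.

Lemma direction_unit l : enorm (direction l) = 1.
Proof. exact: hr_sph. Qed.

Lemma phase_exists : exists al : nat -> R, forall l, a l.+1%:Z = (cos (al l) +i* sin (al l))%C.
Proof.
suff H l : exists psi, a l.+1%:Z = (cos psi +i* sin psi)%C by have [al] := choice H; exists al.
have := ha_abs (n := l.+1%:Z) isT.
rewrite normc_def; case: (a _) => x y /= E.
have {}E : Num.sqrt (x ^+ 2 + y ^+ 2) = 1 by have := congr1 (@complex.Re R) E.
by have [psi] := polar x y; rewrite E !mul1r => -[-> ->]; exists psi.
Qed.

(** The conjugate terms [n] and [- n] add up to twice a cosine, and
    [2 (2N)^{-1/2} = (2 / N)^{1/2}]. *)
Lemma fN_trigsum al N : (forall l, a l.+1%:Z = (cos (al l) +i* sin (al l))%C) -> (0 < N)%N ->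
  fN a r N = trigsum N (fun=> Num.sqrt (2 / N%:R)) direction al.
Proof.
move=> Hal N0; apply/funext => x; rewrite /fN /trigsum.
have N1 : 0 < N%:R :> R by rewrite ltr0n.
have -> : (\sum_(1 <= n < N.+1) (a n%:Z * ee (dotv (r n%:Z) x) + a (- n%:Z) * ee (dotv (r (- n%:Z)) x)) =
    (\sum_(l < N) 2 * cos (2 * pi * dotv (direction l) x + al l))%:C)%C.
  rewrite big_add1/= big_mkord rmorph_sum/=; apply: eq_bigr => l _.
  rewrite hr_sym// ha_sym// Hal /ee dotvNl !mulrN cosN sinN -/(direction l).
  set t := 2 * pi * _; apply/eqP; rewrite eq_complex/= cosD; apply/andP; split; apply/eqP; ring.
rewrite -rmorphM/= mulr_sumr; apply: eq_bigr => l _; rewrite mulrA; congr (_ * _).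
have -> : 2 / N%:R = 2 ^+ 2 * (2 * N%:R)^-1 :> R by field; rewrite gt_eqF.
by rewrite [RHS]sqrtrM ?sqr_ge0// sqrtr_sqr ger0_norm// sqrtrV ?mulr_ge0// mulrC.
Qed.

(** Rational independence, with the indices shifted by one. *)
Lemma freq_neq0 n q : (exists2 l, (l < n)%N & q l != 0) -> freq direction n q != 0.
Proof.
move=> [l ln ql]; apply/eqP => E; move/eqP: ql; apply.
have := @hr_indep n (fun j => (q j.-1)%:~R) _ l.+1; rewrite ltnS ln => H.
have : (q l)%:~R = 0 :> rat.
  apply: H => //; rewrite big_add1/= big_mkord -[RHS]E /freq.
  by apply: eq_bigr => j _; rewrite ratr_int.
by move/eqP; rewrite intr_eq0 => /eqP.
Qed.

(** The forbidden lattice scales. Coefficients are coded by finite sequences, so that the parameter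
    type is countable. *)
Definition resonance (p : nat * seq int * int * 'I_m) : R :=
  p.1.2%:~R / freq direction p.1.1.1 (nth 0 p.1.1.2) ord0 p.2.

(** The resonant scales are countably many, so they cannot fill the interval []0, 1]] of measure
    1. *)
Lemma nonresonant_scale : exists h : R, [/\ 0 < h, h <= 1 & forall n q,
  (exists2 l, (l < n)%N & q l != 0) -> exists i, forall k : int, h * freq direction n q ord0 i != k%:~R].
Proof.
have cB : countable (range resonance).
  by apply: sub_countable (card_image_le _ _) _; exact: countableP.
have [h [h01 nh]] : exists h : R, h \in `]0, 1] /\ ~ range resonance h.
  apply: contrapT => H; have sub : [set` `]0, 1] : interval R] `<=` range resonance.
    by move=> x x01; apply: contrapT => nx; apply: H; exists x.
  have := countable_lebesgue_measure0 (sub_countable (subset_card_le sub) cB).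
  rewrite lebesgue_measure_itv/= lte_fin ltr01 oppr0 adde0 => /eqP.
  by rewrite eqe oner_eq0.
move: h01; rewrite in_itv/= => /andP[h0 h1]; exists h; split => // n q nz.
have /rowP nf : freq direction n q <> 0 by apply/eqP/freq_neq0.
have [i fi] : exists i, freq direction n q ord0 i != 0.
  apply: contrapT => H; apply: nf => i; rewrite mxE; apply: contrapT => fi; apply: H.
  by exists i; apply/eqP.
exists i => k; apply/eqP => E; apply: nh; exists (n, mkseq q n, k, i) => //.
have -> : resonance (n, mkseq q n, k, i) = k%:~R / freq direction n q ord0 i.
  rewrite /resonance/=; congr (_ / _); congr (fun_of_matrix _ _ _).
  by apply: eq_bigr => l _; rewrite nth_mkseq.
by rewrite -E mulfK.
Qed.

Variables (mu : probability (vecB R m) R) (phi : nat -> nat).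
Hypothesis hmu_sph : mu (~` sphere (m:=m)) = 0%E.
Hypothesis phi0 : (0 < phi 0%N)%N.
Hypothesis phiS : forall k, (phi k < phi k.+1)%N.
Hypothesis hweak : forall g : 'rV[R]_m -> R, {within sphere (m:=m), continuous g} ->
  (fun k : nat => ((2 * (phi k)%:R)^-1 *
    \sum_(1 <= n < (phi k).+1) (g (r n%:Z) + g (r (- n%:Z))))%:E)
  @ \oo --> (\int[mu]_(l in sphere (m:=m)) (g l)%:E)%E.

(** For even [g] the symmetric sum is twice the sum over positive indices. The bound on [g] over the
    sphere makes the limiting integral finite. *)
Lemma average_limit (g : 'rV[R]_m -> R) : continuous g -> (forall y, g (- y) = g y) ->
  (forall y, enorm y = 1 -> `|g y| <= 1) ->
  average phi k (fun l => g (direction l)) @[k --> \oo] --> fine (\int[mu]_(y in sphere (m:=m)) (g y)%:E)%E.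
Proof.
move=> cg ge g1; have := hweak (continuous_subspaceT cg).
set L := (\int[mu]_(l in _) _)%E => HL.
have avE k : ((2 * (phi k)%:R)^-1 * \sum_(1 <= n < (phi k).+1) (g (r n%:Z) + g (r (- n%:Z))))%:E =
    (average phi k (fun l => g (direction l)))%:E.
  rewrite /average big_add1/= big_mkord; congr (_%:E).
  rewrite (eq_bigr (fun l : 'I_(phi k) => 2 * g (direction l))) => [|l _]; last first.
    by rewrite hr_sym// ge /direction; ring.
  rewrite -mulr_sumr; have := phi_gt0 phi0 phiS k; rewrite -(ltr0n R) => p0.
  by field; rewrite gt_eqF.
have {}HL : (fun k => (average phi k (fun l => g (direction l)))%:E) @ \oo --> L.
  by move: HL; rewrite (funext avE).
have av1 k : `|average phi k (fun l => g (direction l))| <= 1.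
  have p0 : 0 < (phi k)%:R :> R by rewrite ltr0n (phi_gt0 phi0 phiS).
  rewrite /average normrM gtr0_norm ?invr_gt0// ler_pdivrMl// mulr1.
  apply: le_trans (ler_norm_sum _ _ _) _.
  apply: (@le_trans _ _ (\sum_(l < phi k) 1)); first by apply: ler_sum => l _; exact/g1/direction_unit.
  by rewrite sumr_const card_ord.
have L1 : (L <= 1%:E)%E.
  rewrite -(cvg_lim _ HL)//; apply: lime_le; first by apply/cvg_ex; exists L.
  by apply: nearW => k; rewrite lee_fin (le_trans (ler_norm _)).
have L2 : ((-1)%:E <= L)%E.
  rewrite -(cvg_lim _ HL)//; apply: lime_ge; first by apply/cvg_ex; exists L.
  by apply: nearW => k; rewrite lee_fin; have := av1 k; rewrite ler_norml => /andP[].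
have Lfin : L \is a fin_num.
  by rewrite fin_numE; apply/andP; split; apply/eqP => E; move: L1 L2; rewrite E.
by rewrite -[L]fineK// in HL; exact: (fine_cvg HL).
Qed.

Lemma measurable_vecB (g : 'rV[R]_m -> R) : continuous g -> measurable_fun [set: vecB R m] (g : vecB R m -> R).
Proof.
move=> /continuousP cg; apply: (measurability _ (RGenOpens.measurableE R)).
move=> _ [_ [x [y ->] <-]]; rewrite setTI; apply: sub_sigma_algebra.
exact/cg/interval_open.
Qed.

(** The covariance [gcov] integrates over the whole space and the weak convergence over the sphere;
    the complement is null for [mu]. *)
Lemma integral_sphere (g : 'rV[R]_m -> R) : continuous g -> (forall y, `|g y| <= 1) ->
  (\int[mu]_(y in [set: vecB R m]) (g y)%:E = \int[mu]_(y in sphere (m:=m)) (g y)%:E)%E.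
Proof.
move=> cg g1.
have mS : measurable (~` sphere (m:=m) : set (vecB R m)).
  apply: measurableC.
  have -> : sphere (m:=m) = [set: vecB R m] `&` (@enorm R m) @^-1` [set 1] by rewrite setTI.
  have cE : continuous (@enorm R m).
    apply: (lipschitz_continuous (L := m%:R)) => // y y'.
    rewrite ler_norml; have := enorm_le_norm (y - y').
    by have := ler_enormB y y'; have := ler_enormB y' y; rewrite (enormB y'); lra.
  exact: (measurable_vecB cE measurableT (measurable_set1 1)).
have -> : sphere (m:=m) = [set: vecB R m] `\` ~` sphere (m:=m) :> set (vecB R m) by rewrite setTD setCK.
apply: negligible_integral => //.
apply: measurable_bounded_integrable => //.
- exact: le_lt_trans (probability_le1 mu measurableT) (ltry 1).
- exact: measurable_vecB.
- by exists 1; split => // x x1 y _; exact: le_trans (g1 y) (ltW x1).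
Qed.

End Model.

Lemma limsup_pinfty_cvg0 (R : realType) (g : nat -> R -> \bar R) : (forall k x, (0 <= g k x)%E) ->
  (forall e, 0 < e -> evn (fun k x => (g k x <= e%:E)%E)) -> (fun k => limsup_pinfty (g k)) @ \oo --> 0%E.
Proof.
move=> g0 H.
have l0 k : (0 <= limsup_pinfty (g k))%E.
  apply: le_ereal_inf_tmp => _ [V FV <-]; have [x Vx] := filter_ex FV.
  by apply: le_trans (g0 k x) _; apply: ereal_sup_ubound; exists x.
have le e k : (\forall x \near +oo, (g k x <= e%:E)%E) -> (limsup_pinfty (g k) <= e%:E)%E.
  (* The upper limit is an infimum over neighbourhoods of infinity, one of which is the set where
     the bound holds. *)
  move=> He; apply: ge_ereal_inf; exists (ereal_sup (g k @` [set x | (g k x <= e%:E)%E])); first by exists [set x | (g k x <= e%:E)%E].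
  by apply: ge_ereal_sup => _ [x /= xe <-].
have lfin e : 0 < e -> \forall k \near \oo, (limsup_pinfty (g k) <= e%:E)%E.
  by move=> e0; apply: filterS (H e e0) => k; exact: le.
apply: cvg_EFin.
  apply: filterS (lfin 1 ltr01) => k H1; rewrite ge0_fin_numE//.
  exact: le_lt_trans H1 (ltry _).
apply/cvgrPdist_le => e e0; apply: filterS (lfin e e0) => k He.
rewrite sub0r normrN ger0_norm ?fine_ge0//.
by rewrite -lee_fin fineK// ge0_fin_numE//; exact: le_lt_trans He (ltry _).
Qed.

Theorem theorem1p1 (R : realType) (m : nat) (hm : (2 <= m)%N)
  (r : int -> 'rV[R]_m) (a : int -> R[i])
  (hr_sph : forall n : nat, (0 < n)%N -> sphere (r n%:Z))
  (hr_sym : forall n : nat, (0 < n)%N -> r (- n%:Z) = - r n%:Z)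
  (hr_indep : forall (N : nat) (q : nat -> rat),
      \sum_(1 <= n < N.+1) ratr (q n) *: r n%:Z = 0 ->
      forall n : nat, (1 <= n <= N)%N -> q n = 0)
  (hr_span : forall v : 'rV[R]_m, v != 0 ->
      exists n : nat, (0 < n)%N /\ dotv (r n%:Z) v != 0)
  (ha_abs : forall n : int, n != 0 -> `|a n| = 1)
  (ha_sym : forall n : nat, (0 < n)%N -> a (- n%:Z) = conjc (a n%:Z))
  (mu : probability (vecB R m) R) (hmu_sph : mu (~` sphere (m:=m)) = 0%E)
  (phi : nat -> nat) (hphi0 : (0 < phi 0%N)%N)
  (hphi : forall k : nat, (phi k < phi k.+1)%N)
  (hweak : forall g : 'rV[R]_m -> R, {within sphere (m:=m), continuous g} ->
      (fun k : nat => ((2 * (phi k)%:R)^-1 *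
          \sum_(1 <= n < (phi k).+1) (g (r n%:Z) + g (r (- n%:Z))))%:E)
        @ \oo --> (\int[mu]_(l in sphere (m:=m)) (g l)%:E)%E)
  (d : measure_display) (Omega : measurableType d) (P : probability Omega R)
  (F : Omega -> 'rV[R]_m -> R)
  (hF : gaussian_field P F mu)
  (hFsmooth : {ae P, forall w, smooth (F w)}) :
  exists c : R,
    ((fun rho : R => ((\int[P]_w nodal_count (F w) (eball0 (m:=m) rho))
                        * ((volB m rho)^-1)%:E)%E) @ +oo --> c%:E)
    /\
    ((fun k : nat => limsup_pinfty (fun rho : R =>
        `| nodal_count (fN a r (phi k)) (eball0 (m:=m) rho) * ((volB m rho)^-1)%:E
           - c%:E |)%E) @ \oo --> 0%E).
Proof.
have m1 : (1 <= m)%N by exact: ltnW.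
have rr1 := direction_unit hr_sph.
have [al Hal] := phase_exists ha_abs.
have [h [h0 h1 nonres]] := nonresonant_scale hr_indep.
have avg := average_limit hr_sph hr_sym hphi0 hphi hweak.
have cont_coord (i : 'I_m) : continuous (fun y : 'rV[R]_m => y ord0 i).
  apply: (lipschitz_continuous (L := 1)) => // y y'; rewrite mul1r.
  by have := coord_le_norm (y - y') i; rewrite !mxE.
(* Weak convergence is tested on products of two coordinates here and on plane waves in [covG]; both
   functions are even. *)
have covM i j : average phi k (fun l => direction r l ord0 i * direction r l ord0 j) @[k --> \oo] -->
    fine (\int[mu]_(y in sphere (m:=m)) (y ord0 i * y ord0 j)%:E)%E.
  apply: (avg (fun y => y ord0 i * y ord0 j)).
  - by move=> y; have ci := cont_coord i y; have cj := cont_coord j y; exact: (cvgM ci cj).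
  - by move=> y; rewrite !mxE mulrNN.
  - move=> y y1; rewrite normrM mulr_ile1//; apply: le_trans (coord_le_norm _ _) _;
      by rewrite -y1 norm_le_enorm.
have cont_cos (z : 'rV[R]_m) : continuous (fun y : 'rV[R]_m => cos (2 * pi * dotv z y)).
  apply: (lipschitz_continuous (L := 2 * pi * (m%:R * `|z|))) => [|y y'].
    by rewrite !mulr_ge0 ?pi_ge0.
  apply: le_trans (cos_lip _ _) _; rewrite -mulrBr -dotvBr normrM ger0_norm ?mulr_ge0 ?pi_ge0//.
  by rewrite -[leRHS]mulrA ler_wpM2l ?mulr_ge0 ?pi_ge0// dotv_le.
have covG z : average phi k (fun l => cos (2 * pi * dotv (direction r l) z)) @[k --> \oo] --> (gcov mu z : R).
  have cos1 y : `|cos (2 * pi * dotv z y) : R| <= 1 by exact: cos_max.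
  rewrite /gcov (integral_sphere hmu_sph)//.
  have even y : cos (2 * pi * dotv z (- y)) = cos (2 * pi * dotv z y) :> R by rewrite dotvNr mulrN cosN.
  have := avg _ (cont_cos z) even (fun y _ => cos1 y).
  have -> // : (fun l => cos (2 * pi * dotv z (direction r l))) = (fun l => cos (2 * pi * dotv (direction r l) z)).
  by apply/funext => l; rewrite dotvC.
have Fc : {ae P, forall w, continuous (F w)} by apply: filterS hFsmooth => w /(_ [::])[].
have [c [Hu Hn]] := limit_density al h0 h1 m1 nonres hphi0 hphi rr1 covM covG hF Fc.
have om0 := omega_vol_gt0 R m.
(* [limit_density] is normalised by [rho^m]; the volume of the unit ball enters only now. *)
have sc (x rho : R) : x / volB m rho = x / rho ^+ m / omega_vol R m by rewrite /volB invfM; ring.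
exists (c / omega_vol R m); split.
  apply: (@cvg_trans _ ((fun rho => (mean_count P F rho / rho ^+ m / omega_vol R m)%:E) @ +oo)).
    apply: near_eq_cvg; near=> rho.
    have rho0 : 0 <= rho by near: rho; exact: nbhs_pinfty_ge (num_real _).
    by rewrite (mean_countE al h0 h1 m1 nonres hphi0 hphi rr1 covM covG hF Fc rho0) -EFinM sc.
  apply: cvg_EFin; first by apply: nearW.
  exact: (cvgMl Hu).
apply: limsup_pinfty_cvg0 => [k x|e e0]; first exact: abse_ge0.
have e1 : 0 < e * omega_vol R m by rewrite mulr_gt0.
apply: evnS (Hn _ e1) => k rho H.
have [C [L Hf]] := field_helmholtz al phi rr1 k.
have fE : fN a r (phi k) = field (direction r) al phi k.
  by rewrite (fN_trigsum hr_sym ha_sym Hal)// (phi_gt0 hphi0 hphi).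
rewrite fE /nodal_count nodal_domainsE; [|exact: helmholtz_continuous Hf|exact: open_eball].
rewrite esum_card; last exact: (domains_finite h0 h1 Hf).
rewrite -EFinM -EFinB abse_EFin lee_fin sc.
rewrite -mulrBl normrM (gtr0_norm (x := (_)^-1)) ?invr_gt0// ler_pdivrMr//.
Unshelve. all: by end_near. Qed.
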